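(* Let $n=1$, $0<r,s<1$ and $0<a\le1$ with $a<r/s$. Then there exist $f\in\mathcal E_{(a)}$ and a pseudo-measure $u$ with compact support such that $fu$ is $\mathcal E_{(r)}$-invertible but $u$ is not $\mathcal E_{(s)}$-invertible.
   Context: Fourier transform: $\hat\phi(\xi)=\int e^{-ix\xi}\phi(x)dx$. For $0<\alpha<1$ let $w_\alpha(\xi)=|\xi|^\alpha$ on $\mathbb R$. For a weight $w$: $\|\phi\|^w_\lambda=\int|\hat\phi|e^{\lambda w}$; $\mathcal D_w=\{\phi\in C_0^\infty(\mathbb R):\|\phi\|^w_\lambda<\infty\ \forall\lambda>0\}$; $\mathcal E_w=\{f\in C^\infty:\|\psi f\|^w_\lambda<\infty\ \forall\psi\in\mathcal D_w,\lambda>0\}$; $\mathcal E_w'$ its dual (compactly supported ultradistributions, containing compactly supported distributions). Gevrey notation: $\mathcal E_{(\alpha)}=\mathcal E_{w_\alpha}$ for $0<\alpha<1$, and $\mathcal E_{(1)}$ is the class of real analytic functions on $\mathbb R$. $v\in\mathcal E'_{(\alpha)}$ is $\mathcal E_{(\alpha)}$-invertible if $v*\mathcal E_{(\alpha)}=\mathcal E_{(\alpha)}$, equivalently (known) there is $A>0$ with $\sup_{|\eta|\le A|\xi|^\alpha}|\hat v(\xi+\eta)|\ge A^{-1}e^{-A|\xi|^\alpha}$ for all $|\xi|>1$. A pseudo-measure is a tempered distribution whose Fourier transform is a bounded function. *)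

(* Defs.v *)
From Stdlib Require Import Reals.
From Coquelicot Require Import Coquelicot.
Open Scope R_scope.

Definition smooth (f : R -> C) : Prop :=
  forall (n : nat) (x : R),
    ex_derive_n (fun t => fst (f t)) n x /\ ex_derive_n (fun t => snd (f t)) n x.

Definition cderiv_n (f : R -> C) (k : nat) (x : R) : C :=
  (Derive_n (fun t => fst (f t)) k x, Derive_n (fun t => snd (f t)) k x).

Definition compact_support (f : R -> C) : Prop :=
  exists M : R, forall x, M < Rabs x -> f x = RtoC 0.

Definition test_fun (phi : R -> C) : Prop := smooth phi /\ compact_support phi.

Definition cexpi (t : R) : C := (cos t, sin t).

Definition is_fourier (phi : R -> C) (g : R -> C) : Prop :=
  forall xi : R,
    is_RInt_gen (fun x => Cmult (cexpi (- (x * xi))) (phi x))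
      (Rbar_locally m_infty) (Rbar_locally p_infty) (g xi).

Definition wnorm_finite (w : R -> R) (phi : R -> C) (lam : R) : Prop :=
  exists g : R -> C, is_fourier phi g /\
    ex_RInt_gen (fun xi => Cmod (g xi) * exp (lam * w xi))
      (Rbar_locally m_infty) (Rbar_locally p_infty).

Definition D_w (w : R -> R) (phi : R -> C) : Prop :=
  test_fun phi /\ forall lam, 0 < lam -> wnorm_finite w phi lam.

Definition E_w (w : R -> R) (f : R -> C) : Prop :=
  smooth f /\
  forall (psi : R -> C) (lam : R), D_w w psi -> 0 < lam ->
    wnorm_finite w (fun x => Cmult (psi x) (f x)) lam.

Definition w_pow (alpha xi : R) : R :=
  if Req_EM_T xi 0 then 0 else Rpower (Rabs xi) alpha.

Definition real_analytic (f : R -> C) : Prop :=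
  forall x0 : R, exists delta : R, 0 < delta /\
    exists c : nat -> C, forall x, Rabs (x - x0) < delta ->
      is_series (fun k => Cmult (c k) (RtoC ((x - x0) ^ k))) (f x).

(** Gevrey class E_(alpha): E_{w_alpha} for alpha < 1, real analytic for alpha = 1
    (only used for 0 < alpha <= 1). *)
Definition E_gev (alpha : R) (f : R -> C) : Prop :=
  if Rlt_dec alpha 1 then E_w (w_pow alpha) f else real_analytic f.

(** Compactly supported distributions on R (elements of E'), represented as
    functionals on complex-valued functions, only ever evaluated on smooth ones:
    C-linear on C^infty and continuous for the C^infty topology, i.e. bounded by
    a finite-order seminorm over a compact [-M,M]. *)
Definition cs_dist (u : (R -> C) -> C) : Prop :=
  (forall phi psi, smooth phi -> smooth psi ->
     u (fun x => Cplus (phi x) (psi x)) = Cplus (u phi) (u psi)) /\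
  (forall (c : C) phi, smooth phi -> u (fun x => Cmult c (phi x)) = Cmult c (u phi)) /\
  exists (M K : R) (N : nat), 0 <= K /\
    forall (phi : R -> C) (B : R), smooth phi ->
      (forall (k : nat) (x : R), (k <= N)%nat -> Rabs x <= M ->
         Cmod (cderiv_n phi k x) <= B) ->
      Cmod (u phi) <= K * B.

Definition dist_fourier (u : (R -> C) -> C) (xi : R) : C :=
  u (fun x => cexpi (- (x * xi))).

Definition cs_pseudo_measure (u : (R -> C) -> C) : Prop :=
  cs_dist u /\ exists B : R, forall xi, Cmod (dist_fourier u xi) <= B.

Definition mul_fun_dist (f : R -> C) (u : (R -> C) -> C) : (R -> C) -> C :=
  fun phi => u (fun x => Cmult (f x) (phi x)).

Definition conv (v : (R -> C) -> C) (h : R -> C) : R -> C :=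
  fun x => v (fun y => h (x - y)).

Definition E_invertible (alpha : R) (v : (R -> C) -> C) : Prop :=
  (forall h, E_gev alpha h -> E_gev alpha (conv v h)) /\
  (forall g, E_gev alpha g -> exists h, E_gev alpha h /\ conv v h = g).

(* Main.v *)
(* Idea of the proof.  With [Q z = (sin z / z)^2] and [p] odd, the factor [1 - Q^p / 2] takes values in [[1/2, 1]] on
   the real axis, is bounded away from 1 near 0 and extremely close to 1 far away.  The Fourier transform of [u] is the
   product over [j] of the powers [N j] of such factors, rescaled by [W j] and centred at [X j].  It is at most
   [exp (- q N j)] on an interval of length [2 W j] around [X j]; as [N j] is large compared with [X j ^ s], while [W j]
   exceeds a power [N j ^ (1 / be)] with [be < 1], the function [sum_j exp (- k N j) e^(i X j x)] is in the Gevrey class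
   [s] but not in the range of convolution by [u].  The multiplier is [f = 1 + sum_j c j e^(i om j x)] with
   [c j = exp (- om j ^ b)], where [a < b < r / s] makes it lie in the class [a].  The transform of [f u] is the sum of
   the shifts of that of [u] by [om j], which leave the dip since [om j] exceeds [W j]; so it is at least
   [exp (- C |xi|^r)] on the real axis.  The abscissae [PI * 2 ^ q] are zeros of every [sin ((z - X j) / W j)] involved;
   there [- Q] is nearly positive or huge, hence on the boundary of suitable large boxes the unshifted term dominates
   and the transform of [f u] is at least [1/8].  Such a lower bound is enough to invert the convolution by contour
   integrals: a solution is the Fourier integral of [g^ / V] over a contour which follows the real axis far out and the
   boundary of such a box. *)

Require Import Defs.
From Stdlib Require Import Reals Factorial Compare_dec Lra Lia Psatz FunctionalExtensionality IndefiniteDescription.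
From Coquelicot Require Import Coquelicot.
Open Scope R_scope.

(** [E_invertible] demands surjectivity itself, so both halves of the claim are proved straight from
    it. The Fourier weights are traded for derivative bounds [eps^k (k!)^(1/al)] for every [eps],
    which pass through products, convolutions and contour integrals. Dividing by [V] on the real
    axis solves the equation for compactly supported right-hand sides, but the solutions for the
    pieces of a partition of unity need not add up. Bending the contour around a large box, below or
    above, makes each solution as small as desired on one side of its support. This needs lower
    bounds of [V] at complex points; hence the dips come from an explicit entire function, and each
    one is chosen together with a box where the earlier ones are under control. Complex analysis
    reduces to primitives of exponentials: [V] cancels under the convolution, and a superposition of
    [e^(izc)] is left. With [X] as unit, [N], [W] and the shift have exponents [s1 < s2 < s3] in
    [(s, 1)]: [s < s1] spoils [u], [s1 < s2] keeps its support bounded, [s2 < s3] moves the shifts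
    out of the dip, [s3 * b <= r] limits the loss; [a < r / s] is the room for this. *)

Lemma C_eq (a b : C) : fst a = fst b -> snd a = snd b -> a = b.
Proof. destruct a, b; simpl; congruence. Qed.

Lemma Cmod_le_abs (c : C) : Cmod c <= Rabs (fst c) + Rabs (snd c).
Proof.
  unfold Cmod. apply Rsqr_incr_0_var.
  - rewrite Rsqr_sqrt by nra. unfold Rsqr.
    pose proof (Rabs_pos (fst c)); pose proof (Rabs_pos (snd c)).
    pose proof (pow2_abs (fst c)); pose proof (pow2_abs (snd c)). nra.
  - pose proof (Rabs_pos (fst c)); pose proof (Rabs_pos (snd c)); lra.
Qed.

Lemma Rabs_fst_le (c : C) : Rabs (fst c) <= Cmod c.
Proof. eapply Rle_trans; [apply Rmax_l | apply Rmax_Cmod]. Qed.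

Lemma Rabs_snd_le (c : C) : Rabs (snd c) <= Cmod c.
Proof. eapply Rle_trans; [apply Rmax_r | apply Rmax_Cmod]. Qed.

Lemma Cmod_sub_sym (a b : C) : Cmod (a - b) = Cmod (b - a).
Proof. rewrite <- Cmod_opp. f_equal. ring. Qed.

Lemma Cmod_triangle_inv (a b : C) : Cmod a - Cmod b <= Cmod (a - b).
Proof.
  assert (Cmod a <= Cmod (a - b) + Cmod b); [|lra].
  replace a with ((a - b) + b)%C at 1 by ring. apply Cmod_triangle.
Qed.

Lemma Cmod_add_ge (a b : C) : Cmod a - Cmod b <= Cmod (a + b).
Proof.
  pose proof (Cmod_triangle_inv a (-b)). rewrite Cmod_opp in H.
  replace (a - - b)%C with (a + b)%C in H by ring. exact H.
Qed.

Lemma Cmod_RtoC_pos (x : R) : 0 <= x -> Cmod (RtoC x) = x.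
Proof. intros. rewrite Cmod_R. apply Rabs_pos_eq; auto. Qed.

(** * Continuity and derivatives of complex functions of a real variable *)

Definition ccont (f : R -> C) : Prop :=
  forall x, continuous (fun t => fst (f t)) x /\ continuous (fun t => snd (f t)) x.

Definition cder (f f' : R -> C) : Prop :=
  forall x, is_derive (fun t => fst (f t)) x (fst (f' x)) /\
            is_derive (fun t => snd (f t)) x (snd (f' x)).

Lemma cder_ccont f f' : cder f f' -> ccont f.
Proof.
  intros H x; split; apply (ex_derive_continuous (V:=R_NormedModule));
  [exact (ex_intro _ _ (proj1 (H x)))|exact (ex_intro _ _ (proj2 (H x)))].
Qed.

Lemma ccont_const c : ccont (fun _ => c).
Proof. intros x; split; apply continuous_const. Qed.

Lemma ccont_plus f g : ccont f -> ccont g -> ccont (fun x => (f x + g x)%C).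
Proof.
  intros Hf Hg x; destruct (Hf x), (Hg x); split; simpl;
  apply (continuous_plus (V:=R_NormedModule)); assumption.
Qed.

Lemma ccont_opp f : ccont f -> ccont (fun x => (- f x)%C).
Proof.
  intros Hf x; destruct (Hf x); split; simpl;
  apply (continuous_opp (V:=R_NormedModule)); assumption.
Qed.

Lemma ccont_minus f g : ccont f -> ccont g -> ccont (fun x => (f x - g x)%C).
Proof. intros; apply ccont_plus; auto. now apply ccont_opp. Qed.

Lemma ccont_mult f g : ccont f -> ccont g -> ccont (fun x => (f x * g x)%C).
Proof.
  intros Hf Hg x; destruct (Hf x), (Hg x); split; simpl.
  - apply (continuous_minus (V:=R_NormedModule)); apply (continuous_mult (K:=R_AbsRing)); assumption.
  - apply (continuous_plus (V:=R_NormedModule)); apply (continuous_mult (K:=R_AbsRing)); assumption.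
Qed.

Lemma ccont_comp f (g : R -> R) : ccont f -> (forall x, continuous g x) ->
  ccont (fun x => f (g x)).
Proof.
  intros Hf Hg x; split;
  [exact (continuous_comp g (fun t => fst (f t)) x (Hg x) (proj1 (Hf (g x))))
  |exact (continuous_comp g (fun t => snd (f t)) x (Hg x) (proj2 (Hf (g x))))].
Qed.

Lemma continuous_Cmod f : ccont f -> forall x, continuous (fun t => Cmod (f t)) x.
Proof.
  intros Hf x. destruct (Hf x) as [H1 H2]. unfold Cmod.
  apply (continuous_comp (fun t => fst (f t) ^ 2 + snd (f t) ^ 2) sqrt).
  - apply (continuous_plus (V:=R_NormedModule)); simpl.
    + apply (continuous_mult (K:=R_AbsRing)); [assumption|].
      apply (continuous_mult (K:=R_AbsRing)); [assumption|apply continuous_const].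
    + apply (continuous_mult (K:=R_AbsRing)); [assumption|].
      apply (continuous_mult (K:=R_AbsRing)); [assumption|apply continuous_const].
  - apply continuous_sqrt.
Qed.

Lemma ccont_pow f n : ccont f -> ccont (fun x => Cpow (f x) n).
Proof.
  intros Hf; induction n; simpl; [apply ccont_const | now apply ccont_mult].
Qed.

Lemma ccont_inv f : ccont f -> (forall x, f x <> RtoC 0) -> ccont (fun x => (/ f x)%C).
Proof.
  intros Hf Hn x.
  assert (Hc : forall y, continuous (fun t => (fst (f t) ^ 2 + snd (f t) ^ 2)) y).
  { intros y. destruct (Hf y).
    apply (continuous_plus (V:=R_NormedModule)); simpl;
    (apply (continuous_mult (K:=R_AbsRing)); [assumption|];
      apply (continuous_mult (K:=R_AbsRing)); [assumption|apply continuous_const]). }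
  assert (Hz : fst (f x) ^ 2 + snd (f x) ^ 2 <> 0).
  { intros E. apply (Hn x). apply C_eq; simpl; nra. }
  assert (Hi : continuous (fun t => / (fst (f t) ^ 2 + snd (f t) ^ 2)) x).
  { apply (continuous_comp (fun t => fst (f t) ^ 2 + snd (f t) ^ 2) Rinv); [apply Hc|].
    apply continuous_Rinv. exact Hz. }
  destruct (Hf x) as [H1 H2].
  split; unfold Cinv; simpl fst; simpl snd; unfold Rdiv;
  apply (continuous_mult (K:=R_AbsRing)); auto.
  apply (continuous_opp (V:=R_NormedModule)); assumption.
Qed.

Lemma cder_const c : cder (fun _ => c) (fun _ => RtoC 0).
Proof. intros x; split; apply (is_derive_const (V:=R_NormedModule)). Qed.

Lemma cder_plus f f' g g' : cder f f' -> cder g g' ->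
  cder (fun x => (f x + g x)%C) (fun x => (f' x + g' x)%C).
Proof.
  intros Hf Hg x; destruct (Hf x), (Hg x); split; simpl;
  apply (is_derive_plus (V:=R_NormedModule)); assumption.
Qed.

Lemma cder_mult f f' g g' : cder f f' -> cder g g' ->
  cder (fun x => (f x * g x)%C) (fun x => (f' x * g x + f x * g' x)%C).
Proof.
  intros Hf Hg x; destruct (Hf x) as [a b], (Hg x) as [c d]; split; simpl.
  - eapply is_derive_ext_loc.
    2: evar_last; [apply (is_derive_minus (V:=R_NormedModule));
         [apply (is_derive_mult (fun t => fst (f t)) (fun t => fst (g t)) x _ _ a c); apply Rmult_comm
         |apply (is_derive_mult (fun t => snd (f t)) (fun t => snd (g t)) x _ _ b d); apply Rmult_comm]|].
    + apply filter_forall; intros; reflexivity.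
    + unfold minus, plus, opp, mult; simpl; ring.
  - eapply is_derive_ext_loc.
    2: evar_last; [apply (is_derive_plus (V:=R_NormedModule));
         [apply (is_derive_mult (fun t => fst (f t)) (fun t => snd (g t)) x _ _ a d); apply Rmult_comm
         |apply (is_derive_mult (fun t => snd (f t)) (fun t => fst (g t)) x _ _ b c); apply Rmult_comm]|].
    + apply filter_forall; intros; reflexivity.
    + unfold minus, plus, opp, mult; simpl; ring.
Qed.

Lemma cder_ext f g f' g' : (forall x, f x = g x) -> (forall x, f' x = g' x) ->
  cder f f' -> cder g g'.
Proof.
  intros H H' D. apply functional_extensionality in H, H'. now subst.
Qed.

Lemma cder_scal c f f' : cder f f' -> cder (fun x => (c * f x)%C) (fun x => (c * f' x)%C).
Proof.
  intros H. eapply cder_ext. 3: apply (cder_mult _ _ _ _ (cder_const c) H).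
  - reflexivity.
  - intros; simpl. ring.
Qed.

Lemma cder_affine f f' (a b : R) : cder f f' ->
  cder (fun x => f (a * x + b)) (fun x => (RtoC a * f' (a * x + b)%R)%C).
Proof.
  intros H x. destruct (H (a * x + b)) as [H1 H2].
  assert (D : is_derive (fun t => a * t + b) x a).
  { auto_derive; [easy | ring]. }
  split; evar_last.
  - exact (is_derive_comp (fun t => fst (f t)) (fun t => a * t + b) x _ _ H1 D).
  - unfold scal; simpl; unfold mult; simpl; ring.
  - exact (is_derive_comp (fun t => snd (f t)) (fun t => a * t + b) x _ _ H2 D).
  - unfold scal; simpl; unfold mult; simpl; ring.
Qed.

(** * Complex integrals *)

Definition CI (f : R -> C) (a b : R) : C :=
  (RInt (fun t => fst (f t)) a b, RInt (fun t => snd (f t)) a b).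

Lemma ex_RInt_cont (f : R -> R) a b : (forall x, continuous f x) -> ex_RInt f a b.
Proof. intros; apply (ex_RInt_continuous (V:=R_CompleteNormedModule)); auto. Qed.

Lemma ex_RInt_fst f a b : ccont f -> ex_RInt (fun t => fst (f t)) a b.
Proof. intros H; apply ex_RInt_cont; apply H. Qed.

Lemma ex_RInt_snd f a b : ccont f -> ex_RInt (fun t => snd (f t)) a b.
Proof. intros H; apply ex_RInt_cont; apply H. Qed.

Lemma CI_ext f g a b : (forall x, f x = g x) -> CI f a b = CI g a b.
Proof. intros H; apply functional_extensionality in H; now subst. Qed.

Lemma CI_ext_in f g a b : a <= b -> (forall x, a < x < b -> f x = g x) -> CI f a b = CI g a b.
Proof.
  intros Hab H. unfold CI. f_equal; apply (RInt_ext (V:=R_CompleteNormedModule)); intros x Hx;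
  rewrite Rmin_left, Rmax_right in Hx by lra; now rewrite H.
Qed.

Lemma CI_plus f g a b : ccont f -> ccont g ->
  CI (fun x => (f x + g x)%C) a b = (CI f a b + CI g a b)%C.
Proof.
  intros Hf Hg. apply C_eq; simpl;
  apply (RInt_plus (V:=R_CompleteNormedModule)); auto using ex_RInt_fst, ex_RInt_snd.
Qed.

Lemma CI_scal c f a b : ccont f -> CI (fun x => (c * f x)%C) a b = (c * CI f a b)%C.
Proof.
  intros Hf. apply C_eq; simpl.
  - rewrite (RInt_minus (V:=R_CompleteNormedModule) (fun x => fst c * fst (f x)) (fun x => snd c * snd (f x)));
    try (apply (ex_RInt_scal (V:=R_NormedModule)); auto using ex_RInt_fst, ex_RInt_snd).
    unfold minus, plus, opp; simpl.
    rewrite (RInt_scal (V:=R_CompleteNormedModule) (fun x => fst (f x))) by auto using ex_RInt_fst.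
    rewrite (RInt_scal (V:=R_CompleteNormedModule) (fun x => snd (f x))) by auto using ex_RInt_snd.
    reflexivity.
  - rewrite (RInt_plus (V:=R_CompleteNormedModule) (fun x => fst c * snd (f x)) (fun x => snd c * fst (f x)));
    try (apply (ex_RInt_scal (V:=R_NormedModule)); auto using ex_RInt_fst, ex_RInt_snd).
    unfold plus; simpl.
    rewrite (RInt_scal (V:=R_CompleteNormedModule) (fun x => fst (f x))) by auto using ex_RInt_fst.
    rewrite (RInt_scal (V:=R_CompleteNormedModule) (fun x => snd (f x))) by auto using ex_RInt_snd.
    reflexivity.
Qed.

Lemma CI_minus f g a b : ccont f -> ccont g ->
  CI (fun x => (f x - g x)%C) a b = (CI f a b - CI g a b)%C.
Proof.
  intros Hf Hg.
  assert (E : forall z : C, (- z)%C = (RtoC (-1) * z)%C).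
  { intros; apply C_eq; simpl; ring. }
  rewrite (CI_ext _ (fun x => f x + (RtoC (-1)) * g x)%C).
  - rewrite CI_plus; auto using ccont_mult, ccont_const.
    rewrite CI_scal by auto. unfold Cminus. now rewrite E.
  - intros; unfold Cminus; now rewrite E.
Qed.

Lemma CI_Chasles f a b c : ccont f -> (CI f a b + CI f b c)%C = CI f a c.
Proof.
  intros Hf. apply C_eq; simpl;
  apply (RInt_Chasles (V:=R_CompleteNormedModule)); auto using ex_RInt_fst, ex_RInt_snd.
Qed.

Lemma CI_const c a b : CI (fun _ => c) a b = (RtoC (b - a) * c)%C.
Proof.
  apply C_eq; simpl; rewrite (RInt_const (V:=R_CompleteNormedModule)); unfold scal; simpl;
  unfold mult; simpl; ring.
Qed.

Lemma CI_point f a : CI f a a = RtoC 0.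
Proof. apply C_eq; simpl; apply (RInt_point (V:=R_CompleteNormedModule)). Qed.

Lemma CI_FTC F f a b : cder F f -> ccont f -> CI f a b = (F b - F a)%C.
Proof.
  intros HF Hf. apply C_eq; simpl; apply is_RInt_unique.
  - apply (is_RInt_derive (V:=R_CompleteNormedModule) (fun t => fst (F t)));
    intros; [apply HF | apply Hf].
  - apply (is_RInt_derive (V:=R_CompleteNormedModule) (fun t => snd (F t)));
    intros; [apply HF | apply Hf].
Qed.

Lemma CI_der f a : ccont f -> cder (fun b => CI f a b) f.
Proof.
  intros Hf x; split; simpl.
  - apply (is_derive_RInt (V:=R_CompleteNormedModule) (fun t => fst (f t)) _ a); [|apply Hf].
    apply filter_forall; intros. apply (RInt_correct (V:=R_CompleteNormedModule)).
    now apply ex_RInt_fst.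
  - apply (is_derive_RInt (V:=R_CompleteNormedModule) (fun t => snd (f t)) _ a); [|apply Hf].
    apply filter_forall; intros. apply (RInt_correct (V:=R_CompleteNormedModule)).
    now apply ex_RInt_snd.
Qed.

(** Multiplying by the unimodular constant [c = conj I / |I|] turns the integral into its modulus;
    then real parts are compared pointwise. *)
Lemma CI_Cmod_le f a b : a <= b -> ccont f -> Cmod (CI f a b) <= RInt (fun t => Cmod (f t)) a b.
Proof.
  intros Hab Hf.
  destruct (Req_dec (Cmod (CI f a b)) 0) as [E|E].
  { rewrite E. apply RInt_ge_0; auto.
    - apply ex_RInt_cont. now apply continuous_Cmod.
    - intros; apply Cmod_ge_0. }
  set (I := CI f a b) in *.
  set (c := (RtoC (/ Cmod I) * Cconj I)%C).
  assert (Hp : 0 < Cmod I) by (pose proof (Cmod_ge_0 I); lra).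
  assert (Hc : Cmod c = 1).
  { unfold c. rewrite Cmod_mult, Cmod_conj, Cmod_R, Rabs_pos_eq.
    - field; lra.
    - left; now apply Rinv_0_lt_compat. }
  assert (H : (c * I)%C = RtoC (Cmod I)).
  { unfold c. replace (RtoC (/ Cmod I) * Cconj I * I)%C with (RtoC (/ Cmod I) * (I * Cconj I))%C by ring.
    rewrite <- Cmod2_conj. rewrite <- RtoC_mult. f_equal. field. lra. }
  unfold I in H at 1. rewrite <- CI_scal in H by auto.
  apply (f_equal fst) in H. change (fst (RtoC (Cmod I))) with (Cmod I) in H. rewrite <- H.
  change (RInt (fun t => fst (c * f t)%C) a b <= RInt (fun t => Cmod (f t)) a b).
  apply RInt_le; auto.
  - apply (ex_RInt_fst (fun t => (c * f t)%C)). apply ccont_mult; auto using ccont_const.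
  - apply ex_RInt_cont. now apply continuous_Cmod.
  - intros x _. eapply Rle_trans; [apply Rle_abs|].
    eapply Rle_trans; [apply (Rabs_fst_le (c * f x)%C)|].
    rewrite Cmod_mult, Hc. lra.
Qed.

Lemma CI_bound f a b M : a <= b -> ccont f -> (forall t, a <= t <= b -> Cmod (f t) <= M) ->
  Cmod (CI f a b) <= M * (b - a).
Proof.
  intros Hab Hf HM. eapply Rle_trans; [apply CI_Cmod_le; auto|].
  replace (M * (b - a)) with (RInt (fun _ => M) a b).
  - apply RInt_le; auto.
    + apply ex_RInt_cont. now apply continuous_Cmod.
    + apply (ex_RInt_const (V:=R_NormedModule)).
    + intros; apply HM; lra.
  - rewrite (RInt_const (V:=R_CompleteNormedModule)); unfold scal; simpl; unfold mult; simpl; ring.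
Qed.

(** Both sides are increments of one primitive. Keeping the factor [u] on the left, instead of
    dividing by it, allows [u = 0]. *)
Lemma CI_affine f (u v a b : R) : ccont f ->
  (RtoC u * CI (fun x => f (u * x + v)%R) a b)%C = CI f (u * a + v) (u * b + v).
Proof.
  intros Hf.
  rewrite <- CI_scal.
  2:{ apply ccont_comp; auto. intros x. apply (ex_derive_continuous (V:=R_NormedModule)).
      auto_derive; easy. }
  assert (D := cder_affine _ _ u v (CI_der f (u * a + v) Hf)).
  rewrite (CI_FTC _ _ a b D).
  - rewrite CI_point. ring.
  - apply ccont_mult; [apply ccont_const|]. apply ccont_comp; auto.
    intros x. apply (ex_derive_continuous (V:=R_NormedModule)). auto_derive; easy.
Qed.

(** * Complex series *)

(** The sum of the first [n] terms, one term less than [sum_n a n]; starting from the empty sum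
    keeps shifts and inductions uniform. *)
Fixpoint Csn (a : nat -> C) (n : nat) : C :=
  match n with O => RtoC 0 | S k => (Csn a k + a k)%C end.

(** Built on the total function [Series], hence meaningful only together with convergence: the
    algebraic laws below carry a summable majorant. *)
Definition Csum (a : nat -> C) : C :=
  (Series (fun n => fst (a n)), Series (fun n => snd (a n))).

Lemma fst_Csn a n : fst (Csn a (S n)) = sum_n (fun k => fst (a k)) n.
Proof.
  induction n.
  - rewrite sum_O. simpl. ring.
  - rewrite sum_Sn, <- IHn. reflexivity.
Qed.

Lemma snd_Csn a n : snd (Csn a (S n)) = sum_n (fun k => snd (a k)) n.
Proof.
  induction n.
  - rewrite sum_O. simpl. ring.
  - rewrite sum_Sn, <- IHn. reflexivity.
Qed.

Definition clim (s : nat -> C) (l : C) : Prop := is_lim_seq (fun n => Cmod (s n - l)) 0.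

Lemma clim_fst s l : clim s l -> is_lim_seq (fun n => fst (s n)) (fst l).
Proof.
  intros H. apply is_lim_seq_ext with (fun n => (fst (s n) - fst l) + fst l); [intros; ring|].
  replace (Finite (fst l)) with (Finite (0 + fst l)) by (f_equal; ring).
  apply (is_lim_seq_plus' _ _ 0 (fst l)); [|apply is_lim_seq_const].
  apply is_lim_seq_abs_0. eapply is_lim_seq_le_le; [| apply is_lim_seq_const | apply H].
  intros n; split; [apply Rabs_pos|]. apply (Rabs_fst_le (s n - l)%C).
Qed.

Lemma clim_snd s l : clim s l -> is_lim_seq (fun n => snd (s n)) (snd l).
Proof.
  intros H. apply is_lim_seq_ext with (fun n => (snd (s n) - snd l) + snd l); [intros; ring|].
  replace (Finite (snd l)) with (Finite (0 + snd l)) by (f_equal; ring).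
  apply (is_lim_seq_plus' _ _ 0 (snd l)); [|apply is_lim_seq_const].
  apply is_lim_seq_abs_0. eapply is_lim_seq_le_le; [| apply is_lim_seq_const | apply H].
  intros n; split; [apply Rabs_pos|]. apply (Rabs_snd_le (s n - l)%C).
Qed.

Lemma clim_pair (s : nat -> C) (l : C) : is_lim_seq (fun n => fst (s n)) (fst l) ->
  is_lim_seq (fun n => snd (s n)) (snd l) -> clim s l.
Proof.
  intros H1 H2.
  assert (A1 : is_lim_seq (fun n => Rabs (fst (s n) - fst l)) 0).
  { apply -> is_lim_seq_abs_0. replace (Finite 0) with (Finite (fst l - fst l)) by (f_equal; ring).
    apply is_lim_seq_minus'; auto. apply is_lim_seq_const. }
  assert (A2 : is_lim_seq (fun n => Rabs (snd (s n) - snd l)) 0).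
  { apply -> is_lim_seq_abs_0. replace (Finite 0) with (Finite (snd l - snd l)) by (f_equal; ring).
    apply is_lim_seq_minus'; auto. apply is_lim_seq_const. }
  eapply is_lim_seq_le_le; [| apply is_lim_seq_const |].
  2: replace (Finite 0) with (Finite (0 + 0)) by (f_equal; ring); apply (is_lim_seq_plus' _ _ _ _ A1 A2).
  intros n; split; [apply Cmod_ge_0|]. apply (Cmod_le_abs (s n - l)%C).
Qed.

Lemma clim_unique s l l' : clim s l -> clim s l' -> l = l'.
Proof.
  intros H H'. apply C_eq.
  - pose proof (is_lim_seq_unique _ _ (clim_fst _ _ H)).
    pose proof (is_lim_seq_unique _ _ (clim_fst _ _ H')). congruence.
  - pose proof (is_lim_seq_unique _ _ (clim_snd _ _ H)).
    pose proof (is_lim_seq_unique _ _ (clim_snd _ _ H')). congruence.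
Qed.

Lemma clim_le s l (e : nat -> R) : (forall n, Cmod (s n - l) <= e n) -> is_lim_seq e 0 -> clim s l.
Proof.
  intros H He. eapply is_lim_seq_le_le; [|apply is_lim_seq_const|apply He].
  intros; split; [apply Cmod_ge_0|apply H].
Qed.

Lemma clim_bound s l B : clim s l -> (forall n, Cmod (s n) <= B) -> Cmod l <= B.
Proof.
  intros H HB.
  apply (is_lim_seq_le (fun n => Cmod l - Cmod (s n - l)) (fun _ => B) (Cmod l) B).
  - intros n. pose proof (HB n). pose proof (Cmod_triangle_inv l (l - s n)).
    replace (l - (l - s n))%C with (s n) in H1 by ring.
    rewrite (Cmod_sub_sym (s n) l). lra.
  - replace (Finite (Cmod l)) with (Finite (Cmod l - 0)) by (f_equal; ring).
    apply is_lim_seq_minus'; [apply is_lim_seq_const|exact H].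
  - apply is_lim_seq_const.
Qed.

Lemma clim_const c : clim (fun _ => c) c.
Proof.
  apply is_lim_seq_ext with (fun _ => 0); [|apply is_lim_seq_const].
  intros. replace (c - c)%C with (RtoC 0) by ring. now rewrite Cmod_0.
Qed.

Lemma clim_plus s s' l l' : clim s l -> clim s' l' -> clim (fun n => (s n + s' n)%C) (l + l')%C.
Proof.
  intros H H'. apply clim_pair; simpl; apply is_lim_seq_plus'; auto using clim_fst, clim_snd.
Qed.

Lemma clim_scal c s l : clim s l -> clim (fun n => (c * s n)%C) (c * l)%C.
Proof.
  intros H. apply clim_le with (fun n => Cmod c * Cmod (s n - l)).
  - intros n. rewrite <- Cmod_mult. right. f_equal. ring.
  - replace (Finite 0) with (Rbar_mult (Cmod c) 0) by (simpl; f_equal; ring).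
    apply is_lim_seq_scal_l. exact H.
Qed.

Lemma clim_incr_n s l N : clim (fun n => s (n + N)%nat) l <-> clim s l.
Proof. unfold clim. symmetry. apply (is_lim_seq_incr_n (fun n => Cmod (s n - l))). Qed.

Lemma clim_subseq s l phi : filterlim phi eventually eventually -> clim s l ->
  clim (fun n => s (phi n)) l.
Proof. intros Hp H. unfold clim. apply (is_lim_seq_subseq (fun n => Cmod (s n - l))); auto. Qed.

Lemma clim_Csum_unique a l : clim (Csn a) l -> Csum a = l.
Proof.
  intros H. apply C_eq; simpl; apply is_series_unique.
  - change (is_lim_seq (sum_n (fun n => fst (a n))) (fst l)).
    apply (is_lim_seq_ext (fun n => fst (Csn a (S n)))); [intros; apply fst_Csn|].
    apply -> (is_lim_seq_incr_1 (fun n => fst (Csn a n))). now apply clim_fst.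
  - change (is_lim_seq (sum_n (fun n => snd (a n))) (snd l)).
    apply (is_lim_seq_ext (fun n => snd (Csn a (S n)))); [intros; apply snd_Csn|].
    apply -> (is_lim_seq_incr_1 (fun n => snd (Csn a n))). now apply clim_snd.
Qed.

Lemma clim_Csum a b : (forall n, Cmod (a n) <= b n) -> ex_series b -> clim (Csn a) (Csum a).
Proof.
  intros H Hb. apply clim_pair; simpl.
  - apply is_lim_seq_incr_1. apply (is_lim_seq_ext (sum_n (fun n => fst (a n)))).
    { intros; symmetry; apply fst_Csn. }
    apply (Series_correct (fun n => _)). apply (ex_series_le (K:=R_AbsRing) (V:=R_CompleteNormedModule) _ b); auto.
    intros n; eapply Rle_trans; [apply Rabs_fst_le | apply H].
  - apply is_lim_seq_incr_1. apply (is_lim_seq_ext (sum_n (fun n => snd (a n)))).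
    { intros; symmetry; apply snd_Csn. }
    apply (Series_correct (fun n => _)). apply (ex_series_le (K:=R_AbsRing) (V:=R_CompleteNormedModule) _ b); auto.
    intros n; eapply Rle_trans; [apply Rabs_snd_le | apply H].
Qed.

Lemma Csn_bound a b n : (forall n, Cmod (a n) <= b n) -> ex_series b -> Cmod (Csn a n) <= Series b.
Proof.
  intros H Hb.
  assert (Hp : forall n, 0 <= b n).
  { intros m. eapply Rle_trans; [apply Cmod_ge_0|apply H]. }
  assert (P : forall m, Cmod (Csn a (S m)) <= sum_n b m).
  { induction m.
    - rewrite sum_O. change (Csn a 1) with (RtoC 0 + a O)%C. rewrite Cplus_0_l. apply H.
    - rewrite sum_Sn. change (Csn a (S (S m))) with (Csn a (S m) + a (S m))%C.
      eapply Rle_trans; [apply Cmod_triangle|].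
      change (plus (sum_n b m) (b (S m))) with (sum_n b m + b (S m)).
      pose proof (H (S m)). lra. }
  assert (Q : forall m, sum_n b m <= Series b).
  { intros m. apply (is_lim_seq_incr_compare (sum_n b)).
    - apply Series_correct; auto.
    - intros k. rewrite sum_Sn. unfold plus; simpl. pose proof (Hp (S k)). lra. }
  destruct n.
  - simpl. rewrite Cmod_0. eapply Rle_trans; [|apply (Q O)]. rewrite sum_O. apply Hp.
  - eapply Rle_trans; [apply P|apply Q].
Qed.

Lemma Csum_bound a b : (forall n, Cmod (a n) <= b n) -> ex_series b -> Cmod (Csum a) <= Series b.
Proof.
  intros H Hb. eapply clim_bound; [eapply clim_Csum; eauto|].
  intros. now apply Csn_bound.
Qed.

Lemma Csn_ext a b n : (forall k, a k = b k) -> Csn a n = Csn b n.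
Proof. intros H; apply functional_extensionality in H; now subst. Qed.

Lemma Csum_ext a b : (forall k, a k = b k) -> Csum a = Csum b.
Proof. intros H; apply functional_extensionality in H; now subst. Qed.

Lemma Csn_plus a b n : Csn (fun k => (a k + b k)%C) n = (Csn a n + Csn b n)%C.
Proof. induction n; simpl; [ring | rewrite IHn; ring]. Qed.

Lemma Csn_scal c a n : Csn (fun k => (c * a k)%C) n = (c * Csn a n)%C.
Proof. induction n; simpl; [ring | rewrite IHn; ring]. Qed.

Lemma Csum_scal c a b : (forall n, Cmod (a n) <= b n) -> ex_series b ->
  Csum (fun n => (c * a n)%C) = (c * Csum a)%C.
Proof.
  intros H Hb. apply clim_Csum_unique.
  eapply is_lim_seq_ext; [|apply (clim_scal c _ _ (clim_Csum a b H Hb))].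
  intros n; simpl. now rewrite Csn_scal.
Qed.

Lemma Csum_plus a b a' b' : (forall n, Cmod (a n) <= a' n) -> ex_series a' ->
  (forall n, Cmod (b n) <= b' n) -> ex_series b' ->
  Csum (fun n => (a n + b n)%C) = (Csum a + Csum b)%C.
Proof.
  intros H1 H2 H3 H4. apply clim_Csum_unique.
  eapply is_lim_seq_ext; [|apply (clim_plus _ _ _ _ (clim_Csum _ _ H1 H2) (clim_Csum _ _ H3 H4))].
  intros n; simpl. now rewrite Csn_plus.
Qed.

Lemma Csn_shift a N n : Csn a (N + n) = (Csn a N + Csn (fun k => a (N + k)%nat) n)%C.
Proof.
  induction n.
  - rewrite Nat.add_0_r. simpl. ring.
  - rewrite Nat.add_succ_r. simpl. rewrite IHn. ring.
Qed.

Lemma Csum_shift a b N : (forall n, Cmod (a n) <= b n) -> ex_series b ->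
  Csum a = (Csn a N + Csum (fun k => a (N + k)%nat))%C.
Proof.
  intros H Hb. eapply clim_unique; [eapply clim_Csum; eauto|].
  apply (clim_incr_n _ _ N).
  eapply is_lim_seq_ext.
  2: apply (clim_plus _ _ _ _ (clim_const (Csn a N))
       (clim_Csum (fun k => a (N + k)%nat) (fun k => b (N + k)%nat) (fun n => H _)
         (proj1 (ex_series_incr_n b N) Hb))).
  intros n; simpl. rewrite (Nat.add_comm n N), Csn_shift. reflexivity.
Qed.

Lemma Series_tail_lim b : ex_series b -> is_lim_seq (fun N => Series (fun k => b (N + k)%nat)) 0.
Proof.
  intros Hb. apply is_lim_seq_incr_1.
  apply is_lim_seq_ext with (fun N => Series b - sum_n b N).
  - intros N. rewrite (Series_incr_n b (S N)); [|lia|auto]. simpl Init.Nat.pred.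
    rewrite sum_n_Reals. ring.
  - replace (Finite 0) with (Finite (Series b - Series b)) by (f_equal; ring).
    apply is_lim_seq_minus'; [apply is_lim_seq_const|]. now apply Series_correct.
Qed.

Lemma Csum_tail a b N : (forall n, Cmod (a n) <= b n) -> ex_series b ->
  Cmod (Csum a - Csn a N) <= Series (fun k => b (N + k)%nat).
Proof.
  intros H Hb. rewrite (Csum_shift a b N H Hb).
  replace (Csn a N + Csum (fun k => a (N + k)%nat) - Csn a N)%C with (Csum (fun k => a (N + k)%nat)) by ring.
  apply Csum_bound; auto. now apply (ex_series_incr_n b N).
Qed.

Ltac cring := apply C_eq; unfold Cminus, Cplus, Copp, Cmult, RtoC; simpl; ring.

(** * Complex exponentials *)

Lemma exp_le (x y : R) : x <= y -> exp x <= exp y.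
Proof. intros [H| ->]; [left; now apply exp_increasing | right; reflexivity]. Qed.

(* [e^(izx)] *)
Definition cE (z : C) (x : R) : C :=
  (exp (- (snd z * x)) * cos (fst z * x), exp (- (snd z * x)) * sin (fst z * x)).

Lemma cE_x0 z : cE z 0 = RtoC 1.
Proof.
  apply C_eq; simpl; rewrite !Rmult_0_r, Ropp_0, exp_0; [rewrite cos_0 | rewrite sin_0]; ring.
Qed.

Lemma cE_z0 x : cE (RtoC 0) x = RtoC 1.
Proof.
  apply C_eq; simpl; rewrite !Rmult_0_l, Ropp_0, exp_0; [rewrite cos_0 | rewrite sin_0]; ring.
Qed.

Lemma cE_plus_z z w x : cE (z + w)%C x = (cE z x * cE w x)%C.
Proof.
  apply C_eq; simpl;
  replace (- ((snd z + snd w) * x)) with (- (snd z * x) + - (snd w * x)) by ring;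
  rewrite exp_plus;
  replace ((fst z + fst w) * x) with (fst z * x + fst w * x) by ring;
  [rewrite cos_plus | rewrite sin_plus]; ring.
Qed.

Lemma cE_scal (t : R) z x : cE (RtoC t * z)%C x = cE z (t * x).
Proof. unfold cE; simpl. f_equal; f_equal; f_equal; ring. Qed.

Lemma cE_plus_x z x y : cE z (x + y) = (cE z x * cE z y)%C.
Proof.
  rewrite <- (Rmult_1_r (x + y)), <- cE_scal, RtoC_plus, Cmult_plus_distr_r, cE_plus_z, !cE_scal.
  now rewrite !Rmult_1_r.
Qed.

Lemma cE_opp z x : cE (- z)%C x = cE z (- x).
Proof.
  replace (- z)%C with (RtoC (-1) * z)%C by (cring).
  rewrite cE_scal. f_equal; ring.
Qed.

Lemma cE_mod z x : Cmod (cE z x) = exp (- (snd z * x)).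
Proof.
  replace (cE z x) with (RtoC (exp (- (snd z * x))) * (cos (fst z * x), sin (fst z * x)))%C
    by (cring).
  rewrite Cmod_mult, Cmod_RtoC_pos by (left; apply exp_pos).
  unfold Cmod; simpl fst; simpl snd.
  replace (cos (fst z * x) ^ 2 + sin (fst z * x) ^ 2) with 1.
  - rewrite sqrt_1; ring.
  - pose proof (sin2_cos2 (fst z * x)). unfold Rsqr in H. lra.
Qed.

Lemma cE_real_mod (a x : R) : Cmod (cE (RtoC a) x) = 1.
Proof. rewrite cE_mod. simpl. now rewrite Rmult_0_l, Ropp_0, exp_0. Qed.

Lemma cE_mod_le z x : Cmod (cE z x) <= exp (Cmod z * Rabs x).
Proof.
  rewrite cE_mod. apply exp_le.
  eapply Rle_trans; [apply Rle_abs|]. rewrite Rabs_Ropp, Rabs_mult.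
  apply Rmult_le_compat_r; [apply Rabs_pos|apply Rabs_snd_le].
Qed.

Lemma cE_der z : cder (cE z) (fun x => (Ci * z * cE z x)%C).
Proof. intros x; split; unfold cE; simpl; auto_derive; auto; ring. Qed.

Lemma cE_ccont z : ccont (cE z).
Proof. eapply cder_ccont, cE_der. Qed.

Lemma cexpi_cE x xi : cexpi (- (x * xi)) = cE (RtoC (- xi)) x.
Proof.
  unfold cexpi. apply C_eq; simpl; rewrite Rmult_0_l, Ropp_0, exp_0, Rmult_1_l; f_equal; ring.
Qed.

(** * Jets *)

(** A function with all its derivatives as explicit data. The derivatives of products, series,
    contour integrals and convolutions are then named rather than recomputed, and [smooth] is met
    only at the interface with the definitions. *)
Definition jet (F : nat -> R -> C) : Prop := forall n, cder (F n) (F (S n)).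

Lemma jet_ccont F k : jet F -> ccont (F k).
Proof. intros H; eapply cder_ccont, H. Qed.

Lemma jet_Derive_n F n : jet F -> forall x,
  Derive_n (fun t => fst (F O t)) n x = fst (F n x) /\
  Derive_n (fun t => snd (F O t)) n x = snd (F n x).
Proof.
  intros H; induction n; intros x; [easy|]. split; simpl.
  - rewrite (Derive_ext _ (fun t => fst (F n t))) by apply IHn.
    apply is_derive_unique, H.
  - rewrite (Derive_ext _ (fun t => snd (F n t))) by apply IHn.
    apply is_derive_unique, H.
Qed.

Lemma jet_cderiv_n F n x : jet F -> cderiv_n (F O) n x = F n x.
Proof. intros H. apply C_eq; simpl; now apply jet_Derive_n. Qed.

Lemma jet_smooth F : jet F -> smooth (F O).
Proof.
  intros H [|n] x; [easy|]. split; simpl.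
  - apply ex_derive_ext with (fun t => fst (F n t)).
    + intros t; symmetry; now apply (jet_Derive_n F n H t).
    + exists (fst (F (S n) x)). apply (proj1 (H n x)).
  - apply ex_derive_ext with (fun t => snd (F n t)).
    + intros t; symmetry; now apply (jet_Derive_n F n H t).
    + exists (snd (F (S n) x)). apply (proj2 (H n x)).
Qed.

Lemma smooth_jet f : smooth f -> jet (cderiv_n f).
Proof.
  intros H n x. split; simpl; apply Derive_correct; apply (H (S n) x).
Qed.

Lemma cderiv_n_0 f : cderiv_n f O = f.
Proof. apply functional_extensionality; intros x. unfold cderiv_n; simpl. now destruct (f x). Qed.

Lemma jet_plus F G : jet F -> jet G -> jet (fun n x => (F n x + G n x)%C).
Proof. intros HF HG n. apply cder_plus; auto. Qed.

Lemma jet_scal c F : jet F -> jet (fun n x => (c * F n x)%C).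
Proof. intros HF n. apply cder_scal; auto. Qed.

Lemma jet_minus F G : jet F -> jet G -> jet (fun n x => (F n x - G n x)%C).
Proof.
  intros HF HG n. eapply cder_ext. 3: apply cder_plus; [apply (HF n)|apply (jet_scal (RtoC (-1)) G HG n)].
  - intros x; cring.
  - intros x; cring.
Qed.

Lemma jet_shift F k : jet F -> jet (fun n => F (k + n)%nat).
Proof. intros H n. rewrite Nat.add_succ_r. apply H. Qed.

Lemma jet_affine F (a b : R) : jet F -> jet (fun n x => (RtoC (a ^ n) * F n (a * x + b)%R)%C).
Proof.
  intros H n. eapply cder_ext. 3: apply cder_scal, cder_affine, H.
  - reflexivity.
  - intros x; simpl. rewrite RtoC_mult. ring.
Qed.

Lemma jet_zero : jet (fun _ _ => RtoC 0).
Proof. intros n. apply cder_const. Qed.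

Definition Ejet (z : C) (n : nat) (x : R) : C := (Cpow (Ci * z) n * cE z x)%C.

Lemma jet_E z : jet (Ejet z).
Proof.
  intros n. eapply cder_ext. 3: apply cder_scal, cE_der.
  - reflexivity.
  - intros x; unfold Ejet; simpl. ring.
Qed.

Lemma Ejet_0 z : Ejet z O = cE z.
Proof. apply functional_extensionality; intros x; unfold Ejet; simpl; ring. Qed.

Lemma Cmod_Ejet z n x : Cmod (Ejet z n x) = Cmod z ^ n * Cmod (cE z x).
Proof. unfold Ejet. now rewrite Cmod_mult, Cmod_pow, Cmod_mult, Cmod_Ci, Rmult_1_l. Qed.

(* Leibniz' rule, unfolded as (FG)' = F'G + FG'. *)
Fixpoint pseq (n : nat) (F G : nat -> R -> C) (x : R) : C :=
  match n with
  | O => (F O x * G O x)%C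
  | S k => (pseq k (fun i => F (S i)) G x + pseq k F (fun i => G (S i)) x)%C
  end.

Lemma jet_pseq F G : jet F -> jet G -> jet (fun n => pseq n F G).
Proof.
  intros HF HG n. revert F G HF HG. induction n; intros F G HF HG.
  - simpl. apply cder_mult; [apply HF|apply HG].
  - change (cder (fun x => (pseq n (fun i => F (S i)) G x + pseq n F (fun i => G (S i)) x)%C)
      (fun x => (pseq (S n) (fun i => F (S i)) G x + pseq (S n) F (fun i => G (S i)) x)%C)).
    apply cder_plus; apply IHn; auto.
    + apply (jet_shift F 1 HF).
    + apply (jet_shift G 1 HG).
Qed.

Lemma pseq_bound n F G x A B : (forall i, (i <= n)%nat -> Cmod (F i x) <= A) ->
  (forall i, (i <= n)%nat -> Cmod (G i x) <= B) -> Cmod (pseq n F G x) <= 2 ^ n * (A * B).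
Proof.
  revert F G. induction n; intros F G HF HG.
  - simpl. rewrite Rmult_1_l, Cmod_mult. apply Rmult_le_compat; auto using Cmod_ge_0.
  - simpl. eapply Rle_trans; [apply Cmod_triangle|].
    assert (Cmod (pseq n (fun i => F (S i)) G x) <= 2 ^ n * (A * B)).
    { apply IHn; intros; [apply HF|apply HG]; lia. }
    assert (Cmod (pseq n F (fun i => G (S i)) x) <= 2 ^ n * (A * B)).
    { apply IHn; intros; [apply HF|apply HG]; lia. }
    lra.
Qed.

Lemma pseq_left_zero n F G x : (forall i, F i x = RtoC 0) -> pseq n F G x = RtoC 0.
Proof.
  revert F G; induction n; intros F G H; simpl.
  - rewrite H; ring.
  - rewrite IHn, IHn; auto; ring.
Qed.

Lemma jet_local F G a b : jet F -> jet G -> (forall x, a < x < b -> F O x = G O x) ->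
  forall k x, a < x < b -> F k x = G k x.
Proof.
  intros HF HG H k; induction k; auto. intros x Hx.
  assert (L : locally x (fun y => a < y < b)).
  { apply (open_and (fun y => a < y) (fun y => y < b) (open_gt a) (open_lt b) x Hx). }
  apply C_eq.
  - rewrite <- (is_derive_unique _ _ _ (proj1 (HF k x))), <- (is_derive_unique _ _ _ (proj1 (HG k x))).
    apply Derive_ext_loc. eapply filter_imp; [|exact L]. intros y Hy; now rewrite IHk.
  - rewrite <- (is_derive_unique _ _ _ (proj2 (HF k x))), <- (is_derive_unique _ _ _ (proj2 (HG k x))).
    apply Derive_ext_loc. eapply filter_imp; [|exact L]. intros y Hy; now rewrite IHk.
Qed.

(** * Mean value and Taylor estimates, differentiation of series *)

Lemma CI_bound_abs f a b M : ccont f -> (forall t, Rmin a b <= t <= Rmax a b -> Cmod (f t) <= M) ->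
  Cmod (CI f a b) <= M * Rabs (b - a).
Proof.
  intros Hf HM. destruct (Rle_dec a b) as [H|H].
  - rewrite Rabs_pos_eq by lra. apply CI_bound; auto.
    intros; apply HM. rewrite Rmin_left, Rmax_right; lra.
  - assert (E : (CI f a b + CI f b a)%C = RtoC 0).
    { rewrite CI_Chasles by auto. apply CI_point. }
    replace (CI f a b) with (- CI f b a)%C.
    + rewrite Cmod_opp, <- Rabs_Ropp, Rabs_pos_eq by lra.
      replace (- (b - a)) with (a - b) by ring. apply CI_bound; auto; [lra|].
      intros; apply HM. rewrite Rmin_right, Rmax_left; lra.
    + replace (- CI f b a)%C with (CI f a b - (CI f a b + CI f b a))%C by ring. rewrite E. ring.
Qed.

Lemma cder_mvt F F' B x y : cder F F' -> ccont F' ->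
  (forall t, Rmin x y <= t <= Rmax x y -> Cmod (F' t) <= B) ->
  Cmod (F y - F x) <= B * Rabs (y - x).
Proof. intros HF Hc HB. rewrite <- (CI_FTC F F'); auto. now apply CI_bound_abs. Qed.

(** The mean value inequality is used twice, for the remainder as a function of the endpoint and for
    [F']; the lost factor 1/2 is harmless. *)
Lemma cder_taylor F F' F'' B x s : cder F F' -> cder F' F'' -> ccont F'' ->
  (forall t, Rabs (t - x) <= Rabs s -> Cmod (F'' t) <= B) ->
  Cmod (F (x + s)%R - F x - RtoC s * F' x) <= B * s ^ 2.
Proof.
  intros H1 H2 Hc HB.
  assert (Hr : forall t, Rmin x (x + s) <= t <= Rmax x (x + s) -> Rabs (t - x) <= Rabs s).
  { intros t. unfold Rmin, Rmax; destruct (Rle_dec x (x + s)); intros; unfold Rabs;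
    destruct (Rcase_abs (t - x)), (Rcase_abs s); lra. }
  assert (HB0 : 0 <= B).
  { eapply Rle_trans; [apply Cmod_ge_0|apply (HB x)]. replace (x - x) with 0 by ring.
    rewrite Rabs_R0. apply Rabs_pos. }
  set (G := fun y => (F y + (RtoC (-1) * F x + (RtoC (-1) * F' x) * RtoC (1 * y + - x)))%C).
  assert (HG : cder G (fun y => (F' y - F' x)%C)).
  { eapply cder_ext.
    3: apply cder_plus; [apply H1|]; apply cder_plus; [apply cder_const|];
       apply cder_scal; apply (cder_affine (fun t => RtoC t) (fun _ => RtoC 1) 1 (-x)).
    - reflexivity.
    - intros y; simpl. cring.
    - intros y; split; simpl; [apply (is_derive_id (K:=R_AbsRing)) | apply (is_derive_const (V:=R_NormedModule))]. }
  assert (HH := cder_mvt G _ (B * Rabs s) x (x + s) HG).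
  replace (F (x + s)%R - F x - RtoC s * F' x)%C with (G (x + s)%R - G x)%C.
  - eapply Rle_trans; [apply HH|].
    + apply ccont_minus; [eapply cder_ccont; eauto | apply ccont_const].
    + intros t Ht. eapply Rle_trans; [apply (cder_mvt F' F'' B x t H2 Hc)|].
      * intros u Hu. apply HB. apply Hr in Ht. revert Hu Ht.
        unfold Rmin, Rmax; destruct (Rle_dec x t); intros; unfold Rabs in *;
        destruct (Rcase_abs (t - x)), (Rcase_abs s), (Rcase_abs (u - x)); lra.
      * apply Rmult_le_compat_l; auto.
    + replace (x + s - x) with s by ring. rewrite <- (pow2_abs s). right; ring.
  - unfold G. cring.
Qed.

Lemma cder_of_little_o F F' :
  (forall x eps, 0 < eps -> exists delta, 0 < delta /\ forall s, Rabs s < delta ->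
    Cmod (F (x + s)%R - F x - RtoC s * F' x) <= eps * Rabs s) -> cder F F'.
Proof.
  intros H x. split; apply is_derive_Reals; intros eps He;
  destruct (H x (eps / 2)) as [d [Hd Hs]]; try lra; exists (mkposreal d Hd); simpl;
  intros h Hh Hhd; specialize (Hs h Hhd);
  assert (0 < Rabs h) by now apply Rabs_pos_lt.
  - replace ((fst (F (x + h)) - fst (F x)) / h - fst (F' x)) with
      ((fst (F (x + h)%R - F x - RtoC h * F' x)%C) / h) by (simpl; field; auto).
    unfold Rdiv. rewrite Rabs_mult, Rabs_inv.
    apply Rmult_lt_reg_r with (Rabs h); auto. rewrite Rmult_assoc, Rinv_l, Rmult_1_r by lra.
    eapply Rle_lt_trans; [apply Rabs_fst_le|]. nra.
  - replace ((snd (F (x + h)) - snd (F x)) / h - snd (F' x)) with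
      ((snd (F (x + h)%R - F x - RtoC h * F' x)%C) / h) by (simpl; field; auto).
    unfold Rdiv. rewrite Rabs_mult, Rabs_inv.
    apply Rmult_lt_reg_r with (Rabs h); auto. rewrite Rmult_assoc, Rinv_l, Rmult_1_r by lra.
    eapply Rle_lt_trans; [apply Rabs_snd_le|]. nra.
Qed.

(** The criterion behind differentiation under sums, integrals and distributions: a quadratic
    remainder estimate survives these operations as soon as the second derivatives are bounded
    uniformly. *)
Lemma cder_of_taylor F F' :
  (forall x, exists B, forall s, Rabs s <= 1 ->
    Cmod (F (x + s)%R - F x - RtoC s * F' x) <= B * s ^ 2) -> cder F F'.
Proof.
  intros H. apply cder_of_little_o. intros x eps He.
  destruct (H x) as [B HB]. pose proof (Rabs_pos B).
  assert (Hp : 0 < eps / (Rabs B + 1)) by (apply Rdiv_lt_0_compat; lra).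
  exists (Rmin 1 (eps / (Rabs B + 1))). split.
  - apply Rmin_glb_lt; lra.
  - intros s Hs.
    assert (Rabs s <= 1) by (pose proof (Rmin_l 1 (eps / (Rabs B + 1))); lra).
    assert (Hs2 : Rabs s <= eps / (Rabs B + 1)) by (pose proof (Rmin_r 1 (eps / (Rabs B + 1))); lra).
    eapply Rle_trans; [apply HB; auto|]. rewrite <- (pow2_abs s).
    pose proof (Rle_abs B). pose proof (Rabs_pos s).
    assert (Rabs s * (Rabs B + 1) <= eps).
    { apply Rmult_le_reg_r with (/ (Rabs B + 1)); [apply Rinv_0_lt_compat; lra|].
      rewrite Rmult_assoc, Rinv_r by lra. unfold Rdiv in Hs2. lra. }
    simpl. nra.
Qed.

Lemma jet_taylor F B x s k : jet F ->
  (forall t, Rabs (t - x) <= Rabs s -> Cmod (F (S (S k)) t) <= B) ->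
  Cmod (F k (x + s)%R - F k x - RtoC s * F (S k) x) <= B * s ^ 2.
Proof.
  intros H HB. eapply cder_taylor; [apply H|apply H| |exact HB]. now apply jet_ccont.
Qed.

Definition jets_summable (F : nat -> nat -> R -> C) : Prop :=
  forall M k, exists b : nat -> R, ex_series b /\ forall n x, Rabs x <= M -> Cmod (F n k x) <= b n.

Lemma ex_series_plus_R (a b : nat -> R) : ex_series a -> ex_series b -> ex_series (fun n => a n + b n).
Proof. intros; now apply (ex_series_plus (V:=R_NormedModule)). Qed.

Lemma ex_series_scal_R (c : R) (a : nat -> R) : ex_series a -> ex_series (fun n => c * a n).
Proof. intros [l H]. exists (c * l). apply (is_series_scal_l (K:=R_AbsRing) c a l H). Qed.

(** The Taylor remainders are summed term by term. Only the majorant of the derivatives of order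
    [k + 2] enters the final bound; those of orders [k] and [k + 1] serve to split the series. *)
Lemma jet_series F : (forall n, jet (F n)) -> jets_summable F ->
  jet (fun k x => Csum (fun n => F n k x)).
Proof.
  intros HF Hs k. apply cder_of_taylor. intros x.
  destruct (Hs (Rabs x + 1) k) as [b0 [S0 B0]].
  destruct (Hs (Rabs x + 1) (S k)) as [b1 [S1 B1]].
  destruct (Hs (Rabs x + 1) (S (S k))) as [b2 [S2 B2]].
  exists (Series b2). intros s Hs1.
  assert (Hx : Rabs x <= Rabs x + 1) by lra.
  assert (Hxs : Rabs (x + s) <= Rabs x + 1).
  { eapply Rle_trans; [apply Rabs_triang|]. lra. }
  rewrite <- (Csum_scal (RtoC s) _ b1); auto.
  replace (Csum (fun n => F n k (x + s)%R) - Csum (fun n => F n k x) - Csum (fun n => (RtoC s * F n (S k) x)%C))%C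
   with (Csum (fun n => (F n k (x + s)%R + (RtoC (-1) * F n k x + RtoC (-1) * (RtoC s * F n (S k) x)))%C)).
  - rewrite <- (Rmult_comm (s ^ 2)), <- Series_scal_l.
    apply Csum_bound.
    + intros n. replace (F n k (x + s)%R + (RtoC (-1) * F n k x + RtoC (-1) * (RtoC s * F n (S k) x)))%C
        with (F n k (x + s)%R - F n k x - RtoC s * F n (S k) x)%C by (cring).
      rewrite Rmult_comm. apply jet_taylor; auto. intros t Ht. apply B2.
      replace t with (x + (t - x)) by ring. eapply Rle_trans; [apply Rabs_triang|]. lra.
    + apply ex_series_scal_R; auto.
  - assert (Hm : forall c z, Cmod (c * z) = Cmod c * Cmod z) by (intros; apply Cmod_mult).
    rewrite (Csum_plus _ _ b0 (fun n => Cmod (RtoC (-1)) * b0 n + Cmod (RtoC (-1)) * (Cmod (RtoC s) * b1 n))).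
    + rewrite (Csum_plus _ _ (fun n => Cmod (RtoC (-1)) * b0 n) (fun n => Cmod (RtoC (-1)) * (Cmod (RtoC s) * b1 n))).
      * rewrite (Csum_scal _ _ b0), (Csum_scal _ _ (fun n => Cmod (RtoC s) * b1 n)); auto.
        -- cring.
        -- intros n. rewrite Hm. apply Rmult_le_compat_l; auto using Cmod_ge_0.
        -- apply ex_series_scal_R; auto.
      * intros n. rewrite Hm. apply Rmult_le_compat_l; auto using Cmod_ge_0.
      * apply ex_series_scal_R; auto.
      * intros n. rewrite !Hm. repeat (apply Rmult_le_compat_l; auto using Cmod_ge_0).
      * apply ex_series_scal_R. now apply ex_series_scal_R.
    + auto.
    + auto.
    + intros n. eapply Rle_trans; [apply Cmod_triangle|]. rewrite !Hm.
      apply Rplus_le_compat; repeat (apply Rmult_le_compat_l; auto using Cmod_ge_0).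
    + apply ex_series_plus_R; repeat (apply ex_series_scal_R; auto).
Qed.

Lemma jets_summable_upto F : jets_summable F -> forall M N, exists b : nat -> R, ex_series b /\
  forall n k x, (k <= N)%nat -> Rabs x <= M -> Cmod (F n k x) <= b n.
Proof.
  intros H M N. destruct (Rle_dec 0 M) as [HM|HM].
  2:{ exists (fun _ => 0). split.
      - exists 0. apply filterlim_ext with (fun _ => 0); [|apply filterlim_const].
        intros n. rewrite sum_n_const. ring.
      - intros n k x _ Hx. pose proof (Rabs_pos x). lra. }
  assert (R0 : Rabs 0 <= M) by now rewrite Rabs_R0.
  induction N.
  - destruct (H M O) as [b [Hb Hx]]. exists b; split; auto.
    intros n k x Hk; replace k with O by lia; auto.
  - destruct IHN as [b [Hb Hx]], (H M (S N)) as [b' [Hb' Hx']].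
    exists (fun n => b n + b' n). split; [now apply ex_series_plus_R|].
    intros n k x Hk Hxx.
    pose proof (Rle_trans _ _ _ (Cmod_ge_0 _) (Hx n O 0 ltac:(lia) R0)).
    pose proof (Rle_trans _ _ _ (Cmod_ge_0 _) (Hx' n 0 R0)).
    destruct (Nat.eq_dec k (S N)) as [->|].
    + specialize (Hx' n x Hxx). lra.
    + specialize (Hx n k x ltac:(lia) Hxx). lra.
Qed.

(** * Compactly supported distributions acting on jets *)

Section Dist.
Variable v : (R -> C) -> C.
Hypothesis Hv : cs_dist v.

Lemma cs_dist_add F G : jet F -> jet G ->
  v (fun x => (F O x + G O x)%C) = (v (F O) + v (G O))%C.
Proof. intros HF HG. apply Hv; now apply jet_smooth. Qed.

Lemma cs_dist_scal c F : jet F -> v (fun x => (c * F O x)%C) = (c * v (F O))%C.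
Proof. intros HF. apply Hv; now apply jet_smooth. Qed.

Lemma cs_dist_sub F G : jet F -> jet G ->
  v (fun x => (F O x - G O x)%C) = (v (F O) - v (G O))%C.
Proof.
  intros HF HG.
  replace (fun x => (F O x - G O x)%C) with (fun x => (F O x + RtoC (-1) * G O x)%C)
    by (apply functional_extensionality; intros; cring).
  rewrite (cs_dist_add F (fun n x => (RtoC (-1) * G n x)%C)); auto.
  - rewrite cs_dist_scal by auto. cring.
  - now apply jet_scal.
Qed.

Lemma cs_dist_bound : exists (M K : R) (N : nat), 0 <= K /\ forall F B, jet F ->
  (forall k x, (k <= N)%nat -> Rabs x <= M -> Cmod (F k x) <= B) -> Cmod (v (F O)) <= K * B.
Proof.
  destruct Hv as [_ [_ [M [K [N [HK H]]]]]]. exists M, K, N; split; auto.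
  intros F B HF HB. apply H; [now apply jet_smooth|]. intros k x Hk Hx.
  rewrite jet_cderiv_n by auto. auto.
Qed.

(** The continuity bound sees jets on a compact interval only. The margin 1 gives an open interval
    around it, on which equality of functions passes to all derivatives. *)
Lemma cs_dist_local : exists M, 0 < M /\ forall F G, jet F -> jet G ->
  (forall x, Rabs x < M -> F O x = G O x) -> v (F O) = v (G O).
Proof.
  destruct cs_dist_bound as [M [K [N [HK H]]]]. exists (Rabs M + 1).
  split; [pose proof (Rabs_pos M); lra|]. intros F G HF HG E.
  assert (D := jet_local F G (- (Rabs M + 1)) (Rabs M + 1) HF HG).
  assert (Z : Cmod (v (F O) - v (G O)) <= K * 0).
  { rewrite <- cs_dist_sub by auto.
    apply (H (fun n x => (F n x - G n x)%C)); [now apply jet_minus|].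
    intros k x Hk Hx. rewrite D.
    - replace (G k x - G k x)%C with (RtoC 0) by ring. rewrite Cmod_0; lra.
    - intros y Hy. apply E. apply Rabs_def1; lra.
    - pose proof (Rle_abs M). apply Rabs_le_between in Hx. lra. }
  assert (Z' : Cmod (v (F O) - v (G O)) = 0) by (pose proof (Cmod_ge_0 (v (F O) - v (G O))); lra).
  apply Cmod_eq_0 in Z'.
  replace (v (F O)) with ((v (F O) - v (G O)) + v (G O))%C by ring. rewrite Z'. ring.
Qed.

Lemma jet_Csn F n : (forall i, jet (F i)) -> jet (fun k x => Csn (fun i => F i k x) n).
Proof.
  intros H; induction n; simpl; [apply jet_zero|].
  apply (jet_plus (fun k x => Csn (fun i => F i k x) n) (F n)); auto.
Qed.

Lemma cs_dist_Csn F n : (forall i, jet (F i)) ->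
  v (fun x => Csn (fun i => F i O x) n) = Csn (fun i => v (F i O)) n.
Proof.
  intros H; induction n; simpl.
  - assert (E := cs_dist_scal (RtoC 0) _ jet_zero). simpl in E.
    replace (fun _ : R => RtoC 0) with (fun _ : R => (RtoC 0 * RtoC 0)%C)
      by (apply functional_extensionality; intros; ring).
    rewrite E. ring.
  - rewrite <- IHn. apply (cs_dist_add (fun k x => Csn (fun i => F i k x) n) (F n)); auto.
    now apply jet_Csn.
Qed.

Lemma cs_dist_series_bound F : (forall n, jet (F n)) -> jets_summable F ->
  exists b : nat -> R, ex_series b /\ forall n, Cmod (v (F n O)) <= b n.
Proof.
  intros HF Hs. destruct cs_dist_bound as [M [K [N [HK H]]]].
  destruct (jets_summable_upto F Hs M N) as [b [Hb Hx]].
  exists (fun n => K * b n). split; [now apply ex_series_scal_R|].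
  intros n. apply H; auto.
Qed.

Lemma cs_dist_series F : (forall n, jet (F n)) -> jets_summable F ->
  v (fun x => Csum (fun n => F n O x)) = Csum (fun n => v (F n O)).
Proof.
  intros HF Hs. symmetry. apply clim_Csum_unique.
  destruct cs_dist_bound as [M [K [N [HK H]]]].
  destruct (jets_summable_upto F Hs M N) as [b [Hb Hx]].
  apply clim_le with (fun n => K * Series (fun k => b (n + k)%nat)).
  - intros n. rewrite <- cs_dist_Csn by auto.
    rewrite <- (cs_dist_sub (fun k x => Csn (fun i => F i k x) n) (fun k x => Csum (fun i => F i k x)));
      [| now apply jet_Csn | now apply jet_series].
    apply (H (fun k x => (Csn (fun i => F i k x) n - Csum (fun i => F i k x))%C)).
    + apply (jet_minus (fun k x => Csn (fun i => F i k x) n) (fun k x => Csum (fun i => F i k x)));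
      [now apply jet_Csn | now apply jet_series].
    + intros k x Hk HM. rewrite Cmod_sub_sym. apply Csum_tail; auto.
  - replace (Finite 0) with (Rbar_mult K 0) by (simpl; f_equal; ring).
    apply is_lim_seq_scal_l. now apply Series_tail_lim.
Qed.

(** * Convolution *)

Lemma jet_reflect F x : jet F -> jet (fun j y => (RtoC ((-1) ^ j) * F j (x - y)%R)%C).
Proof.
  intros HF. assert (J := jet_affine F (-1) x HF).
  intros n. eapply cder_ext. 3: apply (J n).
  - intros y; simpl. do 2 f_equal. ring.
  - intros y; simpl. do 2 f_equal. ring.
Qed.

Lemma Cmod_sign j : Cmod (RtoC ((-1) ^ j)) = 1.
Proof. rewrite Cmod_R, <- RPow_abs. replace (Rabs (-1)) with 1; [apply pow1|]. rewrite Rabs_left; lra. Qed.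

Lemma fun_reflect_0 (F : nat -> R -> C) x :
  (fun y => F O (x - y)) = (fun j y => (RtoC ((-1) ^ j) * F j (x - y)%R)%C) O.
Proof. apply functional_extensionality; intros; simpl. ring. Qed.

Lemma conv_bound : exists (M K : R) (N : nat), 0 <= K /\ forall F B x, jet F ->
  (forall k y, (k <= N)%nat -> Rabs (y - x) <= M -> Cmod (F k y) <= B) ->
  Cmod (conv v (F O) x) <= K * B.
Proof.
  destruct cs_dist_bound as [M [K [N [HK H]]]]. exists M, K, N; split; auto.
  intros F B x HF HB. unfold conv. rewrite fun_reflect_0.
  apply (H (fun j y => (RtoC ((-1) ^ j) * F j (x - y)%R)%C)); [now apply jet_reflect|].
  intros k y Hk Hy. rewrite Cmod_mult, Cmod_sign, Rmult_1_l. apply HB; auto.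
  replace (x - y - x) with (- y) by ring. now rewrite Rabs_Ropp.
Qed.

Lemma conv_lin3 F G H c x : jet F -> jet G -> jet H ->
  (conv v (F O) x - conv v (G O) x - c * conv v (H O) x)%C =
  conv v (fun y => (F O y - G O y - c * H O y)%C) x.
Proof.
  intros HF HG HH. unfold conv.
  assert (JF := jet_reflect F x HF). assert (JG := jet_reflect G x HG).
  assert (JH := jet_scal c _ (jet_reflect H x HH)).
  rewrite (fun_reflect_0 F), (fun_reflect_0 G), (fun_reflect_0 H).
  rewrite <- (cs_dist_sub _ _ JF JG).
  rewrite <- (cs_dist_scal c _ (jet_reflect H x HH)).
  rewrite <- (cs_dist_sub _ _ (jet_minus _ _ JF JG) JH).
  f_equal. apply functional_extensionality; intros y; simpl. ring.
Qed.

(** The Taylor remainder of [F], uniform over the [N] orders and the compact set that the continuity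
    bound of [v] involves, is inserted into that bound. *)
Lemma jet_conv F : jet F -> jet (fun k x => conv v (F k) x).
Proof.
  intros HF k. apply cder_of_taylor. intros x.
  destruct conv_bound as [M [K [N [HK H]]]].
  assert (Hb : exists B, 0 <= B /\ forall j y, (j <= N)%nat -> Rabs (y - x) <= Rabs M + 1 -> Cmod (F (S (S k) + j)%nat y) <= B).
  { clear H. induction N.
    - destruct (continuity_ab_maj (fun y => Cmod (F (S (S k) + 0)%nat y)) (x - (Rabs M + 1)) (x + (Rabs M + 1))) as [m [Hm _]].
      + pose proof (Rabs_pos M). lra.
      + intros c _. apply continuity_pt_filterlim. apply (continuous_Cmod _ (jet_ccont F _ HF) c).
      + exists (Cmod (F (S (S k) + 0)%nat m)). split; [apply Cmod_ge_0|].
        intros j y Hj Hy. replace j with O by lia. apply Hm. apply Rabs_le_between in Hy; lra.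
    - destruct IHN as [B [HB0 HB]].
      destruct (continuity_ab_maj (fun y => Cmod (F (S (S k) + S N)%nat y)) (x - (Rabs M + 1)) (x + (Rabs M + 1))) as [m [Hm _]].
      + pose proof (Rabs_pos M). lra.
      + intros c _. apply continuity_pt_filterlim. apply (continuous_Cmod _ (jet_ccont F _ HF) c).
      + exists (B + Cmod (F (S (S k) + S N)%nat m)).
        pose proof (Cmod_ge_0 (F (S (S k) + S N)%nat m)). split; [lra|].
        intros j y Hj Hy. destruct (Nat.eq_dec j (S N)) as [->|].
        * assert (Cmod (F (S (S k) + S N)%nat y) <= Cmod (F (S (S k) + S N)%nat m)); [|lra].
          apply Hm. apply Rabs_le_between in Hy; lra.
        * specialize (HB j y ltac:(lia) Hy). lra. }
  destruct Hb as [B [HB0 HB]].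
  exists (K * B). intros s Hs.
  assert (JS : forall k, jet (fun j y => F (k + j)%nat (y + s))).
  { intros k' n. eapply cder_ext. 3: apply (jet_affine _ 1 s (jet_shift F k' HF) n).
    - intros; simpl. rewrite pow1. rewrite Rmult_1_l. ring.
    - intros; simpl. rewrite pow1. rewrite !Rmult_1_l. ring. }
  assert (E1 : conv v (F k) (x + s) = conv v (fun y => F k (y + s)) x).
  { unfold conv. f_equal. apply functional_extensionality; intros; f_equal; ring. }
  rewrite E1.
  assert (J1 := JS k). assert (J2 := jet_shift F k HF). assert (J3 := jet_shift F (S k) HF).
  replace (F k) with (F (k + 0)%nat) by (f_equal; lia).
  replace (F (S k)) with (F (S k + 0)%nat) by (f_equal; lia).
  rewrite (conv_lin3 (fun j y => F (k + j)%nat (y + s)) (fun j => F (k + j)%nat) (fun j => F (S k + j)%nat) (RtoC s) x J1 J2 J3).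
  rewrite Rmult_assoc.
  apply (H (fun j y => (F (k + j)%nat (y + s)%R - F (k + j)%nat y - RtoC s * F (S k + j)%nat y)%C)).
  - apply (jet_minus (fun j y => (F (k + j)%nat (y + s)%R - F (k + j)%nat y)%C) (fun j y => (RtoC s * F (S k + j)%nat y)%C)).
    + apply (jet_minus (fun j y => (F (k + j)%nat (y + s)%R)%C) (fun j y => (F (k + j)%nat y)%C)); auto.
    + now apply jet_scal.
  - intros j y Hj Hy. apply (jet_taylor F B y s (k + j)); auto.
    intros t Ht. replace (S (S (k + j))) with (S (S k) + j)%nat by lia. apply HB; auto.
    replace (t - x) with ((t - y) + (y - x)) by ring.
    eapply Rle_trans; [apply Rabs_triang|]. pose proof (Rle_abs M). lra.
Qed.

End Dist.

(** * Superpositions of exponentials along segments *)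

Definition seg (p d : C) (t : R) : C := (p + RtoC t * d)%C.

Lemma ccont_bounded f a b : ccont f -> exists B, 0 <= B /\ forall t, a <= t <= b -> Cmod (f t) <= B.
Proof.
  intros Hf. destruct (Rle_dec a b) as [H|H].
  - destruct (continuity_ab_maj (fun y => Cmod (f y)) a b H) as [m [Hm _]].
    + intros c _. apply continuity_pt_filterlim. now apply (continuous_Cmod f).
    + exists (Cmod (f m)); split; [apply Cmod_ge_0|exact Hm].
  - exists 0; split; [lra|]. intros; lra.
Qed.

Lemma seg_der p d : cder (seg p d) (fun _ => d).
Proof.
  intros t; split; unfold seg; simpl; auto_derive; auto; ring.
Qed.

Lemma ccont_seg p d : ccont (seg p d).
Proof. eapply cder_ccont, seg_der. Qed.

Lemma cE_seg p d t x : cE (seg p d t) x = (cE p x * cE d (t * x))%C.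
Proof. unfold seg. now rewrite cE_plus_z, cE_scal. Qed.

Lemma cE_seg_der p d x :
  cder (fun t => cE (seg p d t) x) (fun t => (Ci * d * RtoC x * cE (seg p d t) x)%C).
Proof.
  eapply cder_ext. 3: apply (cder_scal (cE p x)), (cder_affine _ _ x 0 (cE_der d)).
  - intros t; simpl. rewrite cE_seg. do 2 f_equal. ring.
  - intros t; simpl. rewrite cE_seg. replace (x * t + 0) with (t * x) by ring. ring.
Qed.

Lemma ccont_cE_seg p d x : ccont (fun t => cE (seg p d t) x).
Proof. eapply cder_ccont, cE_seg_der. Qed.

Lemma ccont_Ejet_seg p d k x : ccont (fun t => Ejet (seg p d t) k x).
Proof.
  apply ccont_mult; [|apply ccont_cE_seg]. apply ccont_pow.
  apply ccont_mult; [apply ccont_const|apply ccont_seg].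
Qed.

Lemma Cmod_seg_le p d T t : Rabs t <= T -> Cmod (seg p d t) <= Cmod p + T * Cmod d.
Proof.
  intros. unfold seg. eapply Rle_trans; [apply Cmod_triangle|]. rewrite Cmod_mult, Cmod_R.
  pose proof (Rmult_le_compat_r _ _ _ (Cmod_ge_0 d) H). lra.
Qed.

Lemma Ejet_seg_bound p d T M k : exists B, 0 <= B /\ forall t x, Rabs t <= T -> Rabs x <= M ->
  Cmod (Ejet (seg p d t) k x) <= B.
Proof.
  set (Z := Cmod p + Rabs T * Cmod d).
  assert (HZ : 0 <= Z).
  { unfold Z. pose proof (Cmod_ge_0 p). pose proof (Cmod_ge_0 d). pose proof (Rabs_pos T). nra. }
  exists (Z ^ k * exp (Z * Rabs M)). split.
  - apply Rmult_le_pos; [now apply pow_le|left; apply exp_pos].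
  - intros t x Ht Hx. rewrite Cmod_Ejet.
    assert (Hz : Cmod (seg p d t) <= Z).
    { apply Cmod_seg_le. pose proof (Rle_abs T). lra. }
    apply Rmult_le_compat; [apply pow_le, Cmod_ge_0|apply Cmod_ge_0| |].
    + apply pow_incr. split; [apply Cmod_ge_0|exact Hz].
    + eapply Rle_trans; [apply cE_mod_le|]. apply exp_le.
      apply Rmult_le_compat; auto using Cmod_ge_0, Rabs_pos. pose proof (Rle_abs M); lra.
Qed.

(** Along [z = p + t d] the derivative of [(iz)^k e^(izx)] is [i d x] times this function plus a
    multiple of the one of order [k - 1]; both are bounded on compact sets. *)
Lemma Ejet_seg_lipschitz p d T M k : exists L, 0 <= L /\ forall t t' x, Rabs t <= T -> Rabs t' <= T ->
  Rabs x <= M -> Cmod (Ejet (seg p d t') k x - Ejet (seg p d t) k x) <= L * Rabs (t' - t).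
Proof.
  assert (D : forall k x, exists f', cder (fun t => Ejet (seg p d t) k x) f' /\
     (forall t, f' t = (Ci * d * RtoC x * Ejet (seg p d t) k x +
          match k with O => RtoC 0 | S j => Ci * d * RtoC (INR k) * Ejet (seg p d t) j x end)%C)).
  { clear k. intros k x.
    assert (P : cder (fun t => Cpow (Ci * seg p d t) k)
       (fun t => match k with O => RtoC 0 | S j => (Ci * d * RtoC (INR k) * Cpow (Ci * seg p d t) j)%C end)).
    { induction k.
      - simpl. apply cder_const.
      - eapply cder_ext.
        3: apply (cder_mult _ _ _ _ (cder_scal Ci _ _ (seg_der p d)) IHk).
        + intros t; reflexivity.
        + intros t. destruct k.
          * simpl. ring.
          * rewrite (S_INR (S k)), RtoC_plus.
            replace (Cpow (Ci * seg p d t) (S k)) with ((Ci * seg p d t) * Cpow (Ci * seg p d t) k)%C by reflexivity.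
            ring. }
    eexists; split.
    - apply (cder_mult _ _ _ _ P (cE_seg_der p d x)).
    - intros t; unfold Ejet; destruct k; simpl Cpow; ring. }
  assert (B1 : exists B, 0 <= B /\ forall t x, Rabs t <= T -> Rabs x <= M ->
     Cmod (Ci * d * RtoC x * Ejet (seg p d t) k x +
          match k with O => RtoC 0 | S j => Ci * d * RtoC (INR k) * Ejet (seg p d t) j x end)%C <= B).
  { destruct (Ejet_seg_bound p d T M k) as [B [HB0 HB]].
    assert (B2 : exists B', 0 <= B' /\ forall t x, Rabs t <= T -> Rabs x <= M ->
       Cmod (match k with O => RtoC 0 | S j => Ci * d * RtoC (INR k) * Ejet (seg p d t) j x end)%C <= B').
    { destruct k.
      - exists 0; split; [lra|]. intros; rewrite Cmod_0; lra.
      - destruct (Ejet_seg_bound p d T M k) as [B' [HB0' HB']].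
        exists (Cmod (Ci * d * RtoC (INR (S k))) * B'). split.
        + apply Rmult_le_pos; auto using Cmod_ge_0.
        + intros. rewrite Cmod_mult. apply Rmult_le_compat_l; auto using Cmod_ge_0. }
    destruct B2 as [B' [HB0' HB']].
    exists (Cmod d * Rabs M * B + B'). split.
    - pose proof (Rmult_le_pos _ _ (Rmult_le_pos _ _ (Cmod_ge_0 d) (Rabs_pos M)) HB0). lra.
    - intros t x Ht Hx. eapply Rle_trans; [apply Cmod_triangle|].
      apply Rplus_le_compat; auto. rewrite !Cmod_mult, Cmod_Ci, Rmult_1_l, Cmod_R.
      apply Rmult_le_compat; auto using Cmod_ge_0.
      + apply Rmult_le_pos; auto using Cmod_ge_0, Rabs_pos.
      + apply Rmult_le_compat_l; auto using Cmod_ge_0. pose proof (Rle_abs M); lra. }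
  destruct B1 as [B [HB0 HB]]. exists B. split; auto.
  intros t t' x Ht Ht' Hx. destruct (D k x) as [f' [Df Ef]].
  assert (Ef' : f' = fun t => (Ci * d * RtoC x * Ejet (seg p d t) k x +
          match k with O => RtoC 0 | S j => Ci * d * RtoC (INR k) * Ejet (seg p d t) j x end)%C)
   by (apply functional_extensionality; exact Ef).
  apply (cder_mvt (fun t => Ejet (seg p d t) k x) f' B t t' Df).
  - rewrite Ef'. apply ccont_plus.
    + apply ccont_mult; [apply ccont_const|apply ccont_Ejet_seg].
    + destruct k; [apply ccont_const|]. apply ccont_mult; [apply ccont_const|apply ccont_Ejet_seg].
  - intros u Hu. rewrite Ef. apply HB; auto. revert Hu.
    unfold Rmin, Rmax; destruct (Rle_dec t t'); intros;
    apply Rabs_le_between; apply Rabs_le_between in Ht, Ht'; lra.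
Qed.

Definition segint (p d : C) (G : R -> C) (a b : R) (k : nat) (x : R) : C :=
  CI (fun t => (G t * Ejet (seg p d t) k x)%C) a b.

Lemma ccont_segint p d G k x : ccont G -> ccont (fun t => (G t * Ejet (seg p d t) k x)%C).
Proof. intros; apply ccont_mult; auto using ccont_Ejet_seg. Qed.

Lemma Rabs_between_max a b t : Rmin a b <= t <= Rmax a b -> Rabs t <= Rmax (Rabs a) (Rabs b).
Proof.
  intros H. unfold Rmin, Rmax in *. destruct (Rle_dec a b), (Rle_dec (Rabs a) (Rabs b));
  unfold Rabs in *; destruct (Rcase_abs a), (Rcase_abs b), (Rcase_abs t); lra.
Qed.

Lemma jet_segint p d G a b : ccont G -> jet (segint p d G a b).
Proof.
  intros HG k. apply cder_of_taylor. intros x.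
  set (T := Rmax (Rabs a) (Rabs b)).
  destruct (Ejet_seg_bound p d T (Rabs x + 1) (S (S k))) as [B [HB0 HB]].
  destruct (ccont_bounded G (Rmin a b) (Rmax a b) HG) as [A [HA0 HA]].
  exists (A * B * Rabs (b - a)). intros s Hs.
  unfold segint.
  rewrite <- (CI_scal (RtoC s)) by now apply ccont_segint.
  rewrite <- CI_minus by now apply ccont_segint.
  rewrite <- CI_minus.
  2: apply ccont_minus; now apply ccont_segint.
  2: apply ccont_mult; [apply ccont_const|now apply ccont_segint].
  replace (A * B * Rabs (b - a) * s ^ 2) with ((A * (B * s ^ 2)) * Rabs (b - a)) by ring.
  apply CI_bound_abs.
  - apply ccont_minus; [apply ccont_minus; now apply ccont_segint|].
    apply ccont_mult; [apply ccont_const|now apply ccont_segint].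
  - intros t Ht.
    replace (G t * Ejet (seg p d t) k (x + s)%R - G t * Ejet (seg p d t) k x - RtoC s * (G t * Ejet (seg p d t) (S k) x))%C
     with (G t * (Ejet (seg p d t) k (x + s)%R - Ejet (seg p d t) k x - RtoC s * Ejet (seg p d t) (S k) x))%C by ring.
    rewrite Cmod_mult. apply Rmult_le_compat; auto using Cmod_ge_0.
    apply jet_taylor; [apply jet_E|]. intros u Hu. apply HB.
    + now apply Rabs_between_max.
    + replace u with ((u - x) + x) by ring. eapply Rle_trans; [apply Rabs_triang|]. lra.
Qed.

Section Superposition.
Variable v : (R -> C) -> C.
Hypothesis Hv : cs_dist v.

Lemma cs_dist_cE_ccont p d : ccont (fun t => v (cE (seg p d t))).
Proof.
  destruct (cs_dist_bound v Hv) as [M [K [N [HK H]]]].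
  assert (L : forall T, exists L, 0 <= L /\ forall t t', Rabs t <= T -> Rabs t' <= T ->
     Cmod (v (cE (seg p d t')) - v (cE (seg p d t))) <= L * Rabs (t' - t)).
  { intros T.
    assert (Lk : exists L, 0 <= L /\ forall k t t' x, (k <= N)%nat -> Rabs t <= T -> Rabs t' <= T ->
      Rabs x <= M -> Cmod (Ejet (seg p d t') k x - Ejet (seg p d t) k x) <= L * Rabs (t' - t)).
    { clear H. induction N.
      - destruct (Ejet_seg_lipschitz p d T M 0) as [L [HL0 HL]]. exists L; split; auto.
        intros k t t' x Hk; replace k with O by lia; auto.
      - destruct IHN as [L1 [HL1 HL]]. destruct (Ejet_seg_lipschitz p d T M (S N)) as [L2 [HL2 HL']].
        exists (L1 + L2). split; [lra|]. intros k t t' x Hk Ht Ht' Hx.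
        pose proof (Rabs_pos (t' - t)).
        destruct (Nat.eq_dec k (S N)) as [->|].
        + specialize (HL' t t' x Ht Ht' Hx). nra.
        + specialize (HL k t t' x ltac:(lia) Ht Ht' Hx). nra. }
    destruct Lk as [L [HL0 HL]]. exists (K * L). split; [now apply Rmult_le_pos|].
    intros t t' Ht Ht'. rewrite <- !Ejet_0.
    rewrite <- (cs_dist_sub v Hv) by apply jet_E. rewrite Rmult_assoc.
    apply (H (fun k x => (Ejet (seg p d t') k x - Ejet (seg p d t) k x)%C)).
    - apply jet_minus; apply jet_E.
    - intros; now apply HL. }
  assert (Q : forall g : C -> R, (forall a b, Rabs (g a - g b) <= Cmod (a - b)) ->
     forall t, continuous (fun t => g (v (cE (seg p d t)))) t).
  { intros g Hg t. apply continuity_pt_filterlim. intros eps He.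
    destruct (L (Rabs t + 1)) as [L0 [HL0 HL]].
    exists (Rmin 1 (eps / (L0 + 1))). split.
    - apply Rmin_glb_lt; [lra|]. apply Rdiv_lt_0_compat; lra.
    - intros y [_ Hy]. unfold R_met, dist in *; simpl in *. unfold R_dist in *.
      assert (Rabs (y - t) < 1) by (eapply Rlt_le_trans; [exact Hy|apply Rmin_l]).
      assert (Rabs (y - t) < eps / (L0 + 1)) by (eapply Rlt_le_trans; [exact Hy|apply Rmin_r]).
      eapply Rle_lt_trans; [apply Hg|]. eapply Rle_lt_trans; [apply HL|].
      + pose proof (Rabs_pos t); lra.
      + replace y with ((y - t) + t) by ring. eapply Rle_trans; [apply Rabs_triang|]. lra.
      + apply Rle_lt_trans with ((L0 + 1) * Rabs (y - t)).
        * pose proof (Rabs_pos (y - t)); nra.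
        * apply Rmult_lt_reg_r with (/ (L0 + 1)); [apply Rinv_0_lt_compat; lra|].
          replace ((L0 + 1) * Rabs (y - t) * / (L0 + 1)) with (Rabs (y - t)) by (field; lra). exact H1. }
  intros t; split.
  - apply (Q fst). intros a b. apply (Rabs_fst_le (a - b)%C).
  - apply (Q snd). intros a b. apply (Rabs_snd_le (a - b)%C).
Qed.

Lemma ccont_eps G b eps : ccont G -> 0 < eps -> exists delta, 0 < delta /\
  forall t, Rabs (t - b) < delta -> Cmod (G t - G b) <= eps.
Proof.
  intros HG He.
  assert (Hc := continuous_Cmod (fun t => (G t - G b)%C) (ccont_minus _ _ HG (ccont_const _)) b).
  apply continuity_pt_filterlim in Hc. destruct (Hc eps He) as [d [Hd H]].
  exists d; split; auto. intros t Ht.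
  destruct (Req_dec t b) as [->|Hn].
  - replace (G b - G b)%C with (RtoC 0) by ring. rewrite Cmod_0; lra.
  - specialize (H t). unfold dist in H; simpl in H. unfold R_dist in H.
    assert (E : Cmod (G b - G b) = 0) by (replace (G b - G b)%C with (RtoC 0) by ring; apply Cmod_0).
    rewrite E, Rminus_0_r in H. left. eapply Rle_lt_trans; [apply Rle_abs|]. apply H.
    split; [split; [exact I|now apply not_eq_sym]|exact Ht].
Qed.

(** A Fubini theorem for [v] without Riemann sums: as functions of the upper end [b] both sides have
    the same derivative, and both vanish at [b = a]. *)
Lemma cs_dist_segint p d G a b : ccont G ->
  v (segint p d G a b O) = CI (fun t => (G t * v (cE (seg p d t)))%C) a b.
Proof.
  intros HG.
  assert (HW : ccont (fun t => (G t * v (cE (seg p d t)))%C)).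
  { apply ccont_mult; auto using cs_dist_cE_ccont. }
  assert (D : cder (fun b => v (segint p d G a b O)) (fun t => (G t * v (cE (seg p d t)))%C)).
  2:{ assert (E := CI_FTC _ _ a b D HW). rewrite E.
      replace (v (segint p d G a a O)) with (RtoC 0); [ring|].
      replace (segint p d G a a O) with ((fun (k : nat) (x : R) => (RtoC 0 * RtoC 0)%C) O).
      - rewrite (cs_dist_scal v Hv (RtoC 0) (fun _ _ => RtoC 0)) by apply jet_zero. ring.
      - apply functional_extensionality; intros x. unfold segint. rewrite CI_point. ring. }
  apply cder_of_little_o. clear b. intros b eps He.
  destruct (cs_dist_bound v Hv) as [M [K [N [HK H]]]].
  (* The difference quotient in [b] is [v] applied to an average of the integrand over a short
     interval, so its oscillation near [b] must be small for all orders up to [N] and all [x] in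
     [[-M, M]] at once. *)
  assert (Osc : forall eta, 0 < eta -> exists delta, 0 < delta /\ forall k t x, (k <= N)%nat ->
     Rabs (t - b) < delta -> Rabs x <= M ->
     Cmod (G t * Ejet (seg p d t) k x - G b * Ejet (seg p d b) k x) <= eta).
  { intros eta Heta.
    assert (One : forall k, exists delta, 0 < delta /\ forall t x, Rabs (t - b) < delta -> Rabs x <= M ->
      Cmod (G t * Ejet (seg p d t) k x - G b * Ejet (seg p d b) k x) <= eta).
    { intros k.
      destruct (Ejet_seg_bound p d (Rabs b + 1) M k) as [E [HE0 HE]].
      destruct (Ejet_seg_lipschitz p d (Rabs b + 1) M k) as [L [HL0 HL]].
      destruct (ccont_eps G b (eta / (2 * (E + 1))) HG) as [d1 [Hd1 H1]].
      { apply Rdiv_lt_0_compat; lra. }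
      pose proof (Cmod_ge_0 (G b)).
      assert (Hp : 0 < Cmod (G b) * L + 1) by (pose proof (Rmult_le_pos _ _ H0 HL0); lra).
      exists (Rmin (Rmin 1 d1) (eta / (2 * (Cmod (G b) * L + 1)))). split.
      { apply Rmin_glb_lt; [apply Rmin_glb_lt; lra|]. apply Rdiv_lt_0_compat; lra. }
      intros t x Ht Hx.
      assert (T1 : Rabs (t - b) < 1) by (eapply Rlt_le_trans; [exact Ht|]; eapply Rle_trans; [apply Rmin_l|apply Rmin_l]).
      assert (T2 : Rabs (t - b) < d1) by (eapply Rlt_le_trans; [exact Ht|]; eapply Rle_trans; [apply Rmin_l|apply Rmin_r]).
      assert (T3 : Rabs (t - b) < eta / (2 * (Cmod (G b) * L + 1))) by (eapply Rlt_le_trans; [exact Ht|apply Rmin_r]).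
      assert (Tt : Rabs t <= Rabs b + 1).
      { replace t with ((t - b) + b) by ring. eapply Rle_trans; [apply Rabs_triang|]. lra. }
      replace (G t * Ejet (seg p d t) k x - G b * Ejet (seg p d b) k x)%C with
        ((G t - G b) * Ejet (seg p d t) k x + G b * (Ejet (seg p d t) k x - Ejet (seg p d b) k x))%C by ring.
      eapply Rle_trans; [apply Cmod_triangle|]. rewrite !Cmod_mult.
      assert (Q1 : Cmod (G t - G b) * Cmod (Ejet (seg p d t) k x) <= eta / 2).
      { apply Rle_trans with (eta / (2 * (E + 1)) * E).
        - apply Rmult_le_compat; auto using Cmod_ge_0.
        - apply Rmult_le_reg_r with (2 * (E + 1)); [lra|].
          replace (eta / (2 * (E + 1)) * E * (2 * (E + 1))) with (eta * E) by (field; lra). nra. }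
      assert (Q2 : Cmod (G b) * Cmod (Ejet (seg p d t) k x - Ejet (seg p d b) k x) <= eta / 2).
      { apply Rle_trans with (Cmod (G b) * (L * Rabs (t - b))).
        - apply Rmult_le_compat_l; auto. apply HL; auto. lra.
        - apply Rle_trans with ((Cmod (G b) * L + 1) * Rabs (t - b)).
          + pose proof (Rabs_pos (t - b)); nra.
          + apply Rle_trans with ((Cmod (G b) * L + 1) * (eta / (2 * (Cmod (G b) * L + 1)))).
            * apply Rmult_le_compat_l; lra.
            * right; field. lra. }
      lra. }
    clear H. induction N.
    - destruct (One O) as [d0 [Hd0 H0]]. exists d0; split; auto. intros k t x Hk; replace k with O by lia; auto.
    - destruct IHN as [d1 [Hd1 H1]]. destruct (One (S N)) as [d2 [Hd2 H2]].
      exists (Rmin d1 d2). split; [now apply Rmin_glb_lt|]. intros k t x Hk Ht Hx.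
      destruct (Nat.eq_dec k (S N)) as [->|].
      + apply H2; auto. eapply Rlt_le_trans; [exact Ht|apply Rmin_r].
      + apply H1; auto; [lia|]. eapply Rlt_le_trans; [exact Ht|apply Rmin_l]. }
  destruct (Osc (eps / (K + 1))) as [delta [Hd HO]].
  { apply Rdiv_lt_0_compat; lra. }
  exists delta; split; auto. intros s Hs.
  assert (J1 := jet_segint p d G a (b + s) HG). assert (J2 := jet_segint p d G a b HG).
  assert (J3 := jet_scal (RtoC s * G b)%C _ (jet_E (seg p d b))).
  assert (E3 : (RtoC s * (G b * v (cE (seg p d b))))%C = v (fun x => (RtoC s * G b * Ejet (seg p d b) O x)%C)).
  { rewrite (cs_dist_scal v Hv (RtoC s * G b)%C _ (jet_E (seg p d b))). rewrite Ejet_0. ring. }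
  rewrite E3. rewrite <- (cs_dist_sub v Hv _ _ J1 J2).
  rewrite <- (cs_dist_sub v Hv _ _ (jet_minus _ _ J1 J2) J3).
  apply Rle_trans with (K * (eps / (K + 1) * Rabs s)).
  - apply (H (fun n x => (segint p d G a (b + s) n x - segint p d G a b n x - RtoC s * G b * Ejet (seg p d b) n x)%C)).
    + apply (jet_minus (fun n x => (segint p d G a (b + s) n x - segint p d G a b n x)%C)); auto.
      now apply jet_minus.
    + intros k x Hk Hx. unfold segint.
      rewrite <- (CI_Chasles _ a b (b + s)) by now apply ccont_segint.
      replace (CI (fun t => (G t * Ejet (seg p d t) k x)%C) a b + CI (fun t => (G t * Ejet (seg p d t) k x)%C) b (b + s) -
         CI (fun t => (G t * Ejet (seg p d t) k x)%C) a b - RtoC s * G b * Ejet (seg p d b) k x)%C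
       with (CI (fun t => (G t * Ejet (seg p d t) k x)%C) b (b + s) - CI (fun t => (G b * Ejet (seg p d b) k x)%C) b (b + s))%C.
      * rewrite <- (CI_minus _ _ b (b + s) (ccont_segint p d G k x HG) (ccont_const (G b * Ejet (seg p d b) k x)%C)).
        replace (Rabs s) with (Rabs (b + s - b)) by (f_equal; ring).
        apply CI_bound_abs.
        -- apply ccont_minus; [now apply ccont_segint|apply ccont_const].
        -- intros t Ht. apply HO; auto. eapply Rle_lt_trans; [|exact Hs].
           revert Ht. unfold Rmin, Rmax; destruct (Rle_dec b (b + s)); intros; unfold Rabs;
           destruct (Rcase_abs (t - b)), (Rcase_abs s); lra.
      * rewrite CI_const. replace (b + s - b) with s by ring. ring.
  - pose proof (Rabs_pos s).
    assert (K * (eps / (K + 1)) <= eps).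
    { apply Rmult_le_reg_r with (K + 1); [lra|].
      replace (K * (eps / (K + 1)) * (K + 1)) with (K * eps) by (field; lra). nra. }
    nra.
Qed.

End Superposition.

(** An unbounded contour is cut into segments parametrised by [[0, 1]], so improper contour
    integrals become series of proper integrals. *)
Definition superpos (p d : nat -> C) (G : nat -> R -> C) (k : nat) (x : R) : C :=
  Csum (fun n => segint (p n) (d n) (G n) 0 1 k x).

Definition superpos_ok (p d : nat -> C) (G : nat -> R -> C) : Prop :=
  (forall n, ccont (G n)) /\
  forall M k, exists b : nat -> R, ex_series b /\ forall n t x, 0 <= t <= 1 -> Rabs x <= M ->
    Cmod (G n t) * (Cmod (seg (p n) (d n) t) ^ k * Cmod (cE (seg (p n) (d n) t) x)) <= b n.

Lemma superpos_summable p d G : superpos_ok p d G ->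
  jets_summable (fun n => segint (p n) (d n) (G n) 0 1).
Proof.
  intros [HG H] M k. destruct (H M k) as [b [Hb Hx]]. exists b; split; auto.
  intros n x HM. replace (b n) with (b n * (1 - 0)) by ring.
  apply CI_bound; [lra|now apply ccont_segint|].
  intros t Ht. rewrite Cmod_mult, Cmod_Ejet. auto.
Qed.

Lemma jet_superpos p d G : superpos_ok p d G -> jet (superpos p d G).
Proof.
  intros H. apply (jet_series (fun n => segint (p n) (d n) (G n) 0 1)).
  - intros n. apply jet_segint, H.
  - now apply superpos_summable.
Qed.

Lemma cs_dist_superpos v p d G : cs_dist v -> superpos_ok p d G ->
  v (superpos p d G O) = Csum (fun n => CI (fun t => (G n t * v (cE (seg (p n) (d n) t)))%C) 0 1) /\
  exists b : nat -> R, ex_series b /\ forall n, Cmod (CI (fun t => (G n t * v (cE (seg (p n) (d n) t)))%C) 0 1) <= b n.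
Proof.
  intros Hv H.
  assert (J : forall n, jet (segint (p n) (d n) (G n) 0 1)) by (intros; apply jet_segint, H).
  assert (E : forall n, v (segint (p n) (d n) (G n) 0 1 O) = CI (fun t => (G n t * v (cE (seg (p n) (d n) t)))%C) 0 1).
  { intros n. apply cs_dist_segint; auto. apply H. }
  split.
  - unfold superpos. rewrite (cs_dist_series v Hv (fun n => segint (p n) (d n) (G n) 0 1)); auto.
    + now apply Csum_ext.
    + now apply superpos_summable.
  - destruct (cs_dist_series_bound v Hv _ J (superpos_summable _ _ _ H)) as [b [Hb Hn]].
    exists b; split; auto. intros n. now rewrite <- E.
Qed.

(** The Fourier-Laplace transform of [v], defined at complex points: [cE z] is an eigenfunction of
    the convolution by [v] with this eigenvalue. *)
Definition dsym (v : (R -> C) -> C) (z : C) : C := v (fun y => cE z (- y)).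

Lemma dsym_cE v z : dsym v z = v (cE (- z)%C).
Proof. unfold dsym. f_equal. apply functional_extensionality; intros; now rewrite cE_opp. Qed.

Lemma dsym_fourier v xi : dist_fourier v xi = dsym v (RtoC xi).
Proof.
  unfold dist_fourier. rewrite dsym_cE. f_equal. apply functional_extensionality; intros x.
  rewrite cexpi_cE. f_equal. cring.
Qed.

Lemma seg_opp p d t : seg (- p)%C (- d)%C t = (- seg p d t)%C.
Proof. unfold seg; ring. Qed.

Lemma ccont_dsym v p d : cs_dist v -> ccont (fun t => dsym v (seg p d t)).
Proof.
  intros Hv. assert (H := cs_dist_cE_ccont v Hv (- p)%C (- d)%C).
  replace (fun t => dsym v (seg p d t)) with (fun t => v (cE (seg (- p)%C (- d)%C t))); auto.
  apply functional_extensionality; intros t. now rewrite dsym_cE, seg_opp.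
Qed.

(** Reflection of the argument reverses the segments and multiplies the densities by [cE z x], so
    the function to which [v] is applied is a superposition again. *)
Lemma conv_superpos v p d G x : cs_dist v -> superpos_ok p d G ->
  conv v (superpos p d G O) x =
    Csum (fun n => CI (fun t => (G n t * dsym v (seg (p n) (d n) t) * cE (seg (p n) (d n) t) x)%C) 0 1) /\
  exists b : nat -> R, ex_series b /\ forall n,
    Cmod (CI (fun t => (G n t * dsym v (seg (p n) (d n) t) * cE (seg (p n) (d n) t) x)%C) 0 1) <= b n.
Proof.
  intros Hv [HG H].
  set (G' := fun n t => (G n t * cE (seg (p n) (d n) t) x)%C).
  assert (H' : superpos_ok (fun n => - p n)%C (fun n => - d n)%C G').
  { split.
    - intros n. apply ccont_mult; auto using ccont_cE_seg.
    - intros M k. destruct (H (Rabs x + Rabs M) k) as [b [Hb Hx]]. exists b; split; auto.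
      intros n t y Ht Hy. unfold G'. rewrite Cmod_mult.
      replace (Cmod (G n t) * Cmod (cE (seg (p n) (d n) t) x) * (Cmod (seg (- p n)%C (- d n)%C t) ^ k * Cmod (cE (seg (- p n)%C (- d n)%C t) y)))
       with (Cmod (G n t) * (Cmod (seg (p n) (d n) t) ^ k * Cmod (cE (seg (p n) (d n) t) (x - y)))).
      + apply Hx; auto. unfold Rminus. eapply Rle_trans; [apply Rabs_triang|]. rewrite Rabs_Ropp.
        pose proof (Rle_abs M). lra.
      + rewrite seg_opp, Cmod_opp, cE_opp. unfold Rminus. rewrite cE_plus_x, Cmod_mult. ring. }
  assert (E : (fun y => superpos p d G O (x - y)) = superpos (fun n => - p n)%C (fun n => - d n)%C G' O).
  { apply functional_extensionality; intros y. unfold superpos. apply Csum_ext. intros n. unfold segint.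
    apply CI_ext. intros t. unfold G'. rewrite seg_opp, !Ejet_0, cE_opp.
    unfold Rminus. rewrite cE_plus_x. ring. }
  destruct (cs_dist_superpos v _ _ _ Hv H') as [E1 [b [Hb Hn]]].
  assert (E2 : forall n, CI (fun t => (G' n t * v (cE (seg (- p n)%C (- d n)%C t)))%C) 0 1 =
     CI (fun t => (G n t * dsym v (seg (p n) (d n) t) * cE (seg (p n) (d n) t) x)%C) 0 1).
  { intros n. apply CI_ext; intros t. unfold G'. rewrite dsym_cE, seg_opp. ring. }
  split.
  - unfold conv. rewrite E, E1. apply Csum_ext. auto.
  - exists b; split; auto. intros n. now rewrite <- E2.
Qed.

(** * Gevrey classes of Beurling type by derivative bounds *)

Definition fa (al : R) (k : nat) : R := Rpower (INR (fact k)) (1 / al).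

Lemma fact_ge_1 k : 1 <= INR (fact k).
Proof. apply (le_INR 1). apply lt_O_fact. Qed.

Lemma fa_pos al k : 0 < fa al k.
Proof. apply exp_pos. Qed.

Lemma Rpower_ge_1 x y : 1 <= x -> 0 <= y -> 1 <= Rpower x y.
Proof.
  intros Hx Hy. rewrite <- exp_0. apply exp_le. apply Rmult_le_pos; auto.
  rewrite <- ln_1. apply ln_le; lra.
Qed.

Lemma Rpower_le_base x y z : 0 < x -> x <= y -> 0 <= z -> Rpower x z <= Rpower y z.
Proof. intros. apply Rle_Rpower_l; lra. Qed.

Lemma fa_ge_1 al k : 0 < al -> 1 <= fa al k.
Proof.
  intros. apply Rpower_ge_1; [apply fact_ge_1|]. left; apply Rdiv_lt_0_compat; lra.
Qed.

Lemma fact_mult_le i j : (fact i * fact j <= fact (i + j))%nat.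
Proof.
  induction i; simpl; [lia|].
  assert (fact (i + j) + i * fact (i+j) <= fact (i + j) + (i + j) * fact (i + j))%nat by nia. nia.
Qed.

Lemma fact_plus_le i j : (fact (i + j) <= 2 ^ (i + j) * (fact i * fact j))%nat.
Proof.
  remember (i + j)%nat as n. revert i j Heqn. induction n; intros i j E.
  - replace i with O by lia. replace j with O by lia. simpl; lia.
  - destruct i as [|i]; [|destruct j as [|j]].
    + replace j with (S n) by lia. simpl fact at 2. pose proof (Nat.pow_nonzero 2 (S n)). nia.
    + replace i with n by lia. simpl fact at 3. pose proof (Nat.pow_nonzero 2 (S n)). nia.
    + assert (H1 := IHn i (S j) ltac:(lia)). assert (H2 := IHn (S i) j ltac:(lia)).
      replace (fact (S n)) with ((S i) * fact n + (S j) * fact n)%nat.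
      2:{ change (fact (S n)) with ((S n) * fact n)%nat. rewrite <- Nat.mul_add_distr_r. f_equal. lia. }
      replace (fact (S i) * fact (S j))%nat with ((S i) * (fact i * fact (S j)))%nat by (simpl; ring).
      assert (E2 : ((S i) * (fact i * fact (S j)) = (S j) * (fact (S i) * fact j))%nat).
      { change (fact (S i)) with ((S i) * fact i)%nat. change (fact (S j)) with ((S j) * fact j)%nat. ring. }
      rewrite Nat.pow_succ_r'. nia.
Qed.

Lemma pow_Rpower x y n : 0 < x -> Rpower x y ^ n = Rpower x (y * INR n).
Proof. intros. rewrite <- (Rpower_pow n) by apply exp_pos. now rewrite Rpower_mult. Qed.

Lemma fa_mult_le al i j : 0 < al -> fa al i * fa al j <= fa al (i + j).
Proof.
  intros Ha. unfold fa. rewrite Rpower_mult_distr by (apply INR_fact_lt_0).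
  rewrite <- mult_INR. apply Rpower_le_base.
  - apply lt_0_INR. pose proof (lt_O_fact i); pose proof (lt_O_fact j); nia.
  - apply le_INR, fact_mult_le.
  - left; apply Rdiv_lt_0_compat; lra.
Qed.

Lemma fa_plus_le al i j : 0 < al ->
  fa al (i + j) <= Rpower 2 (1 / al) ^ (i + j) * (fa al i * fa al j).
Proof.
  intros Ha. unfold fa.
  rewrite Rpower_mult_distr by (apply INR_fact_lt_0).
  rewrite <- mult_INR, pow_Rpower by lra.
  rewrite (Rmult_comm (1 / al)), <- Rpower_mult, Rpower_pow by lra.
  rewrite Rpower_mult_distr.
  - apply Rpower_le_base.
    + apply INR_fact_lt_0.
    + replace 2 with (INR 2) by reflexivity. rewrite <- pow_INR, <- mult_INR. apply le_INR, fact_plus_le.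
    + left; apply Rdiv_lt_0_compat; lra.
  - apply pow_lt; lra.
  - apply lt_0_INR. pose proof (lt_O_fact i); pose proof (lt_O_fact j); nia.
Qed.

Lemma fa_mono al i j : 0 < al -> (i <= j)%nat -> fa al i <= fa al j.
Proof.
  intros Ha H. replace j with (i + (j - i))%nat by lia.
  eapply Rle_trans; [|now apply fa_mult_le].
  pose proof (fa_ge_1 al (j - i) Ha). pose proof (fa_pos al i). nra.
Qed.

(** Beurling type: the constant may depend on [eps], but every positive [eps] is required. These
    bounds correspond to the weight [|xi|^al] on the Fourier side. *)
Definition gev (al : R) (F : nat -> R -> C) : Prop :=
  forall M eps, 0 < eps -> exists C0, 0 <= C0 /\
    forall k x, Rabs x <= M -> Cmod (F k x) <= C0 * (eps ^ k * fa al k).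

Definition Gev (al : R) (f : R -> C) : Prop := exists F, jet F /\ F O = f /\ gev al F.

Lemma gev_plus al F G : gev al F -> gev al G -> gev al (fun n x => (F n x + G n x)%C).
Proof.
  intros HF HG M eps He. destruct (HF M eps He) as [A [HA H]], (HG M eps He) as [B [HB H']].
  exists (A + B); split; [lra|]. intros k x Hx. eapply Rle_trans; [apply Cmod_triangle|].
  specialize (H k x Hx). specialize (H' k x Hx). lra.
Qed.

Lemma gev_scal al c F : gev al F -> gev al (fun n x => (c * F n x)%C).
Proof.
  intros HF M eps He. destruct (HF M eps He) as [A [HA H]].
  exists (Cmod c * A); split; [apply Rmult_le_pos; auto using Cmod_ge_0|].
  intros k x Hx. rewrite Cmod_mult, Rmult_assoc. apply Rmult_le_compat_l; auto using Cmod_ge_0.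
Qed.

(** Leibniz' rule produces [2^k] terms; half of [eps] for each factor pays for them, and
    [i! j! <= (i + j)!] merges the factorials. *)
Lemma gev_pseq al F G : 0 < al -> gev al F -> gev al G -> gev al (fun n => pseq n F G).
Proof.
  intros Ha HF HG M eps He.
  destruct (HF M (eps / 2)) as [A [HA H]]; [lra|]. destruct (HG M (eps / 2)) as [B [HB H']]; [lra|].
  exists (A * B); split; [now apply Rmult_le_pos|].
  intros k x Hx.
  (* The claim is made for factors already differentiated [i] and [j] times, because each level of
     the recursion of [pseq] raises one of the two orders. *)
  assert (P : forall n F' G' i j, (forall l, Cmod (F' l x) <= A * ((eps / 2) ^ (i + l) * fa al (i + l))) ->
     (forall l, Cmod (G' l x) <= B * ((eps / 2) ^ (j + l) * fa al (j + l))) ->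
     Cmod (pseq n F' G' x) <= 2 ^ n * (A * B * ((eps / 2) ^ (i + j + n) * fa al (i + j + n)))).
  { induction n; intros F' G' i j H1 H2; simpl pseq.
    - rewrite Cmod_mult, pow_O, Rmult_1_l, Nat.add_0_r.
      eapply Rle_trans; [apply Rmult_le_compat; [apply Cmod_ge_0|apply Cmod_ge_0|apply H1|apply H2]|].
      rewrite !Nat.add_0_r, pow_add.
      replace (A * ((eps / 2) ^ i * fa al i) * (B * ((eps / 2) ^ j * fa al j))) with
        ((A * B * ((eps / 2) ^ i * (eps / 2) ^ j)) * (fa al i * fa al j)) by ring.
      replace (A * B * ((eps / 2) ^ i * (eps / 2) ^ j * fa al (i + j))) with
        ((A * B * ((eps / 2) ^ i * (eps / 2) ^ j)) * fa al (i + j)) by ring. apply Rmult_le_compat_l; [|now apply fa_mult_le].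
      assert (0 < eps / 2) by lra.
      apply Rmult_le_pos; [now apply Rmult_le_pos|]. apply Rmult_le_pos; apply pow_le; lra.
    - eapply Rle_trans; [apply Cmod_triangle|].
      assert (Q1 := IHn (fun l => F' (S l)) G' (S i) j).
      assert (Q2 := IHn F' (fun l => G' (S l)) i (S j)).
      replace (i + j + S n)%nat with (S i + j + n)%nat by lia.
      replace (i + S j + n)%nat with (S i + j + n)%nat in Q2 by lia.
      replace (2 ^ S n) with (2 ^ n + 2 ^ n) by (simpl; ring).
      rewrite Rmult_plus_distr_r. apply Rplus_le_compat.
      + apply Q1; auto. intros l. replace (S i + l)%nat with (i + S l)%nat by lia. apply H1.
      + apply Q2; auto. intros l. replace (S j + l)%nat with (j + S l)%nat by lia. apply H2. }
  eapply Rle_trans; [apply (P k F G O O); intros l; [apply H|apply H']; auto|].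
  simpl. right. unfold Rdiv. rewrite Rpow_mult_distr, pow_inv. field. apply pow_nonzero; lra.
Qed.

(** A distribution consumes up to [N] further derivatives. By [(k + j)! <= 2^(k+j) k! j!] they cost
    a geometric factor of ratio [q = 2^(1/al)], paid by starting from [eps / q]. *)
Lemma gev_shift_bound al F M eps N : 0 < al -> 0 < eps -> gev al F -> exists C0, 0 <= C0 /\
  forall k j x, (j <= N)%nat -> Rabs x <= M -> Cmod (F (k + j)%nat x) <= C0 * (eps ^ k * fa al k).
Proof.
  intros Ha He HF.
  set (q := Rpower 2 (1 / al)). assert (Hq : 0 < q) by apply exp_pos.
  destruct (HF M (eps / q)) as [A [HA H]]; [now apply Rdiv_lt_0_compat|].
  exists (A * ((eps + 1) ^ N * fa al N)). split.
  - apply Rmult_le_pos; auto. apply Rmult_le_pos; [apply pow_le; lra|left; apply fa_pos].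
  - intros k j x Hj Hx. eapply Rle_trans; [now apply H|].
    rewrite Rmult_assoc. apply Rmult_le_compat_l; auto.
    apply Rle_trans with ((eps / q) ^ (k + j) * (q ^ (k + j) * (fa al k * fa al j))).
    + apply Rmult_le_compat_l; [apply pow_le; left; now apply Rdiv_lt_0_compat|].
      now apply fa_plus_le.
    + rewrite <- Rmult_assoc, <- Rpow_mult_distr. replace (eps / q * q) with eps by (field; lra).
      rewrite pow_add.
      replace (eps ^ k * eps ^ j * (fa al k * fa al j)) with ((eps ^ j * fa al j) * (eps ^ k * fa al k)) by ring.
      apply Rmult_le_compat_r.
      * apply Rmult_le_pos; [apply pow_le; lra|left; apply fa_pos].
      * apply Rmult_le_compat; [apply pow_le; lra|left; apply fa_pos| |now apply fa_mono].
        apply Rle_trans with ((eps + 1) ^ j); [apply pow_incr; lra|].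
        apply Rle_pow; [lra|auto].
Qed.

Lemma gev_conv v al F : cs_dist v -> 0 < al -> jet F -> gev al F ->
  gev al (fun k x => conv v (F k) x).
Proof.
  intros Hv Ha JF HF M eps He.
  destruct (conv_bound v Hv) as [M0 [K [N [HK H]]]].
  destruct (gev_shift_bound al F (M + Rabs M0) eps N Ha He HF) as [A [HA HB]].
  exists (K * A). split; [now apply Rmult_le_pos|].
  intros k x Hx. rewrite Rmult_assoc.
  replace (F k) with (F (k + 0)%nat) by (f_equal; lia).
  apply (H (fun j => F (k + j)%nat)).
  - now apply jet_shift.
  - intros j y Hj Hy. apply HB; auto. replace y with ((y - x) + x) by ring.
    eapply Rle_trans; [apply Rabs_triang|]. pose proof (Rle_abs M0). lra.
Qed.

Lemma Gev_conv v al f : cs_dist v -> 0 < al -> Gev al f -> Gev al (conv v f).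
Proof.
  intros Hv Ha [F [JF [EF HF]]]. exists (fun k x => conv v (F k) x).
  split; [now apply jet_conv|]. split; [now rewrite EF|now apply gev_conv].
Qed.

(** * The weight *)

Lemma w_pow_abs al t : w_pow al (Rabs t) = w_pow al t.
Proof.
  unfold w_pow. destruct (Req_EM_T t 0) as [->|H].
  - rewrite Rabs_R0. destruct (Req_EM_T 0 0); lra.
  - destruct (Req_EM_T (Rabs t) 0) as [E|]; [|now rewrite Rabs_Rabsolu].
    exfalso. revert E. now apply Rabs_no_R0.
Qed.

Lemma w_pow_pos al t : 0 < t -> w_pow al t = Rpower t al.
Proof.
  intros. unfold w_pow. destruct (Req_EM_T t 0); [lra|]. now rewrite Rabs_pos_eq by lra.
Qed.

Lemma w_pow_0 al : w_pow al 0 = 0.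
Proof. unfold w_pow. destruct (Req_EM_T 0 0); lra. Qed.

Lemma w_pow_ge_0 al t : 0 <= w_pow al t.
Proof. unfold w_pow. destruct (Req_EM_T t 0); [lra|]. left; apply exp_pos. Qed.

Lemma pow_fact_le_exp y k : 0 <= y -> y ^ k / INR (fact k) <= exp y.
Proof.
  intros Hy. set (a := fun n => y ^ n / INR (fact n)).
  assert (P : forall n, 0 <= a n).
  { intros n. apply Rmult_le_pos; [now apply pow_le|]. left; apply Rinv_0_lt_compat, INR_fact_lt_0. }
  assert (E : is_lim_seq (sum_n a) (exp y)).
  { assert (E := is_exp_Reals y). unfold is_pseries in E.
    apply (is_series_ext _ a) in E; [exact E|].
    intros n. unfold a, scal; simpl; unfold mult; simpl. now rewrite pow_n_pow. }
  assert (I : forall n, sum_n a n <= sum_n a (S n)).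
  { intros n. rewrite sum_Sn. change (plus (sum_n a n) (a (S n))) with (sum_n a n + a (S n)).
    pose proof (P (S n)). lra. }
  eapply Rle_trans; [|apply (is_lim_seq_incr_compare _ _ E I k)].
  fold (a k). destruct k; [rewrite sum_O; lra|]. rewrite sum_Sn.
  change (plus (sum_n a k) (a (S k))) with (sum_n a k + a (S k)).
  assert (0 <= sum_n a k); [|lra].
  clear -P I. induction k; [rewrite sum_O; apply P|]. pose proof (I k); lra.
Qed.

Lemma Rpower_pow_comm x k y : 0 < x -> Rpower (x ^ k) y = Rpower x y ^ k.
Proof.
  intros Hx. rewrite pow_Rpower by auto. rewrite <- Rpower_pow by auto.
  rewrite Rpower_mult. f_equal; ring.
Qed.

(** This is [y^k / k! <= e^y] with [y = (t / eps)^al], raised to the power [1 / al]; the value of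
    [mu] is dictated by [mu * t^al = y / al]. *)
Lemma exp_gev al eps : 0 < al -> 0 < eps -> exists mu, 0 < mu /\ forall t k, 0 <= t ->
  t ^ k * exp (- (mu * w_pow al t)) <= eps ^ k * fa al k.
Proof.
  intros Ha He. exists (Rpower eps (- al) / al). split.
  { apply Rdiv_lt_0_compat; [apply exp_pos|lra]. }
  intros t k [Ht| <-].
  2:{ rewrite w_pow_0, Rmult_0_r, Ropp_0, exp_0, Rmult_1_r.
      destruct k.
      - rewrite !pow_O. pose proof (fa_ge_1 al 0 Ha). lra.
      - rewrite pow_i by lia. apply Rmult_le_pos; [apply pow_le; lra|left; apply fa_pos]. }
  rewrite w_pow_pos by auto.
  set (y := Rpower (t / eps) al).
  assert (Hte : 0 < t / eps) by now apply Rdiv_lt_0_compat.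
  assert (Ey : Rpower eps (- al) / al * Rpower t al = y / al).
  { unfold y, Rdiv. rewrite <- (Rpower_mult_distr t (/ eps)); auto; [|now apply Rinv_0_lt_compat].
    replace (Rpower (/ eps) al) with (Rpower eps (- al)); [ring|].
    rewrite Rpower_Ropp. unfold Rpower. rewrite ln_Rinv by auto.
    rewrite <- exp_Ropp. f_equal; ring. }
  rewrite Ey.
  assert (H : y ^ k <= exp y * INR (fact k)).
  { assert (H := pow_fact_le_exp y k ltac:(left; apply exp_pos)).
    apply Rmult_le_reg_r with (/ INR (fact k)); [apply Rinv_0_lt_compat, INR_fact_lt_0|].
    rewrite Rmult_assoc, Rinv_r by (apply Rgt_not_eq, INR_fact_lt_0). unfold Rdiv in H. lra. }
  assert (H2 : (t / eps) ^ k <= exp (y / al) * fa al k).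
  { replace ((t / eps) ^ k) with (Rpower (y ^ k) (1 / al)).
    - unfold fa. replace (exp (y / al)) with (Rpower (exp y) (1 / al)).
      + rewrite Rpower_mult_distr; [|apply exp_pos|apply INR_fact_lt_0].
        apply Rpower_le_base; auto; [apply pow_lt, exp_pos|]. left; apply Rdiv_lt_0_compat; lra.
      + unfold Rpower. rewrite ln_exp. f_equal; field; lra.
    - rewrite Rpower_pow_comm by apply exp_pos. f_equal. unfold y. rewrite Rpower_mult.
      replace (al * (1 / al)) with 1 by (field; lra). now apply Rpower_1. }
  assert (E : t ^ k = eps ^ k * (t / eps) ^ k).
  { rewrite <- Rpow_mult_distr. f_equal. field. lra. }
  rewrite E, exp_Ropp, Rmult_assoc. apply Rmult_le_compat_l; [apply pow_le; lra|].
  apply Rmult_le_reg_r with (exp (y / al)); [apply exp_pos|].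
  rewrite Rmult_assoc, Rinv_l by (apply Rgt_not_eq, exp_pos). lra.
Qed.

Lemma Series_half : Series (fun k => (1/2) ^ k) = 2 /\ ex_series (fun k : nat => (1/2) ^ k).
Proof.
  assert (H : Rabs (1/2) < 1) by (rewrite Rabs_pos_eq; lra).
  split; [rewrite Series_geom; auto; field | now apply ex_series_geom].
Qed.

(** Halving the argument turns the hypothesis into a geometric majorant of ratio 1/2 for the
    exponential series. *)
Lemma exp_le_of_pow y A : 0 <= y -> (forall k, y ^ k <= A * INR (fact k)) -> exp (y / 2) <= 2 * A.
Proof.
  intros Hy H. assert (E := is_exp_Reals (y / 2)). unfold is_pseries in E.
  destruct Series_half as [Hs Hx].
  rewrite <- (is_series_unique _ _ E). replace (2 * A) with (Series (fun k => A * (1/2) ^ k)).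
  - apply Series_le; [|now apply ex_series_scal_R].
    intros n. unfold scal; simpl; unfold mult; simpl. rewrite pow_n_pow.
    assert (Hf := INR_fact_lt_0 n). split.
    + apply Rmult_le_pos; [apply pow_le; lra|]. left; now apply Rinv_0_lt_compat.
    + apply Rmult_le_reg_r with (INR (fact n)); auto.
      rewrite Rmult_assoc, Rinv_l by lra.
      replace (y / 2) with (1 / 2 * y) by field. rewrite Rpow_mult_distr.
      assert (0 < (1/2) ^ n) by (apply pow_lt; lra). specialize (H n). nra.
  - etransitivity; [apply Series_scal_l|]. transitivity (A * 2); [f_equal; exact Hs|ring].
Qed.

(** The converse of [exp_gev]. Raised to the power [al], the hypothesis reads
    [y^k <= (C0 / A)^al k!] with [y = (t / eps)^al]; summation over [k] gives
    [e^(y/2) <= 2 (C0 / A)^al]. The choice [eps^al = 1 / (2 al lam)] makes the power [1 / al] of the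
    left side equal to [e^(lam t^al)]. *)
Lemma gev_decay al lam : 0 < al -> 0 < lam -> exists eps c, 0 < eps /\ 0 < c /\
  forall A C0 t, 0 <= t -> 0 <= C0 -> (forall k, t ^ k * A <= C0 * (eps ^ k * fa al k)) ->
    A <= c * C0 * exp (- (lam * w_pow al t)).
Proof.
  intros Ha Hl. set (eps := Rpower (1 / (2 * al * lam)) (1 / al)).
  assert (Hq : 0 < 2 * al * lam) by (repeat apply Rmult_lt_0_compat; lra).
  exists eps, (Rpower 2 (1 / al)). split; [apply exp_pos|]. split; [apply exp_pos|].
  intros A C0 t Ht HC H.
  assert (H1 : 0 < 1 / al) by (apply Rdiv_lt_0_compat; lra).
  destruct (Rle_dec A 0) as [HA|HA].
  { eapply Rle_trans; [exact HA|]. apply Rmult_le_pos; [apply Rmult_le_pos|]; auto; left; apply exp_pos. }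
  assert (HA' : 0 < A) by lra.
  assert (HC' : A <= C0).
  { specialize (H O). rewrite !pow_O in H. unfold fa in H. simpl fact in H.
    replace (Rpower (INR 1) (1 / al)) with 1 in H; [lra|].
    unfold Rpower. simpl. rewrite ln_1, Rmult_0_r, exp_0. reflexivity. }
  destruct Ht as [Ht| <-].
  2:{ rewrite w_pow_0, Rmult_0_r, Ropp_0, exp_0, Rmult_1_r.
      pose proof (Rpower_ge_1 2 (1 / al) ltac:(lra) ltac:(lra)). nra. }
  rewrite w_pow_pos by auto.
  assert (He : 0 < eps) by apply exp_pos.
  assert (Hea : Rpower eps al = 1 / (2 * al * lam)).
  { unfold eps. rewrite Rpower_mult. replace (1 / al * al) with 1 by (field; lra).
    apply Rpower_1. apply Rdiv_lt_0_compat; lra. }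
  assert (HCp : 0 < C0) by lra.
  set (y := Rpower t al / Rpower eps al).
  assert (Hy : forall k, y ^ k <= Rpower (C0 / A) al * INR (fact k)).
  { intros k. specialize (H k).
    assert (H2 : (t / eps) ^ k <= (C0 / A) * fa al k).
    { unfold Rdiv. rewrite Rpow_mult_distr, pow_inv.
      apply Rmult_le_reg_r with (A * eps ^ k).
      - apply Rmult_lt_0_compat; auto. now apply pow_lt.
      - replace (t ^ k * / eps ^ k * (A * eps ^ k)) with (t ^ k * A) by (field; apply pow_nonzero; lra).
        replace (C0 * / A * fa al k * (A * eps ^ k)) with (C0 * (eps ^ k * fa al k)) by (field; lra). exact H. }
    assert (Hte : 0 < t / eps) by now apply Rdiv_lt_0_compat.
    apply (fun h => Rpower_le_base _ _ al (pow_lt _ k Hte) h ltac:(lra)) in H2.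
    rewrite <- Rpower_mult_distr in H2; [|now apply Rdiv_lt_0_compat|apply fa_pos].
    unfold fa in H2. rewrite Rpower_mult in H2. replace (1 / al * al) with 1 in H2 by (field; lra).
    rewrite Rpower_1 in H2 by apply INR_fact_lt_0.
    rewrite Rpower_pow_comm in H2 by auto.
    replace (Rpower (t / eps) al) with y in H2; auto.
    unfold y, Rdiv. rewrite <- Rpower_mult_distr; auto; [|now apply Rinv_0_lt_compat].
    f_equal. unfold Rpower. rewrite ln_Rinv by auto. rewrite <- exp_Ropp. f_equal; ring. }
  assert (Hy0 : 0 <= y).
  { unfold y. left; apply Rdiv_lt_0_compat; apply exp_pos. }
  assert (HE := exp_le_of_pow y _ Hy0 Hy).
  apply (fun h => Rpower_le_base _ _ (1 / al) (exp_pos (y / 2)) h ltac:(lra)) in HE.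
  rewrite <- Rpower_mult_distr in HE; [|lra|apply exp_pos].
  rewrite Rpower_mult in HE. replace (al * (1 / al)) with 1 in HE by (field; lra).
  rewrite Rpower_1 in HE by now apply Rdiv_lt_0_compat.
  replace (Rpower (exp (y / 2)) (1 / al)) with (exp (lam * Rpower t al)) in HE.
  - rewrite exp_Ropp. apply Rmult_le_reg_r with (exp (lam * Rpower t al) / A).
    + apply Rdiv_lt_0_compat; auto. apply exp_pos.
    + replace (A * (exp (lam * Rpower t al) / A)) with (exp (lam * Rpower t al)) by (field; lra).
      eapply Rle_trans; [exact HE|]. right. field. split; [lra|apply Rgt_not_eq, exp_pos].
  - unfold Rpower at 2. rewrite ln_exp. f_equal. unfold y. rewrite Hea. field. lra.
Qed.

(** * Gevrey cutoff functions *)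

(** Convolution with the uniform density on an interval of length [h]. Its derivative is the
    difference quotient [dq h phi], bounded by [2 / h] times the bound of [phi]: a Gevrey step
    arises from infinitely many such averages. *)
Definition avg (h : R) (phi : R -> R) (x : R) : R := RInt (fun s => phi (x + h * s)) 0 1.
Definition dq (h : R) (phi : R -> R) (x : R) : R := (phi (x + h) - phi x) / h.

Definition lip (L : R) (phi : R -> R) : Prop := forall x y, Rabs (phi x - phi y) <= L * Rabs (x - y).

Lemma lip_cont L (phi : R -> R) : 0 < L -> lip L phi -> forall x, continuous phi x.
Proof.
  intros HL H x. apply continuity_pt_filterlim. intros eps He.
  exists (eps / L). split; [now apply Rdiv_lt_0_compat|].
  intros y [_ Hy]. unfold dist in *; simpl in *; unfold R_dist in *.
  eapply Rle_lt_trans; [apply H|]. apply Rmult_lt_reg_r with (/ L); [now apply Rinv_0_lt_compat|].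
  replace (L * Rabs (y - x) * / L) with (Rabs (y - x)) by (field; lra). exact Hy.
Qed.

Section Avg.
Variables (h L : R).
Hypothesis (Hh : 0 < h) (HL : 0 < L).

Lemma ex_RInt_avg (phi : R -> R) (x : R) : (forall y, continuous phi y) -> ex_RInt (fun s => phi (x + h * s)) 0 1.
Proof.
  intros Hc. apply ex_RInt_cont. intros s. apply (continuous_comp (fun s => x + h * s) phi); [|apply Hc].
  apply (ex_derive_continuous (V:=R_NormedModule)). auto_derive; easy.
Qed.

Lemma RInt_const01 (c : R) : RInt (fun _ => c) 0 1 = c.
Proof. rewrite (RInt_const (V:=R_CompleteNormedModule)). unfold scal; simpl; unfold mult; simpl. ring. Qed.

Lemma avg_sub (phi psi : R -> R) (x y e : R) : (forall z, continuous phi z) -> (forall z, continuous psi z) ->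
  (forall s, 0 <= s <= 1 -> Rabs (phi (x + h * s) - psi (y + h * s)) <= e) ->
  Rabs (avg h phi x - avg h psi y) <= e.
Proof.
  intros H1 H2 H. unfold avg.
  rewrite <- (RInt_minus (V:=R_CompleteNormedModule)) by now apply ex_RInt_avg.
  eapply Rle_trans; [apply (abs_RInt_le_const _ 0 1 e)|]; try lra.
  - apply (ex_RInt_minus (V:=R_NormedModule)); now apply ex_RInt_avg.
  - exact H.
Qed.

Lemma avg_lip phi : lip L phi -> lip L (avg h phi).
Proof.
  intros H x y. assert (Hc := lip_cont L phi HL H).
  apply avg_sub; auto. intros s _. eapply Rle_trans; [apply H|].
  replace (x + h * s - (y + h * s)) with (x - y) by ring. lra.
Qed.

Lemma avg_near phi x : lip L phi -> Rabs (avg h phi x - phi x) <= L * h.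
Proof.
  intros H. assert (Hc := lip_cont L phi HL H).
  rewrite <- (RInt_const01 (phi x)). unfold avg.
  rewrite <- (RInt_minus (V:=R_CompleteNormedModule)).
  2: now apply ex_RInt_avg.
  2: apply (ex_RInt_const (V:=R_NormedModule)).
  replace (L * h) with ((1 - 0) * (L * h)) by ring.
  apply (abs_RInt_le_const _ 0 1 (L * h)); try lra.
  - apply (ex_RInt_minus (V:=R_NormedModule)); [now apply ex_RInt_avg|apply (ex_RInt_const (V:=R_NormedModule))].
  - intros s Hs. unfold minus, plus, opp; simpl. eapply Rle_trans; [apply H|].
    replace (x + h * s - x) with (h * s) by ring. rewrite Rabs_pos_eq by nra.
    apply Rmult_le_compat_l; [lra|]. nra.
Qed.

Lemma avg_const_on phi x c : (forall s, 0 <= s <= 1 -> phi (x + h * s) = c) -> avg h phi x = c.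
Proof.
  intros H. rewrite <- (RInt_const01 c). unfold avg. apply (RInt_ext (V:=R_CompleteNormedModule)).
  intros s. rewrite Rmin_left, Rmax_right by lra. intros; apply H; lra.
Qed.

Lemma avg_range (phi : R -> R) (x : R) : (forall y, continuous phi y) -> (forall y, 0 <= phi y <= 1) -> 0 <= avg h phi x <= 1.
Proof.
  intros Hc H. unfold avg. split.
  - apply RInt_ge_0; try lra; [now apply ex_RInt_avg|intros; apply H].
  - eapply Rle_trans; [|right; apply (RInt_const01 1)]. apply RInt_le; try lra.
    + now apply ex_RInt_avg.
    + apply (ex_RInt_const (V:=R_NormedModule)).
    + intros; apply H.
Qed.

Lemma avg_der (phi : R -> R) (x : R) : (forall y, continuous phi y) -> is_derive (avg h phi) x (dq h phi x).
Proof.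
  intros Hc.
  assert (D : forall y, is_derive (fun z => RInt phi 0 z) y (phi y)).
  { intros y. apply (is_derive_RInt (V:=R_CompleteNormedModule) phi _ 0); auto.
    apply filter_forall; intros. apply (RInt_correct (V:=R_CompleteNormedModule)). now apply ex_RInt_cont. }
  apply is_derive_ext with (fun y => (RInt phi 0 (y + h) - RInt phi 0 y) / h).
  - intros y. unfold avg.
    assert (E := RInt_comp_lin phi h y 0 1). 
    rewrite Rmult_0_r, Rmult_1_r, Rplus_0_l, (Rplus_comm h) in E.
    rewrite <- (RInt_Chasles (V:=R_CompleteNormedModule) phi 0 y (y + h)) by now apply ex_RInt_cont.
    unfold plus; simpl. specialize (E (ex_RInt_cont _ _ _ Hc)).
    rewrite <- E. rewrite (RInt_scal (V:=R_CompleteNormedModule)).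
    + unfold scal; simpl; unfold mult; simpl.
      rewrite (RInt_ext (V:=R_CompleteNormedModule) (fun s => phi (h * s + y)) (fun s => phi (y + h * s)))
       by (intros; f_equal; ring).
      field. lra.
    + eapply ex_RInt_ext; [|apply (ex_RInt_avg phi y Hc)]. intros; simpl. f_equal; ring.
  - unfold dq. apply is_derive_ext with (fun y => / h * (RInt phi 0 (y + h) - RInt phi 0 y)).
    { intros; apply Rmult_comm. }
    evar_last.
    + apply (is_derive_scal (fun y => RInt phi 0 (y + h) - RInt phi 0 y) x (/ h)).
      apply (is_derive_minus (V:=R_NormedModule)); [|apply D].
      apply (is_derive_comp (fun z => RInt phi 0 z) (fun y => y + h)); [apply D|].
      auto_derive; [easy|reflexivity].
    + unfold scal, minus, plus, opp; simpl; unfold mult; simpl. field; lra.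
Qed.

End Avg.

Section Step.
Variable ga : R.
Hypothesis Hga : 0 < ga.

(** The widths [hh i] telescope: their total is [tt_ 0 / 2 = 1/2], while [hh i] is at least of the
    order [i^(-1-ga)], so that [k] differentiations cost about [(k!)^(1+ga)]. *)
Definition tt_ (i : nat) : R := Rpower (INR i + 1) (- ga).
Definition hh (i : nat) : R := (tt_ i - tt_ (S i)) / 2.

Lemma hh_lower i : ga / 2 * Rpower (INR i + 2) (- (1 + ga)) <= hh i.
Proof.
  unfold hh, tt_. rewrite S_INR. pose proof (pos_INR i).
  replace (INR i + 1 + 1) with (INR i + 2) by ring.
  assert (E : Rpower (INR i + 1) (- ga) = Rpower (INR i + 2) (- ga) * exp (ga * ln ((INR i + 2) / (INR i + 1)))).
  { unfold Rpower. rewrite <- exp_plus. f_equal. unfold Rdiv. rewrite ln_mult, ln_Rinv; try lra.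
    apply Rinv_0_lt_compat; lra. }
  assert (E2 : Rpower (INR i + 2) (- (1 + ga)) = Rpower (INR i + 2) (- ga) * / (INR i + 2)).
  { replace (- (1 + ga)) with (- ga + - (1)) by ring. rewrite Rpower_plus. f_equal.
    rewrite Rpower_Ropp, Rpower_1; lra. }
  rewrite E, E2.
  assert (Hl : / (INR i + 2) <= ln ((INR i + 2) / (INR i + 1))).
  { assert (Hx : ln ((INR i + 1) / (INR i + 2)) <= (INR i + 1) / (INR i + 2) - 1).
    { assert (0 < (INR i + 1) / (INR i + 2)) by (apply Rdiv_lt_0_compat; lra).
      set (q := (INR i + 1) / (INR i + 2)) in *. 
      pose proof (exp_ineq1_le (ln q)). rewrite exp_ln in H1 by auto. lra. }
    replace ((INR i + 2) / (INR i + 1)) with (/ ((INR i + 1) / (INR i + 2))) by (field; lra).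
    rewrite ln_Rinv by (apply Rdiv_lt_0_compat; lra).
    replace (/ (INR i + 2)) with (- ((INR i + 1) / (INR i + 2) - 1)) by (field; lra). lra. }
  set (l := ln ((INR i + 2) / (INR i + 1))) in *.
  pose proof (exp_ineq1_le (ga * l)).
  set (P := Rpower (INR i + 2) (- ga)). assert (0 < P) by apply exp_pos.
  assert (ga * / (INR i + 2) <= ga * l) by (apply Rmult_le_compat_l; lra).
  assert (P * (ga * / (INR i + 2)) <= P * (exp (ga * l) - 1)) by (apply Rmult_le_compat_l; lra).
  lra.
Qed.

Lemma hh_pos i : 0 < hh i.
Proof.
  eapply Rlt_le_trans; [|apply hh_lower]. apply Rmult_lt_0_compat; [lra|apply exp_pos].
Qed.

Lemma tt_pos i : 0 < tt_ i.
Proof. apply exp_pos. Qed.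

Lemma tt_0 : tt_ 0 = 1.
Proof. unfold tt_. simpl. rewrite Rplus_0_l. unfold Rpower. now rewrite ln_1, Rmult_0_r, exp_0. Qed.

Lemma tt_lim : is_lim_seq tt_ 0.
Proof.
  apply is_lim_seq_spec. intros eps.
  destruct (archimed_cor1 (Rpower eps (1 / ga)) (exp_pos _)) as [N [HN HN0]].
  exists N. intros n Hn. rewrite Rminus_0_r, Rabs_pos_eq by (left; apply tt_pos).
  apply Rle_lt_trans with (Rpower (INR N) (- ga)).
  - unfold tt_. rewrite !Rpower_Ropp. apply Rinv_le_contravar; [apply exp_pos|].
    assert (0 < INR N) by now apply lt_0_INR. apply le_INR in Hn.
    apply Rpower_le_base; lra.
  - assert (HN1 : 0 < INR N) by now apply lt_0_INR.
    assert (H := Rlt_Rpower_l (/ INR N) (Rpower eps (1 / ga)) ga Hga (conj (Rinv_0_lt_compat _ HN1) HN)).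
    rewrite Rpower_mult in H. replace (1 / ga * ga) with 1 in H by (field; lra).
    rewrite Rpower_1 in H by apply cond_pos.
    replace (Rpower (INR N) (- ga)) with (Rpower (/ INR N) ga); auto.
    rewrite Rpower_Ropp. unfold Rpower. rewrite ln_Rinv by auto. rewrite <- exp_Ropp. f_equal; ring.
Qed.

(** It rises on [[1/2, 1]] only. The averages look to the right by a total of at most 1/2, so the
    limit still vanishes for [x <= 0] and is 1 for [x >= 1]. *)
Definition ramp (x : R) : R := Rmax 0 (Rmin 1 (2 * x - 1)).

Lemma ramp_lip : lip 2 ramp.
Proof.
  intros x y. unfold ramp, Rmax, Rmin.
  repeat destruct (Rle_dec _ _); unfold Rabs; repeat destruct (Rcase_abs _); lra.
Qed.

Fixpoint SS (n k : nat) : R -> R :=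
  match n with O => ramp | S m => avg (hh k) (SS m (S k)) end.

Lemma SS_lip n : forall k, lip 2 (SS n k).
Proof.
  induction n; intros k; [apply ramp_lip|]. simpl. apply avg_lip; auto; try lra. 
Qed.

Lemma SS_cont n k x : continuous (SS n k) x.
Proof. apply (lip_cont 2); [lra|apply SS_lip]. Qed.

Lemma SS_range n : forall k x, 0 <= SS n k x <= 1.
Proof.
  induction n; intros k x; simpl.
  - unfold ramp, Rmax, Rmin. repeat destruct (Rle_dec _ _); lra.
  - apply avg_range; auto. intros; apply SS_cont.
Qed.

Lemma SS_step n : forall k x, Rabs (SS (S n) k x - SS n k x) <= 2 * hh (k + n).
Proof.
  induction n; intros k x.
  - rewrite Nat.add_0_r. simpl. apply avg_near; [apply hh_pos|lra|apply ramp_lip].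
  - change (Rabs (avg (hh k) (SS (S n) (S k)) x - avg (hh k) (SS n (S k)) x) <= 2 * hh (k + S n)).
    apply avg_sub; try apply SS_cont.
    intros s _. replace (k + S n)%nat with (S k + n)%nat by lia. apply IHn.
Qed.

Lemma SS_cauchy n m k x : Rabs (SS (n + m) k x - SS n k x) <= tt_ (k + n) - tt_ (k + n + m).
Proof.
  induction m.
  - rewrite !Nat.add_0_r. replace (SS n k x - SS n k x) with 0 by ring. rewrite Rabs_R0. lra.
  - rewrite !Nat.add_succ_r.
    replace (SS (S (n + m)) k x - SS n k x) with
      ((SS (S (n + m)) k x - SS (n + m) k x) + (SS (n + m) k x - SS n k x)) by ring.
    eapply Rle_trans; [apply Rabs_triang|]. pose proof (SS_step (n + m) k x).
    unfold hh in H. rewrite Nat.add_assoc in H. lra.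
Qed.

(** The infinite average with the widths [hh k], [hh (k+1)], and so on. It is the average of
    [Phi (S k)] over the width [hh k], and differentiation trades this one average for a difference
    quotient. *)
Definition Phi (k : nat) (x : R) : R := Lim_seq (fun n => SS n k x).

Lemma Phi_lim k x : is_lim_seq (fun n => SS n k x) (Phi k x).
Proof.
  apply Lim_seq_correct'. apply ex_lim_seq_cauchy_corr. intros eps.
  assert (H := tt_lim). apply is_lim_seq_spec in H.
  destruct (H (mkposreal (eps / 2) ltac:(pose proof (cond_pos eps); lra))) as [N HN]. simpl in HN.
  assert (P : forall n, (N <= n)%nat -> Rabs (SS n k x - SS N k x) < eps / 2).
  { intros n Hn. replace n with (N + (n - N))%nat by lia.
    eapply Rle_lt_trans; [apply SS_cauchy|].
    specialize (HN (k + N)%nat ltac:(lia)). rewrite Rminus_0_r, Rabs_pos_eq in HN by (left; apply tt_pos).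
    pose proof (tt_pos (k + N + (n - N))). lra. }
  exists N. intros n m Hn Hm.
  replace (SS n k x - SS m k x) with ((SS n k x - SS N k x) + - (SS m k x - SS N k x)) by ring.
  eapply Rle_lt_trans; [apply Rabs_triang|]. rewrite Rabs_Ropp.
  pose proof (P n Hn). pose proof (P m Hm). lra.
Qed.

Lemma Phi_near n k x : Rabs (Phi k x - SS n k x) <= tt_ (k + n).
Proof.
  apply (is_lim_seq_le (fun m => Rabs (SS (n + m) k x - SS n k x)) (fun _ => tt_ (k + n))
     (Rabs (Phi k x - SS n k x)) (tt_ (k + n))).
  - intros m. eapply Rle_trans; [apply SS_cauchy|]. pose proof (tt_pos (k + n + m)). lra.
  - apply (is_lim_seq_abs _ (Phi k x - SS n k x)). apply is_lim_seq_minus'; [|apply is_lim_seq_const].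
    apply (is_lim_seq_ext (fun m => SS (m + n) k x)); [intros; now rewrite Nat.add_comm|].
    apply (is_lim_seq_incr_n (fun m => SS m k x)), Phi_lim.
  - apply is_lim_seq_const.
Qed.

Lemma Phi_lip k : lip 2 (Phi k).
Proof.
  intros x y. apply (is_lim_seq_le (fun n => Rabs (SS n k x - SS n k y)) (fun _ => 2 * Rabs (x - y))
     (Rabs (Phi k x - Phi k y)) (2 * Rabs (x - y))).
  - intros n; apply SS_lip.
  - apply (is_lim_seq_abs _ (Phi k x - Phi k y)). apply is_lim_seq_minus'; apply Phi_lim.
  - apply is_lim_seq_const.
Qed.

Lemma Phi_cont k x : continuous (Phi k) x.
Proof. apply (lip_cont 2); [lra|apply Phi_lip]. Qed.

Lemma Phi_range k x : 0 <= Phi k x <= 1.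
Proof.
  split.
  - apply (is_lim_seq_le (fun _ => 0) (fun n => SS n k x) 0 (Phi k x)).
    + intros; apply SS_range.
    + apply is_lim_seq_const.
    + apply Phi_lim.
  - apply (is_lim_seq_le (fun n => SS n k x) (fun _ => 1) (Phi k x) 1).
    + intros; apply SS_range.
    + apply Phi_lim.
    + apply is_lim_seq_const.
Qed.

Lemma Phi_avg k x : Phi k x = avg (hh k) (Phi (S k)) x.
Proof.
  assert (H : is_lim_seq (fun n => SS (S n) k x) (avg (hh k) (Phi (S k)) x)).
  { apply is_lim_seq_spec. intros eps.
    assert (H := tt_lim). apply is_lim_seq_spec in H. destruct (H eps) as [N HN].
    exists N. intros n Hn. simpl. eapply Rle_lt_trans.
    - apply avg_sub with (e := tt_ (S k + n)); [apply SS_cont|apply Phi_cont|].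
      intros s _. rewrite Rabs_minus_sym. apply Phi_near.
    - specialize (HN (S k + n)%nat ltac:(lia)).
      rewrite Rminus_0_r, Rabs_pos_eq in HN by (left; apply tt_pos). exact HN. }
  apply is_lim_seq_unique in H.
  assert (H2 := proj1 (is_lim_seq_incr_1 _ _) (Phi_lim k x)). apply is_lim_seq_unique in H2.
  rewrite H in H2. congruence.
Qed.

Lemma SS_zero n : forall k x, x <= (1 - (tt_ k - tt_ (k + n))) / 2 -> SS n k x = 0.
Proof.
  induction n; intros k x Hx; simpl.
  - rewrite Nat.add_0_r in Hx. unfold ramp, Rmax, Rmin. repeat destruct (Rle_dec _ _); lra.
  - apply avg_const_on. intros s Hs. apply IHn.
    replace (S k + n)%nat with (k + S n)%nat by lia.
    pose proof (hh_pos k). assert (hh k * s <= hh k) by nra. unfold hh in H0 at 2. lra.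
Qed.

Lemma SS_one n : forall k x, 1 <= x -> SS n k x = 1.
Proof.
  induction n; intros k x Hx; simpl.
  - unfold ramp, Rmax, Rmin. repeat destruct (Rle_dec _ _); lra.
  - apply avg_const_on. intros s Hs. apply IHn. pose proof (hh_pos k). nra.
Qed.

Lemma Phi_zero x : x <= 0 -> Phi 0 x = 0.
Proof.
  intros Hx.
  assert (H := Phi_lim 0 x).
  apply (is_lim_seq_ext _ (fun _ => 0)) in H.
  - apply is_lim_seq_unique in H. rewrite Lim_seq_const in H. congruence.
  - intros n. apply SS_zero. rewrite tt_0. pose proof (tt_pos (0 + n)). lra.
Qed.

Lemma Phi_one x : 1 <= x -> Phi 0 x = 1.
Proof.
  intros Hx. assert (H := Phi_lim 0 x).
  apply (is_lim_seq_ext _ (fun _ => 1)) in H.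
  - apply is_lim_seq_unique in H. rewrite Lim_seq_const in H. congruence.
  - intros n. now apply SS_one.
Qed.

(** [DD k (Phi k)] is the derivative of order [k] of [Phi 0]: the averages of widths [hh 0] to
    [hh (k-1)] have become difference quotients. *)
Fixpoint DD (n : nat) (phi : R -> R) : R -> R :=
  match n with O => phi | S m => DD m (dq (hh m) phi) end.

Lemma DD_der n : forall phi phi', (forall x, is_derive phi x (phi' x)) ->
  forall x, is_derive (DD n phi) x (DD n phi' x).
Proof.
  induction n; intros phi phi' H; [exact H|]. simpl. apply IHn. intros x.
  pose proof (hh_pos n). unfold dq.
  apply is_derive_ext with (fun y => / hh n * (phi (y + hh n) - phi y)).
  { intros; apply Rmult_comm. }
  evar_last.
  - apply (is_derive_scal (fun y => phi (y + hh n) - phi y) x (/ hh n)).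
    apply (is_derive_minus (V:=R_NormedModule)); [|apply H].
    apply (is_derive_comp phi (fun y => y + hh n)); [apply H|].
    auto_derive; [easy|reflexivity].
  - unfold scal, minus, plus, opp; simpl; unfold mult; simpl. field; lra.
Qed.

Fixpoint PP (n : nat) : R := match n with O => 1 | S m => PP m * (2 / hh m) end.

Lemma DD_bound n : forall phi B, 0 <= B -> (forall x, Rabs (phi x) <= B) ->
  forall x, Rabs (DD n phi x) <= PP n * B.
Proof.
  induction n; intros phi B HB H x; simpl; [rewrite Rmult_1_l; apply H|].
  pose proof (hh_pos n).
  rewrite Rmult_assoc. apply IHn.
  - apply Rmult_le_pos; auto. left; apply Rdiv_lt_0_compat; lra.
  - intros y. unfold dq, Rdiv. rewrite Rabs_mult, Rabs_inv, (Rabs_pos_eq (hh n)) by lra.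
    replace (2 * / hh n * B) with ((2 * B) * / hh n) by ring.
    apply Rmult_le_compat_r; [left; now apply Rinv_0_lt_compat|].
    unfold Rminus. eapply Rle_trans; [apply Rabs_triang|]. rewrite Rabs_Ropp.
    pose proof (H (y + hh n)). pose proof (H y). lra.
Qed.

Lemma PP_bound n : PP n <= (4 / ga * Rpower 2 (1 + ga)) ^ n * Rpower (INR (fact n)) (1 + ga).
Proof.
  assert (Q : PP n <= (4 / ga) ^ n * Rpower (INR (fact (S n))) (1 + ga)).
  { induction n.
    - simpl. unfold Rpower. rewrite ln_1, Rmult_0_r, exp_0. lra.
    - simpl PP. pose proof (hh_pos n).
      assert (H2 : 2 / hh n <= 4 / ga * Rpower (INR (S (S n))) (1 + ga)).
      { assert (H3 := hh_lower n). replace (INR n + 2) with (INR (S (S n))) in H3 by (rewrite !S_INR; ring).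
        rewrite Rpower_Ropp in H3. set (w := Rpower (INR (S (S n))) (1 + ga)) in *.
        assert (0 < w) by apply exp_pos.
        apply Rmult_le_reg_r with (hh n * (ga / 2 * / w)).
        - apply Rmult_lt_0_compat; auto. apply Rmult_lt_0_compat; [lra|now apply Rinv_0_lt_compat].
        - replace (2 / hh n * (hh n * (ga / 2 * / w))) with (2 * (ga / 2 * / w)) by (field; lra).
          replace (4 / ga * w * (hh n * (ga / 2 * / w))) with (2 * hh n) by (field; lra). lra. }
      assert (E : Rpower (INR (fact (S (S n)))) (1 + ga) = Rpower (INR (S (S n))) (1 + ga) * Rpower (INR (fact (S n))) (1 + ga)).
      { rewrite Rpower_mult_distr; [|apply lt_0_INR; lia|apply INR_fact_lt_0].
        rewrite <- mult_INR. reflexivity. }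
      rewrite E.
      replace ((4 / ga) ^ S n * (Rpower (INR (S (S n))) (1 + ga) * Rpower (INR (fact (S n))) (1 + ga))) with
        (((4 / ga) ^ n * Rpower (INR (fact (S n))) (1 + ga)) * (4 / ga * Rpower (INR (S (S n))) (1 + ga))) by (simpl; ring).
      apply Rmult_le_compat; auto.
      + clear -Hga. induction n; simpl; [lra|]. apply Rmult_le_pos; auto. pose proof (hh_pos n).
        left; apply Rdiv_lt_0_compat; lra.
      + left; apply Rdiv_lt_0_compat; lra. }
  eapply Rle_trans; [exact Q|]. rewrite Rpow_mult_distr, Rmult_assoc.
  apply Rmult_le_compat_l; [apply pow_le; left; apply Rdiv_lt_0_compat; lra|].
  rewrite <- Rpower_pow_comm by lra. rewrite Rpower_mult_distr; [|apply pow_lt; lra|apply INR_fact_lt_0].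
  apply Rpower_le_base; [apply INR_fact_lt_0| |lra].
  change (fact (S n)) with (S n * fact n)%nat. rewrite mult_INR.
  apply Rmult_le_compat_r; [left; apply INR_fact_lt_0|].
  replace 2 with (INR 2) by reflexivity. rewrite <- pow_INR. apply le_INR.
  clear. induction n; simpl in *; lia.
Qed.

End Step.

Lemma pow_le_fact_power B g : 0 < B -> 0 < g -> exists C0, 0 < C0 /\ forall n, B ^ n <= C0 * Rpower (INR (fact n)) g.
Proof.
  intros HB Hg. set (b := Rpower B (1 / g)). exists (Rpower (exp b) g). split; [apply exp_pos|].
  intros n. assert (H := pow_fact_le_exp b n ltac:(left; apply exp_pos)).
  rewrite Rpower_mult_distr; [|apply exp_pos|apply INR_fact_lt_0].
  replace (B ^ n) with (Rpower (b ^ n) g).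
  - apply Rpower_le_base; [apply pow_lt, exp_pos| |lra].
    apply Rmult_le_reg_r with (/ INR (fact n)); [apply Rinv_0_lt_compat, INR_fact_lt_0|].
    rewrite Rmult_assoc, Rinv_r by (apply Rgt_not_eq, INR_fact_lt_0). unfold Rdiv in H. lra.
  - rewrite Rpower_pow_comm by apply exp_pos. f_equal. unfold b. rewrite Rpower_mult.
    replace (1 / g * g) with 1 by (field; lra). now apply Rpower_1.
Qed.

(** [ga] is half of the room [1 / al - 1] left by [al < 1]. The derivatives are bounded by
    [A^k (k!)^(1+ga)], and the missing [(k!)^ga] in [(k!)^(1/al)] dominates [(A / eps)^k] for every
    [eps]. *)
Lemma gevrey_step al : 0 < al -> al < 1 -> exists T : nat -> R -> C,
  jet T /\ (forall eps, 0 < eps -> exists C0, 0 <= C0 /\ forall k x, Cmod (T k x) <= C0 * (eps ^ k * fa al k)) /\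
  (forall x, exists y, 0 <= y <= 1 /\ T O x = RtoC y) /\
  (forall x, x <= 0 -> T O x = RtoC 0) /\ (forall x, 1 <= x -> T O x = RtoC 1).
Proof.
  intros H0 H1. set (ga := (1 / al - 1) / 2).
  assert (Hga : 0 < ga).
  { unfold ga. assert (1 < 1 / al); [|lra]. apply Rmult_lt_reg_r with al; auto. field_simplify; lra. }
  exists (fun n x => RtoC (DD ga n (Phi ga n) x)). split; [|split; [|split; [|split]]].
  - intros n x. split; simpl; [|apply (is_derive_const (V:=R_NormedModule))].
    apply (DD_der ga Hga n (Phi ga n) (dq (hh ga n) (Phi ga (S n)))).
    intros y. apply is_derive_ext with (avg (hh ga n) (Phi ga (S n))).
    + intros; symmetry; now apply Phi_avg.
    + apply avg_der; [now apply hh_pos|]. intros; now apply Phi_cont.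
  - intros eps He.
    set (A := 4 / ga * Rpower 2 (1 + ga)).
    assert (HA : 0 < A) by (apply Rmult_lt_0_compat; [apply Rdiv_lt_0_compat; lra|apply exp_pos]).
    destruct (pow_le_fact_power (A / eps) ga) as [C0 [HC H]]; auto; [now apply Rdiv_lt_0_compat|].
    exists C0. split; [lra|]. intros k x. rewrite Cmod_R.
    eapply Rle_trans; [apply (DD_bound ga Hga k _ 1); [lra|]|].
    + intros y. pose proof (Phi_range ga Hga k y). rewrite Rabs_pos_eq; lra.
    + rewrite Rmult_1_r. eapply Rle_trans; [now apply PP_bound|]. fold A.
      replace (A ^ k) with ((A / eps) ^ k * eps ^ k) by (rewrite <- Rpow_mult_distr; f_equal; field; lra).
      replace (fa al k) with (Rpower (INR (fact k)) ga * Rpower (INR (fact k)) (1 + ga)).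
      * specialize (H k). assert (0 <= eps ^ k * Rpower (INR (fact k)) (1 + ga)).
        { apply Rmult_le_pos; [apply pow_le; lra|left; apply exp_pos]. } nra.
      * unfold fa. rewrite <- Rpower_plus. f_equal. unfold ga. field. lra.
  - intros x. exists (Phi ga 0 x). split; auto. now apply Phi_range.
  - intros x Hx. simpl. now rewrite Phi_zero.
  - intros x Hx. simpl. now rewrite Phi_one.
Qed.

(** * Fourier transforms of compactly supported jets *)

Definition vanish_out (a b : R) (G : nat -> R -> C) : Prop :=
  forall k x, x <= a \/ b <= x -> G k x = RtoC 0.

Lemma jet_vanish_out a a' b b' G : jet G -> a < a' -> b' < b ->
  (forall x, x <= a' \/ b' <= x -> G O x = RtoC 0) -> vanish_out a b G.
Proof.
  intros J Ha Hb H k x [Hx|Hx].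
  - apply (jet_local G (fun _ _ => RtoC 0) (x - 1) a' J jet_zero); [|lra].
    intros y Hy. apply H. lra.
  - apply (jet_local G (fun _ _ => RtoC 0) b' (x + 1) J jet_zero); [|lra].
    intros y Hy. apply H. lra.
Qed.

Definition FT (a b : R) (g : R -> C) (z : C) : C := CI (fun t => (g t * cE (- z) t)%C) a b.

Lemma smooth_ccont f : smooth f -> ccont f.
Proof. intros H. rewrite <- cderiv_n_0. apply jet_ccont, smooth_jet, H. Qed.

(** Once [g] is seen as a distribution, [FT] inherits continuity along segments and the interchange
    with contour integrals from the general statements. *)
Lemma int_cs_dist g a b : a <= b -> ccont g -> cs_dist (fun phi => CI (fun t => (g t * phi t)%C) a b).
Proof.
  intros Hab Hg. split; [|split].
  - intros phi psi H1 H2. apply smooth_ccont in H1, H2.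
    rewrite <- CI_plus by now apply ccont_mult. apply CI_ext; intros; ring.
  - intros c phi H. apply smooth_ccont in H. rewrite <- CI_scal by now apply ccont_mult.
    apply CI_ext; intros; ring.
  - destruct (ccont_bounded g a b Hg) as [B [HB0 HB]].
    exists (Rmax (Rabs a) (Rabs b)), (B * (b - a)), O. split.
    + apply Rmult_le_pos; lra.
    + intros phi B' H HB'. apply smooth_ccont in H as Hc.
      replace (B * (b - a) * B') with ((B * B') * (b - a)) by ring.
      apply CI_bound; auto; [now apply ccont_mult|]. intros t Ht. rewrite Cmod_mult.
      apply Rmult_le_compat; auto using Cmod_ge_0.
      specialize (HB' O t). rewrite cderiv_n_0 in HB'. apply HB'; auto.
      apply Rabs_between_max. rewrite Rmin_left, Rmax_right; lra.
Qed.

Lemma FT_dist a b g z : FT a b g z = (fun phi => CI (fun t => (g t * phi t)%C) a b) (cE (- z)%C).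
Proof. reflexivity. Qed.

Lemma ccont_FT_seg a b g p d : a <= b -> ccont g -> ccont (fun t => FT a b g (seg p d t)).
Proof.
  intros Hab Hg. assert (H := cs_dist_cE_ccont _ (int_cs_dist g a b Hab Hg) (- p)%C (- d)%C).
  eapply (fun h => eq_ind _ ccont H _ h).
  apply functional_extensionality; intros t. now rewrite FT_dist, seg_opp.
Qed.

Lemma seg_real t : seg (RtoC 0) (RtoC 1) t = RtoC t.
Proof. unfold seg. ring. Qed.

Lemma ccont_FT a b g : a <= b -> ccont g -> ccont (fun xi => FT a b g (RtoC xi)).
Proof.
  intros Hab Hg. eapply (fun h => eq_ind _ ccont (ccont_FT_seg a b g (RtoC 0) (RtoC 1) Hab Hg) _ h).
  apply functional_extensionality; intros t. now rewrite seg_real.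
Qed.

Lemma ccont_cE_real x : ccont (fun xi => cE (RtoC xi) x).
Proof.
  eapply (fun h => eq_ind _ ccont (ccont_cE_seg (RtoC 0) (RtoC 1) x) _ h).
  apply functional_extensionality; intros t. now rewrite seg_real.
Qed.

Lemma FT_deriv a b G z k : jet G -> vanish_out a b G ->
  FT a b (G (S k)) z = (Ci * z * FT a b (G k) z)%C.
Proof.
  intros J V.
  assert (D := cder_mult _ _ _ _ (J k) (cE_der (- z)%C)).
  assert (Hc : ccont (fun x => (G (S k) x * cE (- z) x + G k x * (Ci * - z * cE (- z) x))%C)).
  { apply ccont_plus; apply ccont_mult.
    - now apply jet_ccont.
    - apply cE_ccont.
    - now apply jet_ccont.
    - apply ccont_mult; [apply ccont_const|apply cE_ccont]. }
  assert (E := CI_FTC _ _ a b D Hc). simpl in E.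
  rewrite (V k a), (V k b) in E by lra.
  unfold FT. rewrite <- CI_scal by (apply ccont_mult; [now apply jet_ccont|apply cE_ccont]).
  assert (H1 : ccont (fun x => (G (S k) x * cE (- z) x)%C)) by (apply ccont_mult; [now apply jet_ccont|apply cE_ccont]).
  assert (H2 : ccont (fun x => (G k x * (Ci * - z * cE (- z) x))%C)).
  { apply ccont_mult; [now apply jet_ccont|]. apply ccont_mult; [apply ccont_const|apply cE_ccont]. }
  rewrite (CI_plus _ _ a b H1 H2) in E.
  replace (CI (fun x => (G k x * (Ci * - z * cE (- z) x))%C) a b) with
    (- CI (fun x => (Ci * z * (G k x * cE (- z) x))%C) a b)%C in E.
  - replace (CI (fun t => (G (S k) t * cE (- z) t)%C) a b) with
     ((CI (fun t => (G (S k) t * cE (- z) t)%C) a b + - CI (fun x => (Ci * z * (G k x * cE (- z) x))%C) a b) +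
       CI (fun x => (Ci * z * (G k x * cE (- z) x))%C) a b)%C by ring.
    rewrite E. ring.
  - replace (- CI (fun x => (Ci * z * (G k x * cE (- z) x))%C) a b)%C with
      (RtoC (-1) * CI (fun x => (Ci * z * (G k x * cE (- z) x))%C) a b)%C by cring.
    rewrite <- CI_scal.
    + apply CI_ext; intros; cring.
    + apply ccont_mult; [apply ccont_const|]. apply ccont_mult; [now apply jet_ccont|apply cE_ccont].
Qed.

Lemma FT_pow a b G z k : jet G -> vanish_out a b G ->
  FT a b (G k) z = (Cpow (Ci * z) k * FT a b (G O) z)%C.
Proof.
  intros J V. induction k; [simpl; ring|]. rewrite FT_deriv, IHk; auto. simpl. ring.
Qed.

Lemma FT_bound a b G z k A E : a <= b -> jet G -> vanish_out a b G ->
  (forall t, a <= t <= b -> Cmod (G k t) <= A) -> (forall t, a <= t <= b -> Cmod (cE (- z) t) <= E) ->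
  Cmod z ^ k * Cmod (FT a b (G O) z) <= A * E * (b - a).
Proof.
  intros Hab J V HA HE.
  replace (Cmod z ^ k * Cmod (FT a b (G O) z)) with (Cmod (FT a b (G k) z)).
  - apply CI_bound; auto.
    + apply ccont_mult; [now apply jet_ccont|apply cE_ccont].
    + intros t Ht. rewrite Cmod_mult. apply Rmult_le_compat; auto using Cmod_ge_0.
  - rewrite FT_pow by auto. now rewrite Cmod_mult, Cmod_pow, Cmod_mult, Cmod_Ci, Rmult_1_l.
Qed.

(** The bound [E] of [e^(-izt)] over the support stays a parameter: on the contour its actual size
    at complex [z] decides where the solution is small. *)
Lemma FT_decay al lam a b G : 0 < al -> 0 < lam -> a <= b -> jet G -> vanish_out a b G -> gev al G ->
  exists C0, 0 <= C0 /\ forall z E, (forall t, a <= t <= b -> Cmod (cE (- z) t) <= E) ->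
    Cmod (FT a b (G O) z) <= C0 * exp (- (lam * w_pow al (Cmod z))) * E.
Proof.
  intros Ha Hl Hab J V HG.
  destruct (gev_decay al lam Ha Hl) as [eps [c [He [Hc H]]]].
  destruct (HG (Rmax (Rabs a) (Rabs b)) eps He) as [A [HA HGA]].
  exists (c * (A * (b - a))). split.
  { apply Rmult_le_pos; [lra|]. apply Rmult_le_pos; lra. }
  intros z E HE.
  assert (HE0 : 0 <= E) by (eapply Rle_trans; [apply Cmod_ge_0|apply (HE a); lra]).
  replace (c * (A * (b - a)) * exp (- (lam * w_pow al (Cmod z))) * E) with
    (c * (A * E * (b - a)) * exp (- (lam * w_pow al (Cmod z)))) by ring.
  apply H; [apply Cmod_ge_0| |].
  - apply Rmult_le_pos; [now apply Rmult_le_pos|lra].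
  - intros k. replace (A * E * (b - a) * (eps ^ k * fa al k)) with (A * (eps ^ k * fa al k) * E * (b - a)) by ring.
    apply FT_bound; auto. intros t Ht. apply HGA. apply Rabs_between_max. rewrite Rmin_left, Rmax_right; lra.
Qed.

(** * Fourier series and inversion *)

Lemma jet_locally_lipschitz F k T : jet F -> exists B, 0 <= B /\ forall x y, Rabs x <= T -> Rabs y <= T ->
  Cmod (F k y - F k x) <= B * Rabs (y - x).
Proof.
  intros J. destruct (ccont_bounded (F (S k)) (- T) T (jet_ccont F (S k) J)) as [B [HB0 HB]].
  exists B; split; auto. intros x y Hx Hy. apply (cder_mvt _ (F (S k))); auto.
  - now apply jet_ccont.
  - intros t Ht. apply HB. apply Rabs_le_between in Hx, Hy. revert Ht.
    unfold Rmin, Rmax; destruct (Rle_dec x y); lra.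
Qed.

Lemma ccont_of_eps f : (forall x eps, 0 < eps -> exists delta, 0 < delta /\
  forall y, Rabs (y - x) < delta -> Cmod (f y - f x) < eps) -> ccont f.
Proof.
  intros H x; split; apply continuity_pt_filterlim; intros eps He;
  destruct (H x eps He) as [d [Hd Hy]]; exists d; split; auto;
  intros y [_ Hyd]; unfold dist in *; simpl in *; unfold R_dist in *.
  - eapply Rle_lt_trans; [apply (Rabs_fst_le (f y - f x)%C)|auto].
  - eapply Rle_lt_trans; [apply (Rabs_snd_le (f y - f x)%C)|auto].
Qed.

(* Hadamard's quotient: f t - f 0 = t * hadamard f' t, without a singularity at t = 0. *)
Definition hadamard (f' : R -> C) (t : R) : C := CI (fun s => f' (s * t)) 0 1.

Lemma ccont_scale f t : ccont f -> ccont (fun s => f (s * t)).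
Proof.
  intros H. apply (ccont_comp f (fun s => s * t)); auto.
  intros s. apply (ex_derive_continuous (V:=R_NormedModule)). auto_derive; easy.
Qed.

Lemma hadamard_eq F t : jet F -> (RtoC t * hadamard (F 1%nat) t)%C = (F O t - F O 0)%C.
Proof.
  intros J. unfold hadamard.
  rewrite (CI_ext _ (fun s => F 1%nat (t * s + 0))) by (intros; f_equal; ring).
  rewrite CI_affine by now apply jet_ccont.
  rewrite (CI_FTC (F O)); [|apply J|now apply jet_ccont].
  f_equal; [f_equal; ring|do 2 f_equal; ring].
Qed.

Lemma ccont_hadamard F : jet F -> ccont (hadamard (F 1%nat)).
Proof.
  intros J. apply ccont_of_eps. intros x eps He.
  destruct (jet_locally_lipschitz F 1 (Rabs x + 1) J) as [B [HB0 HB]].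
  exists (Rmin 1 (eps / (B + 1))). split.
  { apply Rmin_glb_lt; [lra|]. apply Rdiv_lt_0_compat; lra. }
  intros y Hy.
  assert (H1 : Rabs (y - x) < 1) by (eapply Rlt_le_trans; [exact Hy|apply Rmin_l]).
  assert (H2 : Rabs (y - x) < eps / (B + 1)) by (eapply Rlt_le_trans; [exact Hy|apply Rmin_r]).
  unfold hadamard. rewrite <- CI_minus by (apply ccont_scale; now apply jet_ccont).
  apply Rle_lt_trans with (B * Rabs (y - x) * (1 - 0)).
  - apply CI_bound; [lra| |].
    + apply ccont_minus; apply ccont_scale; now apply jet_ccont.
    + intros s Hs. 
      assert (Hsc : forall u, Rabs u <= Rabs x + 1 -> Rabs (s * u) <= Rabs x + 1).
      { intros u Hu. rewrite Rabs_mult, (Rabs_pos_eq s) by lra. pose proof (Rabs_pos u). nra. }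
      eapply Rle_trans; [apply HB|].
      * apply Hsc. lra.
      * apply Hsc. replace y with ((y - x) + x) by ring. eapply Rle_trans; [apply Rabs_triang|]. lra.
      * apply Rmult_le_compat_l; auto. replace (s * y - s * x) with (s * (y - x)) by ring.
        rewrite Rabs_mult, (Rabs_pos_eq s) by lra. pose proof (Rabs_pos (y - x)). nra.
  - apply Rle_lt_trans with ((B + 1) * Rabs (y - x)); [pose proof (Rabs_pos (y - x)); nra|].
    apply Rmult_lt_reg_r with (/ (B + 1)); [apply Rinv_0_lt_compat; lra|].
    replace ((B + 1) * Rabs (y - x) * / (B + 1)) with (Rabs (y - x)) by (field; lra). exact H2.
Qed.

Lemma ccont_unif g a b eps : ccont g -> 0 < eps -> exists delta, 0 < delta /\ forall t h, a <= t <= b ->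
  a <= t + h <= b -> Rabs h < delta -> Cmod (g (t + h) - g t) <= eps.
Proof.
  intros Hg He.
  assert (U : forall f, (forall x, continuous f x) -> exists delta, 0 < delta /\ forall t h, a <= t <= b ->
     a <= t + h <= b -> Rabs h < delta -> Rabs (f (t + h) - f t) <= eps / 2).
  { intros f Hf.
    destruct (Heine f (fun x => a <= x <= b) (compact_P3 a b)
        (fun x _ => proj2 (continuity_pt_filterlim f x) (Hf x)) (mkposreal (eps / 2) ltac:(lra))) as [d Hd].
    exists d. split; [apply cond_pos|]. intros t h Ht Hth Hh. left. apply Hd; auto.
    replace (t + h - t) with h by ring. exact Hh. }
  destruct (U (fun t => fst (g t))) as [d1 [H1 U1]]; [apply Hg|].
  destruct (U (fun t => snd (g t))) as [d2 [H2 U2]]; [apply Hg|].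
  exists (Rmin d1 d2). split; [now apply Rmin_glb_lt|]. intros t h Ht Hth Hh.
  eapply Rle_trans; [apply Cmod_le_abs|].
  specialize (U1 t h Ht Hth (Rlt_le_trans _ _ _ Hh (Rmin_l _ _))).
  specialize (U2 t h Ht Hth (Rlt_le_trans _ _ _ Hh (Rmin_r _ _))).
  simpl. unfold Rminus in *. lra.
Qed.

Lemma sin_INR_PI n : sin (INR n * PI) = 0.
Proof. apply sin_eq_0_1. exists (Z.of_nat n). now rewrite INR_IZR_INZ. Qed.

(* Riemann-Lebesgue: shifting the variable by PI / om changes the sign of the exponential. *)
Lemma riemann_lebesgue g a b eps : a <= b -> ccont g -> 0 < eps -> exists Om, 0 < Om /\ forall om, Om <= Rabs om ->
  Cmod (CI (fun t => (g t * cE (RtoC om) t)%C) a b) <= eps.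
Proof.
  intros Hab Hg He.
  destruct (ccont_bounded g (a - 1) (b + 1) Hg) as [B [HB0 HB]].
  destruct (ccont_unif g (a - 1) (b + 1) (eps / (b - a + 1)) Hg) as [d [Hd HU]].
  { apply Rdiv_lt_0_compat; lra. }
  pose proof PI_RGT_0.
  set (d' := Rmin 1 (Rmin d (eps / (2 * B + 1)))).
  assert (Hd' : 0 < d').
  { unfold d'. repeat apply Rmin_glb_lt; try lra. apply Rdiv_lt_0_compat; lra. }
  exists (2 * PI / d'). split; [apply Rdiv_lt_0_compat; lra|].
  intros om Hom.
  assert (Hom0 : 0 < Rabs om) by (eapply Rlt_le_trans; [|exact Hom]; apply Rdiv_lt_0_compat; lra).
  assert (Hn : om <> 0) by (intros ->; rewrite Rabs_R0 in Hom0; lra).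
  set (h := PI / om).
  assert (Hh : Rabs h < d').
  { unfold h, Rdiv. rewrite Rabs_mult, Rabs_inv, (Rabs_pos_eq PI) by lra.
    apply Rmult_lt_reg_r with (Rabs om); auto. rewrite Rmult_assoc, Rinv_l, Rmult_1_r by lra.
    apply Rmult_le_compat_l with (r := d') in Hom; [|lra].
    replace (d' * (2 * PI / d')) with (2 * PI) in Hom by (field; lra). lra. }
  assert (Hh1 : Rabs h < 1) by (eapply Rlt_le_trans; [exact Hh|apply Rmin_l]).
  assert (Hh2 : Rabs h < d) by (eapply Rlt_le_trans; [exact Hh|]; eapply Rle_trans; [apply Rmin_r|apply Rmin_l]).
  assert (Hh3 : Rabs h < eps / (2 * B + 1)) by (eapply Rlt_le_trans; [exact Hh|]; eapply Rle_trans; [apply Rmin_r|apply Rmin_r]).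
  assert (Hh1' := Rabs_def2 _ _ Hh1).
  set (f := fun t => (g t * cE (RtoC om) t)%C).
  assert (Hf : ccont f) by (apply ccont_mult; auto using cE_ccont).
  set (f2 := fun t => (g (1 * t + h)%R * cE (RtoC om) t)%C).
  assert (Hf2 : ccont f2).
  { apply ccont_mult; auto using cE_ccont. apply (ccont_comp g (fun t => 1 * t + h)); auto.
    intros x. apply (ex_derive_continuous (V:=R_NormedModule)). auto_derive; easy. }
  assert (Eh : cE (RtoC om) h = RtoC (-1)).
  { apply C_eq; simpl; rewrite Rmult_0_l, Ropp_0, exp_0, Rmult_1_l; unfold h;
    replace (om * (PI / om)) with PI by (field; auto); [apply cos_PI|apply sin_PI]. }
  assert (E1 : CI f a b = (RtoC (-1) * CI f2 (a - h) (b - h))%C).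
  { assert (E := CI_affine f 1 h (a - h) (b - h) Hf).
    replace (1 * (a - h) + h) with a in E by ring. replace (1 * (b - h) + h) with b in E by ring.
    rewrite <- E, Cmult_1_l, <- (CI_scal (RtoC (-1)) f2) by exact Hf2. apply CI_ext. intros t. unfold f, f2. rewrite cE_plus_x, Eh, Rmult_1_l. ring. }
  assert (E2 : (RtoC 2 * CI f a b)%C = (CI (fun t => (f t - f2 t)%C) a b - CI f2 (a - h) a + CI f2 (b - h) b)%C).
  { rewrite CI_minus by auto.
    assert (X : (CI f2 (a - h) a + CI f2 a b = CI f2 (a - h) (b - h) + CI f2 (b - h) b)%C) by now rewrite !CI_Chasles.
    replace (CI f2 a b) with (CI f2 (a - h) (b - h) + CI f2 (b - h) b - CI f2 (a - h) a)%C by (rewrite <- X; ring).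
    rewrite E1. cring. }
  assert (F2 : forall t, a - 1 <= t <= b + 1 -> a - 1 <= t + h <= b + 1 -> Cmod (f2 t) <= B).
  { intros t Ht Hth. unfold f2. rewrite Cmod_mult, cE_real_mod, Rmult_1_r. apply HB.
    replace (1 * t + h) with (t + h) by ring. auto. }
  assert (T1 : Cmod (CI (fun t => (f t - f2 t)%C) a b) <= eps).
  { apply Rle_trans with (eps / (b - a + 1) * (b - a)).
    - apply CI_bound; auto; [now apply ccont_minus|]. intros t Ht. unfold f, f2.
      replace (g t * cE (RtoC om) t - g (1 * t + h)%R * cE (RtoC om) t)%C with ((g t - g (1 * t + h)%R) * cE (RtoC om) t)%C by ring.
      rewrite Cmod_mult, cE_real_mod, Rmult_1_r, Cmod_sub_sym, Rmult_1_l. apply HU; lra.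
    - apply Rmult_le_reg_r with (b - a + 1); [lra|].
      replace (eps / (b - a + 1) * (b - a) * (b - a + 1)) with (eps * (b - a)) by (field; lra). nra. }
  assert (Hsmall : B * Rabs h <= eps / 2).
  { assert ((2 * B + 1) * Rabs h <= eps).
    { apply Rmult_le_reg_r with (/ (2 * B + 1)); [apply Rinv_0_lt_compat; lra|].
      replace ((2 * B + 1) * Rabs h * / (2 * B + 1)) with (Rabs h) by (field; lra). unfold Rdiv in Hh3. lra. }
    pose proof (Rabs_pos h). lra. }
  assert (T2 : forall c, a <= c <= b -> Cmod (CI f2 (c - h) c) <= eps / 2).
  { intros c Hc. apply Rle_trans with (B * Rabs (c - (c - h))).
    - apply CI_bound_abs; auto. intros t Ht. apply F2; revert Ht; unfold Rmin, Rmax;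
      destruct (Rle_dec (c - h) c); lra.
    - replace (c - (c - h)) with h by ring. exact Hsmall. }
  assert (T : 2 * Cmod (CI f a b) <= 2 * eps).
  { replace (2 * Cmod (CI f a b)) with (Cmod (RtoC 2 * CI f a b)%C).
    - rewrite E2. eapply Rle_trans; [apply Cmod_triangle|]. unfold Cminus.
      pose proof (Cmod_triangle (CI (fun t => (f t - f2 t)%C) a b) (- CI f2 (a - h) a)).
      rewrite Cmod_opp in H0. pose proof (T2 a ltac:(lra)). pose proof (T2 b ltac:(lra)).
      unfold Cminus in *. lra.
    - rewrite Cmod_mult, Cmod_R, Rabs_pos_eq; lra. }
  fold f. lra.
Qed.

(** [ccont] asks for continuity on the whole line, whereas the quotient by [e^(it) - 1] is wanted on
    one period only; freezing the divisor outside [[-PI, PI]] avoids its other zeros. *)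
Definition clampPI (t : R) : R := Rmax (- PI) (Rmin PI t).

Lemma clampPI_cont x : continuous clampPI x.
Proof.
  apply (lip_cont 1); [lra|]. intros u v. pose proof PI_RGT_0. unfold clampPI, Rmax, Rmin.
  repeat destruct (Rle_dec _ _); unfold Rabs; repeat destruct (Rcase_abs _); lra.
Qed.

Lemma clampPI_id t : - PI <= t <= PI -> clampPI t = t.
Proof. intros. unfold clampPI, Rmax, Rmin. repeat destruct (Rle_dec _ _); lra. Qed.

Lemma clampPI_range t : - PI <= clampPI t <= PI.
Proof. pose proof PI_RGT_0. unfold clampPI, Rmax, Rmin. repeat destruct (Rle_dec _ _); lra. Qed.

Lemma cE_neq_1 t : - PI <= t <= PI -> t <> 0 -> cE (RtoC 1) t <> RtoC 1.
Proof.
  intros Ht Hn E. apply (f_equal fst) in E. simpl in E.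
  rewrite Rmult_0_l, Ropp_0, exp_0, !Rmult_1_l in E.
  assert (Hs : sin (t / 2) = 0).
  { assert (E2 := cos_2a_sin (t / 2)). replace (2 * (t / 2)) with t in E2 by field. rewrite E in E2. nra. }
  pose proof PI_RGT_0.
  destruct (Rlt_dec 0 t).
  - assert (0 < sin (t / 2)) by (apply sin_gt_0; lra). lra.
  - assert (0 < sin (- (t / 2))) by (apply sin_gt_0; lra). rewrite sin_neg in H0. lra.
Qed.

Definition FTpi (psi : R -> C) (om : R) : C := FT (- PI) PI psi (RtoC om).

(** Pairing [k] with [-k-1] enumerates the integers so that the unit intervals starting at the first
    [n] pairs fill exactly [[-n, n]]; the passage from series to integrals relies on this. *)
Definition pairsum (a : R -> C) (k : nat) : C := (a (INR k) + a (- INR k - 1)%R)%C.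

Lemma FTpi_const c n : Csn (pairsum (FTpi (fun _ => c))) (S n) = (RtoC (2 * PI) * c)%C.
Proof.
  assert (Z : forall om k, (om = INR (S k) \/ om = - INR (S k)) -> FTpi (fun _ => c) om = RtoC 0).
  { intros om k Hom. unfold FTpi, FT.
    rewrite CI_scal by apply cE_ccont.
    assert (Hn : om <> 0).
    { pose proof (lt_0_INR (S k) ltac:(lia)). destruct Hom; lra. }
    assert (D := CI_FTC (fun t => (/ (Ci * - RtoC om) * cE (- RtoC om) t)%C) (cE (- RtoC om)) (- PI) PI).
    rewrite D; [|eapply cder_ext; [| |apply cder_scal, cE_der]|apply cE_ccont].
    2: reflexivity.
    2:{ intros x; simpl. field. split; [intros E; apply Hn; apply (f_equal fst) in E; exact E|].
        intros E; apply (f_equal snd) in E; simpl in E; lra. }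
    replace (cE (- RtoC om) PI) with (cE (- RtoC om) (- PI)); [ring|].
    assert (Hs : sin (om * PI) = 0).
    { destruct Hom as [->| ->]; [apply sin_INR_PI|].
      rewrite Ropp_mult_distr_l_reverse, sin_neg, sin_INR_PI; ring. }
    apply C_eq; simpl; rewrite !Ropp_0, !Rmult_0_l, !Ropp_0, !exp_0, !Rmult_1_l.
    - replace (- om * - PI) with (om * PI) by ring. replace (- om * PI) with (- (om * PI)) by ring.
      now rewrite cos_neg.
    - replace (- om * - PI) with (om * PI) by ring. replace (- om * PI) with (- (om * PI)) by ring.
      rewrite sin_neg, Hs. ring. }
  induction n.
  - simpl Csn. unfold pairsum. rewrite (Z (- INR 0 - 1) O) by (right; simpl; ring).
    unfold FTpi, FT. rewrite CI_scal by apply cE_ccont.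
    rewrite (CI_ext _ (fun _ => RtoC 1)).
    + rewrite CI_const. replace (PI - - PI) with (2 * PI) by ring. ring.
    + intros t. replace (- RtoC (INR 0))%C with (RtoC 0) by cring. apply cE_z0.
  - change (Csn (pairsum (FTpi (fun _ => c))) (S (S n))) with
     (Csn (pairsum (FTpi (fun _ => c))) (S n) + pairsum (FTpi (fun _ => c)) (S n))%C.
    rewrite IHn. unfold pairsum. rewrite (Z (INR (S n)) n), (Z (- INR (S n) - 1) (S n)).
    + ring.
    + right. rewrite (S_INR (S n)). ring.
    + now left.
Qed.

(* Chernoff's proof of pointwise convergence: psi - psi(0) = (e^{it} - 1) g makes the series telescope. *)
Lemma fourier_series_at_0 Psi : jet Psi ->
  clim (Csn (pairsum (FTpi (Psi O)))) (RtoC (2 * PI) * Psi O 0)%C.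
Proof.
  intros J. pose proof PI_RGT_0 as HPI.
  set (e1 := fun t => hadamard (Ejet (RtoC 1) 1%nat) (clampPI t)).
  assert (He1 : forall t, - PI <= t <= PI -> (RtoC t * e1 t)%C = (cE (RtoC 1) t - 1)%C).
  { intros t Ht. unfold e1. rewrite clampPI_id by auto.
    rewrite (hadamard_eq (Ejet (RtoC 1)) t (jet_E _)). now rewrite Ejet_0, cE_x0. }
  (* The quotient [(e^(it) - 1) / t] has no zero on the clamped range: at 0 its value is [i], and
     elsewhere in [[-PI, PI]] the exponential differs from 1. *)
  assert (Hnz : forall t, e1 t <> RtoC 0).
  { intros t E. set (c := clampPI t) in *. assert (Hc := clampPI_range t). fold c in Hc.
    assert (Ec : e1 t = e1 c) by (unfold e1; now rewrite (clampPI_id c Hc)).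
    rewrite Ec in E. destruct (Req_dec c 0) as [E0|E0].
    - unfold e1 in E. rewrite (clampPI_id c Hc), E0 in E. unfold hadamard in E.
      rewrite (CI_ext _ (fun _ => Ci)) in E.
      + rewrite CI_const in E. apply (f_equal snd) in E. simpl in E. lra.
      + intros s. unfold Ejet. rewrite Rmult_0_r, cE_x0. simpl. ring.
    - apply (cE_neq_1 c Hc E0). 
      assert (X := He1 c Hc). rewrite E in X. replace (cE (RtoC 1) c) with ((cE (RtoC 1) c - 1) + 1)%C by ring.
      rewrite <- X. ring. }
  set (g := fun t => (hadamard (Psi 1%nat) t * / e1 t)%C).
  assert (Hg : ccont g).
  { apply ccont_mult; [now apply ccont_hadamard|]. apply ccont_inv; auto. unfold e1.
    apply (ccont_comp (hadamard (Ejet (RtoC 1) 1%nat)) clampPI); [apply ccont_hadamard, jet_E|apply clampPI_cont]. }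
  assert (Eg : forall t, - PI <= t <= PI -> (Psi O t - Psi O 0)%C = ((cE (RtoC 1) t - 1) * g t)%C).
  { intros t Ht. rewrite <- (He1 t Ht), <- (hadamard_eq Psi t J). unfold g. field. apply Hnz. }
  set (b := FTpi g).
  assert (Eb : forall om, FTpi (Psi O) om = (FTpi (fun _ => Psi O 0) om + (b (om - 1)%R - b om))%C).
  { intros om. unfold b, FTpi, FT.
    assert (Hm : forall f z, ccont f -> ccont (fun t => (f t * cE z t)%C)) by (intros; apply ccont_mult; auto using cE_ccont).
    rewrite <- (CI_minus _ _ _ _ (Hm _ _ Hg) (Hm _ _ Hg)).
    rewrite <- (CI_plus _ _ _ _ (Hm _ _ (ccont_const _)) (ccont_minus _ _ (Hm _ _ Hg) (Hm _ _ Hg))).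
    apply CI_ext_in; [lra|]. intros t Ht.
    replace (Psi O t) with ((Psi O t - Psi O 0) + Psi O 0)%C by ring. rewrite Eg by lra.
    replace (- RtoC (om - 1))%C with (RtoC 1 + - RtoC om)%C by cring. rewrite cE_plus_z. ring. }
  assert (Es : forall n, Csn (pairsum (FTpi (Psi O))) (S n) =
     (RtoC (2 * PI) * Psi O 0 + (b (- INR n - 2)%R - b (INR n)))%C).
  { intros n. rewrite <- (FTpi_const (Psi O 0) n). induction n.
    - simpl Csn. unfold pairsum. rewrite !Eb. simpl INR.
      replace (- 0 - 1 - 1) with (- 0 - 2) by ring. replace (0 - 1) with (- 0 - 1) by ring. ring.
    - change (Csn (pairsum (FTpi (Psi O))) (S (S n))) with (Csn (pairsum (FTpi (Psi O))) (S n) + pairsum (FTpi (Psi O)) (S n))%C.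
      change (Csn (pairsum (FTpi (fun _ => Psi O 0))) (S (S n))) with
        (Csn (pairsum (FTpi (fun _ => Psi O 0))) (S n) + pairsum (FTpi (fun _ => Psi O 0)) (S n))%C.
      rewrite IHn. unfold pairsum. rewrite !Eb.
      replace (INR (S n) - 1) with (INR n) by (rewrite S_INR; ring).
      replace (- INR (S n) - 1 - 1) with (- INR (S n) - 2) by ring.
      replace (- INR (S n) - 1) with (- INR n - 2) by (rewrite S_INR; ring). ring. }
  apply is_lim_seq_spec. intros eps.
  destruct (riemann_lebesgue g (- PI) PI (eps / 4)) as [Om [HOm HR]]; auto; [lra|pose proof (cond_pos eps); lra|].
  destruct (nfloor_ex Om) as [N [HN1 HN2]]; [lra|].
  exists (S (S N)). intros n Hn. destruct n as [|n]; [lia|].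
  rewrite Rminus_0_r, Rabs_pos_eq by apply Cmod_ge_0. rewrite Es.
  replace (RtoC (2 * PI) * Psi O 0 + (b (- INR n - 2)%R - b (INR n)) - RtoC (2 * PI) * Psi O 0)%C with
    (b (- INR n - 2)%R - b (INR n))%C by ring.
  assert (HnN : Om <= INR n).
  { assert (INR (S N) <= INR n) by (apply le_INR; lia). rewrite S_INR in H. lra. }
  assert (Hb : forall om, Om <= Rabs om -> Cmod (b om) <= eps / 4).
  { intros om Hom. unfold b, FTpi, FT.
    rewrite (CI_ext _ (fun t => (g t * cE (RtoC (- om)) t)%C)).
    - apply HR. now rewrite Rabs_Ropp.
    - intros t. do 2 f_equal. cring. }
  pose proof (pos_INR n).
  assert (B1 := Hb (- INR n - 2)). assert (B2 := Hb (INR n)).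
  rewrite (Rabs_pos_eq (INR n)) in B2 by auto.
  replace (- INR n - 2) with (- (INR n + 2)) in B1 at 1 by ring. rewrite Rabs_Ropp, Rabs_pos_eq in B1 by lra.
  specialize (B1 ltac:(lra)). specialize (B2 ltac:(lra)).
  unfold Cminus. pose proof (Cmod_triangle (b (- INR n - 2)) (- b (INR n))). rewrite Cmod_opp in H0.
  pose proof (cond_pos eps). lra.
Qed.

Lemma ex_series_inv_sq : ex_series (fun n => / (INR n + 1) ^ 2).
Proof.
  apply (ex_series_le (K:=R_AbsRing) (V:=R_CompleteNormedModule) _ (fun n => 2 * (/ (INR n + 1) - / (INR (S n) + 1)))).
  - intros n. change (norm (/ (INR n + 1) ^ 2)) with (Rabs (/ (INR n + 1) ^ 2)).
    pose proof (pos_INR n). rewrite S_INR.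
    rewrite Rabs_pos_eq by (left; apply Rinv_0_lt_compat, pow_lt; lra).
    apply Rmult_le_reg_r with ((INR n + 1) ^ 2 * (INR n + 2)); [apply Rmult_lt_0_compat; [apply pow_lt|]; lra|].
    replace (/ (INR n + 1) ^ 2 * ((INR n + 1) ^ 2 * (INR n + 2))) with (INR n + 2) by (field; lra).
    replace (2 * (/ (INR n + 1) - / (INR n + 1 + 1)) * ((INR n + 1) ^ 2 * (INR n + 2))) with (2 * (INR n + 1)) by (field; lra).
    lra.
  - apply ex_series_scal_R. exists 1.
    change (is_lim_seq (sum_n (fun n => / (INR n + 1) - / (INR (S n) + 1))) 1).
    apply is_lim_seq_ext with (fun n => 1 - / (INR (S n) + 1)).
    + intros n; induction n.
      * rewrite sum_O. simpl. field.
      * rewrite sum_Sn, <- IHn. change plus with Rplus. simpl. ring.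
    + replace (Finite 1) with (Finite (1 - 0)) by (f_equal; ring).
      apply is_lim_seq_minus'; [apply is_lim_seq_const|].
      replace (Finite 0) with (Rbar_inv p_infty) by reflexivity.
      apply is_lim_seq_inv; [|easy].
      apply is_lim_seq_ext with (fun n => INR (S (S n))); [intros; now rewrite (S_INR (S n))|].
      apply (is_lim_seq_incr_1 (fun n => INR (S n))). apply (is_lim_seq_incr_1 INR). apply is_lim_seq_INR.
Qed.

Lemma CI_zero_on f a b : a <= b -> (forall t, a < t < b -> f t = RtoC 0) -> CI f a b = RtoC 0.
Proof.
  intros Hab H. rewrite (CI_ext_in f (fun _ => RtoC 0)) by auto. rewrite CI_const. ring.
Qed.

Lemma CI_support f a b a' b' : ccont f -> a' <= a -> a <= b -> b <= b' ->
  (forall t, t <= a \/ b <= t -> f t = RtoC 0) -> CI f a' b' = CI f a b.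
Proof.
  intros Hf H1 H2 H3 H.
  rewrite <- (CI_Chasles f a' a b'), <- (CI_Chasles f a b b') by auto.
  rewrite (CI_zero_on f a' a), (CI_zero_on f b b'); auto; [ring| |]; intros; apply H; lra.
Qed.

Section Inversion.
Variables (a b : R) (G : nat -> R -> C).
Hypotheses (Hab : a <= b) (J : jet G) (V : vanish_out a b G).

Lemma FT_real_bound : exists B, 0 <= B /\ forall xi, Cmod (FT a b (G O) (RtoC xi)) <= B / (1 + xi ^ 2).
Proof.
  destruct (ccont_bounded (G O) a b (jet_ccont G O J)) as [A0 [HA0 H0]].
  destruct (ccont_bounded (G 2%nat) a b (jet_ccont G 2%nat J)) as [A2 [HA2 H2]].
  exists (A0 * 1 * (b - a) + A2 * 1 * (b - a)). split; [nra|].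
  intros xi.
  assert (E : forall t, a <= t <= b -> Cmod (cE (- RtoC xi) t) <= 1).
  { intros t _. replace (- RtoC xi)%C with (RtoC (- xi)) by cring. rewrite cE_real_mod; lra. }
  assert (B0 := FT_bound a b G (RtoC xi) 0 A0 1 Hab J V H0 E).
  assert (B2 := FT_bound a b G (RtoC xi) 2 A2 1 Hab J V H2 E).
  rewrite Cmod_R in *. rewrite pow2_abs in B2. simpl pow in B0.
  assert (0 < 1 + xi ^ 2) by nra.
  apply Rmult_le_reg_r with (1 + xi ^ 2); auto.
  replace ((A0 * 1 * (b - a) + A2 * 1 * (b - a)) / (1 + xi ^ 2) * (1 + xi ^ 2)) with
   (A0 * 1 * (b - a) + A2 * 1 * (b - a)) by (field; lra). lra.
Qed.

Definition Fx (x xi : R) : C := (cE (RtoC xi) x * FT a b (G O) (RtoC xi))%C.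

Lemma ccont_Fx x : ccont (Fx x).
Proof. apply ccont_mult; [apply ccont_cE_real|apply ccont_FT; auto; now apply jet_ccont]. Qed.

Lemma Cmod_Fx x xi : Cmod (Fx x xi) = Cmod (FT a b (G O) (RtoC xi)).
Proof. unfold Fx. rewrite Cmod_mult, cE_real_mod. ring. Qed.

(** The expansion at 0 is applied to [y -> G (T y + x) e^(-i th y)]. The hypotheses on [T] place the
    support of [G] in one period around [x]; the twist [th] moves the sampling points. *)
Lemma fourier_series_shifted x T th : 0 < T -> x - PI * T <= a -> b <= x + PI * T ->
  clim (Csn (pairsum (fun om => Fx x ((th + om) / T)))) (RtoC (T * (2 * PI)) * G O x)%C.
Proof.
  intros HT Ha Hb.
  assert (J1 := jet_pseq _ _ (jet_affine G T x J) (jet_E (RtoC (- th)))).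
  assert (H := clim_scal (RtoC T) _ _ (fourier_series_at_0 _ J1)). simpl in H.
  rewrite Ejet_0, cE_x0 in H.
  replace (RtoC (T * (2 * PI)) * G O x)%C with (RtoC T * (RtoC (2 * PI) * (RtoC 1 * G O (T * 0 + x)%R * RtoC 1)))%C.
  2:{ replace (T * 0 + x) with x by ring. cring. }
  eapply is_lim_seq_ext; [|exact H]. intros n; simpl. do 2 f_equal.
  rewrite <- Csn_scal. apply Csn_ext. intros k. unfold pairsum.
  assert (E : forall om, (RtoC T * FTpi (fun t => (RtoC 1 * G O (T * t + x)%R * cE (RtoC (- th)) t)%C) om)%C = Fx x ((th + om) / T)).
  { intros om. unfold FTpi, FT.
    set (xi := (th + om) / T).
    set (f := fun y => (G O y * cE (- RtoC xi) (y + - x)%R)%C).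
    assert (Hf : ccont f).
    { apply ccont_mult; [now apply jet_ccont|]. apply (ccont_comp (cE (- RtoC xi)) (fun y => y + - x)); [apply cE_ccont|].
      intros y. apply (ex_derive_continuous (V:=R_NormedModule)). auto_derive; easy. }
    rewrite (CI_ext _ (fun t => f (T * t + x))).
    - rewrite CI_affine by auto.
      rewrite (CI_support f a b); auto; try lra.
      + unfold Fx, FT. rewrite <- CI_scal by (apply ccont_mult; [now apply jet_ccont|apply cE_ccont]).
        apply CI_ext. intros t. unfold f. rewrite cE_plus_x.
        replace (cE (- RtoC xi) (- x)) with (cE (RtoC xi) x); [ring|].
        rewrite cE_opp. f_equal. ring.
      + intros t Ht. unfold f. rewrite (V O t Ht). ring.
    - intros t. unfold f. replace (T * t + x + - x) with (T * t) by ring.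
      assert (Ee : (cE (RtoC (- th)) t * cE (- RtoC om) t)%C = cE (- RtoC xi) (T * t)).
      { rewrite <- cE_plus_z, <- cE_scal. f_equal. unfold xi. apply C_eq; simpl; field; lra. }
      rewrite <- Ee. ring. }
  rewrite <- !E. ring.
Qed.

(** Fourier inversion by averaging: the sampling formula holds for every twist [th], and integrating
    it over [th] in [[0, 1]] turns sums of samples into the integral over [[-N/T, N/T]]. The tail of
    the series bounds the error uniformly in [th]. *)
Lemma fourier_partial_error x T : 0 < T -> x - PI * T <= a -> b <= x + PI * T ->
  exists e, is_lim_seq e 0 /\ forall N, 
    Cmod (CI (Fx x) (- (INR N / T)) (INR N / T) - RtoC (2 * PI) * G O x) <= e N.
Proof.
  intros HT Ha Hb. destruct FT_real_bound as [B [HB0 HB]].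
  set (c := fun k => (4 * B * (T ^ 2 + 1)) * / (INR k + 1) ^ 2).
  assert (Hc : ex_series c) by (apply ex_series_scal_R, ex_series_inv_sq).
  assert (Hterm : forall th k, 0 <= th <= 1 -> Cmod (pairsum (fun om => Fx x ((th + om) / T)) k) <= c k).
  { intros th k Hth. unfold pairsum. eapply Rle_trans; [apply Cmod_triangle|]. rewrite !Cmod_Fx.
    assert (Q : forall xi, INR k / T <= Rabs xi -> Cmod (FT a b (G O) (RtoC xi)) <= c k / 2).
    { intros xi Hxi. eapply Rle_trans; [apply HB|]. unfold c. pose proof (pos_INR k).
      assert (Hsq : (INR k / T) ^ 2 <= xi ^ 2).
      { rewrite <- (pow2_abs xi). apply pow_incr. split; [|exact Hxi]. apply Rmult_le_pos; auto. left; now apply Rinv_0_lt_compat. }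
      assert (HTk : (INR k / T) ^ 2 * T ^ 2 = INR k ^ 2) by (field; lra).
      assert (Hp : 0 < 1 + xi ^ 2) by nra. assert (Hp2 : 0 < (INR k + 1) ^ 2) by (apply pow_lt; lra).
      assert (HT2 : 0 < T ^ 2) by (apply pow_lt; lra).
      assert (Hk : (INR k + 1) ^ 2 <= 2 * (T ^ 2 + 1) * (1 + xi ^ 2)).
      { assert (K1 : (INR k + 1) ^ 2 <= 2 * (INR k ^ 2 + 1)) by (pose proof (pow2_ge_0 (INR k - 1)); lra).
        assert (K2 : INR k ^ 2 <= xi ^ 2 * T ^ 2) by (rewrite <- HTk; apply Rmult_le_compat_r; lra).
        pose proof (pow2_ge_0 xi). lra. }
      apply Rmult_le_reg_r with ((1 + xi ^ 2) * (INR k + 1) ^ 2); [now apply Rmult_lt_0_compat|].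
      replace (B / (1 + xi ^ 2) * ((1 + xi ^ 2) * (INR k + 1) ^ 2)) with (B * (INR k + 1) ^ 2) by (field; lra).
      replace (4 * B * (T ^ 2 + 1) * / (INR k + 1) ^ 2 / 2 * ((1 + xi ^ 2) * (INR k + 1) ^ 2)) with
        (B * (2 * (T ^ 2 + 1) * (1 + xi ^ 2))) by (field; lra).
      now apply Rmult_le_compat_l. }
    pose proof (pos_INR k). pose proof (Rinv_0_lt_compat T HT).
    assert (Q1 := Q ((th + INR k) / T)). assert (Q2 := Q ((th + (- INR k - 1)) / T)).
    assert (Cmod (FT a b (G O) (RtoC ((th + INR k) / T))) <= c k / 2).
    { apply Q1. rewrite Rabs_pos_eq; unfold Rdiv; [|apply Rmult_le_pos; lra].
      apply Rmult_le_compat_r; lra. }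
    assert (Cmod (FT a b (G O) (RtoC ((th + (- INR k - 1)) / T))) <= c k / 2).
    { apply Q2. rewrite <- Rabs_Ropp. unfold Rdiv. rewrite Ropp_mult_distr_l.
      rewrite Rabs_pos_eq; [|apply Rmult_le_pos; lra]. apply Rmult_le_compat_r; lra. }
    lra. }
  set (S := fun N th => Csn (pairsum (fun om => Fx x ((th + om) / T))) N).
  assert (HS : forall N, ccont (S N) /\ CI (S N) 0 1 = (RtoC T * CI (Fx x) (- (INR N / T)) (INR N / T))%C).
  { assert (Hcc : forall om, ccont (fun th => Fx x ((th + om) / T))).
    { intros om. apply (ccont_comp (Fx x) (fun th => (th + om) / T)); [apply ccont_Fx|].
      intros y. apply (ex_derive_continuous (V:=R_NormedModule)). auto_derive; auto. }
    assert (HI : forall om, CI (fun th => Fx x ((th + om) / T)) 0 1 = (RtoC T * CI (Fx x) (om / T) ((om + 1) / T))%C).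
    { intros om. assert (E := CI_affine (Fx x) (1 / T) (om / T) 0 1 (ccont_Fx x)).
      replace (1 / T * 0 + om / T) with (om / T) in E by ring.
      replace (1 / T * 1 + om / T) with ((om + 1) / T) in E by (field; lra).
      rewrite <- E. rewrite Cmult_assoc, <- RtoC_mult. replace (T * (1 / T)) with 1 by (field; lra).
      rewrite Cmult_1_l. apply CI_ext. intros t. f_equal. field. lra. }
    intros N; induction N.
    - split; [apply ccont_const|]. unfold S; simpl. replace (0 / T) with 0 by (field; lra).
      rewrite Ropp_0, CI_point, CI_const. ring.
    - destruct IHN as [C1 C2]. split.
      + apply ccont_plus; auto. apply ccont_plus; apply Hcc.
      + change (S (Datatypes.S N)) with (fun th => (S N th + pairsum (fun om => Fx x ((th + om) / T)) N)%C).
        rewrite CI_plus; [|auto|apply ccont_plus; apply Hcc]. rewrite C2. unfold pairsum.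
        rewrite CI_plus by apply Hcc. rewrite !HI.
        replace ((- INR N - 1 + 1) / T) with (- (INR N / T)) by (field; lra).
        replace ((- INR N - 1) / T) with (- (INR (Datatypes.S N) / T)) by (rewrite S_INR; field; lra).
        rewrite <- S_INR.
        rewrite <- (CI_Chasles (Fx x) (- (INR (Datatypes.S N) / T)) (- (INR N / T)) (INR (Datatypes.S N) / T)) by apply ccont_Fx.
        rewrite <- (CI_Chasles (Fx x) (- (INR N / T)) (INR N / T) (INR (Datatypes.S N) / T)) by apply ccont_Fx.
        ring. }
  exists (fun N => / T * Series (fun k => c (N + k)%nat)). split.
  - replace (Finite 0) with (Rbar_mult (/ T) 0) by (simpl; f_equal; ring).
    apply is_lim_seq_scal_l. now apply Series_tail_lim.
  - intros N. destruct (HS N) as [C1 C2].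
    assert (Hpt : forall th, 0 <= th <= 1 -> Cmod (RtoC (T * (2 * PI)) * G O x - S N th) <= Series (fun k => c (N + k)%nat)).
    { intros th Hth. rewrite <- (clim_Csum_unique _ _ (fourier_series_shifted x T th HT Ha Hb)).
      apply Csum_tail; auto. }
    assert (Hi : Cmod (CI (fun th => (RtoC (T * (2 * PI)) * G O x - S N th)%C) 0 1) <= Series (fun k => c (N + k)%nat) * (1 - 0)).
    { apply CI_bound; [lra| |exact Hpt]. apply ccont_minus; [apply ccont_const|auto]. }
    rewrite CI_minus, CI_const, C2 in Hi; [|apply ccont_const|auto].
    replace (RtoC (1 - 0) * (RtoC (T * (2 * PI)) * G O x) - RtoC T * CI (Fx x) (- (INR N / T)) (INR N / T))%C with
      (RtoC (- T) * (CI (Fx x) (- (INR N / T)) (INR N / T) - RtoC (2 * PI) * G O x))%C in Hi by cring.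
    rewrite Cmod_mult, Cmod_R, Rabs_Ropp, Rabs_pos_eq in Hi by lra.
    apply Rmult_le_reg_l with T; auto. rewrite <- Rmult_assoc, Rinv_r by lra. lra.
Qed.

Lemma fourier_inversion x eps : 0 < eps -> exists L0, 0 < L0 /\ forall L, L0 <= L ->
  Cmod (CI (Fx x) (- L) L - RtoC (2 * PI) * G O x) <= eps.
Proof.
  intros He. pose proof PI_RGT_0 as HPI.
  set (T := (Rabs (x - a) + Rabs (b - x)) / PI + 1).
  assert (HT : 0 < T).
  { unfold T. assert (0 <= (Rabs (x - a) + Rabs (b - x)) / PI); [|lra].
    apply Rmult_le_pos; [pose proof (Rabs_pos (x - a)); pose proof (Rabs_pos (b - x)); lra|left; now apply Rinv_0_lt_compat]. }
  assert (HTe : PI * T = Rabs (x - a) + Rabs (b - x) + PI) by (unfold T; field; lra).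
  pose proof (Rle_abs (x - a)). pose proof (Rle_abs (b - x)). pose proof (Rabs_pos (x - a)). pose proof (Rabs_pos (b - x)).
  destruct (fourier_partial_error x T HT) as [e [He0 HeN]]; try lra.
  apply is_lim_seq_spec in He0. destruct (He0 (mkposreal (eps / 2) ltac:(lra))) as [N0 HN0]. simpl in HN0.
  destruct FT_real_bound as [B [HB0 HB]].
  destruct (nfloor_ex (4 * B * T / eps)) as [N1 [_ HN1]].
  { apply Rmult_le_pos; [nra|left; now apply Rinv_0_lt_compat]. }
  set (N2 := (N0 + N1 + 2)%nat).
  exists (INR N2 / T). split; [apply Rdiv_lt_0_compat; auto; apply lt_0_INR; unfold N2; lia|].
  intros L HL.
  assert (HLT : INR N2 <= L * T).
  { apply Rmult_le_compat_r with (r := T) in HL; [|lra]. replace (INR N2 / T * T) with (INR N2) in HL by (field; lra). exact HL. }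
  destruct (nfloor_ex (L * T)) as [N [HNa HNb]]; [pose proof (pos_INR N2); lra|].
  assert (HNN : (N2 <= N)%nat).
  { destruct (Nat.le_gt_cases N2 N) as [Hc|Hc]; auto. exfalso.
    assert (INR (S N) <= INR N2) by (apply le_INR; lia). rewrite S_INR in H3. lra. }
  assert (Hd1 : INR N / T <= L).
  { apply Rmult_le_reg_r with T; auto. replace (INR N / T * T) with (INR N) by (field; lra). exact HNa. }
  assert (Hd2 : L - INR N / T <= 1 / T).
  { apply Rmult_le_reg_r with T; auto. replace ((L - INR N / T) * T) with (L * T - INR N) by (field; lra).
    replace (1 / T * T) with 1 by (field; lra). lra. }
  assert (HNpos : 0 < INR N / T).
  { apply Rdiv_lt_0_compat; auto. apply lt_0_INR. unfold N2 in HNN; lia. }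
  specialize (HN0 N ltac:(unfold N2 in HNN; lia)). rewrite Rminus_0_r in HN0.
  pose proof (Rle_abs (e N)). specialize (HeN N).
  assert (Hpiece : forall c d, c <= d -> d - c <= 1 / T -> (forall t, c <= t <= d -> INR N / T <= Rabs t) ->
     Cmod (CI (Fx x) c d) <= eps / 4).
  { intros c d Hcd Hlen Habs.
    apply Rle_trans with (B / (INR N / T) ^ 2 * (d - c)).
    - apply CI_bound; auto; [apply ccont_Fx|]. intros t Ht. rewrite Cmod_Fx. eapply Rle_trans; [apply HB|].
      apply Rmult_le_compat_l; auto. apply Rinv_le_contravar; [apply pow_lt; lra|].
      assert ((INR N / T) ^ 2 <= t ^ 2); [|lra]. rewrite <- (pow2_abs t). apply pow_incr. split; [lra|now apply Habs].
    - apply Rle_trans with (B / (INR N / T) ^ 2 * (1 / T)).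
      + apply Rmult_le_compat_l; auto. apply Rmult_le_pos; auto. left; apply Rinv_0_lt_compat, pow_lt; lra.
      + replace (B / (INR N / T) ^ 2 * (1 / T)) with (B * T / INR N ^ 2).
        2:{ field. split; [lra|]. apply Rgt_not_eq, lt_0_INR. unfold N2 in HNN; lia. }
        assert (HN1' : 4 * B * T / eps < INR N).
        { eapply Rlt_le_trans; [apply HN1|]. rewrite <- S_INR. apply le_INR. unfold N2 in HNN; lia. }
        assert (H1N : 1 <= INR N) by (apply (le_INR 1); unfold N2 in HNN; lia).
        apply Rmult_le_reg_r with (INR N ^ 2); [apply pow_lt; lra|].
        replace (B * T / INR N ^ 2 * INR N ^ 2) with (B * T) by (field; lra).
        assert (4 * B * T < INR N * eps).
        { apply Rmult_lt_compat_r with (r := eps) in HN1'; auto.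
          replace (4 * B * T / eps * eps) with (4 * B * T) in HN1' by (field; lra). exact HN1'. }
        assert (INR N * eps <= INR N ^ 2 * eps) by (apply Rmult_le_compat_r; nra). nra. }
  rewrite <- (CI_Chasles (Fx x) (- L) (- (INR N / T)) L), <- (CI_Chasles (Fx x) (- (INR N / T)) (INR N / T) L) by apply ccont_Fx.
  assert (P1 : Cmod (CI (Fx x) (- L) (- (INR N / T))) <= eps / 4).
  { apply Hpiece; try lra. intros t Ht. rewrite <- Rabs_Ropp, Rabs_pos_eq; lra. }
  assert (P2 : Cmod (CI (Fx x) (INR N / T) L) <= eps / 4).
  { apply Hpiece; try lra. intros t Ht. rewrite Rabs_pos_eq; lra. }
  replace (CI (Fx x) (- L) (- (INR N / T)) + (CI (Fx x) (- (INR N / T)) (INR N / T) + CI (Fx x) (INR N / T) L) - RtoC (2 * PI) * G O x)%C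
   with ((CI (Fx x) (- L) (- (INR N / T)) + CI (Fx x) (INR N / T) L) + (CI (Fx x) (- (INR N / T)) (INR N / T) - RtoC (2 * PI) * G O x))%C by ring.
  eapply Rle_trans; [apply Cmod_triangle|]. eapply Rle_trans; [apply Rplus_le_compat_r, Cmod_triangle|]. lra.
Qed.

End Inversion.

(** * The two descriptions of the Gevrey classes agree *)

Lemma fourier_compact a b phi xi : a <= b -> ccont phi -> (forall x, x <= a \/ b <= x -> phi x = RtoC 0) ->
  is_RInt_gen (fun x => Cmult (cexpi (- (x * xi))) (phi x)) (Rbar_locally m_infty) (Rbar_locally p_infty)
    (FT a b phi (RtoC xi)).
Proof.
  intros Hab Hc H P HP.
  assert (HPl : P (FT a b phi (RtoC xi))) by now apply locally_singleton.
  apply (Filter_prod _ _ _ (fun u => u < a) (fun w => b < w)).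
  - exists a; auto.
  - exists b; auto.
  - intros u w Hu Hw. exists (FT a b phi (RtoC xi)). split; auto. simpl fst; simpl snd.
    set (f := fun x => (phi x * cE (- RtoC xi) x)%C).
    assert (Hf : ccont f) by (apply ccont_mult; auto using cE_ccont).
    apply is_RInt_ext with f.
    + intros x _. unfold f. rewrite cexpi_cE. replace (- RtoC xi)%C with (RtoC (- xi)) by cring. apply Cmult_comm.
    + replace (FT a b phi (RtoC xi)) with (CI f u w).
      * apply (is_RInt_fct_extend_pair (U:=R_NormedModule) (V:=R_NormedModule));
        apply (RInt_correct (V:=R_CompleteNormedModule)); [now apply ex_RInt_fst|now apply ex_RInt_snd].
      * apply CI_support; auto; try lra. intros t Ht. unfold f. rewrite H by auto. ring.
Qed.

Lemma is_fourier_compact a b phi g : a <= b -> ccont phi -> (forall x, x <= a \/ b <= x -> phi x = RtoC 0) ->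
  is_fourier phi g -> forall xi, g xi = FT a b phi (RtoC xi).
Proof.
  intros Hab Hc H Hg xi. assert (H1 := Hg xi). assert (H2 := fourier_compact a b phi xi Hab Hc H).
  unfold is_RInt_gen in H1, H2.
  refine (filterlimi_locally_unique (F := filter_prod (Rbar_locally m_infty) (Rbar_locally p_infty)) _ _ _ _ H1 H2).
  apply filter_forall. intros ab y1 y2 Y1 Y2. apply C_eq.
  - apply (is_RInt_fct_extend_fst (U:=R_NormedModule) (V:=R_NormedModule)) in Y1, Y2. apply (is_RInt_unique (V:=R_CompleteNormedModule)) in Y1, Y2. exact (eq_trans (eq_sym Y1) Y2).
  - apply (is_RInt_fct_extend_snd (U:=R_NormedModule) (V:=R_NormedModule)) in Y1, Y2. apply (is_RInt_unique (V:=R_CompleteNormedModule)) in Y1, Y2. exact (eq_trans (eq_sym Y1) Y2).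
Qed.

Lemma RInt_mono_interval F a b c d : (forall x, continuous F x) -> (forall x, 0 <= F x) ->
  a <= c -> c <= d -> d <= b -> RInt F c d <= RInt F a b.
Proof.
  intros Hc Hp H1 H2 H3.
  rewrite <- (RInt_Chasles (V:=R_CompleteNormedModule) F a c b), <- (RInt_Chasles (V:=R_CompleteNormedModule) F c d b)
    by now apply ex_RInt_cont.
  change plus with Rplus.
  assert (0 <= RInt F a c) by (apply RInt_ge_0; auto; now apply ex_RInt_cont).
  assert (0 <= RInt F d b) by (apply RInt_ge_0; auto; now apply ex_RInt_cont).
  lra.
Qed.

Lemma ex_RInt_gen_bounded F : (forall x, continuous F x) -> (forall x, 0 <= F x) ->
  ex_RInt_gen F (Rbar_locally m_infty) (Rbar_locally p_infty) ->
  exists I, forall L, 0 <= L -> RInt F (- L) L <= I.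
Proof.
  intros Hc Hp [l Hl]. exists (l + 1). intros L HL.
  destruct (Hl (ball l 1) (locally_ball l (mkposreal 1 Rlt_0_1))) as [Q P [M1 H1] [M2 H2] HQP].
  set (u := Rmin (M1 - 1) (- L)). set (w := Rmax (M2 + 1) L).
  destruct (HQP u w) as [y [Hy Hb]].
  - apply H1. unfold u. pose proof (Rmin_l (M1 - 1) (- L)). lra.
  - apply H2. unfold w. pose proof (Rmax_l (M2 + 1) L). lra.
  - simpl in Hy. apply (is_RInt_unique (V:=R_CompleteNormedModule)) in Hy.
    assert (RInt F (- L) L <= RInt F u w).
    { apply RInt_mono_interval; auto; try lra; [apply Rmin_r|apply Rmax_r]. }
    rewrite Hy in H. unfold ball in Hb; simpl in Hb. unfold AbsRing_ball, abs, minus, plus, opp in Hb; simpl in Hb.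
    apply Rabs_def2 in Hb. lra.
Qed.

(** For a nonnegative integrand the improper integral is the supremum of the integrals over
    [[-L, L]], which [C0 * atan] keeps finite. *)
Lemma ex_RInt_gen_of_bound F C0 : (forall x, continuous F x) -> (forall x, 0 <= F x) ->
  (forall x, F x <= C0 / (1 + x ^ 2)) -> ex_RInt_gen F (Rbar_locally m_infty) (Rbar_locally p_infty).
Proof.
  intros Hc Hp Hb.
  assert (HC : 0 <= C0).
  { pose proof (Hp 0). pose proof (Hb 0). replace (C0 / (1 + 0 ^ 2)) with C0 in H0 by field. lra. }
  assert (Hat : forall a b, a <= b -> RInt F a b <= C0 * PI).
  { intros a b Hab.
    assert (D : forall x, is_derive (fun t => C0 * atan t) x (C0 / (1 + x ^ 2))).
    { intros x. auto_derive; [easy|]. unfold Rsqr. field. nra. }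
    assert (Hcc : forall x, continuous (fun x => C0 / (1 + x ^ 2)) x).
    { intros x. apply (ex_derive_continuous (V:=R_NormedModule)). auto_derive. nra. }
    apply Rle_trans with (RInt (fun x => C0 / (1 + x ^ 2)) a b).
    - apply RInt_le; auto; now apply ex_RInt_cont.
    - rewrite (is_RInt_unique (V:=R_CompleteNormedModule) _ _ _ _ (is_RInt_derive (V:=R_CompleteNormedModule) _ _ a b (fun x _ => D x) (fun x _ => Hcc x))).
      unfold minus, plus, opp; simpl. pose proof (atan_bound a). pose proof (atan_bound b). nra. }
  destruct (completeness (fun y => exists L, 0 <= L /\ y = RInt F (- L) L)) as [l [Hub Hlub]].
  - exists (C0 * PI). intros y [L [HL ->]]. apply Hat. lra.
  - exists (RInt F (- 0) 0), 0. split; [lra|auto].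
  - exists l. intros P [eps HP].
    assert (HL : exists L, 0 <= L /\ l - eps < RInt F (- L) L).
    { destruct (Classical_Prop.classic (exists L, 0 <= L /\ l - eps < RInt F (- L) L)) as [|Hn]; auto. exfalso.
      assert (l <= l - eps); [|pose proof (cond_pos eps); lra].
      apply Hlub. intros y [L [HL ->]]. apply Rnot_lt_le. intros Hlt. apply Hn. eauto. }
    destruct HL as [L [HL0 HL]].
    apply (Filter_prod _ _ _ (fun u => u < - L) (fun w => L < w)).
    + exists (- L); auto.
    + exists L; auto.
    + intros u w Hu Hw. exists (RInt F u w). split.
      * apply (RInt_correct (V:=R_CompleteNormedModule)). now apply ex_RInt_cont.
      * apply HP. unfold ball; simpl. unfold AbsRing_ball, abs, minus, plus, opp; simpl.
        assert (RInt F (- L) L <= RInt F u w) by (apply RInt_mono_interval; auto; lra).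
        assert (RInt F u w <= RInt F (- (Rmax (- u) w)) (Rmax (- u) w)).
        { apply RInt_mono_interval; auto; try lra; [|apply Rmax_r]. pose proof (Rmax_l (- u) w). lra. }
        assert (RInt F (- (Rmax (- u) w)) (Rmax (- u) w) <= l).
        { apply Hub. exists (Rmax (- u) w). split; auto. pose proof (Rmax_r (- u) w). lra. }
        pose proof (cond_pos eps). apply Rabs_def1; lra.
Qed.

Lemma w_pow_cont al x : 0 < al -> continuous (w_pow al) x.
Proof.
  intros Ha. apply continuity_pt_filterlim. destruct (Req_dec x 0) as [->|Hx].
  - intros eps He. exists (Rpower eps (1 / al)). split; [apply exp_pos|].
    intros y [_ Hy]. unfold dist in *; simpl in *; unfold R_dist in *. rewrite Rminus_0_r in Hy.
    rewrite w_pow_0, Rminus_0_r, Rabs_pos_eq by apply w_pow_ge_0.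
    destruct (Req_dec y 0) as [->|Hn]; [rewrite w_pow_0; lra|].
    rewrite <- w_pow_abs, w_pow_pos by now apply Rabs_pos_lt.
    replace eps with (Rpower (Rpower eps (1 / al)) al).
    + apply Rlt_Rpower_l; auto. split; auto. now apply Rabs_pos_lt.
    + rewrite Rpower_mult. replace (1 / al * al) with 1 by (field; lra). now apply Rpower_1.
  - apply continuity_pt_filterlim.
    apply (continuous_ext_loc _ (fun y => exp (al * ln (Rabs y)))).
    + exists (mkposreal (Rabs x) (Rabs_pos_lt x Hx)). intros y Hy.
      unfold ball in Hy; simpl in Hy. unfold AbsRing_ball, abs, minus, plus, opp in Hy; simpl in Hy.
      unfold w_pow. destruct (Req_EM_T y 0) as [->|]; [|reflexivity].
      rewrite Rplus_0_l, Rabs_Ropp in Hy. lra.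
    + apply (continuous_comp (fun y => al * ln (Rabs y)) exp).
      * apply (continuous_mult (K:=R_AbsRing)); [apply continuous_const|].
        apply (continuous_comp Rabs ln); [apply continuous_Rabs|].
        apply (ex_derive_continuous (V:=R_NormedModule)). exists (/ Rabs x). apply is_derive_ln. now apply Rabs_pos_lt.
      * apply (ex_derive_continuous (V:=R_NormedModule)). exists (exp (al * ln (Rabs x))). apply is_derive_exp.
Qed.

Lemma exp_w_cont al lam x : 0 < al -> continuous (fun xi => exp (lam * w_pow al xi)) x.
Proof.
  intros Ha. apply (continuous_comp (fun xi => lam * w_pow al xi) exp).
  - apply (continuous_mult (K:=R_AbsRing)); [apply continuous_const|now apply w_pow_cont].
  - apply (ex_derive_continuous (V:=R_NormedModule)). exists (exp (lam * w_pow al x)). apply is_derive_exp.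
Qed.

Lemma weighted_cont al lam f x : 0 < al -> ccont f -> continuous (fun xi => Cmod (f xi) * exp (lam * w_pow al xi)) x.
Proof.
  intros Ha Hf. apply (continuous_mult (K:=R_AbsRing)); [now apply continuous_Cmod|now apply exp_w_cont].
Qed.

Lemma exp_w_quadratic al : 0 < al -> exists mu Cq, 0 < mu /\ 0 < Cq /\ forall t, 0 <= t ->
  exp (- (mu * w_pow al t)) <= Cq / (1 + t ^ 2).
Proof.
  intros Ha. destruct (exp_gev al 1 Ha ltac:(lra)) as [mu [Hmu H]].
  exists mu, (fa al 0 + fa al 2). split; auto. split; [pose proof (fa_pos al 0); pose proof (fa_pos al 2); lra|].
  intros t Ht. assert (H0 := H t 0%nat Ht). assert (H2 := H t 2%nat Ht).
  simpl pow in H0. rewrite pow1 in H2. assert (0 < 1 + t ^ 2) by nra.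
  apply Rmult_le_reg_r with (1 + t ^ 2); auto.
  replace ((fa al 0 + fa al 2) / (1 + t ^ 2) * (1 + t ^ 2)) with (fa al 0 + fa al 2) by (field; lra). lra.
Qed.

(** The decay is taken at the rate [lam + mu]; the surplus [mu] supplies the integrable factor
    [1 / (1 + xi^2)]. *)
Lemma wnorm_of_gev al lam a b G : 0 < al -> 0 < lam -> a <= b -> jet G -> vanish_out a b G -> gev al G ->
  wnorm_finite (w_pow al) (G O) lam.
Proof.
  intros Ha Hl Hab J V HG. assert (Hc := jet_ccont G O J).
  exists (fun xi => FT a b (G O) (RtoC xi)). split.
  - intros xi. apply fourier_compact; auto.
  - destruct (exp_w_quadratic al Ha) as [mu [Cq [Hmu [HCq Hq]]]].
    destruct (FT_decay al (lam + mu) a b G Ha ltac:(lra) Hab J V HG) as [C0 [HC H]].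
    apply (ex_RInt_gen_of_bound _ (C0 * Cq)).
    + intros x. apply weighted_cont; auto. now apply ccont_FT.
    + intros x. apply Rmult_le_pos; [apply Cmod_ge_0|left; apply exp_pos].
    + intros x.
      assert (E : Cmod (FT a b (G O) (RtoC x)) <= C0 * exp (- ((lam + mu) * w_pow al x)) * 1).
      { rewrite <- (w_pow_abs al x), <- Cmod_R. apply H. intros t _.
        replace (- RtoC x)%C with (RtoC (- x)) by cring. rewrite cE_real_mod. lra. }
      rewrite Rmult_1_r in E.
      apply Rle_trans with (C0 * exp (- ((lam + mu) * w_pow al x)) * exp (lam * w_pow al x)).
      * apply Rmult_le_compat_r; auto. left; apply exp_pos.
      * rewrite Rmult_assoc, <- exp_plus.
        replace (- ((lam + mu) * w_pow al x) + lam * w_pow al x) with (- (mu * w_pow al (Rabs x))) by (rewrite w_pow_abs; ring).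
        unfold Rdiv. rewrite Rmult_assoc. apply Rmult_le_compat_l; auto.
        rewrite <- (pow2_abs x). apply Hq, Rabs_pos.
Qed.

Lemma vanish_shift a b G k : vanish_out a b G -> vanish_out a b (fun n => G (k + n)%nat).
Proof. intros V n x Hx. now apply V. Qed.

(** Fourier inversion of the derivative of order [k], with [|xi|^k] replaced under the integral by
    [eps^k (k!)^(1/al) e^(mu |xi|^al)]; the constant is the weighted norm with parameter [mu]. *)
Lemma gev_of_wnorm al a b G : 0 < al -> a <= b -> jet G -> vanish_out a b G ->
  (forall lam, 0 < lam -> wnorm_finite (w_pow al) (G O) lam) -> gev al G.
Proof.
  intros Ha Hab J V H M eps He. assert (Hc := jet_ccont G O J).
  destruct (exp_gev al eps Ha He) as [mu [Hmu Hg]].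
  destruct (H mu Hmu) as [g [Fg Ig]].
  assert (Eg := is_fourier_compact a b (G O) g Hab Hc (V O) Fg).
  apply functional_extensionality in Eg. subst g.
  destruct (ex_RInt_gen_bounded _ (fun x => weighted_cont al mu _ x Ha (ccont_FT a b (G O) Hab Hc))
     (fun x => Rmult_le_pos _ _ (Cmod_ge_0 _) (Rlt_le _ _ (exp_pos _))) Ig) as [I HI].
  pose proof PI_RGT_0.
  assert (HI0 : 0 <= I).
  { specialize (HI 0 ltac:(lra)). rewrite Ropp_0, (RInt_point (V:=R_CompleteNormedModule)) in HI. exact HI. }
  exists (I / (2 * PI)). split; [apply Rmult_le_pos; auto; left; apply Rinv_0_lt_compat; lra|].
  intros k x _.
  assert (Q : forall e, 0 < e -> 2 * PI * Cmod (G k x) <= eps ^ k * fa al k * I + e).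
  { intros e Hep.
    destruct (fourier_inversion a b (fun n => G (k + n)%nat) Hab (jet_shift G k J) (vanish_shift a b G k V) x e Hep) as [L0 [HL0 HL]].
    specialize (HL L0 (Rle_refl _)). rewrite Nat.add_0_r in HL.
    set (F := Fx a b (fun n => G (k + n)%nat) x) in HL.
    assert (HF : ccont F) by (apply ccont_Fx; auto; now apply jet_shift).
    assert (B : Cmod (CI F (- L0) L0) <= eps ^ k * fa al k * I).
    { eapply Rle_trans; [apply CI_Cmod_le; auto; lra|].
      apply Rle_trans with (RInt (fun xi => (eps ^ k * fa al k) * (Cmod (FT a b (G O) (RtoC xi)) * exp (mu * w_pow al xi))) (- L0) L0).
      - apply RInt_le; try lra.
        + apply ex_RInt_cont. now apply continuous_Cmod.
        + apply ex_RInt_cont. intros y. apply (continuous_mult (K:=R_AbsRing)); [apply continuous_const|].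
          apply weighted_cont; auto. now apply ccont_FT.
        + intros xi _. unfold F. rewrite Cmod_Fx, Nat.add_0_r, FT_pow by auto.
          rewrite Cmod_mult, Cmod_pow, Cmod_mult, Cmod_Ci, Rmult_1_l, Cmod_R.
          specialize (Hg (Rabs xi) k (Rabs_pos xi)). rewrite w_pow_abs in Hg.
          set (N := Cmod (FT a b (G O) (RtoC xi))). assert (0 <= N) by apply Cmod_ge_0.
          assert (E1 : Rabs xi ^ k <= eps ^ k * fa al k * exp (mu * w_pow al xi)).
          { rewrite exp_Ropp in Hg. apply Rmult_le_reg_r with (/ exp (mu * w_pow al xi)); [apply Rinv_0_lt_compat, exp_pos|].
            rewrite Rmult_assoc, Rinv_r by (apply Rgt_not_eq, exp_pos). lra. }
          replace (eps ^ k * fa al k * (N * exp (mu * w_pow al xi))) with (eps ^ k * fa al k * exp (mu * w_pow al xi) * N) by ring.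
          now apply Rmult_le_compat_r.
      - rewrite (RInt_scal (V:=R_CompleteNormedModule)).
        + unfold scal; simpl; unfold mult; simpl. apply Rmult_le_compat_l; [|apply HI; lra].
          apply Rmult_le_pos; [apply pow_le; lra|left; apply fa_pos].
        + apply ex_RInt_cont. intros y. apply weighted_cont; auto. now apply ccont_FT. }
    rewrite Cmod_sub_sym in HL.
    pose proof (Cmod_triangle_inv (RtoC (2 * PI) * G k x)%C (CI F (- L0) L0)).
    rewrite Cmod_mult, Cmod_R, Rabs_pos_eq in H1 by lra. lra. }
  assert (Q' : 2 * PI * Cmod (G k x) <= eps ^ k * fa al k * I) by (apply le_epsilon; intros e Hep; now apply Q).
  apply Rmult_le_reg_l with (2 * PI); [lra|].
  replace (2 * PI * (I / (2 * PI) * (eps ^ k * fa al k))) with (eps ^ k * fa al k * I) by (field; lra). exact Q'.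
Qed.

Lemma compact_support_vanish phi : test_fun phi -> exists K, 0 < K /\ vanish_out (- K) K (cderiv_n phi).
Proof.
  intros [Hs [M HM]]. exists (Rabs M + 2). pose proof (Rabs_pos M). pose proof (Rle_abs M).
  split; [lra|]. apply (jet_vanish_out _ (- (Rabs M + 1)) _ (Rabs M + 1)); try lra.
  - now apply smooth_jet.
  - intros x Hx. rewrite cderiv_n_0. apply HM. destruct Hx.
    + rewrite <- Rabs_Ropp. rewrite Rabs_pos_eq; lra.
    + rewrite Rabs_pos_eq; lra.
Qed.

Lemma D_w_gev al psi : 0 < al -> D_w (w_pow al) psi -> gev al (cderiv_n psi).
Proof.
  intros Ha [Ht Hn]. destruct (compact_support_vanish psi Ht) as [K [HK V]].
  apply (gev_of_wnorm al (- K) K (cderiv_n psi) Ha ltac:(lra) (smooth_jet psi (proj1 Ht)) V).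
  intros lam Hl. rewrite cderiv_n_0. auto.
Qed.

Lemma vanish_pseq a b F G : vanish_out a b F -> vanish_out a b (fun n => pseq n F G).
Proof. intros V k x Hx. apply pseq_left_zero. intros i. now apply V. Qed.

Lemma Gev_E_w al f : 0 < al -> Gev al f -> E_w (w_pow al) f.
Proof.
  intros Ha [F [JF [<- HF]]]. split; [now apply jet_smooth|].
  intros psi lam HD Hl. assert (HG := D_w_gev al psi Ha HD).
  destruct HD as [Ht Hn]. destruct (compact_support_vanish psi Ht) as [K [HK V]].
  replace (fun x => (psi x * F O x)%C) with ((fun n => pseq n (cderiv_n psi) F) O)
    by (simpl; now rewrite cderiv_n_0).
  assert (JP := smooth_jet psi (proj1 Ht)).
  apply (wnorm_of_gev al lam (- K) K (fun n => pseq n (cderiv_n psi) F) Ha Hl ltac:(lra)).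
  - now apply jet_pseq.
  - now apply vanish_pseq.
  - now apply gev_pseq.
Qed.

Lemma gev_affine al (T : nat -> R -> C) (s c : R) : Rabs s = 1 ->
  gev al T -> gev al (fun n x => (RtoC (s ^ n) * T n (s * x + c)%R)%C).
Proof.
  intros Hs HT M eps He. destruct (HT (Rabs M + Rabs c) eps He) as [C0 [HC H]].
  exists C0; split; auto. intros k x Hx. rewrite Cmod_mult, Cmod_R, <- RPow_abs, Hs, pow1, Rmult_1_l.
  apply H. eapply Rle_trans; [apply Rabs_triang|]. rewrite Rabs_mult, Hs.
  pose proof (Rle_abs M). lra.
Qed.

Lemma gevrey_cutoff al K : 0 < al -> al < 1 -> 0 <= K -> exists X, jet X /\ gev al X /\
  (forall x, Rabs x <= K -> X O x = RtoC 1) /\ (forall x, K + 1 <= Rabs x -> X O x = RtoC 0) /\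
  (forall x, exists y, 0 <= y <= 1 /\ X O x = RtoC y).
Proof.
  intros H0 H1 HK. destruct (gevrey_step al H0 H1) as [T [JT [GT [T01 [T0 T1]]]]].
  assert (HG : gev al T) by (intros M eps He; destruct (GT eps He) as [C0 [HC H]]; exists C0; auto).
  exists (fun n => pseq n (fun n x => (RtoC (1 ^ n) * T n (1 * x + (K + 1))%R)%C)
                      (fun n x => (RtoC ((-1) ^ n) * T n (-1 * x + (K + 1))%R)%C)).
  split; [apply jet_pseq; now apply jet_affine|].
  split; [apply gev_pseq; auto; apply gev_affine; auto; [apply Rabs_R1|rewrite Rabs_left; lra]|].
  split; [|split]; intros x; [intros Hx|intros Hx|]; simpl.
  - apply Rabs_le_between in Hx. rewrite !T1 by lra. ring.
  - unfold Rabs in Hx. destruct (Rcase_abs x).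
    + rewrite (T0 (1 * x + (K + 1))) by lra. ring.
    + rewrite (T0 (-1 * x + (K + 1))) by lra. ring.
  - destruct (T01 (1 * x + (K + 1))) as [y1 [Hy1 ->]], (T01 (-1 * x + (K + 1))) as [y2 [Hy2 ->]].
    exists (y1 * y2). split; [nra|]. rewrite RtoC_mult. ring.
Qed.

Lemma cutoff_vanish K X : jet X -> (forall x, K + 1 <= Rabs x -> X O x = RtoC 0) -> 0 <= K ->
  vanish_out (- (K + 2)) (K + 2) X.
Proof.
  intros J H HK. apply (jet_vanish_out _ (- (K + 1)) _ (K + 1)); auto; try lra.
  intros x Hx. apply H. destruct Hx; [rewrite <- Rabs_Ropp|]; rewrite Rabs_pos_eq; lra.
Qed.

(** A Gevrey cutoff equal to 1 around [[-M, M]] is an admissible test function, and near [[-M, M]]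
    the localised function has the derivatives of [f]. The bound [al < 1] provides the cutoff. *)
Lemma E_w_Gev al f : 0 < al -> al < 1 -> E_w (w_pow al) f -> Gev al f.
Proof.
  intros H0 H1 [Hs Hf]. exists (cderiv_n f). assert (JD := smooth_jet f Hs).
  split; auto. split; [apply cderiv_n_0|].
  intros M eps He.
  destruct (gevrey_cutoff al (Rabs M + 1) H0 H1) as [X [JX [GX [X1 [X0 _]]]]]; [pose proof (Rabs_pos M); lra|].
  pose proof (Rabs_pos M).
  assert (VX := cutoff_vanish _ X JX X0 ltac:(lra)).
  assert (GP : gev al (fun n => pseq n X (cderiv_n f))).
  { apply (gev_of_wnorm al (- (Rabs M + 1 + 2)) (Rabs M + 1 + 2) (fun n => pseq n X (cderiv_n f)) H0 ltac:(lra)).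
    - now apply jet_pseq.
    - now apply vanish_pseq.
    - intros lam Hl. simpl. rewrite cderiv_n_0. apply Hf; auto.
      split; [split; [now apply jet_smooth|]|].
      + exists (Rabs M + 1 + 1). intros x Hx. apply X0. lra.
      + intros l Hll. apply (wnorm_of_gev al l (- (Rabs M + 1 + 2)) (Rabs M + 1 + 2) X); auto; lra. }
  destruct (GP M eps He) as [C0 [HC H2]]. exists C0; split; auto. intros k x Hx.
  rewrite <- (jet_local (fun n => pseq n X (cderiv_n f)) (cderiv_n f) (- (Rabs M + 1)) (Rabs M + 1) (jet_pseq _ _ JX JD) JD).
  - now apply H2.
  - intros y Hy. simpl. rewrite X1; [ring|]. apply Rabs_le_between; lra.
  - pose proof (Rle_abs M). apply Rabs_le_between in Hx. lra.
Qed.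

Lemma Gev_E_gev al f : 0 < al -> al < 1 -> Gev al f -> E_gev al f.
Proof. intros H0 H1 H. unfold E_gev. destruct (Rlt_dec al 1); [now apply Gev_E_w|lra]. Qed.

Lemma E_gev_Gev al f : 0 < al -> al < 1 -> E_gev al f -> Gev al f.
Proof. intros H0 H1. unfold E_gev. destruct (Rlt_dec al 1); [now apply E_w_Gev|lra]. Qed.

(** * Contour integrals *)

(** For a single exponential the integral along a segment is the increment of [e^(icz) / (ic)], or
    of [z] when [c = 0]: only the endpoints count. *)
Lemma seg_primitive c : exists Pr : C -> C, forall p d,
  (d * CI (fun t => cE (seg p d t) c) 0 1)%C = (Pr (p + d) - Pr p)%C.
Proof.
  destruct (Req_dec c 0) as [->|Hc].
  - exists (fun z => z). intros p d.
    rewrite (CI_ext _ (fun _ => RtoC 1)) by (intros; apply cE_x0). rewrite CI_const.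
    replace (1 - 0) with 1 by ring. ring.
  - exists (fun z => (/ (Ci * RtoC c) * cE z c)%C). intros p d.
    assert (Hz : (Ci * RtoC c)%C <> RtoC 0).
    { intros E. apply (f_equal snd) in E. simpl in E. apply Hc. lra. }
    assert (D := cder_scal (/ (Ci * RtoC c))%C _ _ (cE_seg_der p d c)).
    rewrite <- CI_scal by apply ccont_cE_seg.
    rewrite (CI_ext _ (fun t => (/ (Ci * RtoC c) * (Ci * d * RtoC c * cE (seg p d t) c))%C)).
    + rewrite (CI_FTC _ _ 0 1 D).
      * unfold seg. f_equal; [|f_equal]; do 2 f_equal; ring.
      * apply ccont_mult; [apply ccont_const|]. apply ccont_mult; [apply ccont_const|apply ccont_cE_seg].
    + intros t. field. split; [intros E; apply Hc; apply (f_equal fst) in E; exact E|].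
      intros E; apply (f_equal snd) in E; simpl in E; lra.
Qed.

Section Cauchy.
Variables (a b : R) (g : R -> C) (x : R).
Hypotheses (Hab : a <= b) (Hg : ccont g).

Definition WI (p d : C) : C := (d * CI (fun t => (FT a b g (seg p d t) * cE (seg p d t) x)%C) 0 1)%C.

(** Cauchy's theorem on a triangle for [g^(z) e^(izx)]: the integrand superposes the exponentials
    [e^(iz(x-y))], and each of them has a primitive. *)
Lemma WI_triangle p d d' : (WI p d + WI (p + d) d')%C = WI p (d + d').
Proof.
  set (ga := fun phi : R -> C => CI (fun t => (g t * phi t)%C) a b).
  assert (Hga : cs_dist ga) by now apply int_cs_dist.
  set (S := fun p d => segint (- p)%C (- d)%C (fun t => cE (seg p d t) x) 0 1).
  assert (JS : forall p d, jet (S p d)) by (intros; apply jet_segint, ccont_cE_seg).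
  assert (E : forall p d, WI p d = ga (fun y => (d * S p d O y)%C)).
  { intros p0 d0. rewrite (cs_dist_scal ga Hga) by apply JS. unfold WI. f_equal.
    unfold S. rewrite (cs_dist_segint ga Hga) by apply ccont_cE_seg.
    apply CI_ext. intros t. rewrite seg_opp. rewrite Cmult_comm. reflexivity. }
  rewrite !E.
  rewrite <- (cs_dist_add ga Hga _ _ (jet_scal d _ (JS p d)) (jet_scal d' _ (JS (p + d)%C d'))).
  f_equal. apply functional_extensionality. intros y.
  destruct (seg_primitive (x - y)) as [Pr HPr].
  assert (Q : forall p d, (d * S p d O y)%C = (Pr (p + d) - Pr p)%C).
  { intros p0 d0. rewrite <- HPr. f_equal. unfold S, segint. apply CI_ext. intros t.
    rewrite Ejet_0, seg_opp, cE_opp. unfold Rminus. now rewrite cE_plus_x. }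
  rewrite !Q. replace (p + d + d')%C with (p + (d + d'))%C by ring. ring.
Qed.

End Cauchy.

(** Densities on segments must be continuous on the whole line, but [dsym v] is known not to vanish
    only on the contour, that is for parameters in [[0, 1]]. *)
Definition clamp01 (t : R) : R := Rmax 0 (Rmin 1 t).

Lemma clamp01_cont x : continuous clamp01 x.
Proof.
  apply (lip_cont 1); [lra|]. intros u v. unfold clamp01, Rmax, Rmin.
  repeat destruct (Rle_dec _ _); unfold Rabs; repeat destruct (Rcase_abs _); lra.
Qed.

Lemma clamp01_id t : 0 <= t <= 1 -> clamp01 t = t.
Proof. intros. unfold clamp01, Rmax, Rmin. repeat destruct (Rle_dec _ _); lra. Qed.

Lemma clamp01_range t : 0 <= clamp01 t <= 1.
Proof. unfold clamp01, Rmax, Rmin. repeat destruct (Rle_dec _ _); lra. Qed.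

(* The contour: the real half-lines beyond -R and R, joined through the points -R - iT and R - iT.
   The third piece is run through downwards, hence its sign. *)
Definition ctr_p (R0 T : R) (n : nat) : C :=
  match n with
  | 0%nat => (- R0, 0) | 1%nat => (- R0, - T) | 2%nat => (R0, 0)
  | S (S (S m)) => if Nat.even m then (R0 + INR (Nat.div2 m), 0) else (- R0 - INR (Nat.div2 m) - 1, 0)
  end.
Definition ctr_d (R0 T : R) (n : nat) : C :=
  match n with
  | 0%nat => (0, - T) | 1%nat => (2 * R0, 0) | 2%nat => (0, - T) | _ => (1, 0)
  end.
Definition ctr_e (n : nat) : R := match n with 2%nat => -1 | _ => 1 end.

Lemma ctr_cases R0 T n t : 0 <= t <= 1 -> 
  (n = 0%nat /\ seg (ctr_p R0 T n) (ctr_d R0 T n) t = (- R0, - T * t)) \/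
  (n = 1%nat /\ seg (ctr_p R0 T n) (ctr_d R0 T n) t = (- R0 + 2 * R0 * t, - T)) \/
  (n = 2%nat /\ seg (ctr_p R0 T n) (ctr_d R0 T n) t = (R0, - T * t)) \/
  ((3 <= n)%nat /\ exists m xi, (n <= 2 * m + 4)%nat /\ R0 + INR m <= Rabs xi /\
     seg (ctr_p R0 T n) (ctr_d R0 T n) t = RtoC xi /\ ctr_d R0 T n = RtoC 1).
Proof.
  intros Ht. destruct n as [|[|[|m]]].
  - left. split; auto. unfold seg; apply C_eq; simpl; ring.
  - right; left. split; auto. unfold seg; apply C_eq; simpl; ring.
  - right; right; left. split; auto. unfold seg; apply C_eq; simpl; ring.
  - right; right; right. split; [lia|].
    assert (Hm := Nat.div2_odd m).
    pose proof (pos_INR (Nat.div2 m)).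
    destruct (Nat.even m) eqn:Ev; simpl; rewrite Ev.
    + exists (Nat.div2 m), (R0 + INR (Nat.div2 m) + t). split; [destruct (Nat.odd m); simpl in Hm; lia|].
      split; [eapply Rle_trans; [|apply Rle_abs]; lra|].
      split; [|reflexivity]. unfold seg; apply C_eq; simpl; ring.
    + exists (Nat.div2 m), (- R0 - INR (Nat.div2 m) - 1 + t). split; [destruct (Nat.odd m); simpl in Hm; lia|].
      split; [rewrite <- Rabs_Ropp; eapply Rle_trans; [|apply Rle_abs]; lra|].
      split; [|reflexivity]. unfold seg; apply C_eq; simpl; ring.
Qed.

(** * Surjectivity from lower bounds on the real axis and on boxes *)

Section Surjectivity.
Variables (v : (R -> C) -> C) (r Cr la0 : R).
Hypotheses (Hv : cs_dist v) (r0 : 0 < r) (r1 : r < 1) (HCr : 0 < Cr) (Hla0 : 0 < la0).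
Hypothesis Hreal : forall xi, 1 <= Cr * exp (la0 * w_pow r xi) * Cmod (dsym v (RtoC xi)).
Hypothesis Hbox : forall B, exists R0 T, B <= R0 /\ R0 <= T /\ forall z,
  (Rabs (fst z) = R0 /\ Rabs (snd z) <= T) \/ (Rabs (snd z) = T /\ Rabs (fst z) <= R0) ->
  / 8 <= Cmod (dsym v z).

Section OneContour.
Variables (R0 tau sg : R).
Hypotheses (HR : 1 <= R0) (Htau : R0 <= tau) (Hsg : Rabs sg = 1).
Hypothesis HB : forall z,
  (Rabs (fst z) = R0 /\ Rabs (snd z) <= tau) \/ (Rabs (snd z) = tau /\ Rabs (fst z) <= R0) ->
  / 8 <= Cmod (dsym v z).

Let T := sg * tau.
Let zt n t := seg (ctr_p R0 T n) (ctr_d R0 T n) t.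

Lemma abs_T t : 0 <= t -> Rabs (- T * t) = tau * t.
Proof.
  intros. unfold T. rewrite Rabs_mult, Rabs_Ropp, Rabs_mult, Hsg, (Rabs_pos_eq t), (Rabs_pos_eq tau); lra.
Qed.

Lemma ctr_dsym n t : 0 <= t <= 1 -> 1 <= (Cr + 8) * exp (la0 * w_pow r (Cmod (zt n t))) * Cmod (dsym v (zt n t)).
Proof.
  intros Ht.
  assert (Hbig : / 8 <= Cmod (dsym v (zt n t)) -> 1 <= (Cr + 8) * exp (la0 * w_pow r (Cmod (zt n t))) * Cmod (dsym v (zt n t))).
  { intros H. assert (1 <= exp (la0 * w_pow r (Cmod (zt n t)))).
    { rewrite <- exp_0. apply exp_le. apply Rmult_le_pos; [lra|apply w_pow_ge_0]. }
    apply Rle_trans with (8 * 1 * / 8); [lra|]. apply Rmult_le_compat; [lra|lra| |exact H].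
    apply Rmult_le_compat; lra. }
  destruct (ctr_cases R0 T n t Ht) as [[En E]|[[En E]|[[En E]|[Hn [m [xi [_ [Hxi [E _]]]]]]]]];
  fold (zt n t) in E.
  - apply Hbig, HB. left. rewrite E. simpl. rewrite Rabs_Ropp, Rabs_pos_eq, abs_T by lra. split; auto. nra.
  - apply Hbig, HB. right. rewrite E. simpl. split.
    + replace (- T) with (- T * 1) by ring. rewrite abs_T; lra.
    + apply Rabs_le. nra.
  - apply Hbig, HB. left. rewrite E. simpl. rewrite Rabs_pos_eq, abs_T by lra. split; auto. nra.
  - rewrite E, Cmod_R, w_pow_abs. eapply Rle_trans; [apply (Hreal xi)|].
    apply Rmult_le_compat_r; [apply Cmod_ge_0|]. apply Rmult_le_compat_r; [left; apply exp_pos|lra].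
Qed.

Lemma ctr_dsym_nz n t : 0 <= t <= 1 -> dsym v (zt n t) <> RtoC 0.
Proof.
  intros Ht E. pose proof (ctr_dsym n t Ht). rewrite E, Cmod_0, Rmult_0_r in H. lra.
Qed.

Lemma ctr_mod_R n t : 0 <= t <= 1 -> R0 <= Cmod (zt n t).
Proof.
  intros Ht. 
  destruct (ctr_cases R0 T n t Ht) as [[En E]|[[En E]|[[En E]|[Hn [m [xi [_ [Hxi [E _]]]]]]]]];
  fold (zt n t) in E; rewrite E.
  - eapply Rle_trans; [|apply Rabs_fst_le]. simpl. rewrite Rabs_Ropp, Rabs_pos_eq; lra.
  - eapply Rle_trans; [|apply Rabs_snd_le]. simpl. replace (- T) with (- T * 1) by ring. rewrite abs_T; lra.
  - eapply Rle_trans; [|apply Rabs_fst_le]. simpl. rewrite Rabs_pos_eq; lra.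
  - rewrite Cmod_R. pose proof (pos_INR m). lra.
Qed.

Lemma ctr_im_sign n t : 0 <= t <= 1 -> sg * snd (zt n t) <= 0 /\ Rabs (snd (zt n t)) <= tau.
Proof.
  assert (sg * sg = 1) by (pose proof (pow2_abs sg) as P; rewrite Hsg in P; lra).
  intros Ht.
  destruct (ctr_cases R0 T n t Ht) as [[En E]|[[En E]|[[En E]|[Hn [m [xi [_ [Hxi [E _]]]]]]]]];
  fold (zt n t) in E; rewrite E; simpl.
  - rewrite abs_T by lra. unfold T. split; [|nra]. replace (sg * (- (sg * tau) * t)) with (- (sg * sg) * (tau * t)) by ring. rewrite H. nra.
  - replace (Rabs (- T)) with (Rabs (- T * 1)) by (f_equal; ring). rewrite abs_T by lra. unfold T. split; [|nra].
    replace (sg * - (sg * tau)) with (- (sg * sg) * tau) by ring. rewrite H. lra.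
  - rewrite abs_T by lra. unfold T. split; [|nra]. replace (sg * (- (sg * tau) * t)) with (- (sg * sg) * (tau * t)) by ring. rewrite H. nra.
  - rewrite Rabs_R0. lra.
Qed.

Variables (a b : R) (G : nat -> R -> C).
Hypotheses (Hab : a <= b) (JG : jet G) (VG : vanish_out a b G) (GG : gev r G).

Definition ctr_G (n : nat) (t : R) : C :=
  (RtoC (ctr_e n / (2 * PI)) * ctr_d R0 T n * FT a b (G O) (zt n (clamp01 t)) * / dsym v (zt n (clamp01 t)))%C.

Lemma ccont_ctr_G n : ccont (ctr_G n).
Proof.
  unfold ctr_G.
  apply (ccont_mult (fun t => (RtoC (ctr_e n / (2 * PI)) * ctr_d R0 T n * FT a b (G O) (zt n (clamp01 t)))%C)).
  - apply ccont_mult; [apply ccont_const|].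
    apply (ccont_comp (fun t => FT a b (G O) (zt n t)) clamp01); [|apply clamp01_cont].
    apply ccont_FT_seg; auto. now apply jet_ccont.
  - apply ccont_inv.
    + apply (ccont_comp (fun t => dsym v (zt n t)) clamp01); [now apply ccont_dsym|apply clamp01_cont].
    + intros t. apply ctr_dsym_nz, clamp01_range.
Qed.

Lemma ctr_d_mod n : Cmod (ctr_d R0 T n) <= 2 * tau.
Proof.
  assert (HT : Cmod (0, - T) <= tau).
  { eapply Rle_trans; [apply Cmod_le_abs|]. simpl. rewrite Rabs_R0.
    replace (- T) with (- T * 1) by ring. rewrite abs_T; lra. }
  destruct n as [|[|[|m]]]; simpl.
  - lra.
  - eapply Rle_trans; [apply Cmod_le_abs|]. simpl. rewrite Rabs_R0, Rabs_pos_eq; lra.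
  - lra.
  - eapply Rle_trans; [apply Cmod_le_abs|]. simpl. rewrite Rabs_R0, Rabs_R1; lra.
Qed.

Section Bounds.
Variables (eps mue mu Cq C0 : R).
Hypotheses (Heps : 0 < eps) (HCq : 0 < Cq) (HC0 : 0 <= C0)
  (Hmue : forall t k, 0 <= t -> t ^ k * exp (- (mue * w_pow r t)) <= eps ^ k * fa r k)
  (Hmu : forall t, 0 <= t -> exp (- (mu * w_pow r t)) <= Cq / (1 + t ^ 2))
  (HFT : forall z E, (forall t, a <= t <= b -> Cmod (cE (- z) t) <= E) ->
    Cmod (FT a b (G O) z) <= C0 * exp (- ((la0 + mue + 2 * mu) * w_pow r (Cmod z))) * E).

Definition ctr_X (E : R) (k : nat) : R :=
  E * ((Cr + 8) * C0 * Cq * Cq / (1 + R0 ^ 2)) * (eps ^ k * fa r k).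

Lemma ctr_X_pos E k : 0 <= E -> 0 <= ctr_X E k.
Proof.
  intros HE. unfold ctr_X. assert (0 < 1 + R0 ^ 2) by nra.
  repeat apply Rmult_le_pos; auto; try lra; try (now left; apply Rinv_0_lt_compat).
  - apply pow_le; lra.
  - left; apply fa_pos.
Qed.

(** The decay rate [la0 + mue + 2 mu] of the transform is spent in four parts: [la0] against the
    division by [dsym v], [mue] against the power [|z|^k], one [mu] for the integrable
    [1 / (1 + |z|^2)], the other for the factor [1 / (1 + R0^2)] that makes large contours cheap. *)
Lemma ctr_pointwise n t x E k : 0 <= t <= 1 -> (forall u, a <= u <= b -> Cmod (cE (zt n t) (x - u)) <= E) ->
  Cmod (ctr_G n t) * (Cmod (zt n t) ^ k * Cmod (cE (zt n t) x)) <=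
    Cmod (ctr_d R0 T n) * (ctr_X E k * / (1 + Cmod (zt n t) ^ 2)).
Proof.
  intros Ht HE. unfold ctr_G. rewrite clamp01_id by auto.
  assert (HzR := ctr_mod_R n t Ht). assert (HV := ctr_dsym n t Ht). assert (Hnz := ctr_dsym_nz n t Ht).
  set (z := zt n t) in *. set (w := w_pow r (Cmod z)) in *. set (m := Cmod z) in *.
  assert (Hm0 : 0 <= m) by apply Cmod_ge_0.
  rewrite !Cmod_mult, Cmod_inv by auto. rewrite Cmod_R.
  assert (HE0 : 0 <= E) by (eapply Rle_trans; [apply Cmod_ge_0|apply (HE a); lra]).
  assert (H1 : Rabs (ctr_e n / (2 * PI)) <= 1).
  { pose proof PI_RGT_0. assert (3 < PI) by (pose proof PI2_3_2; lra).
    unfold Rdiv. rewrite Rabs_mult, (Rabs_pos_eq (/ (2 * PI))) by (left; apply Rinv_0_lt_compat; lra).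
    assert (Rabs (ctr_e n) = 1) by (destruct n as [|[|[|]]]; simpl; first [apply Rabs_R1 | rewrite Rabs_left; lra]).
    rewrite H1, Rmult_1_l. rewrite <- Rinv_1. apply Rinv_le_contravar; lra. }
  assert (Hcx : 0 < Cmod (cE z x)) by (rewrite cE_mod; apply exp_pos).
  (* [HFT] is applied with [E / |e^(izx)|]: only the product [e^(iz(x-u))], with [u] in the support,
     is controlled by [E]. *)
  assert (H2 : Cmod (FT a b (G O) z) * Cmod (cE z x) <= C0 * exp (- ((la0 + mue + 2 * mu) * w)) * E).
  { replace (C0 * exp (- ((la0 + mue + 2 * mu) * w)) * E) with
      (C0 * exp (- ((la0 + mue + 2 * mu) * w)) * (E / Cmod (cE z x)) * Cmod (cE z x)) by (field; lra).
    apply Rmult_le_compat_r; [lra|]. apply HFT. intros u Hu.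
    apply Rmult_le_reg_r with (Cmod (cE z x)); auto.
    replace (E / Cmod (cE z x) * Cmod (cE z x)) with E by (field; lra).
    rewrite <- Cmod_mult, cE_opp, <- cE_plus_x. replace (- u + x) with (x - u) by ring. now apply HE. }
  assert (HVp : 0 < Cmod (dsym v z)) by now apply Cmod_gt_0.
  assert (H3 : / Cmod (dsym v z) <= (Cr + 8) * exp (la0 * w)).
  { apply Rmult_le_reg_r with (Cmod (dsym v z)); auto. rewrite Rinv_l by lra. exact HV. }
  assert (H4 := Hmue m k Hm0). fold w in H4.
  assert (H5 := Hmu m Hm0). fold w in H5.
  assert (H6 : exp (- (mu * w)) <= Cq / (1 + R0 ^ 2)).
  { eapply Rle_trans; [exact H5|]. apply Rmult_le_compat_l; [lra|]. apply Rinv_le_contravar; nra. }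
  assert (Hd := Cmod_ge_0 (ctr_d R0 T n)).
  set (dd := Cmod (ctr_d R0 T n)) in *. set (F := Cmod (FT a b (G O) z)) in *.
  set (iV := / Cmod (dsym v z)) in *. set (cx := Cmod (cE z x)) in *. set (ee := Rabs (ctr_e n / (2 * PI))) in *.
  assert (HF : 0 <= F) by apply Cmod_ge_0. assert (HiV : 0 <= iV) by (left; now apply Rinv_0_lt_compat).
  assert (Hmk : 0 <= m ^ k) by now apply pow_le.
  replace (ee * dd * F * iV * (m ^ k * cx)) with (dd * (ee * (iV * (F * cx) * m ^ k))) by ring.
  apply Rmult_le_compat_l; auto.
  assert (He : 0 <= ee) by apply Rabs_pos.
  assert (HP : iV * (F * cx) * m ^ k <= (Cr + 8) * exp (la0 * w) * (C0 * exp (- ((la0 + mue + 2 * mu) * w)) * E) * m ^ k).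
  { apply Rmult_le_compat_r; auto. apply Rmult_le_compat; auto. apply Rmult_le_pos; lra. }
  apply Rle_trans with (1 * (iV * (F * cx) * m ^ k)).
  { apply Rmult_le_compat_r; auto. apply Rmult_le_pos; auto. apply Rmult_le_pos; auto. apply Rmult_le_pos; lra. }
  rewrite Rmult_1_l. eapply Rle_trans; [exact HP|].
  replace (exp (- ((la0 + mue + 2 * mu) * w))) with (exp (- (la0 * w)) * (exp (- (mue * w)) * (exp (- (mu * w)) * exp (- (mu * w))))).
  2:{ rewrite <- !exp_plus. f_equal. ring. }
  assert (Eexp : exp (la0 * w) * exp (- (la0 * w)) = 1) by (rewrite <- exp_plus, Rplus_opp_r; apply exp_0).
  replace ((Cr + 8) * exp (la0 * w) * (C0 * (exp (- (la0 * w)) * (exp (- (mue * w)) * (exp (- (mu * w)) * exp (- (mu * w))))) * E) * m ^ k)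
   with (((exp (la0 * w) * exp (- (la0 * w))) * ((Cr + 8) * C0 * E)) * ((m ^ k * exp (- (mue * w))) * (exp (- (mu * w)) * exp (- (mu * w))))) by ring.
  rewrite Eexp, Rmult_1_l. unfold ctr_X.
  replace (E * ((Cr + 8) * C0 * Cq * Cq / (1 + R0 ^ 2)) * (eps ^ k * fa r k) * / (1 + m ^ 2)) with
    (((Cr + 8) * C0 * E) * ((eps ^ k * fa r k) * ((Cq / (1 + R0 ^ 2)) * (Cq / (1 + m ^ 2))))) by (field; nra).
  apply Rmult_le_compat_l; [repeat apply Rmult_le_pos; lra|].
  assert (0 < exp (- (mu * w))) by apply exp_pos. assert (0 < exp (- (mue * w))) by apply exp_pos.
  apply Rmult_le_compat; auto; [apply Rmult_le_pos; lra|apply Rmult_le_pos; lra|].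
  apply Rmult_le_compat; lra.
Qed.

(** The height [tau] has no upper bound in terms of [R0], so length times supremum fails on the
    vertical sides; this integral is at most [PI / 2] for every [tau]. *)
Lemma RInt_atan_bound : RInt (fun t => tau / (1 + (tau * t) ^ 2)) 0 1 <= 2.
Proof.
  assert (D : forall t, is_derive (fun t => atan (tau * t)) t (tau / (1 + (tau * t) ^ 2))).
  { intros t. auto_derive; [easy|]. unfold Rsqr. field. nra. }
  rewrite (is_RInt_unique (V:=R_CompleteNormedModule) _ _ _ _ (is_RInt_derive (V:=R_CompleteNormedModule) _ _ 0 1 (fun x _ => D x)
    (fun x _ => ex_derive_continuous (V:=R_NormedModule) (fun t => tau / (1 + (tau * t) ^ 2)) x
       ltac:(auto_derive; nra)))).
  unfold minus, plus, opp; simpl. rewrite Rmult_0_r, atan_0.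
  pose proof (atan_bound (tau * 1)). pose proof PI_4. lra.
Qed.

(** On the vertical sides the estimate uses the arctangent, on the horizontal one
    [|z| >= tau >= R0]. On a real piece [n + 1 <= 5 |xi|], which accounts for the square of 5; the
    constant 50 also covers the three finite sides. *)
Lemma ctr_seg_bound n x E k : (forall t u, 0 <= t <= 1 -> a <= u <= b -> Cmod (cE (zt n t) (x - u)) <= E) ->
  Cmod (segint (ctr_p R0 T n) (ctr_d R0 T n) (ctr_G n) 0 1 k x) <= 50 * ctr_X E k * / (INR n + 1) ^ 2.
Proof.
  intros HE.
  assert (HE0 : 0 <= E) by (eapply Rle_trans; [apply Cmod_ge_0|apply (HE 0 a); lra]).
  assert (HX := ctr_X_pos E k HE0). set (X := ctr_X E k) in *.
  assert (Hc : ccont (fun t => (ctr_G n t * Ejet (seg (ctr_p R0 T n) (ctr_d R0 T n) t) k x)%C))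
    by (apply ccont_segint, ccont_ctr_G).
  assert (Hpt : forall t, 0 <= t <= 1 -> Cmod (ctr_G n t * Ejet (seg (ctr_p R0 T n) (ctr_d R0 T n) t) k x) <=
     Cmod (ctr_d R0 T n) * (X * / (1 + Cmod (zt n t) ^ 2))).
  { intros t Ht. rewrite Cmod_mult, Cmod_Ejet. apply ctr_pointwise; auto. }
  assert (Hvert : Cmod (ctr_d R0 T n) <= tau -> (forall t, 0 <= t <= 1 -> tau * t <= Cmod (zt n t)) ->
     Cmod (segint (ctr_p R0 T n) (ctr_d R0 T n) (ctr_G n) 0 1 k x) <= X * 2).
  { intros Hd Hz. unfold segint. eapply Rle_trans; [apply CI_Cmod_le; auto; lra|].
    apply Rle_trans with (RInt (fun t => X * (tau / (1 + (tau * t) ^ 2))) 0 1).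
    - apply RInt_le; try lra.
      + apply ex_RInt_cont. now apply continuous_Cmod.
      + apply ex_RInt_cont. intros t. apply (ex_derive_continuous (V:=R_NormedModule)). auto_derive. nra.
      + intros t Ht. eapply Rle_trans; [apply Hpt; lra|].
        specialize (Hz t ltac:(lra)). assert (0 <= tau * t) by (apply Rmult_le_pos; lra).
        assert (/ (1 + Cmod (zt n t) ^ 2) <= / (1 + (tau * t) ^ 2)) by (apply Rinv_le_contravar; nra).
        assert (0 < / (1 + Cmod (zt n t) ^ 2)) by (apply Rinv_0_lt_compat; nra).
        replace (X * (tau / (1 + (tau * t) ^ 2))) with (tau * (X * / (1 + (tau * t) ^ 2))) by (unfold Rdiv; ring).
        apply Rmult_le_compat; auto using Cmod_ge_0; [apply Rmult_le_pos; lra|]. now apply Rmult_le_compat_l.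
    - rewrite (RInt_scal (V:=R_CompleteNormedModule)).
      + unfold scal; simpl; unfold mult; simpl. apply Rmult_le_compat_l; auto. apply RInt_atan_bound.
      + apply ex_RInt_cont. intros t. apply (ex_derive_continuous (V:=R_NormedModule)). auto_derive. nra. }
  assert (HdT : Cmod (0, - T) <= tau).
  { eapply Rle_trans; [apply Cmod_le_abs|]. simpl. rewrite Rabs_R0.
    replace (- T) with (- T * 1) by ring. rewrite abs_T; lra. }
  assert (Hflat : forall B, (forall t, 0 <= t <= 1 -> Cmod (ctr_d R0 T n) * / (1 + Cmod (zt n t) ^ 2) <= B) ->
     Cmod (segint (ctr_p R0 T n) (ctr_d R0 T n) (ctr_G n) 0 1 k x) <= X * B).
  { intros B HBB. unfold segint. replace (X * B) with (X * B * (1 - 0)) by ring.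
    apply CI_bound; auto; [lra|]. intros t Ht. eapply Rle_trans; [now apply Hpt|].
    replace (Cmod (ctr_d R0 T n) * (X * / (1 + Cmod (zt n t) ^ 2))) with (X * (Cmod (ctr_d R0 T n) * / (1 + Cmod (zt n t) ^ 2))) by ring.
    apply Rmult_le_compat_l; auto. }
  destruct n as [|[|[|m]]].
  - simpl INR. replace (50 * X * / (0 + 1) ^ 2) with (X * 50) by field.
    eapply Rle_trans; [apply Hvert; auto|lra]. intros t Ht. eapply Rle_trans; [|apply Rabs_snd_le].
    unfold zt, seg; simpl. right. rewrite <- abs_T by lra. f_equal. ring.
  - simpl INR. replace (50 * X * / (1 + 1) ^ 2) with (X * (50/4)) by field.
    eapply Rle_trans; [apply (Hflat 1)|lra]. intros t Ht.
    assert (tau <= Cmod (zt 1 t)).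
    { eapply Rle_trans; [|apply Rabs_snd_le]. unfold zt, seg; simpl. right. replace tau with (tau * 1) by ring.
      rewrite <- abs_T by lra. f_equal. ring. }
    assert (Cmod (ctr_d R0 T 1) <= 2 * R0).
    { simpl. eapply Rle_trans; [apply Cmod_le_abs|]. simpl. rewrite Rabs_R0, Rabs_pos_eq; lra. }
    apply Rmult_le_reg_r with (1 + Cmod (zt 1 t) ^ 2); [nra|].
    rewrite Rmult_assoc, Rinv_l by nra. nra.
  - simpl INR. replace (50 * X * / (1 + 1 + 1) ^ 2) with (X * (50/9)) by field.
    eapply Rle_trans; [apply Hvert; auto|lra]. intros t Ht. eapply Rle_trans; [|apply Rabs_snd_le].
    unfold zt, seg; simpl. right. rewrite <- abs_T by lra. f_equal. ring.
  - set (n := S (S (S m))) in *. pose proof (pos_INR n).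
    replace (50 * X * / (INR n + 1) ^ 2) with (X * (50 / (INR n + 1) ^ 2)) by (field; lra).
    apply Hflat. intros t Ht.
    destruct (ctr_cases R0 T n t Ht) as [[En _]|[[En _]|[[En _]|[Hn [m' [xi [Hm' [Hxi [Ez Ed]]]]]]]]]; try discriminate.
    fold (zt n t) in Ez. rewrite Ez, Ed, Cmod_1, Cmod_R, Rmult_1_l, pow2_abs.
    assert (INR n <= 2 * INR m' + 4).
    { apply le_INR in Hm'. rewrite plus_INR, mult_INR in Hm'. replace (INR 2) with 2 in Hm' by (simpl; ring). replace (INR 4) with 4 in Hm' by (simpl; ring). lra. }
    pose proof (pos_INR m'). rewrite <- (pow2_abs xi).
    apply Rmult_le_reg_r with ((1 + Rabs xi ^ 2) * (INR n + 1) ^ 2); [apply Rmult_lt_0_compat; [nra|apply pow_lt; lra]|].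
    replace (/ (1 + Rabs xi ^ 2) * ((1 + Rabs xi ^ 2) * (INR n + 1) ^ 2)) with ((INR n + 1) ^ 2) by (field; nra).
    replace (50 / (INR n + 1) ^ 2 * ((1 + Rabs xi ^ 2) * (INR n + 1) ^ 2)) with (50 * (1 + Rabs xi ^ 2)) by (field; lra).
    assert (INR n + 1 <= 5 * Rabs xi) by lra. nra.
Qed.

Lemma ctr_superpos_bound x E k :
  (forall n t u, 0 <= t <= 1 -> a <= u <= b -> Cmod (cE (zt n t) (x - u)) <= E) ->
  Cmod (superpos (ctr_p R0 T) (ctr_d R0 T) ctr_G k x) <=
    50 * Series (fun n => / (INR n + 1) ^ 2) * ctr_X E k.
Proof.
  intros HE. replace (50 * Series (fun n => / (INR n + 1) ^ 2) * ctr_X E k) with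
    (Series (fun n => 50 * ctr_X E k * / (INR n + 1) ^ 2)) by (rewrite Series_scal_l; ring).
  apply Csum_bound; [|apply ex_series_scal_R, ex_series_inv_sq].
  intros n. apply ctr_seg_bound. auto.
Qed.

Lemma ctr_E_compact M n t u x : 0 <= t <= 1 -> a <= u <= b -> Rabs x <= M ->
  Cmod (cE (zt n t) (x - u)) <= exp (tau * (Rabs M + Rabs a + Rabs b)).
Proof.
  intros Ht Hu Hx. destruct (ctr_im_sign n t Ht) as [_ Hi]. fold T in Hi. fold (zt n t) in Hi.
  rewrite cE_mod. apply exp_le. eapply Rle_trans; [apply Rle_abs|]. rewrite Rabs_Ropp, Rabs_mult.
  apply Rmult_le_compat; auto using Rabs_pos. unfold Rminus. eapply Rle_trans; [apply Rabs_triang|]. rewrite Rabs_Ropp.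
  pose proof (Rle_abs M).
  assert (Rabs u <= Rmax (Rabs a) (Rabs b)) by (apply Rabs_between_max; rewrite Rmin_left, Rmax_right; lra).
  pose proof (Rmax_Rle (Rabs a) (Rabs b) (Rabs a + Rabs b)). pose proof (Rabs_pos a). pose proof (Rabs_pos b).
  assert (Rmax (Rabs a) (Rabs b) <= Rabs a + Rabs b) by (apply Rmax_lub; lra). lra.
Qed.

Lemma ctr_superpos_ok : superpos_ok (ctr_p R0 T) (ctr_d R0 T) ctr_G.
Proof.
  split; [intros; apply ccont_ctr_G|]. intros M k.
  set (E := exp (tau * (Rabs M + Rabs a + Rabs b))).
  assert (HX := ctr_X_pos E k ltac:(left; apply exp_pos)).
  exists (fun n => ((25 + 18 * tau) * ctr_X E k) * / (INR n + 1) ^ 2).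
  split; [apply ex_series_scal_R, ex_series_inv_sq|].
  intros n t x Ht Hx. eapply Rle_trans; [apply (ctr_pointwise n t x E k Ht); intros; now apply ctr_E_compact|].
  set (X := ctr_X E k) in *. pose proof (pos_INR n).
  replace ((25 + 18 * tau) * X * / (INR n + 1) ^ 2) with (X * ((25 + 18 * tau) * / (INR n + 1) ^ 2)) by ring.
  replace (Cmod (ctr_d R0 T n) * (X * / (1 + Cmod (zt n t) ^ 2))) with (X * (Cmod (ctr_d R0 T n) * / (1 + Cmod (zt n t) ^ 2))) by ring.
  apply Rmult_le_compat_l; auto.
  assert (Hq : 0 < / (1 + Cmod (zt n t) ^ 2) <= 1).
  { split; [apply Rinv_0_lt_compat; nra|]. rewrite <- Rinv_1. apply Rinv_le_contravar; nra. }
  assert (Hsm : (n <= 2)%nat -> Cmod (ctr_d R0 T n) * / (1 + Cmod (zt n t) ^ 2) <= (25 + 18 * tau) * / (INR n + 1) ^ 2).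
  { intros Hn. apply le_INR in Hn. simpl in Hn. pose proof (ctr_d_mod n). pose proof (Cmod_ge_0 (ctr_d R0 T n)).
    apply Rle_trans with (2 * tau); [nra|].
    apply Rmult_le_reg_r with ((INR n + 1) ^ 2); [apply pow_lt; lra|].
    replace ((25 + 18 * tau) * / (INR n + 1) ^ 2 * (INR n + 1) ^ 2) with (25 + 18 * tau) by (field; lra).
    assert ((INR n + 1) ^ 2 <= 9) by nra. nra. }
  destruct (ctr_cases R0 T n t Ht) as [[En _]|[[En _]|[[En _]|[Hn [m' [xi [Hm' [Hxi [Ez Ed]]]]]]]]];
   try (apply Hsm; lia).
  fold (zt n t) in Ez. rewrite Ez, Ed, Cmod_1, Cmod_R, Rmult_1_l.
  assert (INR n <= 2 * INR m' + 4).
  { apply le_INR in Hm'. rewrite plus_INR, mult_INR in Hm'. replace (INR 2) with 2 in Hm' by (simpl; ring). replace (INR 4) with 4 in Hm' by (simpl; ring). lra. }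
  pose proof (pos_INR m').
  apply Rmult_le_reg_r with ((1 + Rabs xi ^ 2) * (INR n + 1) ^ 2); [apply Rmult_lt_0_compat; [nra|apply pow_lt; lra]|].
  replace (/ (1 + Rabs xi ^ 2) * ((1 + Rabs xi ^ 2) * (INR n + 1) ^ 2)) with ((INR n + 1) ^ 2) by (field; nra).
  replace ((25 + 18 * tau) * / (INR n + 1) ^ 2 * ((1 + Rabs xi ^ 2) * (INR n + 1) ^ 2)) with ((25 + 18 * tau) * (1 + Rabs xi ^ 2)) by (field; lra).
  assert (INR n + 1 <= 5 * Rabs xi) by lra. nra.
Qed.

End Bounds.

Lemma WI_real x c l : WI a b (G O) x (RtoC c) (RtoC l) = CI (Fx a b G x) c (c + l).
Proof.
  assert (E := CI_affine (Fx a b G x) l c 0 1 (ccont_Fx a b G Hab JG x)).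
  replace (l * 0 + c) with c in E by ring. replace (l * 1 + c) with (c + l) in E by ring.
  rewrite <- E. unfold WI. f_equal. apply CI_ext. intros t.
  assert (Es : seg (RtoC c) (RtoC l) t = RtoC (l * t + c)) by (unfold seg; cring).
  rewrite Es. unfold Fx. apply Cmult_comm.
Qed.

(** The convolution multiplies the densities by [dsym v] and cancels the denominator. Two uses of
    [WI_triangle] then push the three sides of the box back to [[-R0, R0]]; together with the real
    pieces this is Fourier inversion along growing intervals. *)
Lemma ctr_conv x : superpos_ok (ctr_p R0 T) (ctr_d R0 T) ctr_G ->
  conv v (superpos (ctr_p R0 T) (ctr_d R0 T) ctr_G O) x = G O x.
Proof.
  intros Hok. destruct (conv_superpos v _ _ _ x Hv Hok) as [E [bb [Hb Hn]]]. rewrite E.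
  set (term := fun n => CI (fun t => (ctr_G n t * dsym v (seg (ctr_p R0 T n) (ctr_d R0 T n) t) * cE (seg (ctr_p R0 T n) (ctr_d R0 T n) t) x)%C) 0 1) in *.
  pose proof PI_RGT_0.
  assert (Et : forall n, term n = (RtoC (ctr_e n / (2 * PI)) * WI a b (G O) x (ctr_p R0 T n) (ctr_d R0 T n))%C).
  { intros n. unfold term, WI. rewrite Cmult_assoc, <- CI_scal.
    - apply CI_ext_in; [lra|]. intros t Ht. unfold ctr_G. rewrite clamp01_id by lra. unfold zt.
      field. apply (ctr_dsym_nz n t). lra.
    - apply ccont_mult; [apply ccont_FT_seg; auto; now apply jet_ccont|apply ccont_cE_seg]. }
  assert (Hbase : (WI a b (G O) x (ctr_p R0 T 0) (ctr_d R0 T 0) + WI a b (G O) x (ctr_p R0 T 1) (ctr_d R0 T 1)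
     - WI a b (G O) x (ctr_p R0 T 2) (ctr_d R0 T 2))%C = CI (Fx a b G x) (- R0) R0).
  { assert (T1 := WI_triangle a b (G O) x Hab (jet_ccont G O JG) (- R0, 0) (0, - T) (2 * R0, 0)).
    assert (T2 := WI_triangle a b (G O) x Hab (jet_ccont G O JG) (- R0, 0) (2 * R0, 0) (0, - T)).
    replace ((- R0, 0)%R + (0, - T)%R)%C with (- R0, - T) in T1 by cring.
    replace ((- R0, 0)%R + (2 * R0, 0)%R)%C with (R0, 0) in T2 by cring.
    replace ((0, - T)%R + (2 * R0, 0)%R)%C with ((2 * R0, 0)%R + (0, - T)%R)%C in T1 by cring.
    simpl ctr_p; simpl ctr_d. rewrite T1, <- T2.
    change ((- R0, 0) : C) with (RtoC (- R0)). change ((2 * R0, 0) : C) with (RtoC (2 * R0)).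
    rewrite (WI_real x (- R0) (2 * R0)). replace (- R0 + 2 * R0) with R0 by ring. ring. }
  assert (Hpart : forall m, Csn term (3 + 2 * m) = (RtoC (/ (2 * PI)) * CI (Fx a b G x) (- (R0 + INR m)) (R0 + INR m))%C).
  { assert (HF := ccont_Fx a b G Hab JG x). induction m.
    - simpl INR. rewrite Rplus_0_r, <- Hbase. change (Csn term (3 + 2 * 0)) with (RtoC 0 + term 0%nat + term 1%nat + term 2%nat)%C.
      rewrite !Et. simpl ctr_e. unfold Rdiv. rewrite !Rmult_1_l, RtoC_mult. 
      replace (RtoC (-1)) with (- RtoC 1)%C by cring. ring.
    - replace (3 + 2 * S m)%nat with (S (S (3 + 2 * m))) by lia.
      change (Csn term (S (S (3 + 2 * m)))) with (Csn term (3 + 2 * m) + term (3 + 2 * m)%nat + term (S (3 + 2 * m)))%C.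
      rewrite IHm, !Et.
      assert (P1 : ctr_p R0 T (3 + 2 * m) = RtoC (R0 + INR m)).
      { change (3 + 2 * m)%nat with (S (S (S (2 * m)))). unfold ctr_p. rewrite Nat.even_even, Nat.div2_double. reflexivity. }
      assert (P2 : ctr_p R0 T (S (3 + 2 * m)) = RtoC (- R0 - INR m - 1)).
      { change (S (3 + 2 * m))%nat with (S (S (S (S (2 * m))))). unfold ctr_p.
        replace (Nat.even (S (2 * m))) with false by (rewrite <- Nat.add_1_r, Nat.even_odd; auto).
        rewrite Nat.div2_succ_double. reflexivity. }
      rewrite P1, P2.
      change (ctr_d R0 T (3 + 2 * m)) with (RtoC 1). change (ctr_d R0 T (S (3 + 2 * m))) with (RtoC 1).
      change (ctr_e (3 + 2 * m)) with 1. change (ctr_e (S (3 + 2 * m))) with 1.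
      rewrite !WI_real. rewrite S_INR.
      replace (- (R0 + (INR m + 1))) with (- R0 - INR m - 1) by ring.
      replace (- R0 - INR m - 1 + 1) with (- (R0 + INR m)) by ring.
      replace (R0 + (INR m + 1)) with (R0 + INR m + 1) by ring.
      rewrite <- (CI_Chasles (Fx a b G x) (- R0 - INR m - 1) (- (R0 + INR m)) (R0 + INR m + 1)) by auto.
      rewrite <- (CI_Chasles (Fx a b G x) (- (R0 + INR m)) (R0 + INR m) (R0 + INR m + 1)) by auto.
      replace (1 / (2 * PI)) with (/ (2 * PI)) by (field; lra). ring. }
  assert (L1 := clim_Csum term bb Hn Hb).
  assert (L2 : clim (fun m => Csn term (3 + 2 * m)) (Csum term)).
  { apply (clim_subseq (Csn term) (Csum term) (fun m => (3 + 2 * m)%nat)); auto.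
    apply eventually_subseq. intros n. lia. }
  apply (clim_unique (fun m => Csn term (3 + 2 * m))); auto.
  apply is_lim_seq_spec. intros eps.
  destruct (fourier_inversion a b G Hab JG VG x eps (cond_pos eps)) as [L0 [HL0 HL]].
  destruct (nfloor_ex L0) as [N [_ HN]]; [lra|]. exists (S N). intros m Hm.
  rewrite Rminus_0_r, Rabs_pos_eq by apply Cmod_ge_0. rewrite Hpart.
  assert (HmR : L0 <= R0 + INR m) by (apply le_INR in Hm; rewrite S_INR in Hm; lra).
  specialize (HL _ HmR).
  replace (RtoC (/ (2 * PI)) * CI (Fx a b G x) (- (R0 + INR m)) (R0 + INR m) - G O x)%C with
    (RtoC (/ (2 * PI)) * (CI (Fx a b G x) (- (R0 + INR m)) (R0 + INR m) - RtoC (2 * PI) * G O x))%C.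
  - assert (H2 : 0 < / (2 * PI) < 1).
    { split; [apply Rinv_0_lt_compat; lra|]. rewrite <- Rinv_1. apply Rinv_lt_contravar; [|pose proof PI2_3_2]; lra. }
    rewrite Cmod_mult, Cmod_R, Rabs_pos_eq by lra. pose proof (cond_pos eps).
    apply Rle_lt_trans with (/ (2 * PI) * eps); [apply Rmult_le_compat_l; lra|nra].
  - assert (E2 : (RtoC (/ (2 * PI)) * RtoC (2 * PI))%C = RtoC 1) by (rewrite <- RtoC_mult; f_equal; field; lra).
    replace (RtoC (/ (2 * PI)) * (CI (Fx a b G x) (- (R0 + INR m)) (R0 + INR m) - RtoC (2 * PI) * G O x))%C with
     (RtoC (/ (2 * PI)) * CI (Fx a b G x) (- (R0 + INR m)) (R0 + INR m) - (RtoC (/ (2 * PI)) * RtoC (2 * PI)) * G O x)%C by ring.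
    rewrite E2. ring.
Qed.

End OneContour.

(* The solution is tiny on the side [sg * (x - u) <= 0] of the support, since Im z has the sign of -sg on the
   contour and |z| >= R there. *)
Lemma one_sided_solution sg a b G eps eta : Rabs sg = 1 -> a <= b -> jet G -> vanish_out a b G -> gev r G ->
  0 < eps -> 0 < eta -> exists H, jet H /\ (forall x, conv v (H O) x = G O x) /\ gev r H /\
    forall k x, (forall u, a <= u <= b -> sg * (x - u) <= 0) -> Cmod (H k x) <= eta * (eps ^ k * fa r k).
Proof.
  intros Hsg Hab JG VG GG He Heta.
  destruct (exp_w_quadratic r r0) as [mu [Cq [Hmu [HCq Hq]]]].
  destruct (exp_gev r eps r0 He) as [mue [Hmue Hge]].
  destruct (FT_decay r (la0 + mue + 2 * mu) a b G r0 ltac:(lra) Hab JG VG GG) as [C0 [HC0 HF]].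
  set (K := 50 * Series (fun n => / (INR n + 1) ^ 2) * ((Cr + 8) * C0 * Cq * Cq)).
  (* On the small side the exponentials are at most 1, so [E = 1] and the bound is [K / (1 + R0^2)];
     this size of [R0] brings it below [eta]. *)
  destruct (Hbox (Rabs K / eta + 1)) as [R0 [tau [HBR [HRt HB]]]].
  assert (HK0 : 0 <= Rabs K / eta) by (apply Rmult_le_pos; [apply Rabs_pos|left; now apply Rinv_0_lt_compat]).
  assert (HR : 1 <= R0) by lra.
  assert (Hok := ctr_superpos_ok R0 tau sg HR HRt Hsg HB a b G Hab JG eps mue mu Cq C0 He HCq HC0 Hge Hq HF).
  exists (superpos (ctr_p R0 (sg * tau)) (ctr_d R0 (sg * tau)) (ctr_G R0 tau sg a b G)).
  split; [now apply jet_superpos|].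
  split; [intros x; now apply (ctr_conv R0 tau sg HR HRt Hsg HB a b G Hab JG VG)|].
  split.
  - intros M e He'. 
    destruct (exp_gev r e r0 He') as [mue' [Hmue' Hge']].
    destruct (FT_decay r (la0 + mue' + 2 * mu) a b G r0 ltac:(lra) Hab JG VG GG) as [C0' [HC0' HF']].
    set (E := exp (tau * (Rabs M + Rabs a + Rabs b))).
    exists (50 * Series (fun n => / (INR n + 1) ^ 2) * (E * ((Cr + 8) * C0' * Cq * Cq / (1 + R0 ^ 2)))).
    assert (Bd : forall k x, Rabs x <= M -> Cmod (superpos (ctr_p R0 (sg * tau)) (ctr_d R0 (sg * tau)) (ctr_G R0 tau sg a b G) k x) <=
      50 * Series (fun n => / (INR n + 1) ^ 2) * (E * ((Cr + 8) * C0' * Cq * Cq / (1 + R0 ^ 2))) * (e ^ k * fa r k)).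
    { intros k x Hx.
      eapply Rle_trans; [apply (ctr_superpos_bound R0 tau sg HR HRt Hsg HB a b G Hab JG e mue' mu Cq C0' He' HCq HC0' Hge' Hq HF' x E k)|].
      - intros n t u Ht Hu. now apply (ctr_E_compact R0 tau sg HR HRt Hsg a b Hab).
      - unfold ctr_X. right; ring. }
    split; auto.
    assert (HS : 0 <= Series (fun n => / (INR n + 1) ^ 2)).
    { eapply Rle_trans; [apply Cmod_ge_0|apply (Csum_bound (fun _ => RtoC 0)); [|apply ex_series_inv_sq]].
      intros n. pose proof (pos_INR n). rewrite Cmod_0. left; apply Rinv_0_lt_compat, pow_lt; lra. }
    assert (0 < E) by apply exp_pos. assert (0 < / (1 + R0 ^ 2)) by (apply Rinv_0_lt_compat; nra).
    unfold Rdiv. repeat apply Rmult_le_pos; lra.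
  - intros k x Hx.
    eapply Rle_trans; [apply (ctr_superpos_bound R0 tau sg HR HRt Hsg HB a b G Hab JG eps mue mu Cq C0 He HCq HC0 Hge Hq HF x 1 k)|].
    + intros n t u Ht Hu. rewrite cE_mod, <- exp_0. apply exp_le.
      destruct (ctr_im_sign R0 tau sg HR HRt Hsg n t Ht) as [Hi _].
      specialize (Hx u Hu). set (y := snd _) in *.
      assert (sg * sg = 1) by (pose proof (pow2_abs sg) as P; rewrite Hsg in P; lra).
      assert (0 <= (sg * y) * (sg * (x - u))) by nra.
      replace (sg * y * (sg * (x - u))) with ((sg * sg) * (y * (x - u))) in H0 by ring. rewrite H in H0. lra.
    + unfold ctr_X.
      replace (50 * Series (fun n => / (INR n + 1) ^ 2) * (1 * ((Cr + 8) * C0 * Cq * Cq / (1 + R0 ^ 2)) * (eps ^ k * fa r k)))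
        with ((K / (1 + R0 ^ 2)) * (eps ^ k * fa r k)) by (unfold K, Rdiv; ring).
      apply Rmult_le_compat_r; [apply Rmult_le_pos; [apply pow_le; lra|left; apply fa_pos]|].
      assert (Hp : 0 < 1 + R0 ^ 2) by nra.
      apply Rmult_le_reg_r with (1 + R0 ^ 2); auto.
      replace (K / (1 + R0 ^ 2) * (1 + R0 ^ 2)) with K by (field; lra).
      pose proof (Rle_abs K).
      assert (Rabs K <= eta * R0).
      { apply Rmult_le_reg_r with (/ eta); [now apply Rinv_0_lt_compat|].
        replace (eta * R0 * / eta) with R0 by (field; lra). unfold Rdiv in HBR. lra. }
      apply Rle_trans with (eta * R0); [lra|]. apply Rmult_le_compat_l; nra.
Qed.

Lemma gev_summable F : 
  (forall M e, 0 < e -> exists b : nat -> R, ex_series b /\ forall n k x, Rabs x <= M -> Cmod (F n k x) <= b n * (e ^ k * fa r k)) ->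
  jets_summable F /\ gev r (fun k x => Csum (fun n => F n k x)).
Proof.
  intros H. split.
  - intros M k. destruct (H M 1 Rlt_0_1) as [b [Hb Hn]]. exists (fun n => (1 ^ k * fa r k) * b n).
    split; [now apply ex_series_scal_R|]. intros n x Hx. rewrite Rmult_comm. auto.
  - intros M e He. destruct (H M e He) as [b [Hb Hn]]. exists (Rabs (Series b)). split; [apply Rabs_pos|].
    intros k x Hx. apply Rle_trans with (Series (fun n => b n * (e ^ k * fa r k))).
    + apply Csum_bound; auto. eapply ex_series_ext; [|apply (ex_series_scal_R (e ^ k * fa r k) b Hb)].
      intros; apply Rmult_comm.
    + rewrite Series_scal_r. apply Rmult_le_compat_r; [|apply Rle_abs].
      apply Rmult_le_pos; [apply pow_le; lra|left; apply fa_pos].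
Qed.

(** A Mittag-Leffler argument. A partition of unity cuts [g] into pieces near the points [n + 1] and
    [-n]; the former are solved with a solution tiny to the left of the piece, the latter with one
    tiny to the right. On a fixed compact set almost all solutions are then bounded by [2^(-n)] with
    [eps = 1 / (n + 1)], so their sum converges in the class. *)
Lemma conv_surjective g : Gev r g -> exists h, Gev r h /\ forall x, conv v h x = g x.
Proof.
  intros [Ga [JGa [EGa GGa]]].
  destruct (gevrey_step r r0 r1) as [Th [JT [GT [_ [T0 T1]]]]].
  assert (HGT : gev r Th) by (intros M e He; destruct (GT e He) as [C0 [HC H]]; exists C0; auto).
  set (sh := fun (c : R) n x => (RtoC (1 ^ n) * Th n (1 * x + c)%R)%C).
  assert (Jsh : forall c, jet (sh c)) by (intros; now apply jet_affine).
  assert (Gsh : forall c, gev r (sh c)) by (intros; apply gev_affine; auto; apply Rabs_R1).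
  assert (Esh : forall c x, sh c O x = Th O (x + c)) by (intros; unfold sh; simpl; rewrite Rmult_1_l; ring).
  set (pc := fun (c : R) n x => (sh (c + 1)%R n x + RtoC (-1) * sh c n x)%C).
  assert (Jpc : forall c, jet (pc c)) by (intros; apply jet_plus; auto; now apply jet_scal).
  assert (Gpc : forall c, gev r (pc c)) by (intros; apply gev_plus; auto; now apply gev_scal).
  assert (Zpc : forall c x, x <= - c - 1 \/ - c + 1 <= x -> pc c O x = RtoC 0).
  { intros c x Hx. unfold pc. rewrite !Esh. destruct Hx.
    - rewrite !T0 by lra. ring.
    - rewrite !T1 by lra. cring. }
  set (pg := fun (c : R) n => pseq n (pc c) Ga).
  assert (Jpg : forall c, jet (pg c)) by (intros; now apply jet_pseq).
  assert (Gpg : forall c, gev r (pg c)) by (intros; now apply gev_pseq).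
  assert (Vpg : forall c, vanish_out (- c - 2) (- c + 2) (pg c)).
  { intros c. apply vanish_pseq. apply (jet_vanish_out _ (- c - 1) _ (- c + 1)); auto; lra. }
  assert (He : forall n, 0 < / (INR n + 1)) by (intros n; apply Rinv_0_lt_compat; pose proof (pos_INR n); lra).
  assert (Hh : forall n : nat, 0 < (1/2) ^ n) by (intros; apply pow_lt; lra).
  assert (HR : forall n : nat, exists H, jet H /\ (forall x, conv v (H O) x = pg (- INR n - 1) O x) /\ gev r H /\
    forall k x, x <= INR n - 1 -> Cmod (H k x) <= (1/2) ^ n * ((/ (INR n + 1)) ^ k * fa r k)).
  { intros n. set (c := - INR n - 1).
    destruct (one_sided_solution 1 (- c - 2) (- c + 2) (pg c) _ _ Rabs_R1 ltac:(lra) (Jpg c) (Vpg c) (Gpg c) (He n) (Hh n)) as [H [H1 [H2 [H3 H4]]]].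
    exists H. split; [exact H1|split; [exact H2|split; [exact H3|]]]. intros k x Hx. apply H4. intros u Hu. unfold c in *. lra. }
  assert (HL : forall n : nat, exists H, jet H /\ (forall x, conv v (H O) x = pg (INR n) O x) /\ gev r H /\
    forall k x, - INR n + 2 <= x -> Cmod (H k x) <= (1/2) ^ n * ((/ (INR n + 1)) ^ k * fa r k)).
  { intros n. set (c := INR n).
    destruct (one_sided_solution (-1) (- c - 2) (- c + 2) (pg c) _ _ ltac:(rewrite Rabs_left; lra) ltac:(lra) (Jpg c) (Vpg c) (Gpg c) (He n) (Hh n)) as [H [H1 [H2 [H3 H4]]]].
    exists H. split; [exact H1|split; [exact H2|split; [exact H3|]]]. intros k x Hx. apply H4. intros u Hu. unfold c in *. lra. }
  apply functional_choice in HR. destruct HR as [HRf HR].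
  apply functional_choice in HL. destruct HL as [HLf HL].
  set (F := fun n k x => (HRf n k x + HLf n k x)%C).
  assert (JF : forall n, jet (F n)) by (intros n; apply jet_plus; [apply HR|apply HL]).
  assert (GF : forall n, gev r (F n)) by (intros n; apply gev_plus; [apply HR|apply HL]).
  destruct (gev_summable F) as [SF GS].
  { intros M e Hep.
    (* From this index on, [1 / (n + 1) <= e] and [[-M, M]] lies on the small side of both
       solutions; the finitely many others are bounded one by one. *)
    destruct (nfloor_ex (Rabs M + 2 + / e)) as [N [_ HN]].
    { pose proof (Rabs_pos M). pose proof (Rinv_0_lt_compat e Hep). lra. }
    assert (Hfin : exists c : nat -> R, forall n, 0 <= c n /\ forall k x, Rabs x <= M -> Cmod (F n k x) <= c n * (e ^ k * fa r k)).
    { apply (functional_choice (fun n c => 0 <= c /\ forall k x, Rabs x <= M -> Cmod (F n k x) <= c * (e ^ k * fa r k))).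
      intros n. exact (GF n M e Hep). }
    destruct Hfin as [c Hc].
    exists (fun n => if Compare_dec.le_lt_dec (S N) n then 2 * (1/2) ^ n else c n). split.
    - apply (ex_series_incr_n _ (S N)). apply ex_series_ext with (fun k => 2 * (1/2) ^ (S N) * (1/2) ^ k).
      + intros k. destruct (Compare_dec.le_lt_dec (S N) (S N + k)); [|lia]. rewrite pow_add. apply Rmult_assoc.
      + apply ex_series_scal_R, ex_series_geom. rewrite Rabs_pos_eq; lra.
    - intros n k x Hx. destruct (Compare_dec.le_lt_dec (S N) n) as [Hn|Hn]; [|now apply Hc].
      apply le_INR in Hn. rewrite S_INR in Hn. pose proof (Rle_abs M). apply Rabs_le_between in Hx.
      assert (Hie : / (INR n + 1) <= e).
      { rewrite <- (Rinv_inv e). apply Rinv_le_contravar; [now apply Rinv_0_lt_compat|]. pose proof (Rabs_pos M). lra. }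
      assert (Hpow : (/ (INR n + 1)) ^ k * fa r k <= e ^ k * fa r k).
      { apply Rmult_le_compat_r; [left; apply fa_pos|]. apply pow_incr. split; [left; apply He|auto]. }
      pose proof (Rinv_0_lt_compat e Hep).
      unfold F. eapply Rle_trans; [apply Cmod_triangle|].
      assert (A1 : Cmod (HRf n k x) <= (1/2) ^ n * (e ^ k * fa r k)).
      { eapply Rle_trans; [apply HR; lra|]. apply Rmult_le_compat_l; auto. left; apply Hh. }
      assert (A2 : Cmod (HLf n k x) <= (1/2) ^ n * (e ^ k * fa r k)).
      { eapply Rle_trans; [apply HL; lra|]. apply Rmult_le_compat_l; auto. left; apply Hh. }
      lra. }
  exists (fun x => Csum (fun n => F n O x)). split.
  - exists (fun k x => Csum (fun n => F n k x)). split; [now apply jet_series|]. split; auto.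
  - intros x. unfold conv.
    set (F' := fun n j y => (RtoC ((-1) ^ j) * F n j (x - y)%R)%C).
    replace (fun y => Csum (fun n => F n O (x - y))) with (fun y => Csum (fun n => F' n O y)).
    2:{ apply functional_extensionality; intros y. apply Csum_ext; intros n. unfold F'. simpl. ring. }
    assert (JF' : forall n, jet (F' n)) by (intros; now apply jet_reflect).
    assert (SF' : jets_summable F').
    { intros M k. destruct (SF (Rabs x + Rabs M) k) as [b [Hb Hn]]. exists b; split; auto.
      intros n y Hy. unfold F'. rewrite Cmod_mult, Cmod_sign, Rmult_1_l. apply Hn.
      unfold Rminus. eapply Rle_trans; [apply Rabs_triang|]. rewrite Rabs_Ropp. pose proof (Rle_abs M). lra. }
    rewrite (cs_dist_series v Hv F' JF' SF').
    assert (Ev : forall n, v (F' n O) = (pg (- INR n - 1)%R O x + pg (INR n) O x)%C).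
    { intros n. unfold F'. rewrite <- (fun_reflect_0 (F n) x).
      change (v (fun y => F n O (x - y))) with (conv v (F n O) x).
      unfold F. destruct (HR n) as [JR [<- _]], (HL n) as [JL [<- _]].
      unfold conv. rewrite (fun_reflect_0 (HRf n)), (fun_reflect_0 (HLf n)).
      rewrite <- (cs_dist_add v Hv _ _ (jet_reflect _ x JR) (jet_reflect _ x JL)).
      f_equal. apply functional_extensionality; intros y. simpl. ring. }
    apply clim_Csum_unique.
    (* The partition of unity telescopes: [N] pairs of pieces add up to a difference of two steps,
       which is 1 at [x] as soon as [N >= |x| + 1]. *)
    assert (Ep : forall N, Csn (fun n => v (F' n O)) N = ((Th O (x + INR N)%R - Th O (x - INR N)%R) * g x)%C).
    { induction N.
      - simpl. rewrite Rminus_0_r, Rplus_0_r. ring.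
      - change (Csn (fun n => v (F' n O)) (S N)) with (Csn (fun n => v (F' n O)) N + v (F' N O))%C.
        rewrite IHN, Ev. unfold pg; simpl pseq. unfold pc. rewrite !Esh, EGa.
        replace (x + (- INR N - 1 + 1)) with (x - INR N) by ring.
        replace (x + (- INR N - 1)) with (x - INR (S N)) by (rewrite S_INR; ring).
        replace (x + (INR N + 1)) with (x + INR (S N)) by (rewrite S_INR; ring).
        cring. }
    destruct (nfloor_ex (Rabs x + 1)) as [N [_ HN]]; [pose proof (Rabs_pos x); lra|].
    apply is_lim_seq_spec. intros eps. exists (S N). intros n Hn.
    apply le_INR in Hn. rewrite S_INR in Hn. rewrite Ep.
    rewrite T1, T0.
    + replace ((RtoC 1 - RtoC 0) * g x - g x)%C with (RtoC 0) by ring. rewrite Cmod_0, Rminus_0_r, Rabs_R0. apply cond_pos.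
    + pose proof (Rle_abs x). lra.
    + pose proof (Rle_abs (- x)). rewrite Rabs_Ropp in H. lra.
Qed.

Theorem E_invertible_of_lower_bound : E_invertible r v.
Proof.
  split.
  - intros h Hh. apply Gev_E_gev; auto. apply Gev_conv; auto. now apply E_gev_Gev.
  - intros g Hg. destruct (conv_surjective g) as [h [Hh E]]; [now apply E_gev_Gev|].
    exists h. split; [now apply Gev_E_gev|]. now apply functional_extensionality.
Qed.

End Surjectivity.

(** * Convolutors whose symbol has deep dips *)

Lemma conv_cE v z x : cs_dist v -> conv v (cE z) x = (cE z x * dsym v z)%C.
Proof.
  intros Hv. unfold conv, dsym.
  replace (fun y => cE z (- y)) with (Ejet (- z)%C O)
    by (apply functional_extensionality; intros; now rewrite Ejet_0, cE_opp).
  rewrite <- (cs_dist_scal v Hv (cE z x) _ (jet_E (- z)%C)). f_equal.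
  apply functional_extensionality; intros y. rewrite Ejet_0, cE_opp. unfold Rminus. now rewrite cE_plus_x.
Qed.

Lemma jets_summable_reflect F x : jets_summable F ->
  jets_summable (fun n j y => (RtoC ((-1) ^ j) * F n j (x - y)%R)%C).
Proof.
  intros SF M k. destruct (SF (Rabs x + Rabs M) k) as [b [Hb Hn]]. exists b; split; auto.
  intros n y Hy. rewrite Cmod_mult, Cmod_sign, Rmult_1_l. apply Hn.
  unfold Rminus. eapply Rle_trans; [apply Rabs_triang|]. rewrite Rabs_Ropp. pose proof (Rle_abs M). lra.
Qed.

Lemma conv_series v F x : cs_dist v -> (forall n, jet (F n)) -> jets_summable F ->
  conv v (fun y => Csum (fun n => F n O y)) x = Csum (fun n => conv v (F n O) x).
Proof.
  intros Hv JF SF. unfold conv.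
  set (F' := fun n j y => (RtoC ((-1) ^ j) * F n j (x - y)%R)%C).
  replace (fun y => Csum (fun n => F n O (x - y))) with (fun y => Csum (fun n => F' n O y)).
  - rewrite (cs_dist_series v Hv F').
    + apply Csum_ext. intros n. f_equal. unfold F'. now rewrite <- fun_reflect_0.
    + intros; now apply jet_reflect.
    + now apply jets_summable_reflect.
  - apply functional_extensionality; intros y. apply Csum_ext; intros n. unfold F'. simpl. ring.
Qed.

Lemma conv_local v : cs_dist v -> exists M, 0 < M /\ forall F G x, jet F -> jet G ->
  (forall y, Rabs (y - x) < M -> F O y = G O y) -> conv v (F O) x = conv v (G O) x.
Proof.
  intros Hv. destruct (cs_dist_local v Hv) as [M [HM H]]. exists M; split; auto.
  intros F G x JF JG E. unfold conv. rewrite (fun_reflect_0 F), (fun_reflect_0 G).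
  apply (H _ _ (jet_reflect F x JF) (jet_reflect G x JG)).
  intros y Hy. simpl. rewrite E; auto. replace (x - y - x) with (- y) by ring. now rewrite Rabs_Ropp.
Qed.

Lemma fact_le_pow m : INR (fact m) <= INR m ^ m.
Proof.
  rewrite <- pow_INR. apply le_INR. induction m; [simpl; lia|].
  change (fact (S m)) with (S m * fact m)%nat. rewrite Nat.pow_succ_r'.
  apply Nat.mul_le_mono_l. eapply Nat.le_trans; [apply IHm|]. apply Nat.pow_le_mono_l. lia.
Qed.

Section NonSurjectivity.
Variables (u : (R -> C) -> C) (s be q0 : R) (X W : nat -> R) (N : nat -> nat).
Hypotheses (Hu : cs_dist u) (s0 : 0 < s) (s1 : s < 1) (b0 : 0 < be) (b1 : be < 1) (Hq0 : 0 < q0).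
Hypothesis HX0 : forall j, 0 <= X j.
Hypothesis HN1 : forall j, INR j * (1 + w_pow s (X j)) <= INR (N j).
Hypothesis HN2 : forall j, (2 * N j <= N (S j))%nat.
Hypothesis HW : forall j, (INR j + 1) * Rpower (INR (N j)) (1 / be) <= W j.
Hypothesis HX : forall i j, (i < j)%nat -> W j <= X j - X i.
Hypothesis HU1 : forall xi, Cmod (dsym u (RtoC xi)) <= 1.
Hypothesis HU2 : forall j xi, Rabs (xi - X j) <= W j -> Cmod (dsym u (RtoC xi)) <= exp (- (q0 * INR (N j))).

(** Half of the weaker of two damping rates, [q0] inside the dip and 1 from the decay of the bump
    outside it: both kinds of damping are then at most the square of the coefficient
    [exp (- ka N j)]. *)
Let ka := Rmin q0 1 / 2.

Lemma ka_facts : 0 < ka /\ 2 * ka <= q0 /\ 2 * ka <= 1.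
Proof.
  unfold ka. pose proof (Rmin_l q0 1). pose proof (Rmin_r q0 1).
  assert (0 < Rmin q0 1) by (apply Rmin_glb_lt; lra). lra.
Qed.

Let gc (j : nat) := exp (- (ka * INR (N j))).

Lemma N_ge j : INR j <= INR (N j).
Proof. pose proof (HN1 j). pose proof (w_pow_ge_0 s (X j)). pose proof (pos_INR j). nra. Qed.

(** Since [N j >= j (1 + X j ^ s)], half of the exponent [ka N j] eventually exceeds [mu X j ^ s],
    and the other half leaves a geometric series. *)
Lemma gc_series mu : 0 < mu -> ex_series (fun j => gc j * exp (mu * w_pow s (X j))).
Proof.
  intros Hmu. destruct ka_facts as [Hk _].
  destruct (nfloor_ex (2 * mu / ka)) as [J [_ HJ]].
  { apply Rmult_le_pos; [lra|left; now apply Rinv_0_lt_compat]. }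
  apply (ex_series_incr_n _ (S J)).
  apply (ex_series_le (K:=R_AbsRing) (V:=R_CompleteNormedModule) _ (fun k => exp (- (ka / 2)) ^ k)).
  - intros k. set (j := (S J + k)%nat).
    change (norm (gc j * exp (mu * w_pow s (X j)))) with (Rabs (gc j * exp (mu * w_pow s (X j)))).
    unfold gc. rewrite <- exp_plus, Rabs_pos_eq by (left; apply exp_pos).
    rewrite <- Rpower_pow by apply exp_pos. unfold Rpower. rewrite ln_exp. apply exp_le.
    assert (Hj : INR J + 1 + INR k = INR j) by (unfold j; rewrite plus_INR, S_INR; ring).
    pose proof (pos_INR k). pose proof (N_ge j). pose proof (HN1 j). pose proof (w_pow_ge_0 s (X j)).
    assert (Hjm : 2 * mu <= ka * INR j).
    { apply Rmult_lt_compat_l with (r := ka) in HJ; auto. replace (ka * (2 * mu / ka)) with (2 * mu) in HJ by (field; lra). nra. }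
    pose proof (pos_INR j).
    assert (INR j * w_pow s (X j) <= INR (N j)) by nra.
    assert (mu * w_pow s (X j) <= ka / 2 * INR (N j)) by nra.
    assert (ka / 2 * INR k <= ka / 2 * INR (N j)) by (apply Rmult_le_compat_l; pose proof (pos_INR J); lra). lra.
  - apply ex_series_geom. rewrite Rabs_pos_eq by (left; apply exp_pos). rewrite <- exp_0. apply exp_increasing. lra.
Qed.

Definition gjet (j k : nat) (x : R) : C := (RtoC (gc j) * Ejet (RtoC (X j)) k x)%C.

Lemma jet_gjet j : jet (gjet j).
Proof. apply jet_scal, jet_E. Qed.

Lemma gjet_gev : jets_summable gjet /\ gev s (fun k x => Csum (fun n => gjet n k x)).
Proof.
  apply gev_summable. intros M e He.
  destruct (exp_gev s e s0 He) as [mu [Hmu H]].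
  exists (fun j => gc j * exp (mu * w_pow s (X j))). split; [now apply gc_series|].
  intros j k x _. unfold gjet. rewrite Cmod_mult, Cmod_Ejet, cE_real_mod, Rmult_1_r, !Cmod_R.
  rewrite (Rabs_pos_eq (gc j)) by (left; apply exp_pos). rewrite (Rabs_pos_eq (X j)) by auto.
  rewrite Rmult_assoc. apply Rmult_le_compat_l; [left; apply exp_pos|].
  specialize (H (X j) k (HX0 j)). rewrite exp_Ropp in H.
  apply Rmult_le_reg_r with (/ exp (mu * w_pow s (X j))); [apply Rinv_0_lt_compat, exp_pos|].
  replace (exp (mu * w_pow s (X j)) * (e ^ k * fa s k) * / exp (mu * w_pow s (X j))) with (e ^ k * fa s k)
    by (field; apply Rgt_not_eq, exp_pos). exact H.
Qed.

(** Doubling gives [N (j+1+i) >= (2+i) N j], hence the tail is at most [q^2 / (1 - q)] with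
    [q = gc j]; [q <= 1/13] is what brings six times this below [q / 2]. *)
Lemma gc_tail : exists J, forall j, (J <= j)%nat -> 6 * Series (fun i => gc (S j + i)%nat) <= gc j / 2.
Proof.
  destruct ka_facts as [Hk _].
  destruct (nfloor_ex (ln 13 / ka)) as [J [_ HJ]].
  { apply Rmult_le_pos; [|left; now apply Rinv_0_lt_compat]. rewrite <- ln_1. left; apply ln_increasing; lra. }
  exists (S J). intros j Hj.
  set (q := gc j). assert (Hq : 0 < q) by apply exp_pos.
  assert (Hq13 : q <= / 13).
  { unfold q, gc. rewrite exp_Ropp. apply Rinv_le_contravar; [lra|]. rewrite <- (exp_ln 13) by lra. apply exp_le.
    apply le_INR in Hj. rewrite S_INR in Hj. pose proof (N_ge j).
    apply Rmult_lt_compat_l with (r := ka) in HJ; auto. replace (ka * (ln 13 / ka)) with (ln 13) in HJ by (field; lra). nra. }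
  assert (Hi : forall i, (N j * (2 + i) <= N (S j + i))%nat).
  { induction i.
    - rewrite !Nat.add_0_r. pose proof (HN2 j). lia.
    - replace (S j + S i)%nat with (S (S j + i)) by lia. pose proof (HN2 (S j + i)%nat). nia. }
  assert (Hgi : forall i, gc (S j + i)%nat <= q * q * q ^ i).
  { intros i. unfold q, gc. rewrite <- Rpower_pow by apply exp_pos. unfold Rpower. rewrite ln_exp, <- !exp_plus.
    apply exp_le. specialize (Hi i). apply le_INR in Hi. rewrite mult_INR, plus_INR in Hi.
    replace (INR 2) with 2 in Hi by (simpl; ring). nra. }
  assert (Hs : Series (fun i => gc (S j + i)%nat) <= q * q * (1 / (1 - q))).
  { replace (1 / (1 - q)) with (/ (1 - q)) by (field; lra).
    rewrite <- Series_geom by (rewrite Rabs_pos_eq; lra). rewrite <- Series_scal_l.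
    apply Series_le.
    - intros i; split; [left; apply exp_pos|apply Hgi].
    - apply ex_series_scal_R, ex_series_geom. rewrite Rabs_pos_eq; lra. }
  assert (q * (1 / (1 - q)) <= / 12).
  { apply Rmult_le_reg_r with (1 - q); [lra|]. replace (q * (1 / (1 - q)) * (1 - q)) with q by (field; lra). lra. }
  nra.
Qed.

(* Pairing with the bump [B] modulated to the frequency [X j] gives [gc j] for the right-hand side, but at most a
   multiple of [gc j ^ 2] for [conv u h]: there [h] only contributes frequencies near [X j], damped by the dip. *)
Lemma no_preimage h : smooth h -> conv u h = (fun x => Csum (fun n => gjet n O x)) -> False.
Proof.
  intros Hs Eg.
  destruct ka_facts as [Hk [Hkq Hk1]]. pose proof PI_RGT_0 as HPI.
  destruct gjet_gev as [Sg _].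
  destruct (gevrey_cutoff be 1 b0 b1 ltac:(lra)) as [B [JB [GB [B1 [B0 B01]]]]].
  assert (VB : vanish_out (-3) 3 B).
  { replace (-3) with (- (1 + 2)) by ring. replace 3 with (1 + 2) by ring. apply cutoff_vanish; auto; lra. }
  assert (CB := jet_ccont B O JB).
  set (Th := fun eta => FT (-3) 3 (B O) (RtoC eta)).
  assert (Hre : forall eta t, Cmod (cE (- RtoC eta) t) <= 1).
  { intros. replace (- RtoC eta)%C with (RtoC (- eta)) by cring. rewrite cE_real_mod. lra. }
  assert (HB01 : forall t, Cmod (B O t) <= 1).
  { intros t. destruct (B01 t) as [y [Hy ->]]. rewrite Cmod_R, Rabs_pos_eq; lra. }
  assert (Th6 : forall eta, Cmod (Th eta) <= 6).
  { intros eta. unfold Th, FT. replace 6 with (1 * (3 - -3)) by ring. apply CI_bound; [lra| |].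
    - apply ccont_mult; auto using cE_ccont.
    - intros t _. rewrite Cmod_mult. rewrite <- (Rmult_1_l 1). apply Rmult_le_compat; auto using Cmod_ge_0. }
  assert (Th0 : 2 <= Cmod (Th 0)).
  { eapply Rle_trans; [|apply Rabs_fst_le]. eapply Rle_trans; [|apply Rle_abs].
    unfold Th, FT, CI. simpl fst.
    apply Rle_trans with (RInt (fun t => fst (B O t)) (-3) 3).
    - apply Rle_trans with (RInt (fun t => fst (B O t)) (-1) 1).
      + right. rewrite (RInt_ext (V:=R_CompleteNormedModule) _ (fun _ => 1)).
        * rewrite (RInt_const (V:=R_CompleteNormedModule)). unfold scal; simpl; unfold mult; simpl. ring.
        * intros t. rewrite Rmin_left, Rmax_right by lra. intros Ht. rewrite B1; auto. apply Rabs_le; lra.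
      + apply RInt_mono_interval; try lra; [apply CB|]. intros t. destruct (B01 t) as [y [Hy ->]]. simpl; lra.
    - right. apply (RInt_ext (V:=R_CompleteNormedModule)). intros t _.
      replace (- 0 * t) with 0 by ring. rewrite Ropp_0, exp_0, cos_0, sin_0. match goal with |- ?A1 = ?A2 => change (@eq R A1 A2) end. ring. }
  destruct (GB 3 1 Rlt_0_1) as [CT [HCT HT]].
  (* Integration by parts [N j] times gives [(N!)^(1/be) / |eta|^N]. As [N! <= N^N] and
     [|eta| >= W j >= e N^(1/be)], where [j >= 3] supplies the factor [e], the quotient is at most
     [e^(-N)]. *)
  assert (ThN : forall j eta, (3 <= j)%nat -> W j <= Rabs eta -> Cmod (Th eta) <= 6 * CT * exp (- (INR (N j)))).
  { intros j eta Hj HWj.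
    assert (HNp : 1 <= INR (N j)).
    { pose proof (N_ge j). apply le_INR in Hj. simpl in Hj. lra. }
    assert (FB := FT_bound (-3) 3 B (RtoC eta) (N j) (CT * fa be (N j)) 1 ltac:(lra) JB VB).
    rewrite Cmod_R in FB. fold (Th eta) in FB.
    assert (FB' : Rabs eta ^ N j * Cmod (Th eta) <= CT * fa be (N j) * 1 * (3 - -3)).
    { apply FB; auto. intros t Ht. specialize (HT (N j) t). rewrite pow1, Rmult_1_l in HT. apply HT. apply Rabs_le; lra. }
    set (ro := Rpower (INR (N j)) (1 / be)) in *. assert (Hro : 0 < ro) by apply exp_pos.
    assert (Hfa : fa be (N j) <= ro ^ N j).
    { unfold fa, ro. rewrite <- Rpower_pow_comm by lra. apply Rpower_le_base; [apply INR_fact_lt_0|apply fact_le_pow|].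
      left; apply Rdiv_lt_0_compat; lra. }
    specialize (HW j). fold ro in HW.
    assert (Heta : exp 1 * ro <= Rabs eta).
    { apply le_INR in Hj. simpl in Hj. pose proof exp_le_3. nra. }
    assert (Hpw : (exp 1 * ro) ^ N j <= Rabs eta ^ N j) by (apply pow_incr; split; auto; pose proof (exp_pos 1); nra).
    rewrite Rpow_mult_distr in Hpw.
    assert (Ee : exp 1 ^ N j = exp (INR (N j))).
    { rewrite <- Rpower_pow by apply exp_pos. unfold Rpower. rewrite ln_exp. f_equal; ring. }
    rewrite Ee in Hpw. rewrite exp_Ropp. assert (Hrn : 0 < ro ^ N j) by now apply pow_lt.
    pose proof (exp_pos (INR (N j))). pose proof (Cmod_ge_0 (Th eta)).
    apply Rmult_le_reg_l with (exp (INR (N j)) * ro ^ N j); [now apply Rmult_lt_0_compat|].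
    replace (exp (INR (N j)) * ro ^ N j * (6 * CT * / exp (INR (N j)))) with (6 * CT * ro ^ N j) by (field; lra).
    apply Rle_trans with (Rabs eta ^ N j * Cmod (Th eta)); [now apply Rmult_le_compat_r|].
    eapply Rle_trans; [exact FB'|]. nra. }
  assert (JD := smooth_jet h Hs).
  destruct (conv_local u Hu) as [M [HM Hloc]].
  destruct (gevrey_cutoff be (M + 3) b0 b1 ltac:(lra)) as [Q [JQ [_ [Q1 [Q0 _]]]]].
  set (K1 := M + 3 + 2).
  assert (VQ : vanish_out (- K1) K1 Q) by (apply cutoff_vanish; auto; lra).
  (* Nothing is known about the growth of [h]. The convolution on [[-3, 3]] depends on [h] on a
     bounded interval only, where this truncation agrees with it. *)
  set (P := fun n => pseq n Q (cderiv_n h)).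
  assert (JP : jet P) by now apply jet_pseq.
  assert (VP : vanish_out (- K1) K1 P) by now apply vanish_pseq.
  assert (HK1 : - K1 <= K1) by (unfold K1; lra).
  (* Half a period, [PI * T = 2 K1], so that for every [x] in [[-K1, K1]] the support of [P] lies in
     the period centred at [x]. *)
  set (T := 2 * K1 / PI).
  assert (HT0 : 0 < T) by (apply Rdiv_lt_0_compat; unfold K1; lra).
  assert (HTK : PI * T = 2 * K1) by (unfold T; field; lra).
  set (c := fun xi => FT (- K1) K1 (P O) (RtoC xi)).
  assert (Hc : forall k, exists b, 0 <= b /\ forall xi, Rabs xi ^ k * Cmod (c xi) <= b / (1 + xi ^ 2)).
  { intros k. destruct (FT_real_bound (- K1) K1 (fun n => P (k + n)%nat) HK1 (jet_shift P k JP) (vanish_shift _ _ P k VP)) as [b [Hb0 Hb]].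
    exists b; split; auto. intros xi. specialize (Hb xi). rewrite Nat.add_0_r, FT_pow in Hb by auto.
    rewrite Cmod_mult, Cmod_pow, Cmod_mult, Cmod_Ci, Rmult_1_l, Cmod_R in Hb. exact Hb. }
  set (fr := fun n : nat => INR n / T). set (fl := fun n : nat => (- INR n - 1) / T).
  assert (Hsum : forall k, exists b : nat -> R, ex_series b /\ forall n,
     Rabs (fr n) ^ k * Cmod (c (fr n)) + Rabs (fl n) ^ k * Cmod (c (fl n)) <= b n).
  { intros k. destruct (Hc k) as [b [Hb0 Hb]].
    exists (fun n => (4 * b * (T ^ 2 + 1)) * / (INR n + 1) ^ 2).
    split; [apply ex_series_scal_R, ex_series_inv_sq|]. intros n. pose proof (pos_INR n).
    assert (Q2 : forall xi, INR n ^ 2 <= (xi * T) ^ 2 -> b / (1 + xi ^ 2) <= (2 * b * (T ^ 2 + 1)) * / (INR n + 1) ^ 2).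
    { intros xi Hxi. pose proof (pow2_ge_0 xi). assert (0 < T ^ 2) by (apply pow_lt; lra).
      apply Rmult_le_reg_r with ((1 + xi ^ 2) * (INR n + 1) ^ 2); [apply Rmult_lt_0_compat; [lra|apply pow_lt; lra]|].
      replace (b / (1 + xi ^ 2) * ((1 + xi ^ 2) * (INR n + 1) ^ 2)) with (b * (INR n + 1) ^ 2) by (field; lra).
      replace (2 * b * (T ^ 2 + 1) * / (INR n + 1) ^ 2 * ((1 + xi ^ 2) * (INR n + 1) ^ 2)) with (b * (2 * (T ^ 2 + 1) * (1 + xi ^ 2))) by (field; lra).
      apply Rmult_le_compat_l; auto. rewrite Rpow_mult_distr in Hxi.
      assert ((INR n + 1) ^ 2 <= 2 * (INR n ^ 2 + 1)) by (pose proof (pow2_ge_0 (INR n - 1)); lra). lra. }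
    assert (E1 : INR n ^ 2 <= (fr n * T) ^ 2) by (unfold fr; replace (INR n / T * T) with (INR n) by (field; lra); lra).
    assert (E2 : INR n ^ 2 <= (fl n * T) ^ 2) by (unfold fl; replace ((- INR n - 1) / T * T) with (- INR n - 1) by (field; lra); nra).
    pose proof (Hb (fr n)). pose proof (Hb (fl n)). pose proof (Q2 _ E1). pose proof (Q2 _ E2). lra. }
  set (cT := RtoC (/ (T * (2 * PI)))).
  assert (HcT : 0 < / (T * (2 * PI))) by (apply Rinv_0_lt_compat, Rmult_lt_0_compat; lra).
  (* The pairs of terms of the Fourier series of the truncation, with coefficients multiplied by
     [U]: [U = 1] reproduces the truncation, and the symbol of [u] gives its convolution by [u]. *)
  set (A := fun (U : R -> C) n k x => (cT * (c (fr n) * U (fr n) * Ejet (RtoC (fr n)) k x + c (fl n) * U (fl n) * Ejet (RtoC (fl n)) k x))%C).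
  assert (JA : forall U n, jet (A U n)).
  { intros U n. apply jet_scal. apply (jet_plus (fun k x => (c (fr n) * U (fr n) * Ejet (RtoC (fr n)) k x)%C)); now apply jet_scal, jet_E. }
  assert (SA : forall U, (forall xi, Cmod (U xi) <= 1) -> jets_summable (A U)).
  { intros U HU M' k. destruct (Hsum k) as [b [Hb Hn]]. exists (fun n => / (T * (2 * PI)) * b n).
    split; [now apply ex_series_scal_R|]. intros n x _. unfold A, cT.
    rewrite Cmod_mult, Cmod_R, Rabs_pos_eq by lra. apply Rmult_le_compat_l; [lra|].
    eapply Rle_trans; [|apply Hn]. eapply Rle_trans; [apply Cmod_triangle|].
    apply Rplus_le_compat; rewrite !Cmod_mult, Cmod_Ejet, cE_real_mod, Cmod_R, Rmult_1_r.
    - pose proof (Cmod_ge_0 (c (fr n))). pose proof (HU (fr n)). pose proof (pow_le _ k (Rabs_pos (fr n))).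
      rewrite (Rmult_comm (Rabs (fr n) ^ k)). apply Rmult_le_compat_r; auto. nra.
    - pose proof (Cmod_ge_0 (c (fl n))). pose proof (HU (fl n)). pose proof (pow_le _ k (Rabs_pos (fl n))).
      rewrite (Rmult_comm (Rabs (fl n) ^ k)). apply Rmult_le_compat_r; auto. nra. }
  set (one := fun _ : R => RtoC 1). set (Us := fun xi => dsym u (RtoC xi)).
  assert (S1 := SA one ltac:(intros; unfold one; rewrite Cmod_1; lra)).
  assert (SU := SA Us HU1).
  assert (EP : forall x, Rabs x <= K1 -> Csum (fun n => A one n O x) = P O x).
  { intros x Hx. apply Rabs_le_between in Hx. apply clim_Csum_unique.
    assert (Hf := fourier_series_shifted (- K1) K1 P HK1 JP VP x T 0 HT0 ltac:(lra) ltac:(lra)).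
    apply (clim_scal cT) in Hf.
    replace (cT * (RtoC (T * (2 * PI)) * P O x))%C with (P O x) in Hf.
    - eapply is_lim_seq_ext; [|exact Hf]. intros n; simpl. do 2 f_equal. rewrite <- Csn_scal. apply Csn_ext. intros k.
      unfold A, pairsum, Fx, one. rewrite !Ejet_0, !Rplus_0_l. fold (fr k). fold (fl k).
      unfold c. ring.
    - unfold cT. rewrite Cmult_assoc, <- RtoC_mult, Rinv_l by (apply Rgt_not_eq, Rmult_lt_0_compat; lra). ring. }
  assert (Eg2 : forall x, Rabs x <= 3 -> Csum (fun n => gjet n O x) = Csum (fun n => A Us n O x)).
  { intros x Hx. rewrite <- (f_equal (fun f => f x) Eg). simpl.
    rewrite <- (cderiv_n_0 h).
    rewrite (Hloc (cderiv_n h) (fun k y => Csum (fun n => A one n k y)) x JD (jet_series _ (JA one) S1)).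
    - rewrite (conv_series u (A one) x Hu (JA one) S1). apply Csum_ext. intros n.
      assert (Ec : forall z x0, conv u (fun y => Ejet z O y) x0 = (cE z x0 * dsym u z)%C).
      { intros z x0. rewrite <- conv_cE by auto. f_equal. apply functional_extensionality; intros; now rewrite Ejet_0. }
      assert (HG : forall z, exists G, jet G /\ (forall y, G O y = Ejet z O (x - y)) /\ u (G O) = (cE z x * dsym u z)%C).
      { intros z. exists (fun j y => (RtoC ((-1) ^ j) * Ejet z j (x - y)%R)%C). split; [apply (jet_reflect (Ejet z)), jet_E|].
        split; [intros; simpl; ring|]. rewrite <- Ec. unfold conv. now rewrite (fun_reflect_0 (Ejet z)). }
      destruct (HG (RtoC (fr n))) as [G1 [J1 [E1 U1]]]. destruct (HG (RtoC (fl n))) as [G2 [J2 [E2 U2]]].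
      assert (Ea := cs_dist_add u Hu _ _ (jet_scal (cT * c (fr n))%C _ J1) (jet_scal (cT * c (fl n))%C _ J2)).
      cbv beta in Ea.
      rewrite (cs_dist_scal u Hu _ _ J1), (cs_dist_scal u Hu _ _ J2), U1, U2 in Ea.
      transitivity (cT * c (fr n) * (cE (RtoC (fr n)) x * dsym u (RtoC (fr n))) + cT * c (fl n) * (cE (RtoC (fl n)) x * dsym u (RtoC (fl n))))%C.
      + rewrite <- Ea. unfold conv. f_equal. apply functional_extensionality; intros y. rewrite E1, E2. unfold A, one. ring.
      + unfold A, Us. rewrite !Ejet_0. ring.
    - intros y Hy. rewrite EP.
      + unfold P. simpl. rewrite Q1; [ring|]. replace y with ((y - x) + x) by ring.
        eapply Rle_trans; [apply Rabs_triang|]. lra.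
      + replace y with ((y - x) + x) by ring. eapply Rle_trans; [apply Rabs_triang|]. unfold K1; lra. }
  assert (Hdens : forall j, ccont (fun t => (B O t * cE (- RtoC (X j)) t)%C)) by (intros; apply ccont_mult; auto using cE_ccont).
  set (L := fun j (phi : R -> C) => CI (fun t => (B O t * cE (- RtoC (X j)) t * phi t)%C) (-3) 3).
  assert (HL : forall j, cs_dist (L j)) by (intros j; apply (int_cs_dist _ (-3) 3); [lra|apply Hdens]).
  assert (LE : forall j xi, L j (Ejet (RtoC xi) O) = Th (X j - xi)).
  { intros j xi. unfold L, Th, FT. apply CI_ext. intros t. rewrite Ejet_0.
    replace (- RtoC (X j - xi))%C with (- RtoC (X j) + RtoC xi)%C by cring. rewrite cE_plus_z. ring. }
  assert (Lg : forall j, L j (fun x => Csum (fun n => gjet n O x)) = Csum (fun n => (RtoC (gc n) * Th (X j - X n)%R)%C)).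
  { intros j. rewrite (cs_dist_series (L j) (HL j) gjet jet_gjet Sg). apply Csum_ext. intros n.
    unfold gjet. rewrite (cs_dist_scal (L j) (HL j) _ _ (jet_E _)). now rewrite LE. }
  assert (LA : forall j, L j (fun x => Csum (fun n => gjet n O x)) =
     Csum (fun n => (cT * (c (fr n) * Us (fr n) * Th (X j - fr n)%R + c (fl n) * Us (fl n) * Th (X j - fl n)%R))%C)).
  { intros j. transitivity (L j (fun x => Csum (fun n => A Us n O x))).
    - apply CI_ext_in; [lra|]. intros t Ht. rewrite Eg2; auto. apply Rabs_le; lra.
    - rewrite (cs_dist_series (L j) (HL j) (A Us) (JA Us) SU). apply Csum_ext. intros n. unfold A.
      assert (J1 := jet_E (RtoC (fr n))). assert (J2 := jet_E (RtoC (fl n))).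
      rewrite (cs_dist_scal (L j) (HL j) cT (fun k x => (c (fr n) * Us (fr n) * Ejet (RtoC (fr n)) k x + c (fl n) * Us (fl n) * Ejet (RtoC (fl n)) k x)%C)).
      2: apply (jet_plus (fun k x => (c (fr n) * Us (fr n) * Ejet (RtoC (fr n)) k x)%C)); now apply jet_scal.
      rewrite (cs_dist_add (L j) (HL j) _ _ (jet_scal (c (fr n) * Us (fr n))%C _ J1) (jet_scal (c (fl n) * Us (fl n))%C _ J2)).
      rewrite (cs_dist_scal (L j) (HL j) _ _ J1), (cs_dist_scal (L j) (HL j) _ _ J2), !LE. reflexivity. }
  destruct (Hsum 0%nat) as [b [Hb Hbn]]. simpl pow in Hbn.
  set (Kc := 6 * (1 + CT) * (/ (T * (2 * PI)) * Series b)).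
  (* Every frequency [xi] is damped: within [W j] of [X j] by the dip, farther away by the decay of
     the bump. Both give [exp (- 2 ka N j)], the square of [gc j]. *)
  assert (UT : forall j xi, (3 <= j)%nat -> Cmod (Us xi) * Cmod (Th (X j - xi)) <= 6 * (1 + CT) * exp (- (2 * ka * INR (N j)))).
  { intros j xi Hj. pose proof (Cmod_ge_0 (Us xi)). pose proof (Cmod_ge_0 (Th (X j - xi))).
    pose proof (pos_INR (N j)).
    destruct (Rle_dec (Rabs (xi - X j)) (W j)) as [Hx|Hx].
    - assert (H2 := HU2 j xi Hx). fold (Us xi) in H2. pose proof (Th6 (X j - xi)).
      assert (exp (- (q0 * INR (N j))) <= exp (- (2 * ka * INR (N j)))) by (apply exp_le; nra).
      pose proof (exp_pos (- (2 * ka * INR (N j)))).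
      apply Rle_trans with (exp (- (2 * ka * INR (N j))) * 6); [apply Rmult_le_compat; lra|nra].
    - assert (H2 := ThN j (X j - xi) Hj). rewrite Rabs_minus_sym in H2. specialize (H2 ltac:(lra)).
      assert (H3 := HU1 xi). fold (Us xi) in H3.
      assert (exp (- INR (N j)) <= exp (- (2 * ka * INR (N j)))) by (apply exp_le; nra).
      pose proof (exp_pos (- INR (N j))). pose proof (exp_pos (- (2 * ka * INR (N j)))).
      apply Rle_trans with (1 * (6 * CT * exp (- INR (N j)))); [apply Rmult_le_compat; lra|]. nra. }
  assert (Upper : forall j, (3 <= j)%nat -> Cmod (L j (fun x => Csum (fun n => gjet n O x))) <= Kc * exp (- (2 * ka * INR (N j)))).
  { intros j Hj. rewrite LA.
    replace (Kc * exp (- (2 * ka * INR (N j)))) with (Series (fun n => (6 * (1 + CT) * exp (- (2 * ka * INR (N j))) * / (T * (2 * PI))) * b n))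
      by (rewrite Series_scal_l; unfold Kc; ring).
    apply Csum_bound; [|now apply ex_series_scal_R]. intros n. unfold cT. rewrite Cmod_mult, Cmod_R, Rabs_pos_eq by lra.
    replace (6 * (1 + CT) * exp (- (2 * ka * INR (N j))) * / (T * (2 * PI)) * b n) with
      (/ (T * (2 * PI)) * (b n * (6 * (1 + CT) * exp (- (2 * ka * INR (N j)))))) by ring.
    apply Rmult_le_compat_l; [lra|]. eapply Rle_trans; [apply Cmod_triangle|]. rewrite !Cmod_mult, !Rmult_assoc.
    specialize (Hbn n). rewrite !Rmult_1_l in Hbn.
    pose proof (Cmod_ge_0 (c (fr n))). pose proof (Cmod_ge_0 (c (fl n))).
    set (de := 6 * ((1 + CT) * exp (- (2 * (ka * INR (N j)))))).
    assert (Hde : 6 * (1 + CT) * exp (- (2 * ka * INR (N j))) = de) by (unfold de; rewrite !Rmult_assoc; reflexivity).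
    assert (U1 := UT j (fr n) Hj). assert (U2 := UT j (fl n) Hj). rewrite Hde in U1, U2.
    assert (0 <= de).
    { unfold de. pose proof (exp_pos (- (2 * (ka * INR (N j))))). repeat apply Rmult_le_pos; lra. }
    apply Rle_trans with (Cmod (c (fr n)) * de + Cmod (c (fl n)) * de).
    - apply Rplus_le_compat; now apply Rmult_le_compat_l.
    - rewrite <- Rmult_plus_distr_r. now apply Rmult_le_compat_r. }
  assert (Sgc : ex_series gc).
  { apply (ex_series_le (K:=R_AbsRing) (V:=R_CompleteNormedModule) _ _ ) with (2 := gc_series 1 Rlt_0_1).
    intros n. change (norm (gc n)) with (Rabs (gc n)). assert (0 < gc n) by apply exp_pos. rewrite Rabs_pos_eq by lra.
    assert (1 <= exp (1 * w_pow s (X n))) by (pose proof (exp_ineq1_le (1 * w_pow s (X n))); pose proof (w_pow_ge_0 s (X n)); lra). nra. }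
  destruct gc_tail as [J0 HJ0].
  set (Kg := 6 * CT * Series gc).
  (* In the direct computation the term [j] contributes at least [2 gc j]. The earlier terms have
     frequencies at least [W j] away and meet the decay of the bump; the later ones together cost at
     most half of [gc j]. *)
  assert (Lower : forall j, (3 <= j)%nat -> (J0 <= j)%nat -> 
     gc j <= Cmod (L j (fun x => Csum (fun n => gjet n O x))) + Kg * exp (- INR (N j))).
  { intros j Hj HjJ. rewrite Lg.
    set (a := fun n => (RtoC (gc n) * Th (X j - X n)%R)%C).
    assert (Hgc : forall n, 0 < gc n) by (intros; apply exp_pos).
    assert (Ha6 : forall n, Cmod (a n) <= 6 * gc n).
    { intros n. unfold a. rewrite Cmod_mult, Cmod_RtoC_pos by (left; apply Hgc). rewrite Rmult_comm.
      apply Rmult_le_compat_r; [left; apply Hgc|apply Th6]. }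
    assert (S6 : ex_series (fun n => 6 * gc n)) by now apply ex_series_scal_R.
    assert (Hsp := Csum_shift a _ (S j) Ha6 S6).
    assert (Htail : Cmod (Csum (fun k => a (S j + k)%nat)) <= gc j / 2).
    { eapply Rle_trans; [apply (Csum_bound _ (fun k => 6 * gc (S j + k)%nat)); [intros; apply Ha6|]|].
      - apply ex_series_scal_R. now apply (ex_series_incr_n gc (S j)).
      - rewrite Series_scal_l. now apply HJ0. }
    assert (Hhead : Cmod (Csn a j) <= Kg * exp (- INR (N j))).
    { set (a' := fun n => if lt_dec n j then a n else RtoC 0).
      replace (Csn a j) with (Csn a' j).
      - unfold Kg. replace (6 * CT * Series gc * exp (- INR (N j))) with (Series (fun n => 6 * CT * exp (- INR (N j)) * gc n)) by (rewrite Series_scal_l; ring).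
        apply Csn_bound; [|now apply ex_series_scal_R]. intros n. unfold a'. pose proof (Hgc n). pose proof (exp_pos (- INR (N j))).
        destruct (lt_dec n j).
        + unfold a. rewrite Cmod_mult, Cmod_RtoC_pos by lra. rewrite Rmult_comm. apply Rmult_le_compat_r; [lra|].
          apply ThN; auto. eapply Rle_trans; [apply (HX n j); auto|apply Rle_abs].
        + rewrite Cmod_0. repeat apply Rmult_le_pos; lra.
      - assert (Q3 : forall m, (m <= j)%nat -> Csn a' m = Csn a m).
        { induction m; intros Hm; auto. simpl. rewrite IHm by lia. unfold a'. destruct (lt_dec m j); [auto|lia]. }
        now apply Q3. }
    assert (Hmid : 2 * gc j <= Cmod (a j)).
    { unfold a. rewrite Cmod_mult, Cmod_RtoC_pos by (left; apply Hgc). replace (X j - X j) with 0 by ring.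
      rewrite Rmult_comm. apply Rmult_le_compat_l; [left; apply Hgc|exact Th0]. }
    assert (Ea : a j = (Csum a - Csn a j - Csum (fun k => a (S j + k)%nat))%C).
    { rewrite Hsp. change (Csn a (S j)) with (Csn a j + a j)%C. ring. }
    assert (Cmod (a j) <= Cmod (Csum a) + Cmod (Csn a j) + Cmod (Csum (fun k => a (S j + k)%nat))).
    { rewrite Ea at 1. unfold Cminus. eapply Rle_trans; [apply Cmod_triangle|]. rewrite Cmod_opp.
      apply Rplus_le_compat_r. eapply Rle_trans; [apply Cmod_triangle|]. rewrite Cmod_opp. lra. }
    pose proof (Hgc j). lra. }
  (* Both bounds together read [gc j <= (Kc + Kg) gc j ^ 2], which fails once [ka N j] exceeds
     [|Kc| + |Kg|], because [gc j (1 + ka N j) <= 1]. *)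
  destruct (nfloor_ex ((Rabs Kc + Rabs Kg) / ka)) as [J1 [_ HJ1]].
  { apply Rmult_le_pos; [pose proof (Rabs_pos Kc); pose proof (Rabs_pos Kg); lra|left; now apply Rinv_0_lt_compat]. }
  set (j := (3 + J0 + S J1)%nat).
  specialize (Upper j ltac:(unfold j; lia)). specialize (Lower j ltac:(unfold j; lia) ltac:(unfold j; lia)).
  assert (HjN : INR J1 + 1 <= INR (N j)).
  { eapply Rle_trans; [|apply N_ge]. rewrite <- S_INR. apply le_INR. unfold j; lia. }
  set (n := INR (N j)) in *.
  assert (Hn : (Rabs Kc + Rabs Kg) < ka * n).
  { apply Rmult_lt_compat_l with (r := ka) in HJ1; auto. replace (ka * ((Rabs Kc + Rabs Kg) / ka)) with (Rabs Kc + Rabs Kg) in HJ1 by (field; lra).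
    nra. }
  assert (Hn0 : 0 <= n) by apply pos_INR.
  assert (E2 : exp (- (2 * ka * n)) = gc j * gc j) by (unfold gc; fold n; rewrite <- exp_plus; f_equal; ring).
  assert (E3 : exp (- n) <= gc j * gc j) by (rewrite <- E2; apply exp_le; nra).
  assert (Hg : 0 < gc j) by apply exp_pos.
  assert (Hgn : gc j * (1 + ka * n) <= 1).
  { unfold gc. fold n. rewrite exp_Ropp. pose proof (exp_ineq1_le (ka * n)). pose proof (exp_pos (ka * n)).
    apply Rmult_le_reg_l with (exp (ka * n)); auto. rewrite <- Rmult_assoc, Rinv_r by lra. lra. }
  pose proof (Rle_abs Kc). pose proof (Rle_abs Kg). pose proof (Rabs_pos Kc). pose proof (Rabs_pos Kg).
  rewrite E2 in Upper. pose proof (exp_pos (- n)).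
  assert (gc j <= (Rabs Kc + Rabs Kg) * (gc j * gc j)) by nra.
  assert (1 <= (Rabs Kc + Rabs Kg) * gc j).
  { apply Rmult_le_reg_r with (gc j); auto. lra. }
  nra.
Qed.

Theorem not_E_invertible_of_dips : ~ E_invertible s u.
Proof.
  intros [_ H]. destruct gjet_gev as [Sg Gg].
  destruct (H (fun x => Csum (fun n => gjet n O x))) as [h [Hh E]].
  - apply Gev_E_gev; auto. exists (fun k x => Csum (fun n => gjet n k x)). split; [|split]; auto.
    apply jet_series; auto. apply jet_gjet.
  - apply (no_preimage h); auto. unfold E_gev in Hh. destruct (Rlt_dec s 1); [|lra]. apply Hh.
Qed.

End NonSurjectivity.

(** * The dip factor *)

Definition csin (z : C) : C := (sin (fst z) * cosh (snd z), cos (fst z) * sinh (snd z)).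

(** The entire function [sin z / z], written as the transform of the uniform probability on
    [[-1, 1]]: there is no singularity to remove, and multiplying by it means averaging over
    translations. *)
Definition Snc (z : C) : C := (/ 2 * CI (cE z) (-1) 1)%C.

Lemma Snc_csin z : (z * Snc z)%C = csin z.
Proof.
  assert (H := CI_FTC (cE z) (fun x => (Ci * z * cE z x)%C) (-1) 1 (cE_der z)
    (ccont_mult _ _ (ccont_const _) (cE_ccont z))).
  rewrite (CI_scal (Ci * z)%C (cE z)) in H by apply cE_ccont.
  unfold Snc. set (I := CI (cE z) (-1) 1) in *.
  replace (z * (/ 2 * I))%C with (/ (2 * Ci) * (Ci * z * I))%C.
  - rewrite H. unfold csin, cE, cosh, sinh. destruct z as [x y]. simpl fst; simpl snd.
    replace (- (y * 1)) with (- y) by ring. replace (- (y * -1)) with y by ring.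
    replace (x * 1) with x by ring. replace (x * -1) with (- x) by ring. rewrite cos_neg, sin_neg.
    apply C_eq; simpl; field.
  - field. intros E. injection E. lra.
Qed.

Lemma cosh_sinh_sqr y : cosh y ^ 2 = 1 + sinh y ^ 2.
Proof.
  unfold cosh, sinh. assert (exp y * exp (- y) = 1) by (rewrite <- exp_plus; replace (y + - y) with 0 by ring; apply exp_0).
  set (p := exp y) in *. set (q := exp (- y)) in *. nra.
Qed.

Lemma Cmod_sqr z : Cmod z ^ 2 = fst z ^ 2 + snd z ^ 2.
Proof. unfold Cmod. rewrite <- Rsqr_pow2, Rsqr_sqrt; auto. nra. Qed.

Lemma Cmod_csin_sqr z : Cmod (csin z) ^ 2 = sin (fst z) ^ 2 + sinh (snd z) ^ 2.
Proof.
  rewrite Cmod_sqr. unfold csin. simpl fst; simpl snd. rewrite !Rpow_mult_distr, cosh_sinh_sqr.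
  pose proof (sin2_cos2 (fst z)) as H. unfold Rsqr in H. nra.
Qed.

Lemma Snc_mod_sqr z : Cmod z ^ 2 * Cmod (Snc z) ^ 2 = sin (fst z) ^ 2 + sinh (snd z) ^ 2.
Proof. rewrite <- Rpow_mult_distr, <- Cmod_mult, Snc_csin. apply Cmod_csin_sqr. Qed.

Lemma Snc_0 : Snc 0 = 1.
Proof.
  unfold Snc. replace (CI (cE 0) (-1) 1) with (CI (fun _ => RtoC 1) (-1) 1).
  - rewrite CI_const. apply C_eq; simpl; field.
  - apply CI_ext. intros t. now rewrite cE_z0.
Qed.

(** The lower bound for [|x| <= 1] comes from [cos (x t) >= cos (PI / 3) = 1/2] under the
    integral. *)
Lemma Snc_real x : exists y, Snc (RtoC x) = RtoC y /\ -1 <= y <= 1 /\ (Rabs x <= 1 -> / 2 <= y).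
Proof.
  assert (Hi : exists y, Snc (RtoC x) = RtoC y).
  { destruct (Req_dec x 0) as [->|Hx]; [exists 1; apply Snc_0|]. exists (sin x / x).
    assert (H := Snc_csin (RtoC x)). unfold csin in H. simpl in H. rewrite cosh_0, sinh_0 in H.
    replace (Snc (RtoC x)) with (RtoC (/ x) * (RtoC x * Snc (RtoC x)))%C.
    - rewrite H. apply C_eq; simpl; field; auto.
    - rewrite Cmult_assoc, <- RtoC_mult, Rinv_l by auto. apply Cmult_1_l. }
  destruct Hi as [y Hy]. exists y; split; auto. split.
  - apply Rabs_le_between. rewrite <- Cmod_R, <- Hy. unfold Snc.
    rewrite Cmod_mult, Cmod_inv by (intros E; injection E; lra).
    rewrite (Cmod_R 2), (Rabs_pos_eq 2) by lra.
    assert (Cmod (CI (cE (RtoC x)) (-1) 1) <= 1 * (1 - -1)).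
    { apply CI_bound; [lra|apply cE_ccont|]. intros. rewrite cE_real_mod. lra. }
    lra.
  - intros Hx. assert (E : y = / 2 * RInt (fun t => cos (x * t)) (-1) 1).
    { apply (f_equal fst) in Hy. simpl in Hy. rewrite <- Hy.
      replace (RInt (fun t => exp (- (0 * t)) * cos (x * t)) (-1) 1) with (RInt (fun t => cos (x * t)) (-1) 1).
      - field.
      - apply (RInt_ext (V:=R_CompleteNormedModule)). intros t _. replace (- (0 * t)) with 0 by ring. rewrite exp_0. now rewrite Rmult_1_l. }
    assert (1 <= RInt (fun t => cos (x * t)) (-1) 1); [|lra].
    replace 1 with (RInt (fun _ : R => / 2) (-1) 1) at 1.
    + apply RInt_le; [lra|apply ex_RInt_const| |].
      * apply (ex_RInt_continuous (V:=R_CompleteNormedModule)). intros t _.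
        apply (ex_derive_continuous (V:=R_NormedModule)). auto_derive; auto.
      * intros t Ht. assert (Hxt : Rabs (x * t) <= 1).
        { rewrite Rabs_mult. rewrite <- (Rmult_1_l 1). apply Rmult_le_compat; auto using Rabs_pos. apply Rabs_le; lra. }
        pose proof PI2_3_2. replace (/ 2) with (cos (PI / 3)) by (rewrite cos_PI3; field).
        replace (cos (x * t)) with (cos (Rabs (x * t))) by (unfold Rabs; destruct (Rcase_abs (x * t)); auto using cos_neg).
        pose proof (Rabs_pos (x * t)). apply cos_decr_1; lra.
    + rewrite (RInt_const (V:=R_CompleteNormedModule)). unfold scal; simpl; unfold mult; simpl. field.
Qed.

Definition dipK (p : nat) (z : C) : C := ((Snc z ^ 2) ^ p)%C.
Definition dipF (p : nat) (z : C) : C := (1 - / 2 * dipK p z)%C.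

Lemma Cmod_dipK p z : Cmod (dipK p z) = (Cmod (Snc z) ^ 2) ^ p.
Proof. unfold dipK. now rewrite !Cmod_pow. Qed.

Lemma Cmod_half z : Cmod (/ 2 * z) = / 2 * Cmod z.
Proof. rewrite Cmod_mult, Cmod_inv by (intros E; injection E; lra). now rewrite (Cmod_R 2), (Rabs_pos_eq 2) by lra. Qed.

Lemma Cpow_sub_1 (e : C) p : Cmod e <= 1 -> Cmod (e ^ p - 1) <= INR p * Cmod (e - 1).
Proof.
  intros He. induction p.
  - simpl. replace (1 - 1)%C with (RtoC 0) by ring. rewrite Cmod_0. lra.
  - rewrite S_INR. replace (e ^ S p - 1)%C with (e * (e ^ p - 1) + (e - 1))%C by (simpl; ring).
    eapply Rle_trans; [apply Cmod_triangle|]. rewrite Cmod_mult.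
    pose proof (Cmod_ge_0 (e ^ p - 1)). pose proof (Cmod_ge_0 e). nra.
Qed.

(* On the lines [sin x = 0] the square of [Snc z] is [- sinh y ^ 2 / z ^ 2]; as [p] is odd,
   [- dipK p z] is close to the positive half axis when [y] is small compared with [x]. *)
Lemma dipF_line m de z : sin (fst z) = 0 -> fst z <> 0 -> 0 <= de -> Rabs (snd z) <= de * Rabs (fst z) ->
  1 + / 2 * ((Cmod (Snc z) ^ 2) ^ (2 * m + 1) * (1 - 2 * INR (2 * m + 1) * de)) <= Cmod (dipF (2 * m + 1) z).
Proof.
  intros Hs Hx Hde Hy. set (p := (2 * m + 1)%nat). set (s := Cmod (Snc z) ^ 2).
  assert (Hx2 : 0 < fst z ^ 2) by (rewrite <- Rsqr_pow2; now apply Rlt_0_sqr).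
  assert (Hz2 : 0 < Cmod z ^ 2) by (rewrite Cmod_sqr; pose proof (pow2_ge_0 (snd z)); lra).
  assert (Hz0 : 0 < Cmod z) by (pose proof (Cmod_ge_0 z); destruct H; auto; rewrite <- H in Hz2; lra).
  assert (Hzn : z <> RtoC 0) by (intros E; rewrite E, Cmod_0 in Hz0; lra).
  assert (Hss : s = sinh (snd z) ^ 2 / Cmod z ^ 2).
  { assert (H := Snc_mod_sqr z). rewrite Hs in H. unfold s. apply Rmult_eq_reg_l with (Cmod z ^ 2); [|lra]. rewrite H. field. lra. }
  set (e := (Cconj z ^ 2 * / RtoC (Cmod z ^ 2))%C).
  assert (Hzc : (z * Cconj z)%C = RtoC (Cmod z ^ 2)).
  { rewrite Cmod_sqr. destruct z as [x y]. apply C_eq; simpl; ring. }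
  assert (Hnz : RtoC (Cmod z ^ 2) <> RtoC 0) by (intros E; injection E; lra).
  assert (Hcn : Cconj z <> RtoC 0) by (intros E; rewrite E in Hzc; rewrite Cmult_0_r in Hzc; now symmetry in Hzc).
  assert (HS2 : (Snc z ^ 2)%C = (- (RtoC s * e))%C).
  { assert (H := Snc_csin z). unfold csin in H. rewrite Hs, Rmult_0_l in H.
    assert (Hc2 : cos (fst z) * cos (fst z) = 1) by (pose proof (sin2_cos2 (fst z)) as Q; unfold Rsqr in Q; rewrite Hs in Q; lra).
    assert (H2 : (z ^ 2 * Snc z ^ 2)%C = RtoC (- sinh (snd z) ^ 2)).
    { replace (z ^ 2 * Snc z ^ 2)%C with ((z * Snc z) * (z * Snc z))%C by (simpl; ring). rewrite H. apply C_eq; simpl; nra. }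
    replace (Snc z ^ 2)%C with (/ z ^ 2 * (z ^ 2 * Snc z ^ 2))%C by (field; auto).
    rewrite H2, Hss. unfold e, Rdiv. rewrite RtoC_mult, RtoC_inv by lra. rewrite <- Hzc, RtoC_opp. field. auto. }
  assert (He1 : Cmod e <= 1).
  { unfold e. rewrite Cmod_mult, Cmod_pow, Cmod_conj, Cmod_inv by auto. rewrite Cmod_R, Rabs_pos_eq by lra. right. field. lra. }
  assert (Hed : Cmod (e - 1) <= 2 * de).
  { replace (e - 1)%C with ((Cconj z * (Cconj z - z)) * / RtoC (Cmod z ^ 2))%C by (unfold e; rewrite <- Hzc; field; auto).
    rewrite !Cmod_mult, Cmod_conj, Cmod_inv by auto. rewrite Cmod_R, Rabs_pos_eq by lra.
    replace (Cmod (Cconj z - z)) with (2 * Rabs (snd z)).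
    - apply Rmult_le_reg_r with (Cmod z); auto. replace (Cmod z * (2 * Rabs (snd z)) * / Cmod z ^ 2 * Cmod z) with (2 * Rabs (snd z)) by (field; lra).
      pose proof (Rabs_fst_le z). nra.
    - replace (Cconj z - z)%C with (RtoC (- 2 * snd z) * Ci)%C by (destruct z; apply C_eq; simpl; ring).
      rewrite Cmod_mult, Cmod_Ci, Cmod_R, Rmult_1_r, Rabs_mult, (Rabs_left (-2)) by lra. ring. }
  assert (HK : dipK p z = (- (RtoC (s ^ p) * e ^ p))%C).
  { unfold dipK. rewrite HS2. unfold p.
    assert (Hodd : forall w : C, ((- w) ^ (2 * m + 1))%C = (- w ^ (2 * m + 1))%C).
    { intros w. rewrite !Cpow_add_r, !Cpow_mult_r. replace ((- w) ^ 2)%C with (w ^ 2)%C by (simpl; ring). simpl; ring. }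
    rewrite Hodd, Cpow_mult_l. now rewrite RtoC_pow. }
  assert (Hs0 : 0 <= s ^ p) by (apply pow_le, pow2_ge_0).
  unfold dipF. rewrite HK.
  replace (1 - / 2 * - (RtoC (s ^ p) * e ^ p))%C with (RtoC (1 + / 2 * s ^ p) + / 2 * (RtoC (s ^ p) * (e ^ p - 1)))%C.
  - eapply Rle_trans; [|apply Cmod_add_ge]. rewrite Cmod_half, Cmod_mult, !Cmod_RtoC_pos by lra.
    assert (H1 := Cpow_sub_1 e p He1). pose proof (pos_INR p).
    assert (Cmod (e ^ p - 1) <= 2 * INR p * de) by nra. nra.
  - rewrite RtoC_plus, RtoC_mult, RtoC_inv by lra. field.
Qed.

Lemma dipF_big p z S0 : 0 <= S0 -> S0 <= (Cmod (Snc z) ^ 2) ^ p -> S0 / 2 - 1 <= Cmod (dipF p z).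
Proof.
  intros _ H. unfold dipF. replace (1 - / 2 * dipK p z)%C with (- (/ 2 * dipK p z) + 1)%C by ring.
  eapply Rle_trans; [|apply Cmod_add_ge]. rewrite Cmod_opp, Cmod_half, Cmod_1, Cmod_dipK. lra.
Qed.

Lemma dipF_upper p z : Cmod (dipF p z) <= 1 + / 2 * (Cmod (Snc z) ^ 2) ^ p.
Proof.
  unfold dipF, Cminus. eapply Rle_trans; [apply Cmod_triangle|]. rewrite Cmod_opp, Cmod_half, Cmod_1, Cmod_dipK. lra.
Qed.

(** In [|z|^2 |Snc z|^2 = sin^2 x + sinh^2 y] a real shift leaves the hyperbolic term alone, and the
    sine term is at most 1, hence at most [eta^2 |z|^2] far out. *)
Lemma Snc_shift t eta : 0 < eta -> exists m0, 0 < m0 /\ forall z, m0 <= Cmod z ->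
  Cmod (Snc (z - RtoC t)) ^ 2 <= (1 + eta) ^ 2 * (Cmod (Snc z) ^ 2 + eta ^ 2).
Proof.
  intros He. exists ((1 + eta) * (Rabs t + 1) / eta). pose proof (Rabs_pos t).
  assert (0 < (1 + eta) * (Rabs t + 1)) by nra.
  split; [now apply Rdiv_lt_0_compat|]. intros z Hz.
  assert (Hz' : (1 + eta) * (Rabs t + 1) <= eta * Cmod z).
  { apply Rmult_le_compat_l with (r := eta) in Hz; [|lra]. replace (eta * ((1 + eta) * (Rabs t + 1) / eta)) with ((1 + eta) * (Rabs t + 1)) in Hz by (field; lra). lra. }
  set (w := (z - RtoC t)%C).
  assert (Hw : Cmod z - Rabs t <= Cmod w).
  { unfold w. rewrite <- (Cmod_R t). pose proof (Cmod_triangle (z - RtoC t) (RtoC t)) as Q.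
    replace (z - RtoC t + RtoC t)%C with z in Q by ring. lra. }
  assert (Hzw : Cmod z <= (1 + eta) * Cmod w) by nra.
  assert (Hz0 : 0 < Cmod z) by nra. assert (Hw0 : 0 < Cmod w) by nra.
  assert (A := Snc_mod_sqr z). assert (B := Snc_mod_sqr w).
  replace (snd w) with (snd z) in B by (unfold w; simpl; ring).
  pose proof (SIN_bound (fst w)). pose proof (pow2_ge_0 (sin (fst z))).
  assert (sin (fst w) ^ 2 <= 1) by nra.
  set (a := Cmod (Snc w) ^ 2) in *. set (b := Cmod (Snc z) ^ 2) in *.
  assert (H6 : 1 <= eta ^ 2 * Cmod z ^ 2) by (rewrite <- Rpow_mult_distr; nra).
  assert (H7 : Cmod w ^ 2 * a <= Cmod z ^ 2 * (b + eta ^ 2)) by lra.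
  assert (H8 : Cmod z ^ 2 <= (1 + eta) ^ 2 * Cmod w ^ 2) by (rewrite <- Rpow_mult_distr; apply pow_incr; split; lra).
  assert (0 <= b + eta ^ 2) by (unfold b; pose proof (pow2_ge_0 (Cmod (Snc z))); pose proof (pow2_ge_0 eta); lra).
  apply Rmult_le_reg_l with (Cmod w ^ 2); [now apply pow_lt|]. nra.
Qed.

Lemma pow_1_plus n x : 0 <= x <= 1 -> (1 + x) ^ n <= 1 + 3 ^ n * x.
Proof.
  intros Hx. induction n; [simpl; lra|]. simpl. assert (1 <= 3 ^ n) by (apply pow_R1_Rle; lra).
  set (a := (1 + x) ^ n) in *. set (c := 3 ^ n) in *.
  apply Rle_trans with ((1 + x) * (1 + c * x)); [apply Rmult_le_compat_l; lra|]. assert (0 <= c * x) by (apply Rmult_le_pos; lra). assert (x * (c * x) <= 1 * (c * x)) by (apply Rmult_le_compat_r; lra). assert (1 * x <= c * x) by (apply Rmult_le_compat_r; lra). lra.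
Qed.

(** For [s >= eta] one has [s + eta^2 <= (1 + eta) s] and the error is multiplicative; for smaller
    [s] the whole left side fits into the additive [e]. *)
Lemma shift_numeric p e : (1 <= p)%nat -> 0 < e -> exists eta, 0 < eta /\
  forall s, 0 <= s -> ((1 + eta) ^ 2 * (s + eta ^ 2)) ^ p <= (1 + e) * s ^ p + e.
Proof.
  intros Hp He. set (c := 3 ^ (3 * p)). assert (Hc : 1 <= c) by (apply pow_R1_Rle; lra).
  set (eta := Rmin (/ 2) (e / (4 * c))). 
  assert (He0 : 0 < eta) by (apply Rmin_glb_lt; [lra|apply Rdiv_lt_0_compat; lra]).
  assert (He1 : eta <= / 2) by apply Rmin_l.
  assert (He2 : c * eta <= e / 4).
  { assert (Q := Rmin_r (/ 2) (e / (4 * c))). fold eta in Q. apply Rmult_le_compat_l with (r := c) in Q; [|lra].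
    replace (c * (e / (4 * c))) with (e / 4) in Q by (field; lra). lra. }
  exists eta; split; auto. intros s Hs.
  assert (P3 : (1 + eta) ^ (3 * p) <= 1 + c * eta) by (apply pow_1_plus; lra).
  assert (P2 : (1 + eta) ^ (2 * p) <= (1 + eta) ^ (3 * p)) by (apply Rle_pow; [lra|lia]).
  assert (Hsp : 0 <= s ^ p) by now apply pow_le.
  assert (P20 : 0 < (1 + eta) ^ (2 * p)) by (apply pow_lt; lra).
  rewrite Rpow_mult_distr, <- pow_mult.
  destruct (Rle_dec eta s) as [Hes|Hes].
  - assert (H : (s + eta ^ 2) ^ p <= ((1 + eta) * s) ^ p) by (apply pow_incr; split; nra).
    rewrite Rpow_mult_distr in H.
    apply Rle_trans with ((1 + eta) ^ (2 * p) * ((1 + eta) ^ p * s ^ p)); [now apply Rmult_le_compat_l; [lra|]|].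
    rewrite <- Rmult_assoc, <- pow_add. replace (2 * p + p)%nat with (3 * p)%nat by lia.
    apply Rle_trans with ((1 + e) * s ^ p); [|lra]. apply Rmult_le_compat_r; lra.
  - assert (H : (s + eta ^ 2) ^ p <= (2 * eta) ^ p) by (apply pow_incr; split; nra).
    assert (H2 : (2 * eta) ^ p <= 2 * eta).
    { destruct p; [lia|]. simpl.
      assert ((2 * eta) ^ p <= 1 ^ p) by (apply pow_incr; lra). rewrite pow1 in *. nra. }
    apply Rle_trans with ((1 + c * eta) * (2 * eta)).
    + apply Rmult_le_compat; try lra. apply pow_le; nra.
    + assert (eta <= c * eta) by nra. assert (0 <= (1 + e) * s ^ p) by (apply Rmult_le_pos; lra).
      assert (c * eta * (2 * eta) <= e / 4) by nra. lra.
Qed.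

(** * Domination of translates on vertical and horizontal lines *)

Definition shift_dom (G : C -> C) (t e : R) (z : C) : Prop :=
  1 <= Cmod (G z) /\ Cmod (G (z - RtoC t)%C) <= (1 + e) * Cmod (G z).

(** There are two regimes. On a zero line of the sine with small slope, [- dipK z] is nearly
    positive, so nothing is lost in [1 + |dipK z| / 2]; where [Snc] is huge, the 1 is negligible. In
    both, [|dipF z|] nearly reaches the trivial upper bound of the translated factor. *)
Lemma dipF_dom m t e : 0 < e -> exists m0 de S0, 0 < m0 /\ 0 < de /\ forall z, m0 <= Cmod z ->
  (sin (fst z) = 0 /\ fst z <> 0 /\ Rabs (snd z) <= de * Rabs (fst z)) \/ S0 <= Cmod (Snc z) ^ 2 ->
  shift_dom (dipF (2 * m + 1)) t e z.
Proof.
  intros He. set (p := (2 * m + 1)%nat).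
  assert (Hp : 1 <= INR p) by (change 1 with (INR 1); apply le_INR; unfold p; lia).
  set (e1 := Rmin e 1 / 4). assert (H0 : 0 < Rmin e 1) by (apply Rmin_glb_lt; lra).
  assert (He1 : 0 < e1) by (unfold e1; lra).
  assert (He1e : 4 * e1 <= e) by (unfold e1; pose proof (Rmin_l e 1); lra).
  assert (He11 : 4 * e1 <= 1) by (unfold e1; pose proof (Rmin_r e 1); lra).
  destruct (shift_numeric p e1 ltac:(unfold p; lia) He1) as [eta [Heta Hn]].
  destruct (Snc_shift t eta Heta) as [m0 [Hm0 Hs]].
  assert (UP : forall z, m0 <= Cmod z -> Cmod (dipF p (z - RtoC t)) <= 1 + / 2 * ((1 + e1) * (Cmod (Snc z) ^ 2) ^ p + e1)).
  { intros z Hz. eapply Rle_trans; [apply dipF_upper|]. apply Rplus_le_compat_l, Rmult_le_compat_l; [lra|].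
    eapply Rle_trans; [apply pow_incr; split; [apply pow2_ge_0|apply (Hs z Hz)]|]. apply Hn, pow2_ge_0. }
  set (SS := 16 / e1). assert (HSS : e1 * SS = 16) by (unfold SS; field; lra).
  assert (HSS1 : 64 <= SS) by nra.
  exists m0, (e1 / (2 * INR p)), SS. split; auto. split; [apply Rdiv_lt_0_compat; lra|].
  intros z Hz HH. specialize (UP z Hz). unfold shift_dom.
  set (s := (Cmod (Snc z) ^ 2) ^ p) in *. assert (Hs0 : 0 <= s) by apply pow_le, pow2_ge_0.
  destruct HH as [[H1 [H2 H3]]|H].
  - assert (Hd : 0 <= e1 / (2 * INR p)) by (left; apply Rdiv_lt_0_compat; lra).
    assert (L := dipF_line m _ z H1 H2 Hd H3). fold p s in L.
    replace (2 * INR p * (e1 / (2 * INR p))) with e1 in L by (field; lra).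
    set (A := Cmod (dipF p z)) in *.
    assert (0 <= s * (1 - e1)) by nra. split; [lra|].
    apply Rle_trans with ((1 + e) * (1 + / 2 * (s * (1 - e1)))); [|apply Rmult_le_compat_l; lra].
    assert (C1 : e * e1 <= e * / 4) by (apply Rmult_le_compat_l; lra).
    assert (C2 : s * (1 + e1) <= s * ((1 + e) * (1 - e1))) by (apply Rmult_le_compat_l; lra). lra.
  - assert (Hsb : SS <= s).
    { unfold s. set (x := Cmod (Snc z) ^ 2) in *. destruct p eqn:Ep; [lia|]. simpl.
      assert (1 <= x ^ n) by (apply pow_R1_Rle; lra). nra. }
    assert (L := dipF_big p z s Hs0 (Rle_refl _)). set (A := Cmod (dipF p z)) in *.
    split; [lra|]. apply Rle_trans with ((1 + e) * (s / 2 - 1)); [|apply Rmult_le_compat_l; lra].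
    assert (C1 : e * SS <= e * s) by (apply Rmult_le_compat_l; lra).
    assert (C2 : 4 * e1 * s <= e * s) by (apply Rmult_le_compat_r; lra).
    assert (C3 : e1 * SS <= e1 * s) by (apply Rmult_le_compat_l; lra).
    assert (C4 : e * 64 <= e * SS) by (apply Rmult_le_compat_l; lra). lra.
Qed.

Lemma sinh_ge y : 0 <= y -> y ^ 2 / 8 <= sinh y.
Proof.
  intros Hy. unfold sinh. assert (E : exp y = exp (y / 2) * exp (y / 2)) by (rewrite <- exp_plus; f_equal; field).
  pose proof (exp_ineq1_le (y / 2)). pose proof (exp_le (- y) 0 ltac:(lra)) as H1. rewrite exp_0 in H1. nra.
Qed.

Lemma sinh_sqr_abs y : sinh y ^ 2 = sinh (Rabs y) ^ 2.
Proof.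
  unfold Rabs. destruct (Rcase_abs y); auto. unfold sinh. rewrite Ropp_involutive. field.
Qed.

(** In a sector around the imaginary axis [sinh^2 y >= y^4 / 64] beats [|z|^2 <= (1 + ka^2) y^2]. *)
Lemma Snc_big ka S0 : 0 <= ka -> exists Y, 0 < Y /\ forall z, Y <= Rabs (snd z) -> Rabs (fst z) <= ka * Rabs (snd z) ->
  S0 <= Cmod (Snc z) ^ 2.
Proof.
  intros Hk. pose proof (Rabs_pos S0). assert (K2 : 0 <= ka ^ 2) by apply pow2_ge_0.
  exists (64 * (1 + ka ^ 2) * Rabs S0 + 1). set (Y := 64 * (1 + ka ^ 2) * Rabs S0 + 1).
  assert (HY : 1 <= Y) by (unfold Y; assert (0 <= (1 + ka ^ 2) * Rabs S0) by (apply Rmult_le_pos; lra); lra).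
  split; [lra|]. intros z Hy Hx. set (y := Rabs (snd z)) in *.
  assert (A := Snc_mod_sqr z). rewrite sinh_sqr_abs, Cmod_sqr in A. fold y in A.
  assert (B := sinh_ge y ltac:(lra)). pose proof (pow2_ge_0 (sin (fst z))).
  assert (B2 : (y ^ 2 / 8) ^ 2 <= sinh y ^ 2) by (apply pow_incr; split; auto; pose proof (pow2_ge_0 y); lra).
  assert (E1 : fst z ^ 2 <= ka ^ 2 * y ^ 2).
  { rewrite <- Rpow_mult_distr, <- (pow2_abs (fst z)). apply pow_incr. split; auto using Rabs_pos. }
  assert (E2 : snd z ^ 2 = y ^ 2) by (unfold y; now rewrite pow2_abs). rewrite E2 in A.
  set (s := Cmod (Snc z) ^ 2) in *. assert (Hs : 0 <= s) by apply pow2_ge_0.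
  assert (Hy2 : Y <= y ^ 2) by nra.
  assert (A2 : y ^ 2 * (y ^ 2 / 64) <= y ^ 2 * ((1 + ka ^ 2) * s)).
  { assert ((fst z ^ 2 + y ^ 2) * s <= ((1 + ka ^ 2) * y ^ 2) * s) by (apply Rmult_le_compat_r; lra). nra. }
  apply Rmult_le_reg_l in A2; [|lra].
  assert (A3 : (1 + ka ^ 2) * Rabs S0 <= (1 + ka ^ 2) * s) by (unfold Y in Hy2; lra).
  apply Rmult_le_reg_l in A3; [|lra]. pose proof (Rle_abs S0). lra.
Qed.

(** The precision [e] is arbitrary so that finite products inherit the property. The threshold [q0]
    does not depend on the height [y], which allows the width of a box to be fixed before its
    height. *)
Definition vert_ok (G : C -> C) : Prop := forall t e, 0 < e -> exists q0, forall q y sg, (q0 <= q)%nat ->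
  sg = 1 \/ sg = -1 -> shift_dom G t e (sg * (PI * 2 ^ q), y).

Definition hor_ok (G : C -> C) : Prop := forall t e c, 0 < e -> exists Y, forall x y, Rabs x <= c ->
  Y <= Rabs y -> shift_dom G t e (x, y).

Lemma shift_dom_one t e z : 0 < e -> shift_dom (fun _ => RtoC 1) t e z.
Proof. intros He. split; rewrite Cmod_1; lra. Qed.

Lemma shift_dom_mult G H t e z : 0 < e -> shift_dom G t (Rmin e 1 / 3) z -> shift_dom H t (Rmin e 1 / 3) z ->
  shift_dom (fun w => (G w * H w)%C) t e z.
Proof.
  intros He [G1 G2] [H1 H2]. pose proof (Rmin_l e 1). pose proof (Rmin_r e 1).
  assert (0 < Rmin e 1) by (apply Rmin_glb_lt; lra). set (d := Rmin e 1 / 3) in *.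
  assert (Hd : 0 < d /\ 3 * d <= e /\ 3 * d <= 1) by (unfold d; lra).
  split; rewrite !Cmod_mult.
  - rewrite <- (Rmult_1_l 1). apply Rmult_le_compat; lra.
  - set (g := Cmod (G z)) in *. set (h := Cmod (H z)) in *.
    apply Rle_trans with ((1 + d) * g * ((1 + d) * h)); [apply Rmult_le_compat; auto using Cmod_ge_0|].
    replace ((1 + d) * g * ((1 + d) * h)) with ((1 + d) * (1 + d) * (g * h)) by ring.
    apply Rmult_le_compat_r; [apply Rmult_le_pos; lra|nra].
Qed.

Lemma Rmin_third e : 0 < e -> 0 < Rmin e 1 / 3.
Proof. intros. assert (0 < Rmin e 1) by (apply Rmin_glb_lt; lra). lra. Qed.

Lemma vert_ok_mult G H : vert_ok G -> vert_ok H -> vert_ok (fun w => (G w * H w)%C).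
Proof.
  intros A B t e He. destruct (A t _ (Rmin_third e He)) as [q1 A1]. destruct (B t _ (Rmin_third e He)) as [q2 B1].
  exists (max q1 q2). intros q y sg Hq Hsg. apply shift_dom_mult; auto; [apply A1|apply B1]; auto; lia.
Qed.

Lemma hor_ok_mult G H : hor_ok G -> hor_ok H -> hor_ok (fun w => (G w * H w)%C).
Proof.
  intros A B t e c He. destruct (A t _ c (Rmin_third e He)) as [q1 A1]. destruct (B t _ c (Rmin_third e He)) as [q2 B1].
  exists (Rmax q1 q2). intros x y Hx Hy. pose proof (Rmax_l q1 q2). pose proof (Rmax_r q1 q2).
  apply shift_dom_mult; auto; [apply A1|apply B1]; auto; lra.
Qed.

Lemma vert_ok_pow G N : vert_ok G -> vert_ok (fun w => (G w ^ N)%C).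
Proof.
  intros A. induction N; [intros t e He; exists O; intros; now apply shift_dom_one|]. simpl. now apply vert_ok_mult.
Qed.

Lemma hor_ok_pow G N : hor_ok G -> hor_ok (fun w => (G w ^ N)%C).
Proof.
  intros A. induction N; [intros t e c He; exists 0; intros; now apply shift_dom_one|]. simpl. now apply hor_ok_mult.
Qed.

Definition dipZ (X W : R) (z : C) : C := ((fst z - X) / W, snd z / W).
Definition dipP (p : nat) (X W : R) (N : nat) (z : C) : C := (dipF p (dipZ X W z) ^ N)%C.

Lemma dipZ_shift X W z t : (dipZ X W (z - RtoC t) = dipZ X W z - RtoC (t / W))%C.
Proof. unfold dipZ. apply C_eq; simpl; unfold Rdiv; ring. Qed.

(** The reason why centres are [PI] times powers of 2 and widths are powers of 2: one line
    [Re z = PI * 2^q] is a zero line of the rescaled sines of all chosen factors at once, for large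
    [q]. *)
Lemma sin_dyadic n w q sg : (w <= n)%nat -> (w <= q)%nat -> sg = 1 \/ sg = -1 ->
  sin ((sg * (PI * 2 ^ q) - PI * 2 ^ n) / 2 ^ w) = 0.
Proof.
  intros Hn Hq Hs. apply sin_eq_0_1.
  assert (Hw : 2 ^ w <> 0) by (apply pow_nonzero; lra).
  assert (E : forall m, (w <= m)%nat -> 2 ^ m = IZR (2 ^ Z.of_nat (m - w)) * 2 ^ w).
  { intros m Hm. rewrite <- pow_IZR, <- pow_add. f_equal; lia. }
  exists ((if Rlt_dec sg 0 then -1 else 1) * 2 ^ Z.of_nat (q - w) - 2 ^ Z.of_nat (n - w))%Z.
  rewrite minus_IZR, mult_IZR, (E n Hn), (E q Hq).
  destruct (Rlt_dec sg 0), Hs; subst; try lra; field; auto.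
Qed.

(** At each height one of the two regimes of [dipF_dom] applies: either the rescaled ordinate is at
    most [de] times the abscissa, or it exceeds that and [Snc_big] with aperture [1 / de] makes
    [Snc] huge. *)
Lemma dip_vert m n w t e : (w <= n)%nat -> 0 < e -> exists q0, forall q y sg, (q0 <= q)%nat -> sg = 1 \/ sg = -1 ->
  shift_dom (fun z => dipF (2 * m + 1) (dipZ (PI * 2 ^ n) (2 ^ w) z)) t e (sg * (PI * 2 ^ q), y).
Proof.
  intros Hw He. set (W := 2 ^ w). assert (HW : 0 < W) by (apply pow_lt; lra).
  destruct (dipF_dom m (t / W) e He) as [m0 [de [S0 [Hm0 [Hde D]]]]].
  destruct (Snc_big (/ de) S0 ltac:(left; now apply Rinv_0_lt_compat)) as [Y [HY SB]].
  pose proof PI_RGT_0 as HPI. pose proof PI2_3_2.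
  destruct (nfloor_ex (W * (m0 + Y / de) + 2 ^ n * PI)) as [q0 [_ Hq0]].
  { assert (0 < Y / de) by (now apply Rdiv_lt_0_compat). pose proof (pow_lt 2 n ltac:(lra)).
    assert (0 < W * (m0 + Y / de)) by (apply Rmult_lt_0_compat; lra). assert (0 < 2 ^ n * PI) by (now apply Rmult_lt_0_compat). lra. }
  exists (S q0 + w)%nat. intros q y sg Hq Hsg.
  assert (Hqq : INR q0 + 1 <= 2 ^ q).
  { rewrite <- S_INR. apply Rle_trans with (2 ^ S q0); [|apply Rle_pow; [lra|lia]].
    left. clear. induction (S q0); [simpl; lra|]. rewrite S_INR. simpl. pose proof (pow_R1_Rle 2 n ltac:(lra)). lra. }
  set (x := (sg * (PI * 2 ^ q) - PI * 2 ^ n) / W).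
  assert (Hx : m0 + Y / de <= Rabs x).
  { unfold x. unfold Rdiv at 2. rewrite Rabs_mult, (Rabs_pos_eq (/ W)) by (left; now apply Rinv_0_lt_compat).
    apply Rmult_le_reg_r with W; auto. rewrite Rmult_assoc, Rinv_l, Rmult_1_r by lra.
    apply Rle_trans with (Rabs (sg * (PI * 2 ^ q)) - Rabs (PI * 2 ^ n)).
    - assert (Hs1 : Rabs sg = 1) by (destruct Hsg; subst; [apply Rabs_R1|rewrite Rabs_left; lra]).
      rewrite !Rabs_mult, Hs1, (Rabs_pos_eq PI), !(Rabs_pos_eq (2 ^ _)) by (try (left; apply pow_lt; lra); lra).
      assert (2 ^ q <= PI * 2 ^ q) by (pose proof (pow_lt 2 q ltac:(lra)); nra). lra.
    - pose proof (Rabs_triang_inv (sg * (PI * 2 ^ q)) (PI * 2 ^ n)). lra. }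
  assert (HYd : 0 < Y / de) by now apply Rdiv_lt_0_compat.
  specialize (D (x, y / W)).
  assert (Dz : m0 <= Cmod (x, y / W)) by (eapply Rle_trans; [|apply Rabs_fst_le]; simpl; lra).
  assert (Ds : shift_dom (dipF (2 * m + 1)) (t / W) e (x, y / W)).
  { apply D; auto. simpl fst; simpl snd. destruct (Rle_dec (Rabs (y / W)) (de * Rabs x)) as [Q|Q].
    - left. repeat split; auto; [apply sin_dyadic; auto; lia|]. intros E. rewrite E, Rabs_R0 in Hx. lra.
    - right. apply SB; simpl fst; simpl snd.
      + apply Rle_trans with (de * Rabs x); [|lra]. apply Rmult_le_reg_l with (/ de); [now apply Rinv_0_lt_compat|].
        rewrite <- Rmult_assoc, Rinv_l by lra. unfold Rdiv in Hx. lra.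
      + apply Rmult_le_reg_l with de; auto. rewrite <- Rmult_assoc, Rinv_r by lra. lra. }
  unfold shift_dom in *. rewrite dipZ_shift. exact Ds.
Qed.

(** Over a bounded range of abscissae a large ordinate alone suffices: only the regime of huge [Snc]
    occurs, and no zero of the sine is involved. *)
Lemma dip_hor m X W t e c : 0 < W -> 0 < e -> exists Y, forall x y, Rabs x <= c -> Y <= Rabs y ->
  shift_dom (fun z => dipF (2 * m + 1) (dipZ X W z)) t e (x, y).
Proof.
  intros HW He. destruct (dipF_dom m (t / W) e He) as [m0 [de [S0 [Hm0 [Hde D]]]]].
  destruct (Snc_big 1 S0 ltac:(lra)) as [Y [HY SB]].
  exists (W * (m0 + Y) + c + Rabs X). intros x y Hx Hy. unfold shift_dom. rewrite dipZ_shift.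
  assert (Hi : 0 < / W) by now apply Rinv_0_lt_compat.
  pose proof (Rabs_pos x). pose proof (Rabs_pos X). assert (0 < W * m0 /\ 0 < W * Y) as [] by (split; now apply Rmult_lt_0_compat).
  assert (E1 : Rabs (y / W) = Rabs y / W) by (unfold Rdiv; rewrite Rabs_mult, (Rabs_pos_eq (/ W)); lra).
  assert (E2 : Rabs ((x - X) / W) = Rabs (x - X) / W) by (unfold Rdiv; rewrite Rabs_mult, (Rabs_pos_eq (/ W)); lra).
  assert (Hyw : m0 + Y <= Rabs y / W).
  { apply Rmult_le_reg_r with W; auto. unfold Rdiv. rewrite Rmult_assoc, Rinv_l by lra. lra. }
  apply D.
  - eapply Rle_trans; [|apply Rabs_snd_le]. unfold dipZ; simpl. rewrite E1. lra.
  - right. apply SB; unfold dipZ; simpl; rewrite E1; [lra|]. rewrite E2, Rmult_1_l.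
    apply Rmult_le_compat_r; [lra|]. unfold Rminus. eapply Rle_trans; [apply Rabs_triang|]. rewrite Rabs_Ropp. lra.
Qed.

Lemma vert_ok_dipP m n w N : (w <= n)%nat -> vert_ok (dipP (2 * m + 1) (PI * 2 ^ n) (2 ^ w) N).
Proof. intros Hw. apply vert_ok_pow. intros t e He. now apply dip_vert. Qed.

Lemma hor_ok_dipP m X W N : 0 < W -> hor_ok (dipP (2 * m + 1) X W N).
Proof. intros Hw. apply hor_ok_pow. intros t e c He. now apply dip_hor. Qed.

Lemma pow_1_plus_small n x : 0 <= x -> INR n * x <= / 2 -> (1 + x) ^ n <= 1 + 2 * INR n * x.
Proof.
  intros Hx. induction n; intros H; [simpl; lra|]. rewrite S_INR in *. simpl pow.
  assert (INR n * x <= / 2) by lra. specialize (IHn H0).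
  apply Rle_trans with ((1 + x) * (1 + 2 * INR n * x)); [apply Rmult_le_compat_l; lra|].
  assert (x * (INR n * x) <= x * / 2) by (apply Rmult_le_compat_l; lra). lra.
Qed.

Lemma Cpow_near_1 (w : C) N : Cmod ((1 + w) ^ N - 1) <= (1 + Cmod w) ^ N - 1.
Proof.
  induction N; [simpl; replace (1 - 1)%C with (RtoC 0) by ring; rewrite Cmod_0; lra|].
  replace ((1 + w) ^ S N - 1)%C with (((1 + w) ^ N - 1) + w * (1 + w) ^ N)%C by (simpl; ring).
  eapply Rle_trans; [apply Cmod_triangle|]. rewrite Cmod_mult, Cmod_pow. simpl pow.
  assert (Cmod (1 + w) ^ N <= (1 + Cmod w) ^ N).
  { apply pow_incr. split; [apply Cmod_ge_0|]. eapply Rle_trans; [apply Cmod_triangle|]. rewrite Cmod_1. lra. }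
  pose proof (Cmod_ge_0 w). assert (Cmod w * Cmod (1 + w) ^ N <= Cmod w * (1 + Cmod w) ^ N) by (apply Rmult_le_compat_l; auto). lra.
Qed.

(** In this strip [sin^2 + sinh^2 <= 1 + 3]. *)
Lemma Snc_far z : 0 < Cmod z -> Rabs (snd z) <= 1 -> Cmod (Snc z) ^ 2 <= 4 / Cmod z ^ 2.
Proof.
  intros Hz Hy. assert (A := Snc_mod_sqr z). apply Rabs_le_between in Hy.
  assert (Hz2 : 0 < Cmod z ^ 2) by now apply pow_lt.
  assert (Hs : sinh (snd z) ^ 2 <= 3).
  { unfold sinh. pose proof (exp_le (snd z) 1 ltac:(lra)). pose proof (exp_le (- snd z) 1 ltac:(lra)). pose proof exp_le_3.
    pose proof (exp_pos (snd z)). pose proof (exp_pos (- snd z)).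
    set (a := exp (snd z)) in *. set (b := exp (- snd z)) in *. assert (-3 <= a - b <= 3) by lra. nra. }
  pose proof (SIN_bound (fst z)). assert (sin (fst z) ^ 2 <= 1) by nra.
  apply Rmult_le_reg_l with (Cmod z ^ 2); auto. replace (Cmod z ^ 2 * (4 / Cmod z ^ 2)) with 4 by (field; lra). lra.
Qed.

(** The factor is [(1 + w)^N] with [|w| = |dipK| / 2]; as [N |dipK| <= x <= 1], the power departs
    from 1 at most linearly. *)
Lemma dipP_far p X W N z d x : 0 < W -> 0 < d -> d <= Rabs (fst z - X) -> Rabs (snd z) <= W ->
  INR N * ((2 * W / d) ^ 2) ^ p <= x -> x <= 1 -> Cmod (dipP p X W N z - 1) <= x.
Proof.
  intros HW Hd Hfd Hs Hx Hx1. set (k := Cmod (dipK p (dipZ X W z))).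
  assert (Hi : 0 < / W) by now apply Rinv_0_lt_compat.
  assert (Hk : k <= ((2 * W / d) ^ 2) ^ p).
  { unfold k. rewrite Cmod_dipK. apply pow_incr. split; [apply pow2_ge_0|].
    assert (Hz : d / W <= Cmod (dipZ X W z)).
    { eapply Rle_trans; [|apply Rabs_fst_le]. unfold dipZ; simpl. unfold Rdiv. rewrite Rabs_mult, (Rabs_pos_eq (/ W)) by lra.
      apply Rmult_le_compat_r; lra. }
    assert (Hdw : 0 < d / W) by now apply Rdiv_lt_0_compat.
    eapply Rle_trans; [apply Snc_far|].
    - lra.
    - unfold dipZ; simpl. unfold Rdiv. rewrite Rabs_mult, (Rabs_pos_eq (/ W)) by lra.
      apply Rmult_le_reg_r with W; auto. rewrite Rmult_assoc, Rinv_l by lra. lra.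
    - replace ((2 * W / d) ^ 2) with (4 / (d / W) ^ 2) by (field; lra). unfold Rdiv. apply Rmult_le_compat_l; [lra|].
      apply Rinv_le_contravar; [now apply pow_lt|]. apply pow_incr; split; [left; exact Hdw|exact Hz]. }
  assert (Hk0 : 0 <= k) by apply Cmod_ge_0.
  unfold dipP, dipF. replace (1 - / 2 * dipK p (dipZ X W z))%C with (1 + - (/ 2 * dipK p (dipZ X W z)))%C by ring.
  eapply Rle_trans; [apply Cpow_near_1|]. rewrite Cmod_opp, Cmod_half. fold k.
  pose proof (pos_INR N). assert (INR N * k <= x) by (eapply Rle_trans; [apply Rmult_le_compat_l|]; eauto).
  assert (Q := pow_1_plus_small N (/ 2 * k) ltac:(lra) ltac:(lra)). lra.
Qed.

(** On the real axis the factor is [(1 - y^(2p) / 2)^N] with [|y| <= 1]. The lower bound is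
    Bernoulli's inequality with [|y| <= W / d]; the upper one uses [y >= 1/2] inside the dip. *)
Lemma dipP_real p X W N xi : 0 < W -> exists v, dipP p X W N (RtoC xi) = RtoC v /\ 0 < v <= 1 /\
  (forall d, 0 < d -> d <= Rabs (xi - X) -> 1 - / 2 * (INR N * ((W / d) ^ 2) ^ p) <= v) /\
  (Rabs (xi - X) <= W -> v <= (1 - / 2 * (/ 4) ^ p) ^ N).
Proof.
  intros HW. assert (Hi : 0 < / W) by now apply Rinv_0_lt_compat.
  set (x := (xi - X) / W). destruct (Snc_real x) as [y [Hy [Hy1 Hy2]]].
  set (b := 1 - / 2 * (y ^ 2) ^ p).
  assert (Hyy : 0 <= y ^ 2 <= 1) by (split; [apply pow2_ge_0|nra]).
  assert (Hyp : 0 <= (y ^ 2) ^ p <= 1).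
  { split; [now apply pow_le|]. rewrite <- (pow1 p). apply pow_incr; lra. }
  assert (Eb : dipF p (dipZ X W (RtoC xi)) = RtoC b).
  { unfold dipF, dipK. replace (dipZ X W (RtoC xi)) with (RtoC x) by (unfold dipZ, x; apply C_eq; simpl; unfold Rdiv; ring).
    rewrite Hy, <- !RtoC_pow. unfold b. rewrite RtoC_minus, RtoC_mult, RtoC_inv by lra. reflexivity. }
  exists (b ^ N). unfold dipP. rewrite Eb, <- RtoC_pow.
  assert (Hb : / 2 <= b <= 1) by (unfold b; lra).
  repeat split.
  - apply pow_lt; lra.
  - rewrite <- (pow1 N). apply pow_incr; lra.
  - intros d Hd Hd2.
    assert (Hyd : y ^ 2 <= (W / d) ^ 2).
    { assert (A := Snc_mod_sqr (RtoC x)). rewrite Hy, !Cmod_R, !pow2_abs in A. simpl fst in A; simpl snd in A.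
      rewrite sinh_0 in A. pose proof (SIN_bound x). assert (sin x ^ 2 <= 1) by nra.
      assert (Hx2 : (d / W) ^ 2 <= x ^ 2).
      { rewrite <- (pow2_abs x). apply pow_incr. split; [left; now apply Rdiv_lt_0_compat|].
        unfold x, Rdiv. rewrite Rabs_mult, (Rabs_pos_eq (/ W)) by lra. apply Rmult_le_compat_r; lra. }
      assert (0 < (d / W) ^ 2) by (apply pow_lt; now apply Rdiv_lt_0_compat).
      apply Rmult_le_reg_l with ((d / W) ^ 2); auto.
      replace ((d / W) ^ 2 * (W / d) ^ 2) with 1 by (field; lra). nra. }
    assert (Hpp : (y ^ 2) ^ p <= ((W / d) ^ 2) ^ p) by (apply pow_incr; lra).
    assert (BN : forall n, 1 - / 2 * (INR n * (y ^ 2) ^ p) <= b ^ n).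
    { set (Y := (y ^ 2) ^ p) in *. induction n; [simpl; lra|]. rewrite S_INR. change (b ^ S n) with (b * b ^ n).
      assert (0 <= b ^ n <= 1) by (split; [apply pow_le; lra|rewrite <- (pow1 n); apply pow_incr; lra]).
      set (q := b ^ n) in *. unfold b. assert (Y * q <= Y * 1) by (apply Rmult_le_compat_l; lra). lra. }
    eapply Rle_trans; [|apply BN]. pose proof (pos_INR N). assert (INR N * (y ^ 2) ^ p <= INR N * ((W / d) ^ 2) ^ p) by (apply Rmult_le_compat_l; auto). lra.
  - intros Hd. assert (/ 2 <= y).
    { apply Hy2. unfold x, Rdiv. rewrite Rabs_mult, (Rabs_pos_eq (/ W)) by lra.
      apply Rmult_le_reg_r with W; auto. rewrite Rmult_assoc, Rinv_l by lra. lra. }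
    apply pow_incr. split; [lra|]. unfold b. assert ((/ 4) ^ p <= (y ^ 2) ^ p) by (apply pow_incr; nra). lra.
Qed.

(** * Choice of the parameters *)

(** The scale [2^(sg n)]: for a dip centred at a point of size [2^n] it is the power [sg] of the
    centre, so conditions on the parameters become inequalities between exponents. *)
Definition E2 (sg : R) (n : nat) : R := Rpower 2 (sg * INR n).

Lemma E2_pos sg n : 0 < E2 sg n.
Proof. apply exp_pos. Qed.

Lemma E2_plus a b n : E2 (a + b) n = E2 a n * E2 b n.
Proof. unfold E2. now rewrite <- Rpower_plus, Rmult_plus_distr_r. Qed.

Lemma E2_opp a n : E2 (- a) n = / E2 a n.
Proof. unfold E2. rewrite <- Rpower_Ropp. f_equal; ring. Qed.

Lemma E2_pow a n k : E2 a n ^ k = E2 (INR k * a) n.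
Proof. unfold E2. rewrite <- Rpower_pow by apply exp_pos. rewrite Rpower_mult. f_equal; ring. Qed.

Lemma E2_1 n : E2 1 n = 2 ^ n.
Proof. unfold E2. rewrite Rmult_1_l. apply Rpower_pow; lra. Qed.

Lemma E2_Rpower a b n : Rpower (E2 a n) b = E2 (a * b) n.
Proof. unfold E2. rewrite Rpower_mult. f_equal; ring. Qed.

Lemma E2_grow sg C : 0 < sg -> eventually (fun n => C <= E2 sg n).
Proof.
  intros Hs. assert (Hl : 0 < ln 2) by (rewrite <- ln_1; apply ln_increasing; lra).
  assert (Hsl : 0 < sg * ln 2) by now apply Rmult_lt_0_compat.
  destruct (nfloor_ex (Rabs C / (sg * ln 2))) as [n0 [_ H0]].
  { apply Rmult_le_pos; [apply Rabs_pos|left; now apply Rinv_0_lt_compat]. }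
  exists (S n0). intros n Hn. apply le_INR in Hn. rewrite S_INR in Hn.
  unfold E2, Rpower. pose proof (exp_ineq1_le (sg * INR n * ln 2)). pose proof (Rle_abs C).
  apply Rmult_lt_compat_l with (r := sg * ln 2) in H0; auto.
  replace (sg * ln 2 * (Rabs C / (sg * ln 2))) with (Rabs C) in H0 by (field; lra). nra.
Qed.

Definition far_ok (G : C -> C) : Prop := forall c e, 0 < e -> exists M, forall z, Rabs (snd z) <= c ->
  M <= Rabs (fst z) -> Cmod (G z) <= 1 + e.

Lemma far_ok_one : far_ok (fun _ => RtoC 1).
Proof. intros c e He. exists 0. intros. rewrite Cmod_1. lra. Qed.

Lemma far_ok_mult G H : far_ok G -> far_ok H -> far_ok (fun w => (G w * H w)%C).
Proof.
  intros A B c e He. destruct (A c _ (Rmin_third e He)) as [M1 A1]. destruct (B c _ (Rmin_third e He)) as [M2 B1].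
  exists (Rmax M1 M2). intros z Hc Hz. pose proof (Rmax_l M1 M2). pose proof (Rmax_r M1 M2).
  specialize (A1 z Hc ltac:(lra)). specialize (B1 z Hc ltac:(lra)).
  pose proof (Rmin_l e 1). pose proof (Rmin_r e 1). pose proof (Rmin_third e He). set (d := Rmin e 1 / 3) in *.
  assert (Hd : 3 * d <= e /\ 3 * d <= 1) by (unfold d; lra).
  rewrite Cmod_mult. apply Rle_trans with ((1 + d) * (1 + d)); [apply Rmult_le_compat; auto using Cmod_ge_0|nra].
Qed.

Lemma far_ok_pow G N : far_ok G -> far_ok (fun w => (G w ^ N)%C).
Proof. intros A. induction N; [apply far_ok_one|]. simpl. now apply far_ok_mult. Qed.

Lemma far_ok_dipP p X W N : (1 <= p)%nat -> 0 < W -> far_ok (dipP p X W N).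
Proof.
  intros Hp HW. apply far_ok_pow. intros c e He.
  set (d := Rmin e 1). assert (Hd : 0 < d) by (apply Rmin_glb_lt; lra).
  assert (Hd1 : d <= e) by apply Rmin_l. assert (Hd2 : d <= 1) by apply Rmin_r.
  assert (Hi : 0 < / W) by now apply Rinv_0_lt_compat.
  set (q := 1 + exp (c / W) ^ 2). assert (Hq : 1 <= q) by (unfold q; pose proof (pow2_ge_0 (exp (c / W))); lra).
  exists (W * (q / d) + Rabs X). intros z Hc Hz.
  assert (Hqd : 1 <= q / d) by (apply Rmult_le_reg_r with d; auto; replace (q / d * d) with q by (field; lra); lra).
  set (w := dipZ X W z).
  assert (Hx : q / d <= Rabs (fst w)).
  { unfold w, dipZ; simpl. unfold Rdiv at 2. rewrite Rabs_mult, (Rabs_pos_eq (/ W)) by lra.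
    apply Rmult_le_reg_r with W; auto. rewrite Rmult_assoc, Rinv_l by lra. pose proof (Rabs_triang_inv (fst z) X). lra. }
  assert (Hy : Rabs (snd w) <= c / W).
  { unfold w, dipZ; simpl. unfold Rdiv. rewrite Rabs_mult, (Rabs_pos_eq (/ W)) by lra. apply Rmult_le_compat_r; lra. }
  assert (A := Snc_mod_sqr w).
  assert (Hs : sinh (snd w) ^ 2 <= exp (c / W) ^ 2).
  { apply Rabs_le_between in Hy. unfold sinh. pose proof (exp_le (snd w) (c / W) ltac:(lra)).
    pose proof (exp_le (- snd w) (c / W) ltac:(lra)). pose proof (exp_pos (snd w)). pose proof (exp_pos (- snd w)).
    rewrite <- pow2_abs. apply pow_incr. split; [apply Rabs_pos|]. apply Rabs_le. lra. }
  pose proof (SIN_bound (fst w)). assert (sin (fst w) ^ 2 <= 1) by nra.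
  assert (Hw : q / d <= Cmod w) by (eapply Rle_trans; [exact Hx|apply Rabs_fst_le]).
  assert (Hw2 : q / d <= Cmod w ^ 2) by nra.
  assert (Hsn : Cmod (Snc w) ^ 2 <= d).
  { pose proof (pow2_ge_0 (Cmod (Snc w))). apply Rmult_le_reg_l with (q / d); [lra|].
    replace (q / d * d) with q by (field; lra). unfold q at 2. nra. }
  eapply Rle_trans; [apply dipF_upper|]. fold w.
  assert ((Cmod (Snc w) ^ 2) ^ p <= d); [|lra].
  destruct p; [lia|]. simpl pow at 1. pose proof (pow2_ge_0 (Cmod (Snc w))).
  assert ((Cmod (Snc w) ^ 2) ^ p <= 1) by (rewrite <- (pow1 p); apply pow_incr; lra).
  set (v := Cmod (Snc w) ^ 2) in *. change (v * v ^ p <= d). pose proof (pow_le v p ltac:(lra)). nra.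
Qed.

Fixpoint cprod (P : nat -> C -> C) (k : nat) (z : C) : C :=
  match k with
  | O => 1%C
  | S k => (P k z * cprod P k z)%C
  end.

(** The bound concerns the boundary of a box only. The factor 3/2 is affordable because the weights
    of the translates will add up to at most 1/8. *)
Definition box_dom (G : C -> C) (ts : R -> Prop) (R0 T : R) : Prop := forall z,
  (Rabs (fst z) = R0 /\ Rabs (snd z) <= T) \/ (Rabs (snd z) = T /\ Rabs (fst z) <= R0) ->
  1 <= Cmod (G z) /\ forall t, ts t -> Cmod (G (z - RtoC t)%C) <= 3 / 2 * Cmod (G z).

Section ScaleChoice.
Variables (m : nat) (s b be s1 s2 s3 : R) (Nn ww : nat -> nat).
Hypotheses (hs0 : 0 < s) (hs1 : s < s1) (hs12 : s1 < s2) (hs23 : s2 < s3) (hs3 : s3 < 1)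
  (hb : 0 < b) (hbe0 : 0 < be) (hbe : s1 / be < s2).
Let p := (2 * m + 1)%nat.
Hypothesis hp : s1 < 2 * INR p * (s3 - s2).
Hypothesis HNn : forall n, E2 s1 n <= INR (Nn n) <= 2 * E2 s1 n.
Hypothesis Hww : forall n, (ww n <= n)%nat /\ E2 s2 n / 2 <= 2 ^ ww n <= E2 s2 n.

Let X (n : nat) := PI * 2 ^ n.
Let W (n : nat) := 2 ^ ww n.
Let om (n : nat) := E2 s3 n.
Let cc (n : nat) := exp (- Rpower (om n) b).

(** [B] bounds everything chosen before. [gi_supp] keeps the total support within 1/2; [gi_far] and
    [gi_shift] keep the factor near 1 far from its dip and at least 1/2 on the real axis at distance
    [om / 2]; [gi_c] makes the weights add up to at most 1/8; [gi_N] forces [N] to double. [gi_dip]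
    and [gi_width] are the depth and the width that prevent surjectivity in the class [s]. *)
Record good_index (n j : nat) (B : R) : Prop := {
  gi_X : 8 * B <= X n;
  gi_om : 8 * om n <= X n;
  gi_W : B <= W n;
  gi_supp : 2 * INR p * (INR (Nn n) / W n) <= (/ 2) ^ j / 4;
  gi_far : INR (Nn n) * ((8 * W n / X n) ^ 2) ^ p <= (/ 2) ^ j / 50;
  gi_shift : INR (Nn n) * ((2 * W n / om n) ^ 2) ^ p <= 1;
  gi_c : cc n <= (/ 2) ^ j / 16;
  gi_N : 2 * B <= INR (Nn n);
  gi_dip : INR j * (1 + w_pow s (X n)) <= INR (Nn n);
  gi_width : (INR j + 1) * Rpower (INR (Nn n)) (1 / be) <= W n }.

Lemma X_bounds n : 3 * E2 1 n <= X n <= 4 * E2 1 n.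
Proof.
  unfold X. rewrite E2_1. pose proof PI2_3_2. pose proof PI_4. pose proof (pow_lt 2 n ltac:(lra)). nra.
Qed.

Lemma W_bounds n : E2 s2 n / 2 <= W n <= E2 s2 n.
Proof. apply Hww. Qed.

Lemma pow_half_inv j : (/ 2) ^ j * 2 ^ j = 1.
Proof. rewrite <- Rpow_mult_distr, Rinv_l by lra. apply pow1. Qed.

Lemma ev_ratio (f : nat -> R) a j c : 0 < a -> (exists K, 0 <= K /\ forall n, f n <= K * E2 (- a) n) -> 0 < c ->
  eventually (fun n => f n <= (/ 2) ^ j * c).
Proof.
  intros Ha [K [HK Hf]] Hc. generalize (E2_grow a (K * 2 ^ j / c) Ha). apply filter_imp. intros n Hn.
  eapply Rle_trans; [apply Hf|]. rewrite E2_opp. pose proof (E2_pos a n).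
  apply Rmult_le_reg_r with (E2 a n * 2 ^ j); [apply Rmult_lt_0_compat; auto; apply pow_lt; lra|].
  replace (K * / E2 a n * (E2 a n * 2 ^ j)) with (K * 2 ^ j) by (field; lra).
  replace ((/ 2) ^ j * c * (E2 a n * 2 ^ j)) with (((/ 2) ^ j * 2 ^ j) * (c * E2 a n)) by ring.
  rewrite pow_half_inv, Rmult_1_l. apply Rmult_le_compat_l with (r := c) in Hn; [|lra].
  replace (c * (K * 2 ^ j / c)) with (K * 2 ^ j) in Hn by (field; lra). lra.
Qed.

(** The purpose of the power [p]: with [N] of exponent [s1] and a ratio of exponent [- sg], the
    product has exponent [s1 - 2 p sg], negative for large [p] however small the gap [sg]. *)
Lemma N_ratio_bound (c : R) (sg : R) (v : nat -> R) : 0 <= c -> (forall n, 0 <= v n <= c * E2 (- sg) n) ->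
  exists K, 0 <= K /\ forall n, INR (Nn n) * (v n ^ 2) ^ p <= K * E2 (- (2 * INR p * sg - s1)) n.
Proof.
  intros Hc Hv. exists (2 * (c ^ 2) ^ p). split; [pose proof (pow_le _ p (pow2_ge_0 c)); lra|]. intros n.
  replace (- (2 * INR p * sg - s1)) with (s1 + INR p * (2 * - sg)) by ring.
  rewrite E2_plus, <- E2_pow. replace (2 * - sg) with (INR 2 * - sg) by (simpl; ring). rewrite <- E2_pow.
  replace (2 * (c ^ 2) ^ p * (E2 s1 n * (E2 (- sg) n ^ 2) ^ p)) with ((2 * E2 s1 n) * ((c * E2 (- sg) n) ^ 2) ^ p) by (rewrite !Rpow_mult_distr; ring).
  apply Rmult_le_compat; [apply pos_INR|apply pow_le, pow2_ge_0|apply HNn|].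
  apply pow_incr. split; [apply pow2_ge_0|]. apply pow_incr. apply Hv.
Qed.

(** Each condition compares scales whose exponents are separated by a strict inequality, so it holds
    for all large [n]; finitely many such conditions hold together. *)
Lemma good_index_exists j B M : exists n, good_index n j B /\ M <= om n.
Proof.
  assert (P0 := pos_INR p). pose proof (pos_INR j).
  assert (H1 : eventually (fun n => 8 * B <= X n)).
  { generalize (E2_grow 1 (8 * Rabs B) ltac:(lra)). apply filter_imp. intros n Hn. pose proof (X_bounds n).
    pose proof (Rle_abs B). pose proof (E2_pos 1 n). lra. }
  assert (H2 : eventually (fun n => 8 * om n <= X n)).
  { generalize (E2_grow (1 - s3) 8 ltac:(lra)). apply filter_imp. intros n Hn. pose proof (X_bounds n). unfold om.
    replace 1 with (s3 + (1 - s3)) in H0 by ring. rewrite E2_plus in H0. pose proof (E2_pos s3 n). pose proof (E2_pos (1 - s3) n). nra. }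
  assert (H3 : eventually (fun n => B <= W n)).
  { generalize (E2_grow s2 (2 * B) ltac:(lra)). apply filter_imp. intros n Hn. pose proof (W_bounds n). lra. }
  assert (H4 : eventually (fun n => 2 * INR p * (INR (Nn n) / W n) <= (/ 2) ^ j * / 4)).
  { apply (ev_ratio _ (s2 - s1)); [lra| |lra]. exists (2 * INR p * 4). split; [lra|]. intros n.
    rewrite (Rmult_assoc (2 * INR p)). apply Rmult_le_compat_l; [lra|].
    pose proof (W_bounds n). pose proof (E2_pos s2 n). pose proof (HNn n). pose proof (E2_pos s1 n).
    replace (- (s2 - s1)) with (s1 + - s2) by ring. rewrite E2_plus, E2_opp.
    replace (4 * (E2 s1 n * / E2 s2 n)) with ((2 * E2 s1 n) * / (E2 s2 n / 2)) by (field; lra).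
    unfold Rdiv. apply Rmult_le_compat; [apply pos_INR|left; apply Rinv_0_lt_compat; lra|lra|apply Rinv_le_contravar; lra]. }
  assert (H5 : eventually (fun n => INR (Nn n) * ((8 * W n / X n) ^ 2) ^ p <= (/ 2) ^ j * / 50)).
  { apply (ev_ratio _ (2 * INR p * (1 - s2) - s1)); [nra| |lra]. apply (N_ratio_bound 8); [lra|]. intros n.
    pose proof (W_bounds n). pose proof (X_bounds n). pose proof (E2_pos s2 n). pose proof (E2_pos 1 n).
    split; [apply Rmult_le_pos; [lra|left; apply Rinv_0_lt_compat; lra]|].
    replace (- (1 - s2)) with (s2 + - (1)) by ring. rewrite E2_plus, E2_opp. unfold Rdiv. rewrite (Rmult_assoc 8).
    apply Rmult_le_compat_l; [lra|]. apply Rmult_le_compat; [lra|left; apply Rinv_0_lt_compat; lra|lra|apply Rinv_le_contravar; lra]. }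
  assert (H6 : eventually (fun n => INR (Nn n) * ((2 * W n / om n) ^ 2) ^ p <= (/ 2) ^ 0 * 1)).
  { apply (ev_ratio _ (2 * INR p * (s3 - s2) - s1)); [lra| |lra]. apply (N_ratio_bound 2); [lra|]. intros n.
    pose proof (W_bounds n). pose proof (E2_pos s2 n). pose proof (E2_pos s3 n). unfold om.
    split; [apply Rmult_le_pos; [lra|left; apply Rinv_0_lt_compat; lra]|].
    replace (- (s3 - s2)) with (s2 + - s3) by ring. rewrite E2_plus, E2_opp. unfold Rdiv. rewrite (Rmult_assoc 2).
    apply Rmult_le_compat_l; [lra|]. apply Rmult_le_compat_r; [left; apply Rinv_0_lt_compat|]; lra. }
  assert (H7 : eventually (fun n => cc n <= (/ 2) ^ j * / 16)).
  { apply (ev_ratio _ (s3 * b)); [apply Rmult_lt_0_compat; lra| |lra]. exists 1. split; [lra|]. intros n.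
    unfold cc, om. rewrite E2_Rpower, exp_Ropp, E2_opp, Rmult_1_l. apply Rinv_le_contravar; [apply E2_pos|].
    pose proof (exp_ineq1_le (E2 (s3 * b) n)). lra. }
  assert (H8 : eventually (fun n => 2 * B <= INR (Nn n))).
  { generalize (E2_grow s1 (2 * B) ltac:(lra)). apply filter_imp. intros n Hn. pose proof (HNn n). lra. }
  assert (H9 : eventually (fun n => INR j * (1 + w_pow s (X n)) <= INR (Nn n))).
  { generalize (E2_grow (s1 - s) (5 * INR j) ltac:(lra)). apply filter_imp. intros n Hn.
    eapply Rle_trans; [|apply HNn]. replace s1 with (s + (s1 - s)) by ring. rewrite E2_plus.
    assert (Hw : w_pow s (X n) <= 4 * E2 s n).
    { pose proof PI_RGT_0. pose proof PI_4. pose proof (X_bounds n). pose proof (E2_pos 1 n).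
      rewrite w_pow_pos by lra. unfold X. rewrite <- E2_1, <- Rpower_mult_distr, E2_Rpower, Rmult_1_l by lra.
      apply Rmult_le_compat_r; [left; apply E2_pos|]. apply Rle_trans with (Rpower PI 1); [|rewrite Rpower_1; lra].
      pose proof PI2_3_2. apply Rle_Rpower; lra. }
    assert (1 <= E2 s n).
    { unfold E2. rewrite <- (Rpower_O 2) by lra. apply Rle_Rpower; [lra|]. apply Rmult_le_pos; [lra|apply pos_INR]. }
    apply Rle_trans with (INR j * (5 * E2 s n)); [apply Rmult_le_compat_l; lra|]. pose proof (E2_pos s n). nra. }
  assert (H10 : eventually (fun n => (INR j + 1) * Rpower (INR (Nn n)) (1 / be) <= W n)).
  { set (c := Rpower 2 (1 / be)). assert (Hc : 0 < c) by apply exp_pos.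
    generalize (E2_grow (s2 - s1 / be) (2 * ((INR j + 1) * c)) ltac:(lra)). apply filter_imp. intros n Hn.
    eapply Rle_trans; [|apply W_bounds].
    apply Rle_trans with ((INR j + 1) * (c * E2 (s1 / be) n)).
    - apply Rmult_le_compat_l; [lra|]. replace (s1 / be) with (s1 * (1 / be)) by (field; lra).
      pose proof (HNn n). pose proof (E2_pos s1 n). unfold c.
      rewrite <- E2_Rpower, Rpower_mult_distr by lra.
      apply Rle_Rpower_l; [left; apply Rdiv_lt_0_compat; lra|]. split; lra.
    - replace s2 with (s1 / be + (s2 - s1 / be)) at 1 by ring. rewrite E2_plus. pose proof (E2_pos (s1 / be) n). nra. }
  assert (H11 : eventually (fun n => M <= om n)) by (apply E2_grow; lra).
  destruct (filter_and _ _ H1 (filter_and _ _ H2 (filter_and _ _ H3 (filter_and _ _ H4 (filter_and _ _ H5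
    (filter_and _ _ H6 (filter_and _ _ H7 (filter_and _ _ H8 (filter_and _ _ H9 (filter_and _ _ H10 H11)))))))))) as [n0 Hn0].
  destruct (Hn0 n0 (Nat.le_refl _)) as [Q1 [Q2 [Q3 [Q4 [Q5 [Q6 [Q7 [Q8 [Q9 [Q10 Q11]]]]]]]]]].
  exists n0. split; auto. constructor; auto. rewrite pow_O in Q6. lra.
Qed.

Fixpoint plist (l : list nat) (z : C) : C :=
  match l with
  | nil => 1%C
  | cons n l => (dipP p (X n) (W n) (Nn n) z * plist l z)%C
  end.

Lemma W_pos n : 0 < W n.
Proof. apply pow_lt; lra. Qed.

Lemma plist_ok l : vert_ok (plist l) /\ hor_ok (plist l) /\ far_ok (plist l).
Proof.
  induction l as [|n l [V [H F]]].
  - split; [|split; [|apply far_ok_one]]; [intros t e He; exists O|intros t e c He; exists 0]; intros; now apply (shift_dom_one t e).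
  - split; [|split].
    + apply (vert_ok_mult (dipP p (X n) (W n) (Nn n))); auto. apply vert_ok_dipP, Hww.
    + apply (hor_ok_mult (dipP p (X n) (W n) (Nn n))); auto. apply hor_ok_dipP, W_pos.
    + apply (far_ok_mult (dipP p (X n) (W n) (Nn n))); auto. apply far_ok_dipP; [unfold p; lia|apply W_pos].
Qed.

Lemma eventually_all_in (l : list nat) (Q : nat -> nat -> Prop) :
  (forall i, List.In i l -> exists q0, forall q, (q0 <= q)%nat -> Q i q) ->
  exists q0, forall q, (q0 <= q)%nat -> forall i, List.In i l -> Q i q.
Proof.
  induction l as [|n l IH]; intros H; [exists O; intros q _ i []|].
  destruct (H n (or_introl eq_refl)) as [q1 H1].
  destruct IH as [q2 H2]; [intros i Hi; apply H; now right|].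
  exists (max q1 q2). intros q Hq i [<-|Hi]; [apply H1; lia|apply H2; auto; lia].
Qed.

(** The half-width [R0] is taken first, from the vertical lines, which are good at all heights; the
    height comes second, since its threshold depends on [R0]. *)
Lemma box_exists G (l : list nat) B : vert_ok G -> hor_ok G ->
  exists R0 T, B <= R0 /\ R0 <= T /\ box_dom G (fun t => List.In t (List.map om l)) R0 T.
Proof.
  intros V H.
  (* The additional index 0 keeps the list nonempty, so that the bound [1 <= |G|] can be read off
     some [shift_dom] even for empty [l]. *)
  destruct (eventually_all_in (cons O l) (fun i q => forall y sg, sg = 1 \/ sg = -1 -> shift_dom G (om i) (/ 2) (sg * (PI * 2 ^ q), y)))
    as [q0 Hq0].
  { intros i _. destruct (V (om i) (/ 2) ltac:(lra)) as [q0 H0]. exists q0. intros q Hq y sg Hs. now apply H0. }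
  destruct (E2_grow 1 (Rabs B) ltac:(lra)) as [q1 Hq1].
  set (q := max q0 q1). set (R0 := PI * 2 ^ q).
  assert (HR0 : 0 < R0) by (apply Rmult_lt_0_compat; [apply PI_RGT_0|apply pow_lt; lra]).
  assert (HB : B <= R0).
  { specialize (Hq1 q ltac:(lia)). pose proof (X_bounds q). unfold X in H0. fold R0 in H0. pose proof (Rle_abs B). pose proof (E2_pos 1 q). lra. }
  destruct (eventually_all_in (cons O l) (fun i k => forall x y, Rabs x <= R0 -> INR k <= Rabs y -> shift_dom G (om i) (/ 2) (x, y)))
    as [k0 Hk0].
  { intros i _. destruct (H (om i) (/ 2) R0 ltac:(lra)) as [Y HY].
    destruct (nfloor_ex (Rabs Y) (Rabs_pos Y)) as [k [_ Hk]]. exists (S k). intros k' Hk' x y Hx Hy.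
    apply HY; auto. apply le_INR in Hk'. rewrite S_INR in Hk'. pose proof (Rle_abs Y). lra. }
  exists R0, (R0 + INR k0). pose proof (pos_INR k0). split; [auto|split; [lra|]].
  intros [x y] Hz. simpl fst in Hz; simpl snd in Hz.
  assert (D : forall i, List.In i (cons O l) -> shift_dom G (om i) (/ 2) (x, y)).
  { intros i Hi. destruct Hz as [[Hx Hy]|[Hy Hx]].
    - assert (Ex : exists sg, (sg = 1 \/ sg = -1) /\ x = sg * (PI * 2 ^ q)).
      { unfold R0 in Hx. unfold Rabs in Hx. destruct (Rcase_abs x); [exists (-1)|exists 1]; split; auto; lra. }
      destruct Ex as [sg [Hs ->]]. apply Hq0; auto. unfold q; lia.
    - apply (Hk0 k0); auto. rewrite Hy. lra. }
  split; [apply (D O); now left|]. intros t Ht. apply List.in_map_iff in Ht. destruct Ht as [i [<- Hi]].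
  destruct (D i (or_intror Hi)) as [_ Q]. lra.
Qed.

(* A state is the list of the indices chosen so far together with the size of a box near which all later
   factors have to be close to 1; the new index comes with a larger box satisfying [box_dom]. *)
Definition step_ok (st : list nat * R) (d : nat * (R * R)) : Prop :=
  let (l, B) := st in let (n, RT) := d in
  good_index n (length l) B /\
  (forall z, Rabs (fst z) <= B -> Rabs (snd z) <= B -> Cmod (plist l (z - RtoC (om n))%C) <= 3 / 2) /\
  B <= fst RT /\ fst RT <= snd RT /\
  box_dom (plist (cons n l)) (fun t => List.In t (List.map om (cons n l))) (fst RT) (snd RT).

(** The earlier factors must be small on the box translated by the new [om n]. The threshold [M]
    beyond which they are at most 3/2 depends on them and [B] only, so [om n >= |M| + B] can be
    imposed when [n] is chosen. *)
Lemma step_exists st : exists d, step_ok st d.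
Proof.
  destruct st as [l B]. destruct (plist_ok l) as [_ [_ F]].
  destruct (F B (/ 2) ltac:(lra)) as [M HM].
  destruct (good_index_exists (length l) B (Rabs M + B)) as [n [Hn Hom]].
  destruct (plist_ok (cons n l)) as [V [H _]].
  destruct (box_exists _ (cons n l) B V H) as [R0 [T [H1 [H2 H3]]]].
  exists (n, (R0, T)). split; [auto|]. split; [|auto].
  intros z Hx Hy. replace (3 / 2) with (1 + / 2) by field. apply HM.
  - simpl. replace (snd z + - 0) with (snd z) by ring. auto.
  - simpl. pose proof (Rabs_triang_inv (om n) (fst z)) as Q. rewrite Rabs_minus_sym in Q.
    rewrite (Rabs_pos_eq (om n)) in Q by (left; apply E2_pos). pose proof (Rle_abs M).
    unfold Rminus in Q. lra.
Qed.

(** [Bd] accumulates all scales used so far, box included; since the next index is good for this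
    bound, the next dip lies beyond everything already constructed. *)
Theorem dip_sequences : exists (nu : nat -> nat) (Bd Rd Td : nat -> R),
  let P := fun k => dipP p (X (nu k)) (W (nu k)) (Nn (nu k)) in
  Bd O = 1 /\
  (forall k, Bd (S k) = Bd k + Rd k + Td k + X (nu k) + INR (Nn (nu k)) + om (nu k)) /\
  forall k, good_index (nu k) k (Bd k) /\
    (forall z, Rabs (fst z) <= Bd k -> Rabs (snd z) <= Bd k -> Cmod (cprod P k (z - RtoC (om (nu k)))%C) <= 3 / 2) /\
    Bd k <= Rd k /\ Rd k <= Td k /\
    box_dom (cprod P (S k)) (fun t => exists i, (i <= k)%nat /\ t = om (nu i)) (Rd k) (Td k).
Proof.
  destruct (functional_choice _ step_exists) as [d Hd].
  set (next := fun st : list nat * R => let (l, B) := st in let (n, RT) := d st in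
    (cons n l, B + fst RT + snd RT + X n + INR (Nn n) + om n)).
  set (st := fun k => Nat.iter k next (nil, 1)).
  set (nu := fun k => fst (d (st k))).
  exists nu, (fun k => snd (st k)), (fun k => fst (snd (d (st k)))), (fun k => snd (snd (d (st k)))).
  intros P.
  assert (HS : forall k, fst (st (S k)) = cons (nu k) (fst (st k)) /\ snd (st (S k)) =
    snd (st k) + fst (snd (d (st k))) + snd (snd (d (st k))) + X (nu k) + INR (Nn (nu k)) + om (nu k)).
  { intros k. change (st (S k)) with (next (st k)). unfold next, nu. destruct (st k) as [l B] eqn:E. 
    destruct (d (l, B)) as [n RT]. simpl. auto. }
  assert (HL : forall k, length (fst (st k)) = k).
  { induction k; [reflexivity|]. destruct (HS k) as [-> _]. simpl. now rewrite IHk. }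
  assert (HP : forall k, plist (fst (st k)) = cprod P k).
  { intros k. apply functional_extensionality; intros z. induction k; [reflexivity|].
    destruct (HS k) as [-> _]. simpl. now rewrite IHk. }
  assert (HI : forall k i, (i < k)%nat -> List.In (om (nu i)) (List.map om (fst (st k)))).
  { induction k; intros i Hi; [lia|]. destruct (HS k) as [-> _]. simpl.
    destruct (Nat.eq_dec i k) as [->|Hn]; [now left|right; apply IHk; lia]. }
  split; [reflexivity|]. split; [intros k; apply HS|].
  intros k. assert (H := Hd (st k)). unfold step_ok in H.
  rewrite <- HP, <- HP. destruct (HS k) as [E _]. rewrite E.
  specialize (HL k). specialize (HI (S k)). rewrite E in HI. unfold nu in *.
  destruct (st k) as [l B]. simpl fst in HL, HI |- *. simpl snd. destruct (d (l, B)) as [n RT].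
  simpl fst in HI |- *. simpl snd. destruct H as [H1 [H2 [H3 [H4 H5]]]]. rewrite HL in H1.
  split; [auto|split; [auto|split; [auto|split; [auto|]]]].
  intros z Hz. destruct (H5 z Hz) as [Q1 Q2]. split; auto. intros t [i [Hi ->]]. apply Q2, HI. lia.
Qed.
End ScaleChoice.

(** * Distributions given by Fourier sums *)

Lemma CI_Csum (a : nat -> R -> C) (f : R -> C) (b : nat -> R) (l r : R) : l <= r ->
  (forall n, ccont (a n)) -> ccont f -> ex_series b ->
  (forall n t, l <= t <= r -> Cmod (a n t) <= b n) ->
  (forall t, l <= t <= r -> f t = Csum (fun n => a n t)) ->
  CI f l r = Csum (fun n => CI (a n) l r).
Proof.
  intros Hlr Ha Hf Sb Hb E. symmetry. apply clim_Csum_unique.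
  assert (Hc : forall n, ccont (fun t => Csn (fun k => a k t) n)).
  { induction n; [exact (ccont_const (RtoC 0))|]. exact (ccont_plus _ _ IHn (Ha n)). }
  assert (Hn : forall n, Csn (fun k => CI (a k) l r) n = CI (fun t => Csn (fun k => a k t) n) l r).
  { induction n; simpl; [rewrite CI_const; ring|]. rewrite IHn. now rewrite CI_plus. }
  apply clim_le with (fun n => Series (fun k => b (n + k)%nat) * (r - l)).
  - intros n. rewrite Hn, Cmod_sub_sym, <- CI_minus by auto. apply CI_bound; auto.
    + now apply ccont_minus.
    + intros t Ht. rewrite E by auto. apply Csum_tail; auto.
  - replace (Finite 0) with (Rbar_mult 0 (r - l)) by (simpl; f_equal; ring).
    apply is_lim_seq_scal_r. now apply Series_tail_lim.
Qed.

Lemma clim_Csum_dominated (a : nat -> nat -> C) (l : nat -> C) (b : nat -> R) : ex_series b ->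
  (forall k n, Cmod (a k n) <= b n) -> (forall n, clim (fun k => a k n) (l n)) ->
  clim (fun k => Csum (a k)) (Csum l).
Proof.
  intros Sb Ha Hl.
  assert (Hlb : forall n, Cmod (l n) <= b n) by (intros n; eapply clim_bound; eauto).
  apply is_lim_seq_spec. intros e. 
  assert (T := Series_tail_lim b Sb). apply is_lim_seq_spec in T.
  destruct (T (mkposreal (e / 4) ltac:(pose proof (cond_pos e); lra))) as [N HN]. simpl in HN.
  specialize (HN N (Nat.le_refl _)). rewrite Rminus_0_r in HN. set (s := Series (fun k => b (N + k)%nat)) in *.
  assert (Hf : clim (fun k => Csn (a k) N) (Csn l N)).
  { clear - Hl. induction N; simpl; [apply clim_const|]. now apply clim_plus. }
  apply is_lim_seq_spec in Hf. destruct (Hf (mkposreal (e / 4) ltac:(pose proof (cond_pos e); lra))) as [K HK]. simpl in HK.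
  exists K. intros k Hk. specialize (HK k Hk). rewrite Rminus_0_r in HK |- *.
  rewrite Rabs_pos_eq in HK |- * by apply Cmod_ge_0. pose proof (Rle_abs s).
  assert (A1 := Csum_tail (a k) b N (Ha k) Sb). assert (A2 := Csum_tail l b N Hlb Sb). fold s in A1, A2.
  replace (Csum (a k) - Csum l)%C with ((Csum (a k) - Csn (a k) N) + (Csn (a k) N - Csn l N) + - (Csum l - Csn l N))%C by ring.
  eapply Rle_lt_trans; [apply Cmod_triangle|]. rewrite Cmod_opp.
  assert (Q := Cmod_triangle (Csum (a k) - Csn (a k) N) (Csn (a k) N - Csn l N)). pose proof (cond_pos e). lra.
Qed.

Definition inv_sq_seq (n : nat) : R := / (INR n + 1) ^ 2.

Lemma pairsum_bound (f : R -> C) B n : 0 <= B -> (forall om, Cmod (f om) <= B / (1 + om ^ 2)) ->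
  Cmod (pairsum f n) <= 4 * B * inv_sq_seq n.
Proof.
  intros HB Hf. unfold pairsum, inv_sq_seq. pose proof (pos_INR n).
  assert (Q : forall om, (INR n + 1) ^ 2 <= 2 * (1 + om ^ 2) -> Cmod (f om) <= 2 * B * / (INR n + 1) ^ 2).
  { intros om H2. eapply Rle_trans; [apply Hf|]. pose proof (pow2_ge_0 om). assert (0 < (INR n + 1) ^ 2) by (apply pow_lt; lra).
    apply Rmult_le_reg_r with ((1 + om ^ 2) * (INR n + 1) ^ 2); [apply Rmult_lt_0_compat; lra|].
    replace (B / (1 + om ^ 2) * ((1 + om ^ 2) * (INR n + 1) ^ 2)) with (B * (INR n + 1) ^ 2) by (field; lra).
    replace (2 * B * / (INR n + 1) ^ 2 * ((1 + om ^ 2) * (INR n + 1) ^ 2)) with (B * (2 * (1 + om ^ 2))) by (field; lra).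
    now apply Rmult_le_compat_l. }
  eapply Rle_trans; [apply Cmod_triangle|].
  assert (Q1 := Q (INR n) ltac:(pose proof (pow2_ge_0 (INR n - 1)); nra)).
  assert (Q2 := Q (- INR n - 1) ltac:(nra)). lra.
Qed.

Section FourierSums.
Variables (chi : nat -> R -> C).
Hypotheses (Jc : jet chi) (chi1 : forall x, Rabs x <= / 2 -> chi O x = RtoC 1)
  (Vc : vanish_out (- (/ 2 + 2)) (/ 2 + 2) chi).

Let a0 := - (/ 2 + 2).
Let b0 := / 2 + 2.

Definition fcoef (phi : R -> C) (om : R) : C := FT a0 b0 (fun t => (chi O t * phi t)%C) (RtoC om).

Lemma fcoef_decay : exists K, 0 <= K /\ forall F B, jet F -> 0 <= B ->
  (forall k x, (k <= 2)%nat -> Rabs x <= b0 -> Cmod (F k x) <= B) -> forall om, Cmod (fcoef (F O) om) <= K * B / (1 + om ^ 2).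
Proof.
  assert (Hc : exists A, 0 <= A /\ forall k x, (k <= 2)%nat -> Rabs x <= b0 -> Cmod (chi k x) <= A).
  { destruct (ccont_bounded (chi 0%nat) a0 b0 (jet_ccont chi 0 Jc)) as [A0 H0].
    destruct (ccont_bounded (chi 1%nat) a0 b0 (jet_ccont chi 1 Jc)) as [A1 H1].
    destruct (ccont_bounded (chi 2%nat) a0 b0 (jet_ccont chi 2 Jc)) as [A2 H2].
    exists (Rabs A0 + Rabs A1 + Rabs A2).
    pose proof (Rabs_pos A0). pose proof (Rabs_pos A1). pose proof (Rabs_pos A2). split; [lra|].
    pose proof (Rle_abs A0). pose proof (Rle_abs A1). pose proof (Rle_abs A2).
    intros k x Hk Hx. assert (Hx' : a0 <= x <= b0) by (apply Rabs_le_between in Hx; unfold a0, b0 in *; lra).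
    destruct k as [|[|[|k]]]; [| | |lia]; eapply Rle_trans; try apply H0; try apply H1; try apply H2; auto; lra. }
  destruct Hc as [A [HA Hc]].
  exists (5 * (4 * A + A)). split; [lra|]. intros F B JF HB HF om.
  set (P := fun n => pseq n chi F). assert (JP : jet P) by now apply jet_pseq.
  assert (VP : vanish_out a0 b0 P) by now apply vanish_pseq.
  assert (Hab : a0 <= b0) by (unfold a0, b0; lra).
  assert (E : forall t, a0 <= t <= b0 -> Cmod (cE (- RtoC om) t) <= 1).
  { intros t _. replace (- RtoC om)%C with (RtoC (- om)) by cring. rewrite cE_real_mod. lra. }
  assert (Pb : forall n t, (n <= 2)%nat -> a0 <= t <= b0 -> Cmod (P n t) <= 2 ^ n * (A * B)).
  { intros n t Hn Ht. assert (Rabs t <= b0) by (apply Rabs_le; unfold a0, b0 in *; lra).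
    apply pseq_bound; intros i Hi; [apply Hc|apply HF]; auto; lia. }
  assert (Q0 := FT_bound a0 b0 P (RtoC om) 0 (2 ^ 0 * (A * B)) 1 Hab JP VP ltac:(intros; apply Pb; auto) E).
  assert (Q2 := FT_bound a0 b0 P (RtoC om) 2 (2 ^ 2 * (A * B)) 1 Hab JP VP ltac:(intros; apply Pb; auto) E).
  change (P O) with (fun t => (chi O t * F O t)%C) in Q0, Q2. fold (fcoef (F O) om) in Q0, Q2.
  rewrite Cmod_R, pow2_abs in Q2. rewrite Cmod_R in Q0. simpl pow in Q0.
  replace (b0 - a0) with 5 in Q0, Q2 by (unfold a0, b0; field).
  pose proof (pow2_ge_0 om). apply Rmult_le_reg_r with (1 + om ^ 2); [lra|].
  replace (5 * (4 * A + A) * B / (1 + om ^ 2) * (1 + om ^ 2)) with (5 * (4 * A + A) * B) by (field; lra). lra.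
Qed.

Variable U : R -> C.
Hypothesis HU : forall xi, Cmod (U xi) <= 1.

Definition fterm (phi : R -> C) (om : R) : C := (RtoC (/ (2 * PI)) * fcoef phi om * U (- om)%R)%C.

(** The Fourier series of [chi * phi] with period [2 PI], in which [e^(i n y)] is replaced by
    [U (-n)]. A distribution carried by [[-1/2, 1/2]] is thus recovered from its transform at the
    integers; whether the transform of [fdist] is [U] elsewhere depends on [U] and is the matter of
    [frep]. *)
Definition fdist (phi : R -> C) : C := Csum (pairsum (fterm phi)).

Lemma fterm_decay : exists K, 0 <= K /\ forall F B, jet F -> 0 <= B ->
  (forall k x, (k <= 2)%nat -> Rabs x <= b0 -> Cmod (F k x) <= B) -> forall n, Cmod (pairsum (fterm (F O)) n) <= K * B * inv_sq_seq n.
Proof.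
  destruct fcoef_decay as [K [HK H]]. exists (4 * K). split; [lra|]. intros F B JF HB HF n.
  replace (4 * K * B) with (4 * (K * B)) by ring. apply pairsum_bound; [now apply Rmult_le_pos|].
  intros om. unfold fterm. rewrite !Cmod_mult. specialize (H F B JF HB HF om). pose proof (HU (- om)).
  pose proof PI_RGT_0. pose proof PI2_3_2. assert (0 < / (2 * PI)) by (apply Rinv_0_lt_compat; lra).
  assert (/ (2 * PI) <= 1) by (rewrite <- Rinv_1; apply Rinv_le_contravar; lra).
  rewrite (Cmod_RtoC_pos (/ (2 * PI))) by lra. pose proof (Cmod_ge_0 (fcoef (F O) om)). pose proof (Cmod_ge_0 (U (- om))).
  apply Rle_trans with (1 * (K * B / (1 + om ^ 2)) * 1); [|lra].
  apply Rmult_le_compat; auto; [apply Rmult_le_pos; lra|]. apply Rmult_le_compat; lra.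
Qed.

Lemma jet_bounded F M N : jet F -> exists B, 0 <= B /\ forall k x, (k <= N)%nat -> Rabs x <= M -> Cmod (F k x) <= B.
Proof.
  intros JF. induction N as [|N [B [HB H]]].
  - destruct (ccont_bounded (F O) (- M) M (jet_ccont F O JF)) as [A HA]. exists (Rabs A). split; [apply Rabs_pos|].
    intros k x Hk Hx. replace k with O by lia. eapply Rle_trans; [apply HA|apply Rle_abs]. now apply Rabs_le_between.
  - destruct (ccont_bounded (F (S N)) (- M) M (jet_ccont F (S N) JF)) as [A HA]. exists (B + Rabs A).
    pose proof (Rabs_pos A). pose proof (Rle_abs A). split; [lra|].
    intros k x Hk Hx. destruct (Nat.eq_dec k (S N)) as [->|Hn].
    + apply Rle_trans with A; [apply HA; now apply Rabs_le_between|lra].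
    + apply Rle_trans with B; [apply H; auto; lia|lra].
Qed.

Lemma fterm_summable F : jet F -> exists b, ex_series b /\ forall n, Cmod (pairsum (fterm (F O)) n) <= b n.
Proof.
  intros JF. destruct fterm_decay as [K [HK H]]. destruct (jet_bounded F b0 2 JF) as [B [HB HF]].
  exists (fun n => K * B * inv_sq_seq n). split; [apply ex_series_scal_R, ex_series_inv_sq|]. now apply H.
Qed.

Lemma fdist_cs_dist : cs_dist fdist.
Proof.
  assert (C1 := jet_ccont chi O Jc).
  assert (CC : forall phi z, ccont phi -> ccont (fun t => (chi O t * phi t * cE z t)%C)).
  { intros phi z Hp. exact (ccont_mult _ _ (ccont_mult _ _ C1 Hp) (cE_ccont z)). }
  split; [|split].
  - intros phi psi Hp Hq. assert (P1 := smooth_ccont _ Hp). assert (P2 := smooth_ccont _ Hq).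
    destruct (fterm_summable _ (smooth_jet _ Hp)) as [b1 [S1 B1]]. destruct (fterm_summable _ (smooth_jet _ Hq)) as [b2 [S2 B2]].
    rewrite cderiv_n_0 in B1, B2. unfold fdist. rewrite <- (Csum_plus _ _ b1 b2) by auto. apply Csum_ext. intros n.
    assert (E : forall om, fterm (fun x => (phi x + psi x)%C) om = (fterm phi om + fterm psi om)%C).
    { intros om. unfold fterm, fcoef, FT.
      rewrite (CI_ext _ (fun t => (chi O t * phi t * cE (- RtoC om) t + chi O t * psi t * cE (- RtoC om) t)%C)) by (intros; ring).
      rewrite (CI_plus _ _ _ _ (CC _ _ P1) (CC _ _ P2)). ring. }
    unfold pairsum. rewrite !E. ring.
  - intros c phi Hp. assert (P1 := smooth_ccont _ Hp).
    destruct (fterm_summable _ (smooth_jet _ Hp)) as [b1 [S1 B1]]. rewrite cderiv_n_0 in B1.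
    unfold fdist. rewrite <- (Csum_scal c _ b1) by auto. apply Csum_ext. intros n.
    assert (E : forall om, fterm (fun x => (c * phi x)%C) om = (c * fterm phi om)%C).
    { intros om. unfold fterm, fcoef, FT.
      rewrite (CI_ext _ (fun t => (c * (chi O t * phi t * cE (- RtoC om) t))%C)) by (intros; ring).
      rewrite (CI_scal c _ _ _ (CC _ _ P1)). ring. }
    unfold pairsum. rewrite !E. ring.
  - destruct fterm_decay as [K [HK H]]. exists b0, (K * Series inv_sq_seq), 2%nat.
    assert (HS : 0 <= Series inv_sq_seq).
    { replace 0 with (Series (fun n : nat => 0 * inv_sq_seq n)) by (rewrite Series_scal_l; ring).
      assert (forall n, 0 < inv_sq_seq n) by (intros n; unfold inv_sq_seq; pose proof (pos_INR n); apply Rinv_0_lt_compat, pow_lt; lra).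
      apply Series_le; [|apply ex_series_inv_sq]. intros n. specialize (H0 n). lra. }
    split; [now apply Rmult_le_pos|]. intros phi B Hp HB.
    assert (HB0 : 0 <= B).
    { eapply Rle_trans; [apply Cmod_ge_0|apply (HB O 0); [lia|rewrite Rabs_R0; unfold b0; lra]]. }
    specialize (H _ B (smooth_jet _ Hp) HB0 HB). rewrite cderiv_n_0 in H.
    replace (K * Series inv_sq_seq * B) with (Series (fun n => K * B * inv_sq_seq n)) by (rewrite Series_scal_l; ring).
    apply Csum_bound; auto. apply ex_series_scal_R, ex_series_inv_sq.
Qed.

End FourierSums.

(* [frep F D]: multiplication of the Fourier coefficients of [chi * e^(-izy)] by [F] reproduces [F z * e^(-izy)]
   for [Rabs y <= D], as if [F] were the Fourier transform of a measure carried by [|y| <= 1/2 - D]. *)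
Section Representation.
Variables (chi : nat -> R -> C) (z : C).
Hypotheses (Jc : jet chi) (chi1 : forall x, Rabs x <= / 2 -> chi O x = RtoC 1)
  (Vc : vanish_out (- (/ 2 + 2)) (/ 2 + 2) chi).

Let co (om : R) : C := fcoef chi (fun y => cE z (- y)) om.
Definition rterm (F : C -> C) (y om : R) : C := (RtoC (/ (2 * PI)) * co om * F (RtoC (- om)) * cE (RtoC om) y)%C.

Definition frep (F : C -> C) (D : R) : Prop :=
  (exists b, 0 <= b /\ forall x, Cmod (F (RtoC x)) <= b) /\
  forall y, Rabs y <= D -> (F z * cE (- z) y)%C = Csum (pairsum (rterm F y)).

Lemma eq_cE_opp : (fun y => cE z (- y)) = Ejet (- z)%C O.
Proof. apply functional_extensionality; intros y. now rewrite Ejet_0, cE_opp. Qed.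

Lemma rterm_bound : exists K, 0 <= K /\ forall F b, 0 <= b -> (forall x, Cmod (F (RtoC x)) <= b) ->
  forall y n, Cmod (pairsum (rterm F y) n) <= K * b * inv_sq_seq n.
Proof.
  destruct (fcoef_decay chi Jc Vc) as [K [HK H]].
  destruct (jet_bounded (Ejet (- z)%C) (/ 2 + 2) 2 (jet_E _)) as [B [HB HE]].
  specialize (H _ B (jet_E (- z)%C) HB HE). rewrite <- eq_cE_opp in H.
  assert (HKB : 0 <= K * B) by now apply Rmult_le_pos.
  exists (4 * (K * B)). split; [lra|]. intros F b Hb HF.
  replace (4 * (K * B) * b) with (4 * (K * B * b)) by ring.
  intros y n. apply pairsum_bound; [now apply Rmult_le_pos|]. intros om. unfold rterm.
  rewrite !Cmod_mult, cE_real_mod, Rmult_1_r. fold (co om) in H.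
  pose proof PI_RGT_0. pose proof PI2_3_2. assert (0 < / (2 * PI)) by (apply Rinv_0_lt_compat; lra).
  assert (/ (2 * PI) <= 1) by (rewrite <- Rinv_1; apply Rinv_le_contravar; lra).
  rewrite (Cmod_RtoC_pos (/ (2 * PI))) by lra. specialize (H om). fold (co om) in H. pose proof (Cmod_ge_0 (co om)).
  apply Rle_trans with (1 * (K * B / (1 + om ^ 2)) * b); [|right; unfold Rdiv; ring].
  apply Rmult_le_compat; auto using Cmod_ge_0; [apply Rmult_le_pos; lra|]. apply Rmult_le_compat; lra.
Qed.

Lemma frep_ext F G D : (forall w, F w = G w) -> frep F D -> frep G D.
Proof. intros E. replace G with F by (now apply functional_extensionality). auto. Qed.

Lemma frep_le F D D' : D' <= D -> frep F D -> frep F D'.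
Proof. intros Hd [H1 H2]. split; auto. intros y Hy. apply H2. lra. Qed.

(** The Fourier series of [chi * e^(-izy)]: since [PI >= 3], the support of [chi], of half-length
    5/2, lies in the period around any [y] with [|y| <= 1/2]. *)
Lemma frep_one : frep (fun _ => RtoC 1) (/ 2).
Proof.
  split; [exists 1; split; [lra|intros; rewrite Cmod_1; lra]|]. intros y Hy. symmetry. apply clim_Csum_unique.
  apply Rabs_le_between in Hy. pose proof PI2_3_2. 
  set (G := fun n => pseq n chi (Ejet (- z)%C)).
  assert (EG : G O = (fun t => (chi O t * cE z (- t))%C)).
  { apply functional_extensionality; intros t. unfold G. simpl pseq. now rewrite Ejet_0, cE_opp. }
  assert (JG : jet G) by (apply jet_pseq; auto; apply jet_E).
  assert (VG : vanish_out (- (/ 2 + 2)) (/ 2 + 2) G) by now apply vanish_pseq.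
  assert (H1 := fourier_series_shifted (- (/ 2 + 2)) (/ 2 + 2) G ltac:(lra) JG VG y 1 0 ltac:(lra) ltac:(lra) ltac:(lra)).
  apply (clim_scal (RtoC (/ (2 * PI)))) in H1. pose proof PI_RGT_0.
  replace (RtoC (/ (2 * PI)) * (RtoC (1 * (2 * PI)) * G 0%nat y))%C with (RtoC 1 * cE (- z) y)%C in H1.
  - eapply is_lim_seq_ext; [|exact H1]. intros n; simpl. do 2 f_equal. rewrite <- Csn_scal. apply Csn_ext. intros k.
    assert (E : forall om, (RtoC (/ (2 * PI)) * Fx (- (/ 2 + 2)) (/ 2 + 2) G y ((0 + om) / 1))%C = rterm (fun _ => RtoC 1) y om).
    { intros om. replace ((0 + om) / 1) with om by field. unfold rterm, Fx, co, fcoef. rewrite EG. ring. }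
    unfold pairsum. rewrite <- !E. ring.
  - rewrite Cmult_assoc, <- RtoC_mult. replace (/ (2 * PI) * (1 * (2 * PI))) with 1 by (field; lra).
    rewrite EG, chi1, cE_opp by (apply Rabs_le; lra). ring.
Qed.

Lemma frep_lin F G D c d : frep F D -> frep G D -> frep (fun w => (c * F w + d * G w)%C) D.
Proof.
  intros [[b1 [Hb1 B1]] H1] [[b2 [Hb2 B2]] H2]. split.
  - exists (Cmod c * b1 + Cmod d * b2). pose proof (Cmod_ge_0 c). pose proof (Cmod_ge_0 d).
    split; [apply Rplus_le_le_0_compat; now apply Rmult_le_pos|].
    intros x. eapply Rle_trans; [apply Cmod_triangle|]. rewrite !Cmod_mult. apply Rplus_le_compat; now apply Rmult_le_compat_l.
  - intros y Hy. destruct rterm_bound as [K [_ Q]].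
    assert (Q1 := Q F b1 Hb1 B1). assert (Q2 := Q G b2 Hb2 B2). set (K1 := K * b1) in *. set (K2 := K * b2) in *.
    assert (S1 : ex_series (fun n => K1 * inv_sq_seq n)) by apply ex_series_scal_R, ex_series_inv_sq.
    assert (S2 : ex_series (fun n => K2 * inv_sq_seq n)) by apply ex_series_scal_R, ex_series_inv_sq.
    replace ((c * F z + d * G z) * cE (- z) y)%C with (c * (F z * cE (- z) y) + d * (G z * cE (- z) y))%C by ring.
    rewrite (H1 y Hy), (H2 y Hy).
    rewrite <- (Csum_scal c _ _ (Q1 y) S1), <- (Csum_scal d _ _ (Q2 y) S2).
    rewrite <- (Csum_plus _ _ (fun n => Cmod c * (K1 * inv_sq_seq n)) (fun n => Cmod d * (K2 * inv_sq_seq n))).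
    + apply Csum_ext. intros n. unfold pairsum, rterm. ring.
    + intros n. rewrite Cmod_mult. apply Rmult_le_compat_l; auto using Cmod_ge_0.
    + now apply ex_series_scal_R.
    + intros n. rewrite Cmod_mult. apply Rmult_le_compat_l; auto using Cmod_ge_0.
    + now apply ex_series_scal_R.
Qed.

Lemma cE_dipZ X W w t : 0 < W -> cE (dipZ X W w) t = (cE (RtoC (- X)) (t / W) * cE w (t / W))%C.
Proof.
  intros HW. rewrite <- cE_plus_z. rewrite <- (Rmult_1_l t) at 2. unfold Rdiv. rewrite (Rmult_comm 1), Rmult_1_r, (Rmult_comm t).
  rewrite <- cE_scal. f_equal. unfold dipZ. apply C_eq; simpl; unfold Rdiv; ring.
Qed.

(** Multiplication by the rescaled [Snc] averages [e^(-izy)] over the translations [y - t / W] with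
    [|t| <= 1], with unimodular weights. The identity at [y] needs the old one up to distance
    [1 / W], which is the loss in [D]. *)
Lemma frep_Snc F D X W : 0 < W -> frep F D -> frep (fun w => (Snc (dipZ X W w) * F w)%C) (D - / W).
Proof.
  intros HW [[b [Hb B]] H]. assert (Hi : 0 < / W) by now apply Rinv_0_lt_compat. split.
  - exists b. split; auto. intros x. rewrite Cmod_mult.
    replace (dipZ X W (RtoC x)) with (RtoC ((x - X) / W)) by (unfold dipZ; apply C_eq; simpl; unfold Rdiv; ring).
    destruct (Snc_real ((x - X) / W)) as [v [-> [Hv _]]]. rewrite Cmod_R. specialize (B x).
    assert (Rabs v <= 1) by (apply Rabs_le; lra). pose proof (Cmod_ge_0 (F (RtoC x))). nra.
  - intros y Hy. destruct rterm_bound as [K' [_ Q']].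
    assert (Q := Q' F b Hb B). set (K := K' * b) in *.
    assert (SK : ex_series (fun n => K * inv_sq_seq n)) by apply ex_series_scal_R, ex_series_inv_sq.
    assert (Dv : forall t, continuous (T:=R_UniformSpace) (U:=R_UniformSpace) (fun t : R => t / W) t).
    { intros t. apply (ex_derive_continuous (V:=R_NormedModule)). auto_derive; lra. }
    assert (Dy : forall t, continuous (T:=R_UniformSpace) (U:=R_UniformSpace) (fun t : R => y - t / W) t).
    { intros t. apply (ex_derive_continuous (V:=R_NormedModule)). auto_derive; lra. }
    set (g := fun t => cE (RtoC (- X)) (t / W)).
    assert (Cg : ccont g) by (exact (ccont_comp _ _ (cE_ccont _) Dv)).
    assert (Cr : forall n, ccont (fun t => pairsum (rterm F (y - t / W)) n)).
    { intros n. unfold pairsum, rterm.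
      assert (Ct : forall c w, ccont (fun t => (c * cE w (y - t / W))%C)).
      { intros c w. exact (ccont_mult _ _ (ccont_const c) (ccont_comp _ _ (cE_ccont _) Dy)). }
      exact (ccont_plus _ _ (Ct _ _) (Ct _ _)). }
    assert (Cf : ccont (fun t => (g t * (F z * cE (- z) (y - t / W)))%C)).
    { apply ccont_mult; auto. apply ccont_mult; [apply ccont_const|]. exact (ccont_comp _ _ (cE_ccont _) Dy). }
    transitivity (/ 2 * CI (fun t => (g t * (F z * cE (- z) (y - t / W)))%C) (-1) 1)%C.
    + unfold Snc. replace (/ 2 * CI (cE (dipZ X W z)) (-1) 1 * F z * cE (- z) y)%C with
        (/ 2 * (F z * cE (- z) y * CI (cE (dipZ X W z)) (-1) 1))%C by ring.
      f_equal. rewrite <- CI_scal by apply cE_ccont. apply CI_ext. intros t. rewrite cE_dipZ by auto. unfold Rminus.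
      rewrite cE_plus_x. rewrite <- (cE_opp (- z)). replace (- - z)%C with z by ring. unfold g. ring.
    + assert (E := CI_Csum (fun n t => (g t * pairsum (rterm F (y - t / W)) n)%C) (fun t => (g t * (F z * cE (- z) (y - t / W)))%C)
        (fun n => K * inv_sq_seq n) (-1) 1 ltac:(lra)).
      rewrite E; auto.
      * rewrite <- (Csum_scal (/ 2)%C _ (fun n => K * inv_sq_seq n * (1 - -1))); [| |].
        -- apply Csum_ext. intros n. unfold pairsum.
           assert (T : forall om, (/ 2 * CI (fun t => (g t * rterm F (y - t / W) om)%C) (-1) 1)%C = rterm (fun w => (Snc (dipZ X W w) * F w)%C) y om).
           { intros om. unfold rterm. 
             rewrite (CI_ext _ (fun t => (RtoC (/ (2 * PI)) * co om * F (RtoC (- om)) * cE (RtoC om) y * cE (dipZ X W (RtoC (- om))) t)%C)).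
             - rewrite CI_scal by apply cE_ccont. unfold Snc. ring.
             - intros t. rewrite cE_dipZ by auto. unfold Rminus. rewrite cE_plus_x, <- (cE_opp (RtoC om)), RtoC_opp. unfold g. ring. }
           rewrite <- !T. rewrite (CI_ext _ (fun t => (g t * rterm F (y - t / W) (INR n) + g t * rterm F (y - t / W) (- INR n - 1))%C)) by (intros; ring).
           assert (C0 : forall om, ccont (fun t => (g t * rterm F (y - t / W) om)%C)).
           { intros om. apply ccont_mult; auto. unfold rterm. apply ccont_mult; [apply ccont_const|exact (ccont_comp _ _ (cE_ccont _) Dy)]. }
           rewrite CI_plus by auto. ring.
        -- intros n. apply CI_bound; [lra|now apply ccont_mult|]. intros t _. rewrite Cmod_mult. unfold g. rewrite cE_real_mod, Rmult_1_l. apply Q.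
        -- apply (ex_series_ext (fun n => (1 - -1) * (K * inv_sq_seq n))); [intros; apply Rmult_comm|now apply ex_series_scal_R].
      * intros n. now apply ccont_mult.
      * intros n t _. rewrite Cmod_mult. unfold g. rewrite cE_real_mod, Rmult_1_l. apply Q.
      * intros t Ht. rewrite H.
        -- symmetry. apply Csum_scal with (2 := SK). intros n; apply Q.
        -- unfold Rminus. eapply Rle_trans; [apply Rabs_triang|]. rewrite Rabs_Ropp. unfold Rdiv. rewrite Rabs_mult, (Rabs_pos_eq (/ W)) by lra.
           assert (Rabs t <= 1) by (apply Rabs_le; lra). assert (Rabs t * / W <= 1 * / W) by (apply Rmult_le_compat_r; lra). lra.
Qed.

(** Each [dipF] contains [2 p] factors [Snc], and there are [N] of them: the total loss is the
    quantity that [gi_supp] makes summable. *)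
Lemma frep_dipP F D p X W N : 0 < W -> frep F D -> frep (fun w => (dipP p X W N w * F w)%C) (D - 2 * INR p * (INR N / W)).
Proof.
  intros HW. unfold dipP.
  assert (S1 : forall k F D, frep F D -> frep (fun w => (Snc (dipZ X W w) ^ k * F w)%C) (D - INR k * / W)).
  { induction k; intros F' D' HF.
    - apply (frep_ext F'); [intros; simpl; ring|]. apply (frep_le _ D'); auto. simpl; lra.
    - rewrite S_INR. apply (frep_ext (fun w => (Snc (dipZ X W w) * (Snc (dipZ X W w) ^ k * F' w))%C)); [intros; simpl; ring|].
      replace (D' - (INR k + 1) * / W) with (D' - INR k * / W - / W) by ring. apply frep_Snc; auto. }
  assert (S2 : forall F D, frep F D -> frep (fun w => (dipF p (dipZ X W w) * F w)%C) (D - 2 * INR p * / W)).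
  { intros F' D' HF. assert (Hi : 0 < / W) by now apply Rinv_0_lt_compat. pose proof (pos_INR p).
    assert (A := S1 (2 * p)%nat F' D' HF). rewrite mult_INR in A. replace (INR 2) with 2 in A by (simpl; ring).
    assert (B := frep_le F' D' (D' - 2 * INR p * / W) ltac:(assert (0 <= INR p * / W) by (apply Rmult_le_pos; lra); lra) HF).
    apply (frep_ext (fun w => (1 * F' w + - / 2 * (Snc (dipZ X W w) ^ (2 * p) * F' w))%C)); [|now apply frep_lin].
    intros w. unfold dipF, dipK. rewrite Cpow_mult_r. ring. }
  revert F D. induction N; intros F D HF.
  - apply (frep_ext F); [intros; simpl; ring|]. apply (frep_le _ D); auto. simpl INR. unfold Rdiv. lra.
  - rewrite S_INR. apply (frep_ext (fun w => (dipF p (dipZ X W w) * (dipF p (dipZ X W w) ^ N * F w))%C)); [intros; simpl; ring|].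
    replace (D - 2 * INR p * ((INR N + 1) / W)) with (D - 2 * INR p * (INR N / W) - 2 * INR p * / W) by (unfold Rdiv; ring). auto.
Qed.

(** At [y = 0] the value [F k z] is a dominated series in the values of [F k] at the integers.
    Bounded pointwise convergence on the real axis therefore carries over to complex [z], with the
    transform of [fdist] as the limit. *)
Lemma frep_dsym_lim (F : nat -> C -> C) (D : nat -> R) U : (forall k, 0 <= D k) -> (forall k, frep (F k) (D k)) ->
  (forall k x, Cmod (F k (RtoC x)) <= 1) -> (forall x, clim (fun k => F k (RtoC x)) (U x)) ->
  clim (fun k => F k z) (dsym (fdist chi U) z).
Proof.
  intros HD HF HB HU.
  assert (E : forall k, Csum (pairsum (rterm (F k) 0)) = F k z).
  { intros k. destruct (HF k) as [_ H]. specialize (H 0). rewrite cE_x0, Cmult_1_r in H. rewrite H; auto. rewrite Rabs_R0. auto. }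
  destruct rterm_bound as [K [_ Q]].
  set (lt := fun om : R => (RtoC (/ (2 * PI)) * co om * U (- om)%R)%C).
  replace (dsym (fdist chi U) z) with (Csum (pairsum lt)).
  - apply (is_lim_seq_ext (fun k => Cmod (Csum (pairsum (rterm (F k) 0)) - Csum (pairsum lt)))).
    { intros k. now rewrite E. }
    apply (clim_Csum_dominated _ _ (fun n => K * 1 * inv_sq_seq n)).
    + apply ex_series_scal_R, ex_series_inv_sq.
    + intros k n. apply Q; [lra|apply HB].
    + assert (HL : forall om, clim (fun k => rterm (F k) 0 om) (lt om)).
      { intros om. apply (is_lim_seq_ext (fun k => Cmod (RtoC (/ (2 * PI)) * co om * F k (RtoC (- om)) - lt om))).
        - intros k. unfold rterm. now rewrite cE_x0, Cmult_1_r.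
        - apply (clim_scal (RtoC (/ (2 * PI)) * co om)%C). apply HU. }
      intros n. unfold pairsum. apply clim_plus; apply HL.
  - reflexivity.
Qed.

End Representation.

(** * The dip product *)

Section DipProduct.
Variables (p : nat) (X W om c Bd Rd Td : nat -> R) (N : nat -> nat) (chi : nat -> R -> C).
Let P (k : nat) := dipP p (X k) (W k) (N k).
Hypotheses (Bd0 : Bd O = 1)
  (BdS : forall k, Bd (S k) = Bd k + Rd k + Td k + X k + INR (N k) + om k)
  (om_pos : forall k, 0 < om k)
  (gX : forall k, 8 * Bd k <= X k)
  (gom : forall k, 8 * om k <= X k)
  (gW : forall k, Bd k <= W k)
  (gsupp : forall k, 2 * INR p * (INR (N k) / W k) <= (/ 2) ^ k / 4)
  (gfar : forall k, INR (N k) * ((8 * W k / X k) ^ 2) ^ p <= (/ 2) ^ k / 50)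
  (gshift : forall k, INR (N k) * ((2 * W k / om k) ^ 2) ^ p <= 1)
  (gc : forall k, 0 < c k <= (/ 2) ^ k / 16)
  (hprev : forall k z, Rabs (fst z) <= Bd k -> Rabs (snd z) <= Bd k -> Cmod (cprod P k (z - RtoC (om k))%C) <= 3 / 2)
  (hR : forall k, Bd k <= Rd k) (hT : forall k, Rd k <= Td k)
  (hbox : forall k, box_dom (cprod P (S k)) (fun t => exists i, (i <= k)%nat /\ t = om i) (Rd k) (Td k))
  (Jc : jet chi) (chi1 : forall x, Rabs x <= / 2 -> chi O x = RtoC 1)
  (Vc : vanish_out (- (/ 2 + 2)) (/ 2 + 2) chi).

Lemma Bd_ge_1 k : 1 <= Bd k.
Proof.
  induction k; [rewrite Bd0; lra|]. rewrite BdS. pose proof (hR k). pose proof (hT k). pose proof (gX k).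
  pose proof (om_pos k). pose proof (pos_INR (N k)). lra.
Qed.

Lemma Bd_step k : Bd k + Rd k + Td k <= Bd (S k) /\ Bd k + Rd k + om k <= Bd (S k) /\ X k + Bd k <= Bd (S k) /\ INR (N k) <= Bd (S k) /\ Bd k + om k <= Bd (S k).
Proof.
  rewrite BdS. pose proof (hR k). pose proof (hT k). pose proof (gX k). pose proof (Bd_ge_1 k).
  pose proof (om_pos k). pose proof (pos_INR (N k)). lra.
Qed.

Lemma Bd_mono i j : (i <= j)%nat -> Bd i <= Bd j.
Proof.
  induction 1; [lra|]. destruct (Bd_step m) as [H1 _]. pose proof (hR m). pose proof (hT m). pose proof (Bd_ge_1 m). lra.
Qed.

Lemma W_pos' k : 0 < W k.
Proof. pose proof (gW k). pose proof (Bd_ge_1 k). lra. Qed.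

Lemma X_sep i j : (i < j)%nat -> 8 * X i + 8 <= X j.
Proof.
  intros H. pose proof (gX j). assert (Bd (S i) <= Bd j) by now apply Bd_mono.
  destruct (Bd_step i) as [_ [_ [H3 _]]]. pose proof (Bd_ge_1 i). lra.
Qed.

Definition in_box (B : R) (z : C) : Prop := Rabs (fst z) <= B /\ Rabs (snd z) <= B.

Lemma in_box_le B B' z : B <= B' -> in_box B z -> in_box B' z.
Proof. unfold in_box. lra. Qed.

Lemma in_box_shift B t z : 0 <= t -> in_box B z -> in_box (B + t) (z - RtoC t).
Proof.
  intros Ht [H1 H2]. split; simpl.
  - eapply Rle_trans; [apply Rabs_triang|]. rewrite Rabs_Ropp, (Rabs_pos_eq t); lra.
  - replace (snd z + - 0) with (snd z) by ring. lra.
Qed.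

Lemma pow_half_pos k : 0 < (/ 2) ^ k <= 1.
Proof. split; [apply pow_lt; lra|]. rewrite <- (pow1 k). apply pow_incr; lra. Qed.

Lemma far_factor k z : X k / 4 <= Rabs (fst z - X k) -> Rabs (snd z) <= Bd k -> Cmod (P k z - 1) <= (/ 2) ^ k / 50.
Proof.
  intros H1 H2. pose proof (gX k). pose proof (Bd_ge_1 k). pose proof (pow_half_pos k).
  apply (dipP_far p (X k) (W k) (N k) z (X k / 4)); auto using W_pos'; try lra.
  - pose proof (gW k). lra.
  - replace (2 * W k / (X k / 4)) with (8 * W k / X k) by (field; lra). apply gfar.
Qed.

Lemma far_box k z : in_box (Bd k) z -> Cmod (P k z - 1) <= (/ 2) ^ k / 50.
Proof.
  intros [H1 H2]. apply far_factor; auto. pose proof (gX k). pose proof (Bd_ge_1 k).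
  rewrite Rabs_minus_sym. pose proof (Rabs_triang_inv (X k) (fst z)). rewrite (Rabs_pos_eq (X k)) in H3; lra.
Qed.

Lemma far_box_shift k z : in_box (Bd k) z -> Cmod (P k (z - RtoC (om k))%C - 1) <= (/ 2) ^ k / 50.
Proof.
  intros [H1 H2]. pose proof (gX k). pose proof (Bd_ge_1 k). pose proof (om_pos k).
  apply far_factor; simpl; [|now replace (snd z + - 0) with (snd z) by ring].
  apply Rabs_le_between in H1. rewrite Rabs_left; lra.
Qed.

(** Inside the box of index [k] every later factor is close to 1. The errors are kept relative to
    the product of the first [k] factors and stay within the geometric budget [1/16 + 1/32 + ...] of
    total 1/8. *)
Lemma prod_tail k i z : in_box (Bd k) z ->
  Cmod (cprod P (i + k) z - cprod P k z) <= / 8 * (1 - (/ 2) ^ i) * Cmod (cprod P k z).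
Proof.
  intros Hz. set (A := Cmod (cprod P k z)). assert (HA : 0 <= A) by apply Cmod_ge_0. induction i.
  - simpl. replace (cprod P k z - cprod P k z)%C with (RtoC 0) by ring. rewrite Cmod_0. lra.
  - simpl cprod. simpl pow. set (q := cprod P (i + k) z) in *.
    assert (Hf : Cmod (P (i + k)%nat z - 1) <= (/ 2) ^ i / 50).
    { eapply Rle_trans; [apply far_box, (in_box_le (Bd k)); auto; apply Bd_mono; lia|].
      rewrite pow_add. pose proof (pow_half_pos i). pose proof (pow_half_pos k). nra. }
    replace (P (i + k)%nat z * q - cprod P k z)%C with ((P (i + k)%nat z - 1) * q + (q - cprod P k z))%C by ring.
    eapply Rle_trans; [apply Cmod_triangle|]. rewrite Cmod_mult.
    assert (Hq : Cmod q <= 9 / 8 * A).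
    { replace q with (cprod P k z + (q - cprod P k z))%C by ring. eapply Rle_trans; [apply Cmod_triangle|]. fold A.
      pose proof (pow_half_pos i). nra. }
    pose proof (pow_half_pos i). set (h := (/ 2) ^ i) in *.
    assert (Cmod (P (i + k)%nat z - 1) * Cmod q <= h / 50 * (9 / 8 * A)) by (apply Rmult_le_compat; auto using Cmod_ge_0).
    assert (0 <= h * A) by (apply Rmult_le_pos; lra). lra.
Qed.

Lemma prod_tail_bound k i z : in_box (Bd k) z -> Cmod (cprod P (i + k) z) <= 9 / 8 * Cmod (cprod P k z).
Proof.
  intros Hz. assert (H := prod_tail k i z Hz). replace (cprod P (i + k) z) with (cprod P k z + (cprod P (i + k) z - cprod P k z))%C by ring.
  eapply Rle_trans; [apply Cmod_triangle|]. pose proof (pow_half_pos i). pose proof (Cmod_ge_0 (cprod P k z)). nra.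
Qed.

Definition vfac (k : nat) (xi : R) : R := fst (P k (RtoC xi)).

Lemma vfac_spec k xi : P k (RtoC xi) = RtoC (vfac k xi) /\ 0 < vfac k xi <= 1 /\
  (X k / 4 <= Rabs (xi - X k) -> 1 - (/ 2) ^ k / 100 <= vfac k xi) /\
  (om k / 2 <= Rabs (xi - X k) -> / 2 <= vfac k xi) /\
  (Rabs (xi - X k) <= W k -> vfac k xi <= exp (- (/ 2 * (/ 4) ^ p * INR (N k)))).
Proof.
  pose proof (W_pos' k) as HW. destruct (dipP_real p (X k) (W k) (N k) xi HW) as [v [E [Hv [H1 H2]]]].
  assert (Ev : vfac k xi = v) by (unfold vfac, P; now rewrite E). rewrite Ev.
  pose proof (gX k). pose proof (Bd_ge_1 k). pose proof (om_pos k). pose proof (pos_INR (N k)).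
  split; [exact E|]. split; [auto|]. split; [|split].
  - intros Hd. specialize (H1 (X k / 4) ltac:(lra) Hd).
    assert (INR (N k) * ((W k / (X k / 4)) ^ 2) ^ p <= INR (N k) * ((8 * W k / X k) ^ 2) ^ p).
    { apply Rmult_le_compat_l; auto. apply pow_incr. split; [apply pow2_ge_0|].
      replace (8 * W k / X k) with (2 * (W k / (X k / 4))) by (field; lra). rewrite Rpow_mult_distr. pose proof (pow2_ge_0 (W k / (X k / 4))). lra. }
    pose proof (gfar k). lra.
  - intros Hd. specialize (H1 (om k / 2) ltac:(lra) Hd).
    replace (W k / (om k / 2)) with (2 * W k / om k) in H1 by (field; lra). pose proof (gshift k). lra.
  - intros Hd. eapply Rle_trans; [apply H2, Hd|].
    assert (Hq4 : 0 <= (/ 4) ^ p <= 1).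
    { split; [apply pow_le; lra|]. rewrite <- (pow1 p). apply pow_incr; lra. }
    apply Rle_trans with (exp (- (/ 2 * (/ 4) ^ p)) ^ N k).
    + apply pow_incr. split; [lra|]. pose proof (exp_ineq1_le (- (/ 2 * (/ 4) ^ p))). lra.
    + rewrite <- Rpower_pow by apply exp_pos. unfold Rpower. rewrite ln_exp. apply exp_le. lra.
Qed.

Fixpoint vprod (k : nat) (xi : R) : R := match k with O => 1 | S k => vfac k xi * vprod k xi end.

Lemma cprod_real k xi : cprod P k (RtoC xi) = RtoC (vprod k xi).
Proof.
  induction k; [reflexivity|]. simpl. rewrite IHk. destruct (vfac_spec k xi) as [-> _]. now rewrite <- RtoC_mult.
Qed.

Lemma vprod_bounds k xi : 0 < vprod k xi <= 1.
Proof.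
  induction k; simpl; [lra|]. destruct (vfac_spec k xi) as [_ [H _]]. split; [apply Rmult_lt_0_compat; lra|].
  rewrite <- (Rmult_1_l 1). apply Rmult_le_compat; lra.
Qed.

Lemma vprod_decr k xi : vprod (S k) xi <= vprod k xi.
Proof.
  simpl. destruct (vfac_spec k xi) as [_ [H _]]. pose proof (vprod_bounds k xi). rewrite <- (Rmult_1_l (vprod k xi)) at 2.
  apply Rmult_le_compat_r; lra.
Qed.

Definition vlim (xi : R) : R := real (Lim_seq (fun k => vprod k xi)).

Lemma vlim_spec xi : is_lim_seq (fun k => vprod k xi) (vlim xi).
Proof.
  assert (H : ex_finite_lim_seq (fun k => vprod k xi)).
  { apply ex_finite_lim_seq_decr with 0; intros k; [apply vprod_decr|left; apply vprod_bounds]. }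
  destruct H as [l Hl]. unfold vlim. now rewrite (is_lim_seq_unique _ _ Hl).
Qed.

Lemma vlim_le k xi : vlim xi <= vprod k xi.
Proof. apply (is_lim_seq_decr_compare _ _ (vlim_spec xi)). intros; apply vprod_decr. Qed.

Lemma vlim_ge m xi : (forall k, m <= vprod k xi) -> m <= vlim xi.
Proof.
  intros H. apply (is_lim_seq_le (fun _ => m) (fun k => vprod k xi) m (vlim xi) H); [apply is_lim_seq_const|apply vlim_spec].
Qed.

Lemma vlim_bounds xi : 0 <= vlim xi <= 1.
Proof. split; [apply vlim_ge; intros; left; apply vprod_bounds|]. exact (vlim_le O xi). Qed.

Lemma vlim_dip j xi : Rabs (xi - X j) <= W j -> vlim xi <= exp (- (/ 2 * (/ 4) ^ p * INR (N j))).
Proof.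
  intros H. eapply Rle_trans; [apply (vlim_le (S j))|]. simpl. destruct (vfac_spec j xi) as [_ [H1 [_ [_ H2]]]].
  pose proof (vprod_bounds j xi). specialize (H2 H). nra.
Qed.

(** At most one factor can be as small as 1/2, the one of index [i]; the others lie within
    [2^(-k) / 100] of 1, so their product stays above 1/2. *)
Lemma vlim_good i xi : (forall j, j <> i -> X j / 4 <= Rabs (xi - X j)) -> om i / 2 <= Rabs (xi - X i) -> / 4 <= vlim xi.
Proof.
  intros Hj Hi. apply vlim_ge.
  (* The induction bound decreases from 1 to 1/2 through [1/2 + 2^(-k) / 2], and is halved once,
     when the factor [i] is included. *)
  assert (H : forall k, (if lt_dec i k then / 2 else 1) * (/ 2 + (/ 2) ^ k / 2) <= vprod k xi).
  { induction k; [destruct (lt_dec i 0); [lia|simpl; lra]|]. simpl vprod. simpl pow.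
    pose proof (pow_half_pos k). set (h := (/ 2) ^ k) in *.
    destruct (vfac_spec k xi) as [_ [Hv [Hf [Hs _]]]]. fold h in Hf.
    destruct (Nat.eq_dec k i) as [->|Hn].
    - specialize (Hs Hi). destruct (lt_dec i (S i)); [|lia]. destruct (lt_dec i i); [lia|].
      apply Rle_trans with (/ 2 * (1 * (/ 2 + h / 2))); [lra|]. apply Rmult_le_compat; lra.
    - specialize (Hf (Hj k Hn)).
      assert (Q : forall b, / 2 <= b <= 1 -> b * (/ 2 + h / 2) <= vprod k xi -> b * (/ 2 + / 2 * h / 2) <= vfac k xi * vprod k xi).
      { intros b Hb HQ. apply Rle_trans with ((1 - h / 100) * (b * (/ 2 + h / 2))).
        - assert (h * h <= h) by nra. assert (0 <= b * h) by (apply Rmult_le_pos; lra).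
          assert (b * (h * h) <= b * h) by (apply Rmult_le_compat_l; lra). lra.
        - apply Rmult_le_compat; try lra. apply Rmult_le_pos; lra. }
      destruct (lt_dec i (S k)), (lt_dec i k); try lia; apply Q; auto; lra. }
  intros k. specialize (H k). pose proof (pow_half_pos k). destruct (lt_dec i k); lra.
Qed.

Definition dip_dist : (R -> C) -> C := fdist chi (fun xi => RtoC (vlim xi)).

Lemma vlim_clim xi : clim (fun k => cprod P k (RtoC xi)) (RtoC (vlim xi)).
Proof.
  unfold clim. apply (is_lim_seq_ext (fun k => Rabs (vprod k xi - vlim xi))).
  - intros k. now rewrite cprod_real, <- RtoC_minus, Cmod_R.
  - apply (is_lim_seq_abs_0 (fun k => vprod k xi - vlim xi)). replace (Finite 0) with (Finite (vlim xi - vlim xi)) by (f_equal; ring).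
    apply is_lim_seq_minus'; [apply vlim_spec|apply is_lim_seq_const].
Qed.

Lemma vlim_Cmod xi : Cmod (RtoC (vlim xi)) <= 1.
Proof. rewrite Cmod_R. apply Rabs_le. pose proof (vlim_bounds xi). lra. Qed.

Lemma dip_dist_cs : cs_dist dip_dist.
Proof. apply fdist_cs_dist; auto. intros; apply vlim_Cmod. Qed.

(** The part of the initial 1/2 not yet consumed by the first [k] factors; it remains positive, so
    the representation stays valid at [y = 0]. *)
Fixpoint supp_left (k : nat) : R := match k with O => / 2 | S k => supp_left k - 2 * INR p * (INR (N k) / W k) end.

Lemma supp_left_ge k : (/ 2) ^ k / 2 <= supp_left k.
Proof. induction k; simpl; [lra|]. pose proof (gsupp k). lra. Qed.

Lemma dip_dist_lim z : clim (fun k => cprod P k z) (dsym dip_dist z).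
Proof.
  apply (frep_dsym_lim chi z Jc Vc (cprod P) supp_left).
  - intros k. pose proof (supp_left_ge k). pose proof (pow_half_pos k). lra.
  - induction k; [exact (frep_one chi z Jc chi1 Vc)|].
    exact (frep_dipP chi z Jc Vc (cprod P k) (supp_left k) p (X k) (W k) (N k) (W_pos' k) IHk).
  - intros k x. rewrite cprod_real, Cmod_R. pose proof (vprod_bounds k x). apply Rabs_le; lra.
  - apply vlim_clim.
Qed.

Lemma dip_dist_real xi : dsym dip_dist (RtoC xi) = RtoC (vlim xi).
Proof. eapply clim_unique; [apply dip_dist_lim|apply vlim_clim]. Qed.

Definition on_box (k : nat) (z : C) : Prop :=
  (Rabs (fst z) = Rd k /\ Rabs (snd z) <= Td k) \/ (Rabs (snd z) = Td k /\ Rabs (fst z) <= Rd k).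

Lemma on_box_in k z : on_box k z -> Rabs (fst z) <= Rd k /\ Rabs (snd z) <= Td k.
Proof. unfold on_box. lra. Qed.

Lemma dsym_near k z : on_box k z -> Cmod (dsym dip_dist z - cprod P (S k) z) <= / 8 * Cmod (cprod P (S k) z).
Proof.
  intros Hz. apply on_box_in in Hz.
  assert (Hb : in_box (Bd (S k)) z).
  { destruct (Bd_step k) as [H _]. pose proof (hR k). pose proof (hT k). pose proof (Bd_ge_1 k). unfold in_box. lra. }
  apply clim_bound with (s := fun i => (cprod P (i + S k) z - cprod P (S k) z)%C).
  - apply (is_lim_seq_ext (fun i => Cmod (cprod P (i + S k) z - dsym dip_dist z))).
    + intros i. f_equal. ring.
    + apply (clim_incr_n (fun i => cprod P i z)). apply dip_dist_lim.
  - intros i. eapply Rle_trans; [apply prod_tail; auto|]. pose proof (pow_half_pos i). pose proof (Cmod_ge_0 (cprod P (S k) z)). nra.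
Qed.

Lemma dsym_bound k z B : in_box (Bd k) z -> Cmod (cprod P k z) <= B -> Cmod (dsym dip_dist z) <= 9 / 8 * B.
Proof.
  intros Hz HB. apply clim_bound with (s := fun i => cprod P (i + k) z).
  - apply (clim_incr_n (fun i => cprod P i z)). apply dip_dist_lim.
  - intros i. eapply Rle_trans; [apply prod_tail_bound; auto|lra].
Qed.

(** For [i <= k] the shift is covered by [box_dom], up to the tail factor 9/8. For [i > k] the first
    [i] factors at the shifted point are bounded by 3/2 through [hprev], the factor [i] is near 1
    there, and the later ones cost 9/8; as the unshifted product is at least 1 in modulus, the
    product of these constants, below 2, suffices. *)
Lemma dsym_shift_bound k i z : on_box k z -> Cmod (dsym dip_dist (z - RtoC (om i))%C) <= 2 * Cmod (cprod P (S k) z).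
Proof.
  intros Hz. destruct (hbox k z Hz) as [A1 A2]. apply on_box_in in Hz. set (A := Cmod (cprod P (S k) z)) in *.
  assert (Hb : in_box (Bd (S k)) z).
  { destruct (Bd_step k) as [H _]. pose proof (hR k). pose proof (hT k). pose proof (Bd_ge_1 k). unfold in_box. lra. }
  pose proof (om_pos i).
  destruct (le_lt_dec i k) as [Hi|Hi].
  - apply Rle_trans with (9 / 8 * (3 / 2 * A)); [|lra]. apply (dsym_bound (S k)).
    + assert (Hk : om i <= Bd k + om k).
      { destruct (Nat.eq_dec i k) as [->|Hn]; [pose proof (Bd_ge_1 k); lra|].
        destruct (Bd_step i) as [_ [_ [_ [_ H5]]]]. assert (Bd (S i) <= Bd k) by (apply Bd_mono; lia).
        pose proof (Bd_ge_1 i). pose proof (om_pos k). lra. }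
      destruct (Bd_step k) as [H1 [H2 _]]. pose proof (Bd_ge_1 k). pose proof (hR k). pose proof (hT k). split; simpl.
      * eapply Rle_trans; [apply Rabs_triang|]. rewrite Rabs_Ropp, (Rabs_pos_eq (om i)) by lra. lra.
      * replace (snd z + - 0) with (snd z) by ring. apply Hb.
    + apply A2. exists i; auto.
  - assert (Hbi : in_box (Bd i) z) by (apply (in_box_le (Bd (S k))); auto; apply Bd_mono; lia).
    apply Rle_trans with (9 / 8 * (51 / 50 * (3 / 2))); [|lra]. apply (dsym_bound (S i)).
    + apply (in_box_le (Bd i + om i)); [apply Bd_step|]. apply in_box_shift; auto. lra.
    + simpl. rewrite Cmod_mult. apply Rmult_le_compat; auto using Cmod_ge_0.
      * replace (P i (z - RtoC (om i))) with (1 + (P i (z - RtoC (om i)) - 1))%C by ring.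
        eapply Rle_trans; [apply Cmod_triangle|]. rewrite Cmod_1.
        pose proof (far_box_shift i z Hbi). pose proof (pow_half_pos i). lra.
      * apply hprev; apply Hbi.
Qed.

(* The multiplier is [1 + sum_j c j * e^(i om j x)]; index [0] is its constant term. *)
Definition fc (n : nat) : R := match n with O => 1 | S j => c j end.
Definition fo (n : nat) : R := match n with O => 0 | S j => om j end.

Lemma c_series : ex_series c /\ Series c <= / 8.
Proof.
  assert (G : Rabs (/ 2) < 1) by (rewrite Rabs_pos_eq; lra).
  assert (E : ex_series (fun k => / 16 * (/ 2) ^ k)) by (apply ex_series_scal_R, ex_series_geom; auto).
  assert (L : forall k, 0 <= c k <= / 16 * (/ 2) ^ k) by (intros k; pose proof (gc k); lra).
  split.
  - apply (ex_series_le (K:=R_AbsRing) (V:=R_CompleteNormedModule) c _) with (2 := E).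
    intros k. change (norm (c k)) with (Rabs (c k)). specialize (L k). rewrite Rabs_pos_eq; lra.
  - eapply Rle_trans; [apply (Series_le _ _ L E)|]. rewrite Series_scal_l, Series_geom by auto. lra.
Qed.

Definition Vsum (z : C) : C := Csum (fun n => (RtoC (fc n) * dsym dip_dist (z - RtoC (fo n))%C)%C).

Lemma Vsum_split z A : 0 <= A -> (forall i, Cmod (dsym dip_dist (z - RtoC (om i))%C) <= A) ->
  Vsum z = (dsym dip_dist z + Csum (fun i => (RtoC (c i) * dsym dip_dist (z - RtoC (om i)))%C))%C /\
  Cmod (Csum (fun i => (RtoC (c i) * dsym dip_dist (z - RtoC (om i)))%C)) <= / 8 * A.
Proof.
  intros HA HB. destruct c_series as [Sc Sc8].
  assert (HcA : forall i, Cmod (RtoC (c i) * dsym dip_dist (z - RtoC (om i))) <= A * c i).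
  { intros i. pose proof (gc i). rewrite Cmod_mult, Cmod_RtoC_pos by lra. rewrite Rmult_comm. apply Rmult_le_compat_r; [lra|apply HB]. }
  split.
  - unfold Vsum. set (b := fun n => match n with O => Cmod (dsym dip_dist z) | S j => A * c j end).
    rewrite (Csum_shift _ b 1).
    + simpl. f_equal. replace (z - RtoC 0)%C with z by ring. ring.
    + intros [|j]; unfold b; simpl.
      * replace (z - RtoC 0)%C with z by ring. rewrite Cmult_1_l. lra.
      * apply HcA.
    + apply (ex_series_incr_1 b). apply (ex_series_ext (fun j => A * c j)); [reflexivity|]. now apply ex_series_scal_R.
  - eapply Rle_trans; [apply (Csum_bound _ _ HcA); now apply ex_series_scal_R|]. rewrite Series_scal_l. nra.
Qed.

(** With [A] the modulus of the finite product, the unshifted term is at least [7/8 A], while all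
    shifted ones together are at most [1/8 * 2 A]. *)
Lemma Vsum_box k z : on_box k z -> / 8 <= Cmod (Vsum z).
Proof.
  intros Hz. destruct (hbox k z Hz) as [A1 _]. set (A := Cmod (cprod P (S k) z)) in *.
  destruct (Vsum_split z (2 * A) ltac:(lra) (fun i => dsym_shift_bound k i z Hz)) as [-> HB].
  assert (H := dsym_near k z Hz). fold A in H.
  assert (Q : A <= Cmod (dsym dip_dist z) + / 8 * A).
  { unfold A at 1. replace (cprod P (S k) z) with (dsym dip_dist z - (dsym dip_dist z - cprod P (S k) z))%C by ring.
    unfold Cminus at 1. eapply Rle_trans; [apply Cmod_triangle|]. rewrite Cmod_opp. lra. }
  eapply Rle_trans; [|apply Cmod_add_ge]. lra.
Qed.

(** On the real axis all terms are nonnegative, so any single one bounds the sum from below: no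
    cancellation has to be excluded. *)
Lemma Vsum_ge n xi : fc n * vlim (xi - fo n) <= Cmod (Vsum (RtoC xi)).
Proof.
  assert (Hfc : forall n, 0 < fc n) by (intros [|j]; simpl; [lra|apply gc]).
  assert (E : Vsum (RtoC xi) = Csum (fun n => RtoC (fc n * vlim (xi - fo n)))).
  { unfold Vsum. apply Csum_ext. intros i. rewrite <- RtoC_minus, dip_dist_real. now rewrite RtoC_mult. }
  assert (S1 : ex_series fc) by (apply (ex_series_incr_1 fc); apply (ex_series_ext c); [reflexivity|apply c_series]).
  assert (L : forall i, 0 <= fc i * vlim (xi - fo i) <= fc i).
  { intros i. pose proof (vlim_bounds (xi - fo i)). specialize (Hfc i). split; [apply Rmult_le_pos; lra|nra]. }
  assert (S2 : ex_series (fun i => fc i * vlim (xi - fo i))).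
  { apply (ex_series_le (K:=R_AbsRing) (V:=R_CompleteNormedModule) _ fc) with (2 := S1).
    intros i. change (norm (fc i * vlim (xi - fo i))) with (Rabs (fc i * vlim (xi - fo i))). rewrite Rabs_pos_eq; apply L. }
  eapply Rle_trans; [|apply Rabs_fst_le]. eapply Rle_trans; [|apply Rle_abs]. rewrite E. simpl.
  apply Rle_trans with (sum_n (fun i => fc i * vlim (xi - fo i)) n).
  - destruct n; [rewrite sum_O; lra|]. rewrite sum_Sn. change plus with Rplus.
    assert (0 <= sum_n (fun i => fc i * vlim (xi - fo i)) n).
    { clear - L. induction n; [rewrite sum_O; apply L|]. rewrite sum_Sn. change plus with Rplus. pose proof (L (S n)). lra. }
    lra.
  - apply (is_lim_seq_incr_compare (sum_n (fun i => fc i * vlim (xi - fo i)))).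
    + apply Series_correct in S2. exact S2.
    + intros k. rewrite sum_Sn. change plus with Rplus. pose proof (L (S k)). lra.
Qed.

(** Away from all dips, or at distance at least [om i / 2] from the centre of one, the unshifted
    term is at least 1/4. Otherwise [xi - om i] is at distance at least [om i / 2] from [X i], on
    its left, and the shifted term [i] takes over at the price of [c i]. *)
Lemma Vsum_real xi : / 4 <= Cmod (Vsum (RtoC xi)) \/
  exists i, 3 / 4 * X i <= xi /\ / 4 * c i <= Cmod (Vsum (RtoC xi)).
Proof.
  assert (V0 := Vsum_ge O xi). simpl fc in V0; simpl fo in V0. rewrite Rminus_0_r, Rmult_1_l in V0.
  destruct (Classical_Prop.classic (exists i, Rabs (xi - X i) < X i / 4)) as [[i Hi]|Hn].
  - assert (Hom := gom i). pose proof (om_pos i).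
    assert (Hoth : forall xi', Rabs (xi' - X i) <= 3 / 8 * X i -> forall j, j <> i -> X j / 4 <= Rabs (xi' - X j)).
    { intros xi' Hx j Hj. apply Rabs_le_between in Hx.
      assert (Hp : forall k, 0 < X k) by (intros k; pose proof (gX k); pose proof (Bd_ge_1 k); lra).
      pose proof (Hp i). pose proof (Hp j).
      destruct (lt_dec i j) as [Hl|Hl].
      - pose proof (X_sep i j Hl). rewrite Rabs_left; lra.
      - pose proof (X_sep j i ltac:(lia)). rewrite Rabs_pos_eq; lra. }
    destruct (Rle_dec (om i / 2) (Rabs (xi - X i))) as [Hd|Hd].
    + left. assert (/ 4 <= vlim xi) by (apply (vlim_good i); auto; apply Hoth; lra). lra.
    + right. exists i. apply Rabs_lt_between in Hi. split; [lra|].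
      assert (Vi := Vsum_ge (S i) xi). simpl in Vi.
      assert (Hd' : Rabs (xi - X i) <= om i / 2) by lra. apply Rabs_le_between in Hd'.
      assert (/ 4 <= vlim (xi - om i)).
      { apply (vlim_good i).
        - apply Hoth. apply Rabs_le. lra.
        - rewrite Rabs_left1; lra. }
      pose proof (gc i). nra.
  - left. assert (/ 4 <= vlim xi); [|lra].
    assert (Ha : forall j, X j / 4 <= Rabs (xi - X j)).
    { intros j. destruct (Rle_dec (X j / 4) (Rabs (xi - X j))); auto. exfalso. apply Hn. exists j. lra. }
    apply (vlim_good O); auto. pose proof (gom O). specialize (Ha O). pose proof (om_pos O). lra.
Qed.

Theorem dip_distribution : exists u, cs_dist u /\
  (forall xi, Cmod (dsym u (RtoC xi)) <= 1) /\
  (forall j xi, Rabs (xi - X j) <= W j -> Cmod (dsym u (RtoC xi)) <= exp (- (/ 2 * (/ 4) ^ p * INR (N j)))) /\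
  let V := fun z => Csum (fun n => (RtoC (fc n) * dsym u (z - RtoC (fo n))%C)%C) in
  (forall k z, on_box k z -> / 8 <= Cmod (V z)) /\
  forall xi, / 4 <= Cmod (V (RtoC xi)) \/ exists i, 3 / 4 * X i <= xi /\ / 4 * c i <= Cmod (V (RtoC xi)).
Proof.
  exists dip_dist. split; [exact dip_dist_cs|]. split; [|split; [|split; [exact Vsum_box|exact Vsum_real]]].
  - intros xi. rewrite dip_dist_real. apply vlim_Cmod.
  - intros j xi H. rewrite dip_dist_real, Cmod_R, Rabs_pos_eq by apply vlim_bounds. now apply vlim_dip.
Qed.

End DipProduct.

(** * The multiplier *)

Lemma cs_dist_mul_fun F v : jet F -> cs_dist v -> cs_dist (mul_fun_dist (F O) v).
Proof.
  intros JF Hv. unfold mul_fun_dist.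
  assert (JP : forall phi, smooth phi -> jet (fun n => pseq n F (cderiv_n phi))) by (intros; apply jet_pseq; auto using smooth_jet).
  assert (E : forall phi, (fun x => (F O x * phi x)%C) = (fun n => pseq n F (cderiv_n phi)) O).
  { intros phi. simpl. now rewrite cderiv_n_0. }
  split; [|split].
  - intros phi psi Hp Hq.
    assert (A := cs_dist_add v Hv _ _ (JP phi Hp) (JP psi Hq)). cbn [pseq] in A. rewrite !cderiv_n_0 in A. rewrite <- A. f_equal.
    apply functional_extensionality; intros x. ring.
  - intros c phi Hp.
    assert (A := cs_dist_scal v Hv c _ (JP phi Hp)). cbn [pseq] in A. rewrite !cderiv_n_0 in A. rewrite <- A. f_equal.
    apply functional_extensionality; intros x. ring.
  - destruct (cs_dist_bound v Hv) as [M [K [N [HK H]]]]. destruct (jet_bounded F M N JF) as [A [HA HF]].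
    exists M, (K * (2 ^ N * A)), N. assert (0 < 2 ^ N) by (apply pow_lt; lra).
    split; [repeat apply Rmult_le_pos; lra|]. intros phi B Hp HB. rewrite E.
    rewrite Rmult_assoc. apply (H (fun n => pseq n F (cderiv_n phi))); [now apply JP|]. intros k x Hk Hx. rewrite Rmult_assoc.
    eapply Rle_trans; [apply (pseq_bound k F (cderiv_n phi) x A B)|].
    + intros i Hi. apply HF; auto. lia.
    + intros i Hi. apply HB; auto. lia.
    + apply Rmult_le_compat_r; [|apply Rle_pow; [lra|auto]]. apply Rmult_le_pos; auto.
      eapply Rle_trans; [apply Cmod_ge_0|apply (HB O x); [lia|auto]].
Qed.

(** * Taylor's formula and real analyticity, for the endpoint [a = 1] *)

Lemma jet_taylor_forward F x h n B : jet F -> 0 < h ->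
  (forall t, Rabs (t - x) <= h -> Cmod (F (S n) t) <= B) ->
  Cmod (F O (x + h) - Csn (fun k => (F k x * / RtoC (INR (fact k)) * RtoC (h ^ k))%C) (S n)) <= 2 * (B * (h ^ S n / INR (fact (S n)))).
Proof.
  intros JF Hh HB. set (r := h ^ S n / INR (fact (S n))).
  assert (Hr : 0 < r) by (apply Rdiv_lt_0_compat; [now apply pow_lt|apply INR_fact_lt_0]).
  assert (Sm := jet_smooth F JF).
  assert (D1 : forall k t, Derive_n (fun s => fst (F O s)) k t = fst (F k t)) by (intros k t; exact (f_equal fst (jet_cderiv_n F k t JF))).
  assert (D2 : forall k t, Derive_n (fun s => snd (F O s)) k t = snd (F k t)) by (intros k t; exact (f_equal snd (jet_cderiv_n F k t JF))).
  assert (HS : forall m, Csn (fun k => (F k x * / RtoC (INR (fact k)) * RtoC (h ^ k))%C) (S m) =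
     (sum_f_R0 (fun k => h ^ k / INR (fact k) * fst (F k x)) m, sum_f_R0 (fun k => h ^ k / INR (fact k) * snd (F k x)) m)).
  { assert (T : forall k, (F k x * / RtoC (INR (fact k)) * RtoC (h ^ k))%C = (h ^ k / INR (fact k) * fst (F k x), h ^ k / INR (fact k) * snd (F k x))).
    { intros k. pose proof (INR_fact_neq_0 k). rewrite <- RtoC_inv by auto. apply C_eq; simpl; field; auto. }
    induction m; [simpl Csn; rewrite T; apply C_eq; simpl; ring|].
    change (Csn (fun k => (F k x * / RtoC (INR (fact k)) * RtoC (h ^ k))%C) (S (S m))) with
      (Csn (fun k => (F k x * / RtoC (INR (fact k)) * RtoC (h ^ k))%C) (S m) + F (S m) x * / RtoC (INR (fact (S m))) * RtoC (h ^ (S m)))%C.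
    rewrite IHm, T. apply C_eq; reflexivity. }
  destruct (Taylor_Lagrange (fun s => fst (F O s)) n x (x + h) ltac:(lra)) as [z1 [Hz1 E1]]; [intros; apply Sm|].
  destruct (Taylor_Lagrange (fun s => snd (F O s)) n x (x + h) ltac:(lra)) as [z2 [Hz2 E2]]; [intros; apply Sm|].
  rewrite D1 in E1. rewrite D2 in E2. replace (x + h - x) with h in E1, E2 by ring. fold r in E1, E2.
  rewrite (sum_eq _ (fun k => h ^ k / INR (fact k) * fst (F k x))) in E1 by (intros; now rewrite D1).
  rewrite (sum_eq _ (fun k => h ^ k / INR (fact k) * snd (F k x))) in E2 by (intros; now rewrite D2).
  rewrite HS.
  match goal with |- Cmod ?A <= _ => replace A with ((r * fst (F (S n) z1), r * snd (F (S n) z2)) : C) end.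
  - eapply Rle_trans; [apply Cmod_le_abs|]. simpl. rewrite !Rabs_mult, (Rabs_pos_eq r) by lra.
    assert (B1 : Rabs (fst (F (S n) z1)) <= B) by (eapply Rle_trans; [apply Rabs_fst_le|apply HB, Rabs_le; lra]).
    assert (B2 : Rabs (snd (F (S n) z2)) <= B) by (eapply Rle_trans; [apply Rabs_snd_le|apply HB, Rabs_le; lra]).
    nra.
  - apply C_eq; simpl.
    + rewrite E1. ring.
    + rewrite E2. ring.
Qed.

Lemma Csn_zero_powers (c : nat -> C) n : Csn (fun k => (c k * RtoC (0 ^ k))%C) (S n) = c O.
Proof.
  induction n; [simpl; ring|].
  change (Csn (fun k => (c k * RtoC (0 ^ k))%C) (S n) + c (S n) * RtoC (0 ^ S n) = c O)%C. rewrite IHn, pow_i by lia. ring.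
Qed.

Lemma jet_taylor_bound F x h n B : jet F ->
  (forall t, Rabs (t - x) <= Rabs h -> Cmod (F (S n) t) <= B) ->
  Cmod (F O (x + h) - Csn (fun k => (F k x * / RtoC (INR (fact k)) * RtoC (h ^ k))%C) (S n)) <= 2 * (B * (Rabs h ^ S n / INR (fact (S n)))).
Proof.
  intros JF HB. assert (HB0 : 0 <= B) by (eapply Rle_trans; [apply Cmod_ge_0|apply (HB x)]; rewrite Rminus_diag, Rabs_R0; apply Rabs_pos).
  pose proof (INR_fact_lt_0 (S n)).
  destruct (Rtotal_order h 0) as [Hh|[Hh|Hh]].
  - rewrite (Rabs_left h) in HB |- * by auto.
    set (G := fun j y => (RtoC ((-1) ^ j) * F j (2 * x - y)%R)%C).
    assert (JG : jet G) by now apply jet_reflect.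
    assert (Q := jet_taylor_forward G x (- h) n B JG ltac:(lra)).
    replace (F O (x + h)) with (G O (x + - h)) by (unfold G; simpl; replace (2 * x - (x + - h)) with (x + h) by ring; ring).
    rewrite (Csn_ext _ (fun k => (G k x * / RtoC (INR (fact k)) * RtoC ((- h) ^ k))%C)).
    + apply Q. intros t Ht. unfold G. rewrite Cmod_mult, Cmod_sign, Rmult_1_l. apply HB.
      replace (2 * x - t - x) with (- (t - x)) by ring. now rewrite Rabs_Ropp.
    + intros k. unfold G. replace (2 * x - x) with x by ring. replace (h ^ k) with ((-1) ^ k * (- h) ^ k).
      * rewrite RtoC_mult. ring.
      * rewrite <- Rpow_mult_distr. f_equal; ring.
  - subst h. rewrite Rplus_0_r.
    replace (Csn (fun k => (F k x * / RtoC (INR (fact k)) * RtoC (0 ^ k))%C) (S n)) with (F O x).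
    + replace (F O x - F O x)%C with (RtoC 0) by ring. rewrite Cmod_0.
      assert (0 <= Rabs 0 ^ S n / INR (fact (S n))).
      { apply Rmult_le_pos; [apply pow_le, Rabs_pos|left; now apply Rinv_0_lt_compat]. }
      assert (0 <= B * (Rabs 0 ^ S n / INR (fact (S n)))) by now apply Rmult_le_pos. lra.
    + rewrite (Csn_zero_powers (fun k => (F k x * / RtoC (INR (fact k)))%C)). change (INR (fact 0)) with 1. rewrite <- RtoC_inv by lra. rewrite Rinv_1. ring.
  - rewrite (Rabs_pos_eq h) in HB |- * by lra. now apply jet_taylor_forward.
Qed.

Lemma fa_1 k : fa 1 k = INR (fact k).
Proof. unfold fa. replace (1 / 1) with 1 by field. apply Rpower_1, INR_fact_lt_0. Qed.

(** For [al = 1] the bounds are [eps^k k!] for every [eps]; already [eps = 1/2] makes the Taylor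
    remainder at distance less than 1 tend to 0 geometrically. *)
Lemma gev_1_real_analytic F : jet F -> gev 1 F -> real_analytic (F O).
Proof.
  intros JF HF x0. exists 1. split; [lra|]. exists (fun k => (F k x0 * / RtoC (INR (fact k)))%C). intros x Hx.
  destruct (HF (Rabs x0 + 1) (/ 2) ltac:(lra)) as [A [HA HB]].
  set (h := x - x0) in *.
  assert (HR : forall n, Cmod (F O x - Csn (fun k => (F k x0 * / RtoC (INR (fact k)) * RtoC (h ^ k))%C) (S n)) <= A * (/ 2) ^ n).
  { intros n. replace x with (x0 + h) by (unfold h; ring).
    eapply Rle_trans; [apply (jet_taylor_bound F x0 h n (A * ((/ 2) ^ S n * fa 1 (S n)))); auto|].
    - intros t Ht. apply HB. replace t with ((t - x0) + x0) by ring. eapply Rle_trans; [apply Rabs_triang|]. lra.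
    - rewrite fa_1. pose proof (INR_fact_lt_0 (S n)). assert (0 < (/ 2) ^ n) by (apply pow_lt; lra).
      replace (2 * (A * ((/ 2) ^ S n * INR (fact (S n))) * (Rabs h ^ S n / INR (fact (S n))))) with (A * (/ 2) ^ n * Rabs h ^ S n).
      + rewrite <- (Rmult_1_r (A * (/ 2) ^ n)) at 2. apply Rmult_le_compat_l; [apply Rmult_le_pos; lra|].
        rewrite <- (pow1 (S n)). apply pow_incr. split; [apply Rabs_pos|lra].
      + change ((/ 2) ^ S n) with (/ 2 * (/ 2) ^ n). field. lra. }
  assert (Hsum : forall n, @sum_n C_AbelianGroup (fun k => (F k x0 * / RtoC (INR (fact k)) * RtoC (h ^ k))%C) n =
    Csn (fun k => (F k x0 * / RtoC (INR (fact k)) * RtoC (h ^ k))%C) (S n)).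
  { induction n; [rewrite sum_O; simpl; ring|]. rewrite sum_Sn, IHn. reflexivity. }
  unfold is_series. apply (filterlim_locally_ball_norm (K := C_AbsRing) (U := C_NormedModule)). intros e.
  assert (L : is_lim_seq (fun n => A * (/ 2) ^ n) 0).
  { replace (Finite 0) with (Rbar_mult A 0) by (simpl; f_equal; ring). apply is_lim_seq_scal_l, is_lim_seq_geom. rewrite Rabs_pos_eq; lra. }
  apply is_lim_seq_spec in L. destruct (L e) as [n0 Hn0]. exists n0. intros n Hn. specialize (Hn0 n Hn). rewrite Rminus_0_r in Hn0.
  unfold ball_norm. change (Cmod (@sum_n C_AbelianGroup (fun k => (F k x0 * / RtoC (INR (fact k)) * RtoC (h ^ k))%C) n - F O x) < e).
  rewrite Hsum, Cmod_sub_sym. eapply Rle_lt_trans; [apply HR|]. eapply Rle_lt_trans; [apply Rle_abs|exact Hn0].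
Qed.

Lemma E_gev_of_jet al F : 0 < al -> al <= 1 -> jet F -> gev al F -> E_gev al (F O).
Proof.
  intros H0 H1 JF GF. destruct (Req_dec al 1) as [->|Hn].
  - unfold E_gev. destruct (Rlt_dec 1 1); [lra|]. now apply gev_1_real_analytic.
  - apply Gev_E_gev; [auto|lra|]. now exists F.
Qed.

Section Multiplier.
Variables (a b : R) (c om : nat -> R).
Hypotheses (ha : 0 < a) (hab : a < b) (om_pos : forall k, 0 < om k)
  (hc : forall k, c k = exp (- Rpower (om k) b)) (hc2 : forall k, c k <= (/ 2) ^ k / 16).

Definition mjet (n k : nat) (x : R) : C := (RtoC (fc c n) * Ejet (RtoC (fo om n)) k x)%C.

Lemma jet_mjet n : jet (mjet n).
Proof. apply jet_scal, jet_E. Qed.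

(** Above [T0], where [t^(b-a) >= 2 mu], the left side is at most [t^b / 2]; below [T0] it is
    bounded by [K]. *)
Lemma power_absorb mu : 0 < mu -> exists K, forall t, 0 < t -> mu * Rpower t a <= Rpower t b / 2 + K.
Proof.
  intros Hmu. set (T0 := Rpower (2 * mu) (1 / (b - a))). exists (mu * Rpower T0 a). intros t Ht.
  pose proof (exp_pos (b * ln t)) as Hb. fold (Rpower t b) in Hb.
  assert (HT0 : 0 < T0) by apply exp_pos. pose proof (exp_pos (a * ln T0)) as HA. fold (Rpower T0 a) in HA.
  destruct (Rle_dec t T0) as [H|H].
  - assert (Rpower t a <= Rpower T0 a) by (apply Rle_Rpower_l; lra). nra.
  - assert (H2 : 2 * mu <= Rpower t (b - a)).
    { replace (2 * mu) with (Rpower T0 (b - a)).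
      - apply Rle_Rpower_l; lra.
      - unfold T0. rewrite Rpower_mult. replace (1 / (b - a) * (b - a)) with 1 by (field; lra). apply Rpower_1; lra. }
    replace b with (a + (b - a)) at 1 by ring. rewrite Rpower_plus.
    pose proof (exp_pos (a * ln t)) as Ht2. fold (Rpower t a) in Ht2.
    assert (0 < mu * Rpower T0 a) by (now apply Rmult_lt_0_compat). nra.
Qed.

Lemma mjet_gev : jets_summable mjet /\ gev a (fun k x => Csum (fun n => mjet n k x)).
Proof.
  apply gev_summable. intros M e He. destruct (exp_gev a e ha He) as [mu [Hmu H]].
  exists (fun n => fc c n * exp (mu * w_pow a (fo om n))). split.
  - apply (ex_series_incr_1 (fun n => fc c n * exp (mu * w_pow a (fo om n)))). simpl fc; simpl fo.
    destruct (power_absorb mu Hmu) as [K HK].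
    (* The coefficient is split into two square roots: one absorbs [e^(mu om^a)] through
       [power_absorb], the other is bounded by the geometric sequence of ratio [sqrt (1/2)] because
       [c k <= 2^(-k)]. *)
    assert (Hq : 0 < sqrt (/ 2) < 1).
    { split; [apply sqrt_lt_R0; lra|]. rewrite <- sqrt_1. apply sqrt_lt_1; lra. }
    apply (ex_series_le (K:=R_AbsRing) (V:=R_CompleteNormedModule) _ (fun k => exp K * sqrt (/ 2) ^ k)).
    + intros k. change (norm (c k * exp (mu * w_pow a (om k)))) with (Rabs (c k * exp (mu * w_pow a (om k)))).
      rewrite hc, <- exp_plus, Rabs_pos_eq by (left; apply exp_pos). rewrite w_pow_pos by auto. specialize (HK (om k) (om_pos k)).
      apply Rle_trans with (exp K * exp (- (Rpower (om k) b / 2))).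
      * rewrite <- exp_plus. apply exp_le. lra.
      * apply Rmult_le_compat_l; [left; apply exp_pos|]. apply Rsqr_incr_0.
        -- unfold Rsqr. rewrite <- exp_plus, <- Rpow_mult_distr, sqrt_sqrt by lra.
           replace (- (Rpower (om k) b / 2) + - (Rpower (om k) b / 2)) with (- Rpower (om k) b) by field.
           rewrite <- hc. specialize (hc2 k). assert (0 < (/ 2) ^ k) by (apply pow_lt; lra). lra.
        -- left; apply exp_pos.
        -- apply pow_le; lra.
    + apply ex_series_scal_R, ex_series_geom. rewrite Rabs_pos_eq; lra.
  - intros n k x _. unfold mjet. rewrite Cmod_mult, Cmod_Ejet, cE_real_mod, Rmult_1_r, Cmod_R.
    assert (Hc : 0 < fc c n) by (destruct n; simpl; [lra|rewrite hc; apply exp_pos]).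
    assert (Ho : 0 <= fo om n) by (destruct n; simpl; [lra|left; auto]).
    rewrite Cmod_R, !Rabs_pos_eq by lra. rewrite Rmult_assoc. apply Rmult_le_compat_l; [lra|].
    specialize (H (fo om n) k Ho). rewrite exp_Ropp in H.
    pose proof (exp_pos (mu * w_pow a (fo om n))) as HE. apply Rmult_le_reg_r with (/ exp (mu * w_pow a (fo om n))); [now apply Rinv_0_lt_compat|].
    replace (exp (mu * w_pow a (fo om n)) * (e ^ k * fa a k) * / exp (mu * w_pow a (fo om n))) with (e ^ k * fa a k)
      by (field; lra). exact H.
Qed.

Definition multiplier (k : nat) (x : R) : C := Csum (fun n => mjet n k x).

Lemma jet_multiplier : jet multiplier.
Proof. apply jet_series; [apply jet_mjet|apply mjet_gev]. Qed.

(** Multiplication by [e^(i om x)] translates the transform by [om]; the series passes through the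
    distribution obtained by multiplying [u] by [e^(-izx)]. *)
Lemma dsym_multiplier u z : cs_dist u ->
  dsym (mul_fun_dist (multiplier O) u) z = Csum (fun n => (RtoC (fc c n) * dsym u (z - RtoC (fo om n))%C)%C).
Proof.
  intros Hu. unfold dsym at 1, mul_fun_dist.
  assert (Hv := cs_dist_mul_fun (Ejet (- z)%C) u (jet_E _) Hu).
  assert (E := cs_dist_series _ Hv mjet jet_mjet (proj1 mjet_gev)). unfold mul_fun_dist in E.
  transitivity (u (fun x => (Ejet (- z) O x * Csum (fun n => mjet n O x))%C)).
  - f_equal. apply functional_extensionality; intros x. rewrite Ejet_0, cE_opp. unfold multiplier. ring.
  - rewrite E. apply Csum_ext. intros n.
    assert (Q := cs_dist_scal u Hu (RtoC (fc c n)) _ (jet_E (- (z - RtoC (fo om n)))%C)).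
    unfold dsym. transitivity (u (fun x => (RtoC (fc c n) * Ejet (- (z - RtoC (fo om n))) O x)%C)).
    + f_equal. apply functional_extensionality; intros x. unfold mjet. rewrite !Ejet_0.
      replace (- (z - RtoC (fo om n)))%C with (- z + RtoC (fo om n))%C by ring. rewrite cE_plus_z. ring.
    + rewrite Q. do 2 f_equal. apply functional_extensionality; intros x. now rewrite Ejet_0, cE_opp.
Qed.
End Multiplier.

(** * Choice of the exponents and conclusion *)

Lemma dyadic_exponents s1 s2 : 0 < s1 -> 0 < s2 < 1 -> exists (Nn ww : nat -> nat),
  (forall n, E2 s1 n <= INR (Nn n) <= 2 * E2 s1 n) /\
  (forall n, (ww n <= n)%nat /\ E2 s2 n / 2 <= 2 ^ ww n <= E2 s2 n).
Proof.
  intros H1 H2.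
  destruct (functional_choice (fun n N => E2 s1 n <= INR N <= 2 * E2 s1 n)) as [Nn HN].
  { intros n. destruct (nfloor_ex (E2 s1 n) ltac:(left; apply E2_pos)) as [k Hk]. exists (S k). rewrite S_INR.
    assert (1 <= E2 s1 n); [|lra]. unfold E2. rewrite <- (Rpower_O 2) by lra. apply Rle_Rpower; [lra|].
    apply Rmult_le_pos; [lra|apply pos_INR]. }
  destruct (functional_choice (fun n w => (w <= n)%nat /\ E2 s2 n / 2 <= 2 ^ w <= E2 s2 n)) as [ww Hw].
  { intros n. pose proof (pos_INR n). destruct (nfloor_ex (s2 * INR n) ltac:(apply Rmult_le_pos; lra)) as [w [Hw1 Hw2]].
    exists w. split; [apply INR_le; nra|]. rewrite <- Rpower_pow by lra. unfold E2. split.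
    - replace (Rpower 2 (s2 * INR n) / 2) with (Rpower 2 (s2 * INR n + - (1))).
      + apply Rle_Rpower; lra.
      + rewrite Rpower_plus, Rpower_Ropp, Rpower_1 by lra. reflexivity.
    - apply Rle_Rpower; lra. }
  exists Nn, ww. auto.
Qed.

Theorem mainTheorem13 (r s a : R)
  (hr0 : 0 < r) (hr1 : r < 1) (hs0 : 0 < s) (hs1 : s < 1)
  (ha0 : 0 < a) (ha1 : a <= 1) (har : a < r / s) :
  exists (f : R -> C) (u : (R -> C) -> C),
    E_gev a f /\ cs_pseudo_measure u /\
    E_invertible r (mul_fun_dist f u) /\ ~ E_invertible s u.
Proof.
  set (b := (a + r / s) / 2). assert (Hab : a < b) by (unfold b; lra). assert (Hb : b < r / s) by (unfold b; lra).
  assert (Hbs : s < r / b).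
  { apply Rmult_lt_reg_r with b; [lra|]. replace (r / b * b) with r by (field; lra).
    apply Rmult_lt_compat_r with (r := s) in Hb; auto. replace (r / s * s) with r in Hb by (field; lra). lra. }
  (* The exponents must stay below 1, so that the shifts are small compared with [X], and below
     [r / b], so that [om^b] is at most of the order [X^r]; [b < r / s] is what places [s] below
     both. *)
  set (t := Rmin 1 (r / b)). assert (Ht : s < t) by (now apply Rmin_glb_lt).
  assert (Ht1 : t <= 1) by apply Rmin_l. assert (Htr : t <= r / b) by apply Rmin_r.
  set (d := (t - s) / 4). assert (Hd : 0 < d) by (unfold d; lra). assert (Htd : t = s + 4 * d) by (unfold d; lra).
  set (s1 := s + d). set (s2 := s + 2 * d). set (s3 := s + 3 * d).
  assert (Hbs3 : s3 * b <= r).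
  { apply Rle_trans with (r / b * b); [apply Rmult_le_compat_r; unfold s3; lra|]. right. field; lra. }
  (* Between [s1 / s2] and 1: below 1 a compactly supported Gevrey bump exists, above [s1 / s2] the
     width [W] exceeds [N^(1/be)]. *)
  set (be := (s1 / s2 + 1) / 2).
  assert (Hq : 0 < s1 / s2 < 1).
  { split; [apply Rdiv_lt_0_compat; unfold s1, s2; lra|]. apply Rmult_lt_reg_r with s2; [unfold s2; lra|].
    replace (s1 / s2 * s2) with s1 by (field; unfold s2; lra). unfold s1, s2; lra. }
  assert (Hbe : s1 / be < s2).
  { apply Rmult_lt_reg_r with be; [unfold be; lra|]. replace (s1 / be * be) with s1 by (field; unfold be; lra).
    replace s1 with (s2 * (s1 / s2)) at 1 by (field; unfold s2; lra). apply Rmult_lt_compat_l; [unfold s2; lra|unfold be; lra]. }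
  (* The power is taken odd and large enough that [(W / om)^(2p)] outweighs [N], although the
     exponents of [W] and [om] differ by [d] only. *)
  destruct (nfloor_ex (s1 / d) ltac:(left; apply Rdiv_lt_0_compat; unfold s1; lra)) as [m [_ Hm]].
  assert (Hp : s1 < 2 * INR (2 * m + 1) * (s3 - s2)).
  { apply Rmult_lt_compat_r with (r := d) in Hm; auto. replace (s1 / d * d) with s1 in Hm by (field; lra).
    rewrite plus_INR, mult_INR. replace (INR 2) with 2 by (simpl; ring). replace (INR 1) with 1 by reflexivity.
    replace (s3 - s2) with d by (unfold s3, s2; ring). pose proof (pos_INR m). nra. }
  destruct (dyadic_exponents s1 s2 ltac:(unfold s1; lra) ltac:(unfold s2; lra)) as [Nn [ww [HNn Hww]]].
  destruct (dip_sequences m s b be s1 s2 s3 Nn ww) as [nu [Bd [Rd [Td HS]]]]; auto; try (unfold s1, s2, s3, be; lra).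
  set (p := (2 * m + 1)%nat) in *.
  set (X := fun k => PI * 2 ^ nu k). set (W := fun k => 2 ^ ww (nu k)). set (N := fun k => Nn (nu k)).
  set (om := fun k => E2 s3 (nu k)). set (c := fun k => exp (- Rpower (om k) b)).
  destruct HS as [Bd0 [BdS HS]].
  assert (HG : forall k, good_index m s b be s3 Nn ww (nu k) k (Bd k)) by (intros k; apply HS).
  destruct (gevrey_cutoff (/ 2) (/ 2) ltac:(lra) ltac:(lra) ltac:(lra)) as [chi [Jc [_ [chi1 [chi0 _]]]]].
  assert (Vc := cutoff_vanish (/ 2) chi Jc chi0 ltac:(lra)).
  assert (Hom : forall k, 0 < om k) by (intros; apply E2_pos).
  assert (gX : forall k, 8 * Bd k <= X k) by (intros k; apply (gi_X _ _ _ _ _ _ _ _ _ _ (HG k))).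
  assert (gom : forall k, 8 * om k <= X k) by (intros k; apply (gi_om _ _ _ _ _ _ _ _ _ _ (HG k))).
  assert (gW : forall k, Bd k <= W k) by (intros k; apply (gi_W _ _ _ _ _ _ _ _ _ _ (HG k))).
  assert (gc : forall k, 0 < c k <= (/ 2) ^ k / 16).
  { intros k. split; [apply exp_pos|]. apply (gi_c _ _ _ _ _ _ _ _ _ _ (HG k)). }
  assert (hR : forall k, Bd k <= Rd k) by (intros k; apply HS).
  assert (hT : forall k, Rd k <= Td k) by (intros k; apply HS).
  assert (gfar : forall k, INR (N k) * ((8 * W k / X k) ^ 2) ^ p <= (/ 2) ^ k / 50) by (intros k; apply (gi_far _ _ _ _ _ _ _ _ _ _ (HG k))).
  assert (gshift : forall k, INR (N k) * ((2 * W k / om k) ^ 2) ^ p <= 1) by (intros k; apply (gi_shift _ _ _ _ _ _ _ _ _ _ (HG k))).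
  assert (gsupp : forall k, 2 * INR p * (INR (N k) / W k) <= (/ 2) ^ k / 4) by (intros k; apply (gi_supp _ _ _ _ _ _ _ _ _ _ (HG k))).
  assert (B1 := Bd_ge_1 X om Bd Rd Td N Bd0 BdS Hom gX hR hT).
  assert (Bst := Bd_step X om Bd Rd Td N Bd0 BdS Hom gX hR hT).
  destruct (dip_distribution p X W om c Bd Rd Td N chi) as [u [Hu [HU1 [HU2 [HV1 HV2]]]]]; auto;
    try (intros k; apply HS).
  destruct (mjet_gev a b c om ha0 Hab Hom (fun k => eq_refl) (fun k => proj2 (gc k))) as [Sf Gf].
  assert (Jf := jet_multiplier a b c om ha0 Hab Hom (fun k => eq_refl) (fun k => proj2 (gc k))).
  assert (Df := fun z => dsym_multiplier a b c om ha0 Hab Hom (fun k => eq_refl) (fun k => proj2 (gc k)) u z Hu).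
  exists (multiplier c om O), u. split; [|split; [|split]].
  - apply E_gev_of_jet; auto.
  - split; auto. exists 1. intros xi. rewrite dsym_fourier. apply HU1.
  - apply (E_invertible_of_lower_bound _ r 4 2); auto; try lra.
    + now apply cs_dist_mul_fun.
    + intros xi. rewrite Df. pose proof (w_pow_ge_0 r xi).
      destruct (HV2 xi) as [H1|[i [Hxi H1]]].
      * assert (1 <= exp (2 * w_pow r xi)) by (pose proof (exp_ineq1_le (2 * w_pow r xi)); lra). nra.
      * assert (HXi : 0 < X i) by (pose proof (gX i); pose proof (B1 i); lra).
        (* With [n = nu i] the chain is [om^b = 2^(s3 b n) <= 2^(r n) <= (2 xi)^r <= 2 xi^r], since
           [2^n <= X i <= 4/3 xi]. *)
        assert (Hw : Rpower (om i) b <= 2 * w_pow r xi).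
        { rewrite w_pow_pos by lra. unfold om. rewrite E2_Rpower.
          apply Rle_trans with (E2 r (nu i)).
          - unfold E2. apply Rle_Rpower; [lra|]. apply Rmult_le_compat_r; [apply pos_INR|auto].
          - rewrite <- (Rmult_1_l r). rewrite <- E2_Rpower, E2_1, Rmult_1_l.
            assert (HX2 : 2 ^ nu i <= X i) by (unfold X; pose proof PI2_3_2; pose proof (pow_lt 2 (nu i) ltac:(lra)); nra).
            pose proof (pow_lt 2 (nu i) ltac:(lra)).
            apply Rle_trans with (Rpower (2 * xi) r); [apply Rle_Rpower_l; lra|].
            rewrite <- Rpower_mult_distr by lra. apply Rmult_le_compat_r; [left; apply exp_pos|].
            rewrite <- (Rpower_1 2) at 2 by lra. apply Rle_Rpower; lra. }
        apply Rle_trans with (4 * exp (2 * w_pow r xi) * (/ 4 * c i)).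
        -- unfold c. replace (4 * exp (2 * w_pow r xi) * (/ 4 * exp (- Rpower (om i) b))) with (exp (2 * w_pow r xi) * exp (- Rpower (om i) b)) by field.
           rewrite <- exp_plus. rewrite <- exp_0. apply exp_le. lra.
        -- apply Rmult_le_compat_l; auto. pose proof (exp_pos (2 * w_pow r xi)). lra.
    + intros B. assert (HB : forall k, INR k + 1 <= Bd k).
      { induction k; [rewrite Bd0; simpl; lra|]. rewrite S_INR. destruct (Bst k) as [H _]. pose proof (hR k). pose proof (hT k). pose proof (B1 k). lra. }
      destruct (nfloor_ex (Rabs B) (Rabs_pos B)) as [k [_ Hk]]. exists (Rd k), (Td k).
      specialize (HB k). pose proof (hR k). pose proof (Rle_abs B). split; [lra|]. split; [auto|].
      intros z Hz. rewrite Df. now apply (HV1 k).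
  - apply (not_E_invertible_of_dips u s be (/ 2 * (/ 4) ^ p) X W N); auto; try (unfold be; lra).
    + apply Rmult_lt_0_compat; [lra|apply pow_lt; lra].
    + intros j. pose proof (gX j). pose proof (B1 j). lra.
    + intros j. apply (gi_dip _ _ _ _ _ _ _ _ _ _ (HG j)).
    + intros j. apply INR_le. rewrite mult_INR. replace (INR 2) with 2 by (simpl; ring).
      assert (H := gi_N _ _ _ _ _ _ _ _ _ _ (HG (S j))). destruct (Bst j) as [_ [_ [_ [H2 _]]]]. unfold N in *. lra.
    + intros j. apply (gi_width _ _ _ _ _ _ _ _ _ _ (HG j)).
    + intros i j Hij. assert (HW : 3 * W j <= X j).
      { unfold W, X. destruct (Hww (nu j)) as [Hwn _]. assert (2 ^ ww (nu j) <= 2 ^ nu j) by (apply Rle_pow; [lra|auto]).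
        pose proof PI2_3_2. pose proof (pow_lt 2 (ww (nu j)) ltac:(lra)). nra. }
      pose proof (X_sep X om Bd Rd Td N Bd0 BdS Hom gX hR hT i j Hij). pose proof (gX j). pose proof (B1 j). lra.
Qed.
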